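(* Let $n\ge1$, $N\ge2$. There is a constant $c>0$ depending only on $n$ and $N$ such that the following holds. Let $U=(u_1,\dots,u_N)$ be a minimizer of $J_N$ in $B_1\subset\mathbb R^n$ with $\sum_{i=1}^N u_i=0$ and $0\in\partial\{|U|>0\}$. Then $$\max_{B_r}|U|\ge c\,r\qquad\text{for all } r\in(0,1),$$ and there exists a sequence $r_j\to0$ such that $U_{r_j}(x):=U(r_jx)/r_j$ converges uniformly on compact subsets of $\mathbb R^n$ to a cone $\bar U$, i.e. a minimizer of $J_N$ in $\mathbb R^n$ that is homogeneous of degree one, and $0\in\partial\{|\bar U|>0\}$.
   Context: For a bounded Lipschitz domain $\Omega\subset\mathbb R^n$ and $N\ge2$, let $\mathcal A=\{U=(u_1,\dots,u_N)\in H^1(\Omega;\mathbb R^N): u_1\ge u_2\ge\dots\ge u_N \text{ a.e.}\}$ and $$J_N(U,\Omega)=\int_\Omega\big(|\nabla U|^2+W(U)\big)\,dx,\qquad |\nabla U|^2=\sum_{i=1}^N|\nabla u_i|^2,\qquad W(U)=\sum_{i=1}^{N-1}\chi_{\{u_i>u_{i+1}\}}.$$ $U\in\mathcal A$ is a minimizer of $J_N$ in $\Omega$ if $J_N(U,\Omega)\le J_N(V,\Omega)$ for all $V\in\mathcal A$ with $V-U\in H^1_0(\Omega)$. A function on $\mathbb R^n$ is a minimizer in $\mathbb R^n$ if it is a minimizer in every ball. Minimizers are (locally Lipschitz) continuous, and their continuous representatives are used. $B_r$ is the ball of radius $r$ centered at $0$. *)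

(* Defs.v *)
From HB Require Import structures.
From mathcomp Require Import all_boot all_order all_algebra.
From mathcomp Require Import all_classical all_reals all_analysis.
Set Implicit Arguments.
Unset Strict Implicit.
Unset Printing Implicit Defensive.
Import Order.TTheory GRing.Theory Num.Theory.
Import numFieldNormedType.Exports.
Local Open Scope classical_set_scope.
Local Open Scope ring_scope.

(* R^n is 'rV[R]_n. Its library norm `| | is the sup norm, which yields the
   usual topology and uniformity; Euclidean norms are written l2norm. *)

Definition rV_display : measure_display.
Proof. exact: default_measure_display. Qed.

Section measurable_rV.
Context {R : realType} {n : nat}.

Let coord (i : 'I_n) (x : 'rV[R]_n) : R := x ord0 i.

Let rV_set0 : g_sigma_preimage coord set0.
Proof. exact: sigma_algebra0. Qed.

Let rV_setC A : g_sigma_preimage coord A -> g_sigma_preimage coord (~` A).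
Proof. exact: sigma_algebraC. Qed.

Let rV_bigcup (F : (set 'rV[R]_n)^nat) :
  (forall i, g_sigma_preimage coord (F i)) ->
  g_sigma_preimage coord (\bigcup_i (F i)).
Proof. exact: sigma_algebra_bigcup. Qed.

HB.instance Definition _ := @isMeasurable.Build rV_display
  'rV[R]_n (g_sigma_preimage coord) rV_set0 rV_setC rV_bigcup.

End measurable_rV.

Section lebesgue_rV.
Context {R : realType}.

Lemma measurable_coord n (i : 'I_n) :
  measurable_fun [set: 'rV[R]_n] (fun x : 'rV[R]_n => x ord0 i).
Proof.
move=> _ Y mY; rewrite setTI; apply: sub_sigma_algebra => /=.
rewrite -bigcup_seq/=; exists i => /=; first by rewrite mem_index_enum.
by exists Y => //; rewrite setTI.
Qed.

Lemma measurable_fun_rV d (T : measurableType d) n (f : T -> 'rV[R]_n) :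
  (forall i, measurable_fun [set: T] (fun x => f x ord0 i)) ->
  measurable_fun [set: T] f.
Proof.
move=> mf _; rewrite (_ : measurable =
  <<s \big[setU/set0]_(i < n) preimage_set_system setT
      (fun x : 'rV[R]_n => x ord0 i) measurable >>) //.
suff: <<s \big[setU/set0]_(i < n) preimage_set_system setT
      (fun x : 'rV[R]_n => x ord0 i) measurable >> `<=`
   [set Y | measurable (setT `&` f @^-1` Y)] by apply.
apply: smallest_sub.
  split => /=.
  - by rewrite preimage_set0 setI0.
  - move=> A /=; rewrite !setTI => mA; rewrite setTD preimage_setC.
    exact: measurableC.
  - move=> F mF /=; rewrite preimage_bigcup setI_bigcupr.
    exact: bigcupT_measurable.
rewrite -bigcup_seq => A [i _] [Y mY <-] /=.
by rewrite setTI; exact: mf.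
Qed.

Lemma measurable_box n (A : 'I_n -> set R) :
  (forall i, measurable (A i)) ->
  measurable [set x : 'rV[R]_n | forall i, A i (x ord0 i)].
Proof.
move=> mA; have -> : [set x : 'rV[R]_n | forall i, A i (x ord0 i)] =
    \bigcap_(i in [set: 'I_n]) ((fun x : 'rV[R]_n => x ord0 i) @^-1` A i).
  by apply/seteqP; split=> [x xA i _|x xA i]; exact: xA.
apply: fin_bigcap_measurable => // i _.
by rewrite -[X in measurable X]setTI; exact: measurable_coord.
Qed.

Definition rV_cons n (p : measurableTypeR R * 'rV[R]_n) : 'rV[R]_n.+1 :=
  row_mx (p.1 : R)%:M p.2 : 'rV[R]_(1 + n).

Definition rV_uncons n (x : 'rV[R]_n.+1) : measurableTypeR R * 'rV[R]_n :=
  (x ord0 ord0, \row_j x ord0 (lift ord0 j)).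

Lemma rV_cons0 n p : @rV_cons n p ord0 ord0 = p.1.
Proof.
transitivity (@rV_cons n p ord0 (lshift n (ord0 : 'I_1))).
  by congr (_ _ _); exact/val_inj.
by apply: etrans (row_mxEl _ _ _ _) _; rewrite mxE.
Qed.

Lemma rV_consS n p (i : 'I_n) : rV_cons p ord0 (lift ord0 i) = p.2 ord0 i.
Proof.
transitivity (rV_cons p ord0 (rshift 1 i)).
  by congr (_ _ _); exact/val_inj.
exact: row_mxEr.
Qed.

Lemma rV_consK n : cancel (@rV_cons n) (@rV_uncons n).
Proof.
move=> [a v]; rewrite /rV_uncons rV_cons0; congr pair.
by apply/rowP => j; rewrite mxE rV_consS.
Qed.

Lemma measurable_rV_cons n : measurable_fun setT (@rV_cons n).
Proof.
apply: measurable_fun_rV => i; have [<-|/unlift_some[j -> _]] := eqVneq ord0 i.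
  rewrite (_ : (fun _ => _) = fst) //; apply/funext => p.
  exact: rV_cons0.
rewrite (_ : (fun _ => _) = (fun x : 'rV[R]_n => x ord0 j) \o snd).
  by apply: measurableT_comp => //; exact: measurable_coord.
by apply/funext => p /=; exact: rV_consS.
Qed.

Lemma measurable_rV_uncons n : measurable_fun setT (@rV_uncons n).
Proof.
apply: measurable_fun_pair; first exact: measurable_coord.
apply: measurable_fun_rV => i.
rewrite (_ : (fun _ => _) = (fun x : 'rV[R]_n.+1 => x ord0 (lift ord0 i))).
  exact: measurable_coord.
by apply/funext => x; rewrite mxE.
Qed.

Section step.
Local Open Scope ereal_scope.
Variables (n : nat) (mu : {sigma_finite_measure set 'rV[R]_n -> \bar R}).

Definition lebesgue_rVS : set 'rV[R]_n.+1 -> \bar R :=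
  pushforward (lebesgue_measure \x mu) (@rV_cons n).

Let mcons A : measurable A -> measurable (@rV_cons n @^-1` A).
Proof. by move=> mA; rewrite -[X in measurable X]setTI; exact: measurable_rV_cons. Qed.

Let lebesgue_rVS0 : lebesgue_rVS set0 = 0.
Proof. by rewrite /lebesgue_rVS /pushforward preimage_set0 measure0. Qed.

Let lebesgue_rVS_ge0 A : 0 <= lebesgue_rVS A.
Proof. by rewrite /lebesgue_rVS /pushforward; exact: measure_ge0. Qed.

Let lebesgue_rVS_sigma_additive : semi_sigma_additive lebesgue_rVS.
Proof.
move=> F mF tF mUF; rewrite /lebesgue_rVS /pushforward preimage_bigcup.
apply: measure_semi_sigma_additive.
- by move=> k; exact: mcons.
- apply/trivIsetP => i j _ _ ij; rewrite -preimage_setI.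
  by move/trivIsetP : tF => /(_ _ _ _ _ ij) ->//; rewrite preimage_set0.
- by rewrite -preimage_bigcup; exact: mcons.
Qed.

HB.instance Definition _ := isMeasure.Build _ _ _ lebesgue_rVS
  lebesgue_rVS0 lebesgue_rVS_ge0 lebesgue_rVS_sigma_additive.

Let lebesgue_rVS_sigma_finite : sigma_finite setT lebesgue_rVS.
Proof.
have /sigma_finiteP[F [TF ndF Foo]] := sigma_finiteT (@lebesgue_measure R).
have /sigma_finiteP[G [TG ndG Goo]] := sigma_finiteT mu.
exists (fun k => @rV_uncons n @^-1` (F k `*` G k)).
  rewrite -preimage_bigcup (_ : \bigcup_k _ = setT) ?preimage_setT//.
  rewrite -setXTT TF TG predeqE => -[x y]; split.
    by move=> [k _ []/= ? ?]; split; exists k.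
  move=> [/= [k _ Fkx] [l _ Gly]]; exists (maxn k l) => //; split.
    by move: x Fkx; exact/subsetPset/ndF/leq_maxl.
  by move: y Gly; exact/subsetPset/ndG/leq_maxr.
move=> k; have [? ?] := Foo k; have [? ?] := Goo k; split.
  rewrite -[X in measurable X]setTI; apply: measurable_rV_uncons => //.
  exact: measurableX.
rewrite /lebesgue_rVS /pushforward -comp_preimage.
rewrite (_ : _ \o _ = id); last by apply/funext => p; exact: rV_consK.
by rewrite preimage_id product_measure1E// lte_mul_pinfty// ge0_fin_numE.
Qed.

HB.instance Definition _ := @Measure_isSigmaFinite.Build _ _ _ lebesgue_rVS
  lebesgue_rVS_sigma_finite.

End step.

(* R^0 is a point of mass one; the measure on R^(n+1) is the image of the
   product of the measures on R and R^n under (a, x) |-> (a, x_0, x_1, ...). *)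
Fixpoint lebesgue_rV (n : nat) : {sigma_finite_measure set 'rV[R]_n -> \bar R} :=
  match n with
  | 0 => \d_ (0 : 'rV[R]_0)
  | n'.+1 => lebesgue_rVS (lebesgue_rV n')
  end.

(* Sanity check of the normalization: boxes have the expected volume. *)
Lemma lebesgue_rV_box n (A : 'I_n -> set R) :
  (forall i, measurable (A i)) ->
  lebesgue_rV n [set x | forall i, A i (x ord0 i)] =
  (\prod_(i < n) lebesgue_measure (A i))%E.
Proof.
elim: n A => [A _|n IHn A mA].
  by rewrite big_ord0 /= diracE mem_set//= => -[].
rewrite big_ord_recl /= /lebesgue_rVS /pushforward.
rewrite (_ : _ @^-1` _ = A ord0 `*`
  [set x : 'rV[R]_n | forall i, A (lift ord0 i) (x ord0 i)]).
  rewrite product_measure1E//; first by congr (_ * _)%E; exact: IHn.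
    exact: mA.
  exact: (measurable_box (fun i => mA (lift ord0 i))).
apply/seteqP; split=> -[a v] /=.
- move=> H; split; first by have := H ord0; rewrite rV_cons0.
  by move=> i; have := H (lift ord0 i); rewrite rV_consS.
- move=> [Aa Av] i; have [<-|/unlift_some[j -> _]] := eqVneq ord0 i.
    by rewrite rV_cons0.
  by rewrite rV_consS; exact: Av.
Qed.

End lebesgue_rV.

Section euclidean.
Context {R : realType}.

Definition l2norm k (v : 'rV[R]_k) : R := Num.sqrt (\sum_(i < k) v ord0 i ^+ 2).

Definition l2ball n (x0 : 'rV[R]_n) (r : R) : set 'rV[R]_n :=
  [set x | l2norm (x - x0) < r].

Definition boundary (T : topologicalType) (A : set T) : set T :=
  closure A `\` interior A.

Definition partial n (i : 'I_n) (f : 'rV[R]_n -> R) : 'rV[R]_n -> R :=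
  'D_(delta_mx ord0 i) f.

(* Differentiability of every iterated partial derivative makes all of them
   continuous, so this is C^oo. *)
Definition smooth n (f : 'rV[R]_n -> R) : Prop :=
  forall (s : seq 'I_n) (x : 'rV[R]_n),
    differentiable (foldr (@partial n) f s) x.

(* C_c^oo(Omega), with functions extended by zero to the whole space. *)
Definition test_function n (Omega : set 'rV[R]_n) (phi : 'rV[R]_n -> R) : Prop :=
  [/\ smooth phi, compact (closure [set x | phi x != 0]) &
      closure [set x | phi x != 0] `<=` Omega].

End euclidean.

(* Functions on Omega are represented by total functions whose values outside
   Omega are never used. *)
Section sobolev.
Context {R : realType} {n : nat}.
Implicit Types (Omega : set 'rV[R]_n) (u : 'rV[R]_n -> R).

Local Notation mu := (@lebesgue_rV R n).

Definition L2 Omega u : Prop :=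
  measurable_fun Omega u /\
  mu.-integrable Omega (EFin \o (fun x => u x ^+ 2)).

Definition is_weak_grad Omega u (G : 'rV[R]_n -> 'rV[R]_n) : Prop :=
  forall i : 'I_n, L2 Omega (fun x => G x ord0 i) /\
    forall phi, test_function Omega phi ->
      (\int[mu]_(x in Omega) (u x * partial i phi x)%:E =
       - \int[mu]_(x in Omega) (G x ord0 i * phi x)%:E)%E.

Definition H1 Omega u : Prop :=
  L2 Omega u /\ exists G, is_weak_grad Omega u G.

(* The weak gradient is unique up to a negligible set: any choice yields the
   same integrals below. *)
Definition weak_grad Omega u : 'rV[R]_n -> 'rV[R]_n :=
  xget (cst 0) [set G | is_weak_grad Omega u G].

Definition H1_normsq Omega u : \bar R :=
  (\int[mu]_(x in Omega) (u x ^+ 2 + l2norm (weak_grad Omega u x) ^+ 2)%:E)%E.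

(* The closure of C_c^oo(Omega) in H^1(Omega). *)
Definition H10 Omega u : Prop :=
  H1 Omega u /\ forall e : R, 0 < e ->
    exists2 phi, test_function Omega phi & (H1_normsq Omega (u \- phi)%R < e%:E)%E.

End sobolev.

Section functional.
Context {R : realType} {n N : nat}.
Implicit Types (Omega : set 'rV[R]_n) (U V : 'rV[R]_n -> 'rV[R]_N).

Local Notation mu := (@lebesgue_rV R n).

Definition component U (i : 'I_N) : 'rV[R]_n -> R := fun x => U x ord0 i.

Definition admissible Omega U : Prop :=
  (forall i, H1 Omega (component U i)) /\
  {ae mu, forall x, Omega x -> forall i j : 'I_N, j = i.+1 :> nat ->
     U x ord0 i >= U x ord0 j}.

(* The inner sum has at most one term, j = i + 1, and is empty for the last
   index i. *)
Definition W (v : 'rV[R]_N) : R :=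
  \sum_(i < N) \sum_(j < N | j == i.+1 :> nat) (v ord0 i > v ord0 j)%R%:R.

Definition J Omega U : \bar R :=
  (\int[mu]_(x in Omega)
    (\sum_(i < N) l2norm (weak_grad Omega (component U i) x) ^+ 2 +
     W (U x))%:E)%E.

Definition minimizer Omega U : Prop :=
  admissible Omega U /\
  forall V, admissible Omega V ->
    (forall i, H10 Omega (component V i \- component U i)) ->
    (J Omega U <= J Omega V)%E.

(* Minimizers are identified with their continuous representatives. *)
Definition continuous_minimizer Omega U : Prop :=
  {within Omega, continuous U} /\ minimizer Omega U.

Definition global_minimizer U : Prop :=
  continuous U /\
  forall (x0 : 'rV[R]_n) (r : R), 0 < r -> minimizer (l2ball x0 r) U.

Definition homogeneous1 U : Prop :=
  forall (t : R) (x : 'rV[R]_n), 0 < t -> U (t *: x) = t *: U x.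

Definition cone U : Prop := global_minimizer U /\ homogeneous1 U.

Definition rescale U (r : R) : 'rV[R]_n -> 'rV[R]_N :=
  fun x => r^-1 *: U (r *: x).

(* {|U| > 0}, for U defined on Omega. *)
Definition positivity Omega U : set 'rV[R]_n :=
  Omega `&` [set x | 0 < l2norm (U x)].

End functional.

(* Main.v *)
(* Every estimate comes from an explicit competitor. (1 + t phi) U leaves W
   unchanged, so that Delta |U|^2 = 2 |DU|^2 weakly and |U|^2 satisfies the mean
   value inequality. Adding an ordered w costs at most the measure of its support;
   this bounds the spherical growth of u_1 - u_N, hence |U(x)| <= C |x| when
   U(0) = 0, and, applied to two translates of U with w a multiple of the other
   one, gives a modulus of continuity. Multiplying U by a cutoff that vanishes on a
   half ball removes the measure of {U <> 0}, so that a small U vanishes near the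
   center: this is the lower bound on the sup.

   The derivative of the Weiss energy
     s^-n int (|DU|^2 + W(U)) b(x/s) - s^(-n-2) int |U|^2 psi(x/s),  Db = - x psi,
   is a multiple of the defect int |x.DU - U|^2 psi(x/s), by inner variations. The
   energy is bounded below, hence the defect is small for some radii s_j -> 0.
   Rescalings by r_j = s_j / (j + 1) subconverge locally uniformly by Ascoli's
   theorem; the limit is minimizing (gluing with a cutoff, lower semicontinuity by
   Mazur's lemma), and homogeneous because the weak form of x.DU - U passes to the
   limit. *)

Require Import Defs.
From HB Require Import structures.
From mathcomp Require Import all_boot all_order all_algebra.
From mathcomp Require Import all_classical all_reals all_analysis.
From mathcomp Require Import measurable_realfun ring lra.
Set Implicit Arguments.
Unset Strict Implicit.
Unset Printing Implicit Defensive.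
Import Order.TTheory GRing.Theory Num.Theory.
Import numFieldNormedType.Exports.
Local Open Scope classical_set_scope.
Local Open Scope ring_scope.

(** * Integration *)

(** The obstacle is that [W] is discontinuous and that competitors must stay ordered. Ordered
    vectors form a convex cone and [W] is invariant under positive multiples. So a nonnegative
    factor and a change of variables keep the order and never raise [W], while the sum with an
    ordered vector is paid by the measure of its support. Zero sum enters twice: it lets u_1 - u_N
    control |U|, and it makes [W] at least 1 wherever U is nonzero. Averages over spheres are
    replaced by averages against the kernels b and psi of the Weiss energy. As Db = - x psi, the
    derivative in the radius of a psi-average is an integral against the Laplacian of a dilated b;
    the same pair thus serves for mean values and for monotonicity. Inner variations are built from
    deformations along single coordinates, whose Jacobian is explicit. No Lipschitz bound is used
    for compactness: the comparison of two minimizers turns closeness in L^2 into closeness at a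
    point. The constants of growth, continuity and nondegeneracy are fixed before U. *)

Section real_integral.
Context d (T : measurableType d) (R : realType) (mu : {measure set T -> \bar R}).
Implicit Types f g h : T -> R.

(** Integrals are real numbers, through [fine]; as [fine] sends infinite values to 0, the rules of
    calculus below ask for [itg]. *)
Definition itg f : Prop := mu.-integrable [set: T] (EFin \o f).
Definition RI f : R := fine (\int[mu]_x (f x)%:E).

Lemma itg_meas f : itg f -> measurable_fun setT f.
Proof. by move=> /measurable_int /measurable_EFinP. Qed.

Lemma EFin_RI f : itg f -> ((RI f)%:E = \int[mu]_x (f x)%:E)%E.
Proof. by move=> ifn; rewrite /RI fineK//; exact: integrable_fin_num. Qed.

Lemma itg_le g f : measurable_fun setT f -> (forall x, `|f x| <= g x) ->
  itg g -> itg f.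
Proof.
move=> mf fg; apply: le_integrable => //; first exact/measurable_EFinP.
by move=> x _ /=; rewrite lee_fin (le_trans (fg x))// ler_norm.
Qed.

Lemma itgD f g : itg f -> itg g -> itg (fun x => f x + g x).
Proof. by move=> hf hg; have := integrableD measurableT hf hg. Qed.

Lemma itgN f : itg f -> itg (fun x => - f x).
Proof. by move=> hf; have := integrableN hf. Qed.

Lemma itgB f g : itg f -> itg g -> itg (fun x => f x - g x).
Proof. by move=> hf hg; exact: itgD hf (itgN hg). Qed.

Lemma itgZ (k : R) f : itg f -> itg (fun x => k * f x).
Proof. by move=> hf; have := integrableZl measurableT k hf. Qed.

Lemma itgZr (k : R) f : itg f -> itg (fun x => f x * k).
Proof. by move=> hf; under eq_fun do rewrite mulrC; exact: itgZ. Qed.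

Lemma itg0 : itg (fun _ => 0).
Proof. exact: integrable0. Qed.

Lemma itg_sum (I : Type) (s : seq I) (P : pred I) (F : I -> T -> R) :
  (forall i, itg (F i)) -> itg (fun x => \sum_(i <- s | P i) F i x).
Proof.
move=> hF; elim: s => [|a s IH].
  by under eq_fun do rewrite big_nil; exact: itg0.
under eq_fun do rewrite big_cons.
by case: (P a) => //; exact: itgD.
Qed.

Lemma itg_abs f : itg f -> itg (fun x => `|f x|).
Proof. by move=> /integrable_norm. Qed.

Lemma RI_D f g : itg f -> itg g -> RI (fun x => f x + g x) = RI f + RI g.
Proof. by move=> hf hg; exact: (RintegralD measurableT hf hg). Qed.

Lemma RI_B f g : itg f -> itg g -> RI (fun x => f x - g x) = RI f - RI g.
Proof. by move=> hf hg; exact: (RintegralB measurableT hf hg). Qed.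

Lemma RI_Z (k : R) f : itg f -> RI (fun x => k * f x) = k * RI f.
Proof. by move=> hf; exact: (RintegralZl k measurableT hf). Qed.

Lemma RI_N f : itg f -> RI (fun x => - f x) = - RI f.
Proof.
by move=> hf; under eq_fun do rewrite -mulN1r; rewrite RI_Z// mulN1r.
Qed.

Lemma RI_0 : RI (fun _ => 0) = 0.
Proof. by rewrite /RI integral0. Qed.

Lemma RI_sum (I : Type) (s : seq I) (P : pred I) (F : I -> T -> R) :
  (forall i, itg (F i)) ->
  RI (fun x => \sum_(i <- s | P i) F i x) = \sum_(i <- s | P i) RI (F i).
Proof.
move=> hF; elim: s => [|a s IH].
  by under eq_fun do rewrite big_nil; rewrite big_nil RI_0.
under eq_fun do rewrite big_cons; rewrite big_cons.
by case: (P a) => //; rewrite RI_D ?IH//; exact: itg_sum.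
Qed.

Lemma RI_le f g : itg f -> itg g -> (forall x, f x <= g x) -> RI f <= RI g.
Proof. by move=> hf hg fg; exact: (le_Rintegral measurableT hf hg). Qed.

Lemma RI_ge0 f : (forall x, 0 <= f x) -> 0 <= RI f.
Proof. by move=> f0; exact: Rintegral_ge0. Qed.

Lemma RI_abs f : itg f -> `|RI f| <= RI (fun x => `|f x|).
Proof. by move=> hf; exact: (le_normr_Rintegral measurableT hf). Qed.

Lemma RI_eq0 f : itg f -> (forall x, 0 <= f x) -> RI f = 0 ->
  {ae mu, forall x, f x = 0}.
Proof.
move=> hf f0 h0.
have h : (\int[mu]_x `|(f x)%:E| = 0)%E.
  transitivity (\int[mu]_x (f x)%:E)%E; last by rewrite -EFin_RI// h0.
  by apply: eq_integral => x _; rewrite gee0_abs// lee_fin.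
have mf : measurable_fun setT (EFin \o f) by exact: measurable_int hf.
have [/(_ h) + _] := ae_eq_integral_abs mu measurableT mf.
by apply: filterS => x /= /(_ Logic.I) [].
Qed.

End real_integral.

(** * Square-integrable functions and limits of integrals *)

Section square_integrable.
Context d (T : measurableType d) (R : realType) (mu : {measure set T -> \bar R}).
Implicit Types f g h : T -> R.
Local Notation itg := (itg mu).
Local Notation RI := (RI mu).

Definition sqi f : Prop := measurable_fun setT f /\ itg (fun x => f x ^+ 2).

Lemma sqi_mul f g : sqi f -> sqi g -> itg (fun x => f x * g x).
Proof.
move=> [mf hf] [mg hg].
apply: (@itg_le _ _ _ _ (fun x => f x ^+ 2 + g x ^+ 2)) => [||].
- exact: measurable_funM.
- move=> x; rewrite normrM; have := sqr_ge0 (`|f x| - `|g x|).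
  rewrite -(real_normK (num_real (f x))) -(real_normK (num_real (g x))).
  have := normr_ge0 (f x); have := normr_ge0 (g x); nra.
- exact: itgD.
Qed.

Lemma sqi_le g f : measurable_fun setT f -> (forall x, `|f x| <= `|g x|) ->
  sqi g -> sqi f.
Proof.
move=> mf fg [mg hg]; split => //; apply: itg_le hg.
  exact: measurable_funX.
by move=> x; rewrite normrX -(real_normK (num_real (g x))) ler_sqr ?nnegrE.
Qed.

Lemma sqiZ (k : R) f : sqi f -> sqi (fun x => k * f x).
Proof.
move=> [mf hf]; split; first exact: measurable_funM.
by under eq_fun do rewrite exprMn; exact: itgZ.
Qed.

Lemma sqiD f g : sqi f -> sqi g -> sqi (fun x => f x + g x).
Proof.
move=> sf sg; have [mf hf] := sf; have [mg hg] := sg.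
split; first exact: measurable_funD.
under eq_fun do rewrite sqrrD.
apply: itgD => //; apply: itgD => //.
by under eq_fun do rewrite -mulr_natl; apply: itgZ; exact: sqi_mul.
Qed.

Lemma sqiN f : sqi f -> sqi (fun x => - f x).
Proof. by move=> sf; under eq_fun do rewrite -mulN1r; exact: sqiZ. Qed.

Lemma sqiB f g : sqi f -> sqi g -> sqi (fun x => f x - g x).
Proof. by move=> hf hg; apply: sqiD => //; exact: sqiN. Qed.

Lemma sqi0 : sqi (fun _ => 0).
Proof.
split => //; under eq_fun do rewrite expr0n /=; exact: itg0.
Qed.

Lemma sqi_sum (I : Type) (s : seq I) (P : pred I) (F : I -> T -> R) :
  (forall i, sqi (F i)) -> sqi (fun x => \sum_(i <- s | P i) F i x).
Proof.
move=> hF; elim: s => [|a s IH].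
  by under eq_fun do rewrite big_nil; exact: sqi0.
under eq_fun do rewrite big_cons.
by case: (P a) => //; exact: sqiD.
Qed.

Lemma itg_bM (M : R) (b f : T -> R) : measurable_fun setT b -> (forall x, `|b x| <= M) ->
  itg f -> itg (fun x => b x * f x).
Proof.
move=> mb hb hf; have mf := itg_meas hf.
apply: (@itg_le _ _ _ _ (fun x => M * `|f x|)) => [||].
- exact: measurable_funM.
- by move=> x; rewrite normrM ler_wpM2r.
- exact/itgZ/itg_abs.
Qed.

Lemma sqi_bM (M : R) (b f : T -> R) : measurable_fun setT b -> (forall x, `|b x| <= M) ->
  sqi f -> sqi (fun x => b x * f x).
Proof.
move=> mb hb sf; have [mf _] := sf.
apply: (@sqi_le (fun x => M * f x)) (sqiZ M sf) => [|x].
  exact: measurable_funM.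
by rewrite !normrM ler_wpM2r// (le_trans (hb x))// ler_norm.
Qed.

Lemma RI_lin2 (a b : R) f g : itg f -> itg g ->
  RI (fun x => a * f x + b * g x) = a * RI f + b * RI g.
Proof. by move=> hf hg; rewrite RI_D ?RI_Z//; exact: itgZ. Qed.

Lemma RI_sqr_ge0 f : 0 <= RI (fun x => f x ^+ 2).
Proof. by apply: RI_ge0 => x; exact: sqr_ge0. Qed.

Lemma RI_CS f g : sqi f -> sqi g ->
  RI (fun x => f x * g x) ^+ 2 <=
  RI (fun x => f x ^+ 2) * RI (fun x => g x ^+ 2).
Proof.
move=> sf sg; have ifg := sqi_mul sf sg.
have key (a b : R) : 0 <= a ^+ 2 * RI (fun x => f x ^+ 2) +
    2 * a * b * RI (fun x => f x * g x) + b ^+ 2 * RI (fun x => g x ^+ 2).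
  have -> : a ^+ 2 * RI (fun x => f x ^+ 2) +
    2 * a * b * RI (fun x => f x * g x) + b ^+ 2 * RI (fun x => g x ^+ 2) =
    RI (fun x => (a * f x + b * g x) ^+ 2).
    have -> : (fun x => (a * f x + b * g x) ^+ 2) = (fun x => a ^+ 2 * f x ^+ 2 +
        (2 * a * b * (f x * g x) + b ^+ 2 * g x ^+ 2)).
      by apply/funext => x; ring.
    have if2 := proj2 sf; have ig2 := proj2 sg.
    rewrite RI_D ?RI_lin2 ?RI_Z ?addrA//; first exact: itgZ.
    by apply: itgD; exact: itgZ.
  exact: RI_sqr_ge0.
set A := RI (fun x => f x ^+ 2) in key *.
set B := RI (fun x => g x ^+ 2) in key *.
set X := RI _ in key *.
have A0 : 0 <= A by exact: RI_sqr_ge0.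
have B0 : 0 <= B by exact: RI_sqr_ge0.
have [Az|An] := eqVneq A 0.
  (* At (a, b) = (-(B + 1), X) the form equals -(B + 2) X^2, which forces X = 0. *)
  rewrite Az mul0r; have := key (- (B + 1)) X; rewrite Az.
  have := sqr_ge0 X; nra.
have Ap : 0 < A by rewrite lt_def An A0.
have := key (- X) A.
have -> : (- X) ^+ 2 * A + 2 * - X * A * X + A ^+ 2 * B = A * (A * B - X ^+ 2) by ring.
by rewrite pmulr_rge0// subr_ge0.
Qed.

Lemma RI_sqD f g : sqi f -> sqi g ->
  RI (fun x => (f x + g x) ^+ 2) <=
  2 * RI (fun x => f x ^+ 2) + 2 * RI (fun x => g x ^+ 2).
Proof.
move=> sf sg; rewrite -RI_lin2; [|exact: (proj2 sf)|exact: (proj2 sg)]; apply: RI_le.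
- exact: (proj2 (sqiD sf sg)).
- by apply: itgD; apply: itgZ; [apply: (proj2 sf)|apply: (proj2 sg)].
- by move=> x; have := sqr_ge0 (f x - g x); nra.
Qed.

Lemma RI_dom (F : nat -> T -> R) f g :
  (forall k, measurable_fun setT (F k)) -> measurable_fun setT f ->
  (forall k x, `|F k x| <= g x) -> itg g ->
  (forall x, (fun k => F k x) @ \oo --> f x) ->
  itg f /\ (fun k => RI (F k)) @ \oo --> RI f.
Proof.
move=> mF mf Fg ig Ff.
have [] := @dominated_convergence _ T R mu setT measurableT
  (fun k => EFin \o F k) (EFin \o f) (EFin \o g).
- by move=> k; exact/measurable_EFinP.
- exact/measurable_EFinP.
- apply: aeW => x _; by apply/cvg_EFin; [exact: nearW|exact: Ff].
- exact: ig.
- by apply: aeW => x k _ /=; rewrite lee_fin.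
move=> hf _ hc; split => //.
have e : (\int[mu]_x (EFin \o f) x = (RI f)%:E)%E by rewrite EFin_RI.
by move: hc; rewrite e => /fine_cvgP[].
Qed.

Lemma cvg_sub0P (a : nat -> R) (l : R) :
  (forall e, 0 < e -> exists K, forall k, (K <= k)%N -> `|a k - l| <= e) ->
  a @ \oo --> l.
Proof.
move=> h; apply/cvgrPdist_le => e e0; have [K hK] := h e e0.
by exists K => // k /= Kk; rewrite distrC; exact: hK.
Qed.

Lemma cvg_evP (a : nat -> R) (l : R) : a @ \oo --> l ->
  forall e, 0 < e -> exists K, forall k, (K <= k)%N -> `|a k - l| <= e.
Proof.
move=> /cvgrPdist_le h e e0; have [K _ hK] := h e e0.
by exists K => k Kk; rewrite distrC; exact: hK.
Qed.

Lemma itg_indic (A : set T) : measurable A -> (mu A < +oo)%E -> itg (\1_A).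
Proof.
move=> mA fA; apply/integrableP; split; first exact/measurable_EFinP.
rewrite (eq_integral (fun x => (\1_A x)%:E)); last first.
  by move=> t _; rewrite /= ger0_norm// /indic.
by rewrite integral_indic// setIT.
Qed.

End square_integrable.

(** * Borel sets of R^n *)

Section rV_measurable.
Context {R : realType} {n : nat}.
Local Notation E := 'rV[R]_n.

Lemma rV_ball_coordP (x y : E) (e : R) : 0 < e ->
  ball x e y <-> forall i, `|x ord0 i - y ord0 i| < e.
Proof.
move=> e0; split => [[_ h] i|h]; first exact: h.
by split=> // i j; rewrite (ord1 i); exact: h.
Qed.

Lemma coord_le_norm (x : E) i : `|x ord0 i| <= `|x|.
Proof.
rewrite -[leRHS]/(mx_norm x) mx_normrE.
exact: (le_bigmax _ (fun ij : 'I_1 * 'I_n => `|x ij.1 ij.2|) (ord0, i)).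
Qed.

(** The sigma-algebra is generated by the coordinates, so an open set is written as the union of the
    countably many boxes with rational centre and half side 1/(k+1) that it contains. *)
Lemma open_rV_measurable (A : set E) : open A -> measurable A.
Proof.
move=> oA; pose B (p : 'rV[rat]_n * nat) : set E :=
  [set y | forall i, `](ratr (p.1 ord0 i) - p.2.+1%:R^-1), (ratr (p.1 ord0 i) + p.2.+1%:R^-1)[%classic (y ord0 i)].
have mB p : measurable (B p).
  by apply: (@measurable_box R n (fun i => [set` `](ratr (p.1 ord0 i) - p.2.+1%:R^-1 : R),
    (ratr (p.1 ord0 i) + p.2.+1%:R^-1)[])) => i; exact: measurable_itv.
have -> : A = \bigcup_(p : 'rV[rat]_n * nat)
    (if `[< B p `<=` A >] then B p else set0).
  apply/seteqP; split=> [x Ax|x [p _]]; last by case: asboolP => // pA; exact: pA.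
  have /nbhs_ballP[e /= e0 xeA] := open_nbhs_nbhs (conj oA Ax).
  have [k ke] : exists k : nat, k.+1%:R^-1 < e / 2.
    have [k _ hk] := near_infty_natSinv_lt (PosNum (divr_gt0 e0 (@ltr0Sn R 1))).
    by exists k; have /= := hk k (leqnn k).
  have k0 : (0 : R) < k.+1%:R^-1 by rewrite invr_gt0.
  move: ke k0; set dl : R := k.+1%:R^-1 => ke k0.
  have /choice [q hq] : forall i : 'I_n, exists q : rat,
      ratr q \in `](x ord0 i - dl), (x ord0 i + dl)[.
    by move=> i; apply: rat_in_itvoo; rewrite ltrBlDr -addrA ltrDl addr_gt0.
  have xB : B (\row_i q i, k) x.
    move=> i /=; have := hq i; rewrite !mxE !in_itv/= -/dl => /andP[? ?].
    by apply/andP; split; lra.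
  exists (\row_i q i, k) => //; rewrite asboolT//.
  move=> y yB; apply: xeA; apply/rV_ball_coordP => // i.
  have := xB i; have := yB i; rewrite /= !in_itv/= !mxE -/dl => /andP[? ?] /andP[? ?].
  by rewrite ltr_norml; apply/andP; split; lra.
apply: countable_bigcupT_measurable; first exact: countableP.
by move=> p; case: asboolP.
Qed.

Lemma closed_rV_measurable (A : set E) : closed A -> measurable A.
Proof.
move=> cA; rewrite -(setCK A); apply: measurableC; apply: open_rV_measurable.
exact: closed_openC.
Qed.

Lemma continuous_rV_measurable (f : E -> R) : continuous f ->
  measurable_fun setT f.
Proof.
move=> cf; apply: (measurability _ (RGenOInfty.measurableE R)).
move=> _ [_ [a ->] <-]; rewrite setTI; apply: open_rV_measurable.
by apply: open_comp => //; exact: rray_open.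
Qed.

Lemma measurable_addrV : measurable_fun setT (fun p : E * E => p.1 + p.2).
Proof.
apply: measurable_fun_rV => i; under eq_fun do rewrite mxE.
by apply: measurable_funD; apply: (measurableT_comp (measurable_coord i)).
Qed.

Lemma measurable_affine (r : R) (h : E) :
  measurable_fun setT (fun x : E => r *: x + h).
Proof.
apply: measurable_fun_rV => i; under eq_fun do rewrite !mxE.
apply: measurable_funD => //; apply: measurable_funM => //.
exact: measurable_coord.
Qed.

End rV_measurable.

(** * Images of measures with a density *)

Section density_measure.
Context d d' (T : measurableType d) (T' : measurableType d') (R : realType).
Context (mu : {measure set T -> \bar R}).
Variables (J : T -> R) (J0 : forall x, 0 <= J x) (mJ : measurable_fun setT J).
Variables (F : T -> T') (mF : measurable_fun setT F).

(** The image under [F] of the measure with density [J]. A change of variables with Jacobian [J]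
    amounts to the equality of this measure with [mu]. The proofs are arguments so that the measure
    structure below can be attached to the term. *)
Definition density_measure of (forall x, 0 <= J x) & measurable_fun setT J
    & measurable_fun setT F :
  set T' -> \bar R := fun A => (\int[mu]_(x in F @^-1` A) (J x)%:E)%E.
Local Notation dm := (density_measure J0 mJ mF).
Import HBNNSimple.

Let mpre A : measurable A -> measurable (F @^-1` A).
Proof. by move=> mA; rewrite -[X in measurable X]setTI; exact: mF. Qed.

Let dm0 : dm set0 = 0%E.
Proof. by rewrite /density_measure preimage_set0 integral_set0. Qed.
Let dm_ge0 A : (0 <= dm A)%E.
Proof. by apply: integral_ge0 => x _; rewrite lee_fin. Qed.
Let dm_sigma_additive : semi_sigma_additive dm.
Proof.
have h : semi_sigma_additive (fun A => \int[mu]_(x in A) (J x)%:E)%E.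
  by apply: semi_sigma_additive_nng_induced => //; exact/measurable_EFinP.
move=> G mG tG mUG; rewrite /density_measure preimage_bigcup; apply: h.
- by move=> i; exact: mpre.
- apply/trivIsetP => /= i k _ _ ik; rewrite -preimage_setI.
  by move/trivIsetP : tG => /(_ _ _ _ _ ik) -> //; rewrite preimage_set0.
- by rewrite -preimage_bigcup; exact: mpre.
Qed.
HB.instance Definition _ := isMeasure.Build _ _ _ dm dm0 dm_ge0 dm_sigma_additive.

(** Both sides are monotone limits along the simple approximations of [f], and for an indicator the
    formula is the definition. *)
Lemma integral_density (f : T' -> \bar R) : measurable_fun setT f ->
  (forall x, 0 <= f x)%E ->
  (\int[dm]_x f x = \int[mu]_x (f (F x) * (J x)%:E))%E.
Proof.
move=> mf f0; pose h := nnsfun_approx measurableT mf.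
have mh k : measurable_fun setT (EFin \o h k) by exact/measurable_EFinP.
have hf x : (EFin \o h k) x @[k --> \oo] --> f x.
  by apply: cvg_nnsfun_approx.
have ndh x a b : (a <= b)%N -> (h a x <= h b x)%R.
  by move=> ab; exact/lefP/nd_nnsfun_approx.
transitivity (limn (fun k => \int[dm]_x (h k x)%:E))%E.
  rewrite -monotone_convergence//=.
  - by apply: eq_integral => x _; apply/esym/cvg_lim => //; exact: hf.
  - by move=> k x _; rewrite lee_fin.
  - by move=> x _ a b ab; rewrite lee_fin ndh.
transitivity (limn (fun k => \int[mu]_x ((h k (F x))%:E * (J x)%:E)))%E; last first.
  rewrite -monotone_convergence//=.
  - apply: eq_integral => x _; apply/cvg_lim => //.
    by apply: cvgeZr => //; exact: hf.
  - move=> k; apply/measurable_EFinP; apply: measurable_funM => //.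
    exact: measurableT_comp.
  - by move=> k x _; rewrite -EFinM lee_fin mulr_ge0.
  - by move=> x _ a b ab; rewrite -!EFinM lee_fin ler_wpM2r ?ndh.
congr (limn _); apply/funext => k.
under [LHS]eq_integral do rewrite fimfunE -fsumEFin//.
rewrite [LHS]ge0_integral_fsum//; last 2 first.
  - by move=> y; apply/measurable_EFinP; exact: measurable_funM.
  - by move=> y x _; rewrite EFinM nnfun_muleindic_ge0.
under [RHS]eq_integral.
  move=> x _; rewrite fimfunE -fsumEFin// ge0_mule_fsuml; last first.
    by move=> y; rewrite EFinM nnfun_muleindic_ge0.
  over.
rewrite ge0_integral_fsum//; last 2 first.
  - move=> y; apply/measurable_EFinP; apply: measurable_funM => //.
    by apply: measurable_funM => //; exact: measurableT_comp.
  - by move=> y x _; rewrite mule_ge0 ?lee_fin// -lee_fin EFinM nnfun_muleindic_ge0.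
apply: eq_fsbigr => y _; have mA : measurable (h k @^-1` [set y]) by [].
set A := h k @^-1` _ in mA *.
(* A negative value is not taken by the nonnegative approximations, so both terms are 0. *)
have [y0|y0] := leP 0 y; last first.
  have A0 : A = set0.
    apply/seteqP; split=> // x /= hy; have : 0 <= h k x by [].
    by rewrite hy leNgt y0.
  by rewrite A0; under eq_integral do rewrite indic0 mulr0;
   under [RHS]eq_integral do rewrite indic0 mulr0 mul0e; rewrite !integral0.
under eq_integral do rewrite EFinM.
under [RHS]eq_integral do rewrite EFinM -muleA.
rewrite ge0_integralZl//; last by exact/measurable_EFinP.
rewrite ge0_integralZl//; last 2 first.
  - under eq_fun do rewrite -EFinM; apply/measurable_EFinP.
    by apply: measurable_funM => //; exact: measurableT_comp.
  - by move=> x _; rewrite -EFinM lee_fin mulr_ge0.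
congr (_ * _)%E; rewrite integral_indic// setIT /density_measure.
rewrite [LHS]integral_mkcond; apply: eq_integral => x _.
have -> : \1_A (F x) = \1_(F @^-1` A) x :> R.
  by rewrite /indic; congr (_ _); apply/idP/idP => /set_mem ?; apply/mem_set.
by rewrite patchE indicE; case: (x \in _); rewrite ?mul1e ?mul0e.
Qed.

End density_measure.

(** * Lebesgue measure under dilations and translations *)

Section affine_invariance.
Context {R : realType}.

(** The left side is itself a measure, so it is enough to check the intervals ]a, b]. *)
Lemma lebesgue_measure_affine (r h : R) (A : set (measurableTypeR R)) : 0 < r -> measurable A ->
  (r%:E * lebesgue_measure ((fun s : R => (r * s + h)%R) @^-1` A) =
   lebesgue_measure A)%E.
Proof.
move=> r0 mA; pose F : measurableTypeR R -> measurableTypeR R := fun s : R => r * s + h.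
have mF : measurable_fun setT F.
  by apply: measurable_funD => //; exact: measurable_funM.
pose m := density_measure (@lebesgue_measure R) (fun=> ltW r0) (measurable_cst r) mF.
have mpre B : measurable B -> measurable (F @^-1` B).
  by move=> mB; rewrite -[X in measurable X]setTI; exact: (mF measurableT B mB).
have mE B : measurable B -> (r%:E * lebesgue_measure (F @^-1` B) = m B)%E.
  by move=> mB; rewrite /m /density_measure integral_cst//; exact: mpre.
rewrite mE//; apply/esym/lebesgue_measure_unique => //.
move=> _ [[a b] _ <-]; apply: (etrans _ (mE _ _)) => //.
have -> : F @^-1` [set` `]a, b]] = [set` `]((a - h) / r), ((b - h) / r)]].
  apply/seteqP; split=> x /=; rewrite !in_itv /= ltr_pdivrMr// ler_pdivlMr//.
    by rewrite ltrBlDr lerBrDr /F mulrC.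
  by rewrite ltrBlDr lerBrDr /F mulrC.
rewrite !lebesgue_measure_itv /= !lte_fin ltr_pM2r ?invr_gt0// ltrD2r.
case: ifPn => _; last by rewrite mule0.
by rewrite -!EFinD -EFinM; congr (_%:E); field; rewrite gt_eqF.
Qed.

Context {n : nat}.
Local Notation E := 'rV[R]_n.
Local Notation mu := (@lebesgue_rV R n).

Lemma cube_lty (M : R) :
  (mu [set x : E | forall i : 'I_n, [set` `[(- M : R)%R, (M : R)%R]] (x ord0 i)] < +oo)%E.
Proof.
apply: (@le_lt_trans _ _ (\prod_(i < n) lebesgue_measure [set` `[(- M : R)%R, (M : R)%R]])%E).
  rewrite le_eqVlt; apply/orP; left; apply/eqP.
  by apply: (@lebesgue_rV_box R n (fun=> [set` `[(- M : R), M]])).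
set m := lebesgue_measure _.
have [m0 moo] : (0 <= m)%E /\ (m < +oo)%E.
  split; first exact: measure_ge0.
  rewrite /m lebesgue_measure_itv /=; case: ifPn => _; last by rewrite lt0y.
  by first [exact: ltry | rewrite -EFinD; exact: ltry].
have : forall s : seq 'I_n, (0 <= \prod_(i <- s) m < +oo)%E.
  elim=> [|a s /andP[IH1 IH2]]; rewrite ?big_nil ?ltry ?lee_fin ?ler01// big_cons.
  apply/andP; split; first exact: mule_ge0.
  by rewrite lte_mul_pinfty// ge0_fin_numE.
by move=> /(_ (index_enum 'I_n)) /andP[].
Qed.

(** Boxes form a pi-system that generates the measurable sets, and the cubes of half side k exhaust
    the space with finite measure. *)
Lemma rV_measure_unique (m : {measure set E -> \bar R}) :
  (forall A : 'I_n -> set R, (forall i, measurable (A i)) ->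
    mu [set x | forall i, A i (x ord0 i)] = m [set x | forall i, A i (x ord0 i)]) ->
  forall A, measurable A -> mu A = m A.
Proof.
move=> mm A mA.
pose G : set (set E) := [set B | exists2 C : 'I_n -> set R, (forall i, measurable (C i)) &
  B = [set x : E | forall i, C i (x ord0 i)]].
pose g (k : nat) : set E := [set x | forall i : 'I_n, [set` `[(- k%:R : R), k%:R]] (x ord0 i)].
apply: (measure_unique G g) => //.
- apply/seteqP; split; last first.
    apply: smallest_sub; first exact: sigma_algebra_measurable.
    by move=> _ [C mC ->]; exact: measurable_box.
  apply: smallest_sub; first exact: smallest_sigma_algebra.
  rewrite -bigcup_seq => _ [i _] [Y mY <-]; apply: sub_sigma_algebra.
  rewrite setTI; exists (fun j => if j == i then Y else setT).
    by move=> j; case: eqP.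
  apply/seteqP; split=> x /=; first by move=> xY j; case: eqP => // ->.
  by move=> /(_ i); rewrite eqxx.
- move=> _ _ [C mC ->] [D mD ->]; exists (fun i => C i `&` D i).
    by move=> i; exact: measurableI.
  by apply/seteqP; split=> x /= => [[xC xD] i|xCD]; [split|split=> i; case: (xCD i)].
- by move=> k; exists (fun=> [set` `[(- k%:R : R), k%:R]]).
- apply/seteqP; split=> // x _.
  exists (Num.truncn `|x|).+1 => // i; rewrite /= in_itv /= -ler_norml.
  apply: (le_trans (coord_le_norm x i)).
  by rewrite ltW// truncnS_gt.
- by move=> B [C mC ->]; exact: mm.
- move=> k.
  exact: (cube_lty k%:R).
Qed.

Lemma lebesgue_rV_affine (r : R) (h : E) (A : set E) : 0 < r -> measurable A ->
  ((r ^+ n)%:E * mu ((fun x => r *: x + h)%R @^-1` A) = mu A)%E.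
Proof.
move=> r0 mA.
pose m := density_measure mu (fun=> exprn_ge0 n (ltW r0)) (measurable_cst (r ^+ n)) (measurable_affine r h).
have mE B : measurable B -> ((r ^+ n)%:E * mu ((fun x => r *: x + h)%R @^-1` B) = m B)%E.
  move=> mB; rewrite /m /density_measure integral_cst//.
  by rewrite -[X in measurable X]setTI; exact: measurable_affine.
rewrite mE//; apply/esym/rV_measure_unique => // C mC.
apply: (etrans _ (mE _ (measurable_box mC))).
have -> : (fun x => r *: x + h)%R @^-1` [set x | forall i, C i (x ord0 i)] =
   [set x | forall i, ((fun s => (r * s + h ord0 i)%R) @^-1` (C i)) (x ord0 i)].
  by apply/seteqP; split=> x /= + i => /(_ i); rewrite !mxE.
have mC' i : measurable ((fun s => (r * s + h ord0 i)%R) @^-1` C i).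
  rewrite -[X in measurable X]setTI.
  by apply: measurable_funD => //; exact: measurable_funM.
apply: (etrans _ (congr1 _ (esym (lebesgue_rV_box mC')))).
apply: (etrans (lebesgue_rV_box mC)).
under eq_bigr => i _ do rewrite -(lebesgue_measure_affine (h ord0 i) r0 (mC i)).
rewrite big_split /=; congr (_ * _)%E.
by rewrite -(big_morph EFin EFinM (erefl _)) prodr_const card_ord.
Qed.

End affine_invariance.

(** * Change of variables in integrals *)

Section change_of_variables.
Context d (T : measurableType d) (R : realType) (mu : {measure set T -> \bar R}).
Variables (J : T -> R) (J0 : forall x, 0 <= J x) (mJ : measurable_fun setT J).
Variables (F : T -> T) (mF : measurable_fun setT F).
Hypothesis dmE : forall A, measurable A -> density_measure mu J0 mJ mF A = mu A.

Lemma ge0_integral_cv (f : T -> \bar R) : measurable_fun setT f ->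
  (forall x, 0 <= f x)%E ->
  (\int[mu]_x (f (F x) * (J x)%:E) = \int[mu]_x f x)%E.
Proof.
move=> mf f0; rewrite -(integral_density mu J0 mJ mF)//.
by apply: eq_measure_integral => A mA _; exact: dmE.
Qed.

Let RI_cv_ge0 (f : T -> R) : (forall x, 0 <= f x) -> itg mu f ->
  itg mu (fun x => f (F x) * J x) /\ RI mu (fun x => f (F x) * J x) = RI mu f.
Proof.
move=> f0 hf; have mf := itg_meas hf.
have e : (\int[mu]_x (f (F x) * J x)%:E = \int[mu]_x (f x)%:E)%E.
  under eq_integral do rewrite EFinM.
  rewrite (ge0_integral_cv (f := EFin \o f))//.
  exact/measurable_EFinP.
split; last by rewrite /RI e.
apply/integrableP; split.
  apply/measurable_EFinP; apply: measurable_funM => //; exact: measurableT_comp.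
under eq_integral do rewrite gee0_abs ?lee_fin ?mulr_ge0//.
by rewrite e -EFin_RI// ltry.
Qed.

Lemma RI_cv (f : T -> R) : itg mu f ->
  itg mu (fun x => f (F x) * J x) /\ RI mu (fun x => f (F x) * J x) = RI mu f.
Proof.
(* Reduction to the nonnegative functions |f| + f and |f| - f, whose half difference is f. *)
move=> hf; have ha := itg_abs hf.
have [|i1 e1] := @RI_cv_ge0 (fun x => `|f x| + f x) _ (itgD ha hf).
  by move=> x; have := ler_norm (- f x); rewrite normrN; lra.
have [|i2 e2] := @RI_cv_ge0 (fun x => `|f x| - f x) _ (itgB ha hf).
  by move=> x; have := ler_norm (f x); lra.
have e x : f (F x) * J x = 2^-1 * ((`|f (F x)| + f (F x)) * J x - (`|f (F x)| - f (F x)) * J x).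
  by field.
under eq_fun do rewrite e; split; first exact/itgZ/itgB.
rewrite RI_Z ?RI_B ?e1 ?e2//; last exact: itgB.
by rewrite RI_D// RI_B//; field.
Qed.

(** The preimage of a null set has zero mass for the density [J], hence is null because [J] is
    positive. *)
Lemma ae_cv (P : T -> Prop) : (forall x, 0 < J x) ->
  {ae mu, forall x, P x} -> {ae mu, forall x, P (F x)}.
Proof.
move=> Jp [N [mN N0 NP]].
have mFN : measurable (F @^-1` N) by rewrite -[X in measurable X]setTI; exact: mF.
exists (F @^-1` N); split => //; last by move=> x /= hx; exact: NP.
have := dmE mN; rewrite N0 /density_measure => h.
have mJN : measurable_fun (F @^-1` N) (EFin \o J).
  by apply/measurable_EFinP; exact: measurable_funTS.
have [/(_ _) + _] := @ae_eq_integral_abs _ _ _ mu _ mFN (EFin \o J) mJN.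
have -> : (\int[mu]_(x in F @^-1` N) `|(EFin \o J) x| = 0)%E.
  by rewrite -[RHS]h; apply: eq_integral => x _ /=; rewrite ger0_norm.
move=> /(_ erefl) [M [mM M0 NM]].
apply: (subset_measure0 _ _ _ M0) => // x hx; apply: NM => /=.
by move=> /(_ hx) [] /eqP; rewrite gt_eqF.
Qed.

End change_of_variables.

Section rV_affine_integral.
Context {R : realType} {n : nat}.
Local Notation E := 'rV[R]_n.
Local Notation mu := (@lebesgue_rV R n).

Lemma affine_dmE (r : R) (h : E) (r0 : 0 < r) A : measurable A ->
  density_measure mu (fun=> exprn_ge0 n (ltW r0)) (measurable_cst (r ^+ n))
    (measurable_affine r h) A = mu A.
Proof.
move=> mA; rewrite /density_measure integral_cst//.
  exact: lebesgue_rV_affine.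
by rewrite -[X in measurable X]setTI; exact: measurable_affine.
Qed.

Lemma itg_affine (r : R) (h : E) (f : E -> R) : 0 < r -> itg mu f ->
  itg mu (fun x => f (r *: x + h)).
Proof.
move=> r0 hf; have [+ _] := RI_cv (affine_dmE h r0) hf.
move=> /(itgZr (r ^+ n)^-1); under eq_fun do rewrite mulfK ?expf_neq0 ?gt_eqF//.
exact.
Qed.

Lemma RI_affine (r : R) (h : E) (f : E -> R) : 0 < r -> itg mu f ->
  RI mu (fun x => f (r *: x + h)) = (r ^+ n)^-1 * RI mu f.
Proof.
move=> r0 hf; have [+ <-] := RI_cv (affine_dmE h r0) hf.
move=> /RI_Z <-; congr (RI _ _); apply/funext => x.
by rewrite mulrC mulfK// expf_neq0// gt_eqF.
Qed.

Lemma sqi_affine (r : R) (h : E) (f : E -> R) : 0 < r -> sqi mu f ->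
  sqi mu (fun x => f (r *: x + h)).
Proof.
move=> r0 [mf hf]; split; first by apply: measurableT_comp => //; exact: measurable_affine.
exact: itg_affine hf.
Qed.

Lemma ae_affine (r : R) (h : E) (P : E -> Prop) : 0 < r ->
  {ae mu, forall x, P x} -> {ae mu, forall x, P (r *: x + h)}.
Proof.
by move=> r0; apply: (ae_cv (affine_dmE h r0)) => _; exact: exprn_gt0.
Qed.

Lemma itg_translate (h : E) (f : E -> R) : itg mu f -> itg mu (fun x => f (x + h)).
Proof.
by move=> /(itg_affine h ltr01); under eq_fun do rewrite scale1r.
Qed.

Lemma RI_translate (h : E) (f : E -> R) : itg mu f ->
  RI mu (fun x => f (x + h)) = RI mu f.
Proof.
move=> /(RI_affine h ltr01); under eq_fun do rewrite scale1r.
by rewrite expr1n invr1 mul1r.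
Qed.

Lemma sqi_translate (h : E) (f : E -> R) : sqi mu f -> sqi mu (fun x => f (x + h)).
Proof.
by move=> /(sqi_affine h ltr01); under eq_fun do rewrite scale1r.
Qed.

Lemma mu_bounded_lty (A : set E) (M : R) : measurable A ->
  (forall x, A x -> `|x| <= M) -> (mu A < +oo)%E.
Proof.
move=> mA AM; pose B : set E := [set x | forall i : 'I_n, [set` `[(- M : R), M]] (x ord0 i)].
have mB : measurable B by apply: (@measurable_box R n (fun=> [set` `[(- M : R), M]])).
apply: (@le_lt_trans _ _ (mu B)).
  apply: le_measure; rewrite ?inE// => x /AM xM i /=.
  by rewrite in_itv/= -ler_norml (le_trans (coord_le_norm _ _)).
exact: cube_lty.
Qed.

Lemma compact_bounded_rV (K : set E) : compact K -> exists2 M : R, 0 < M & forall x, K x -> `|x| <= M.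
Proof.
move=> /compact_bounded [M [_ hM]]; exists (`|M| + 1); first by rewrite ltr_wpDl.
by move=> x Kx; apply: hM => //; rewrite (le_lt_trans (ler_norm M))// ltrDl.
Qed.

Lemma itg_bounded_supp (f : E -> R) (M C : R) : measurable_fun setT f ->
  (forall x, `|f x| <= C) -> (forall x, M < `|x| -> f x = 0) -> itg mu f.
Proof.
move=> mf fC f0; pose B : set E := [set x | `|x| <= M].
have mB : measurable B.
  apply: closed_rV_measurable; have -> : B = Num.norm @^-1` [set y | y <= M] by [].
  by apply: closed_comp => [x _|]; [exact: norm_continuous|exact: closed_le].
have iB : itg mu (\1_B) by apply: itg_indic => //; apply: (@mu_bounded_lty _ M).
apply: (itg_le mf _ (itgZ C iB)) => x; rewrite indicE.
have [xB|xB] := boolP (x \in B); first by rewrite mulr1.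
rewrite mulr0 f0 ?normr0// ltNge; apply/negP => h; move/negP: xB; apply.
by rewrite inE.
Qed.

End rV_affine_integral.

(** * Smooth functions and mollification *)

Section smooth_functions.
Context {R : realType} {n : nat}.
Local Notation E := 'rV[R]_n.
Implicit Types (f g : E -> R) (x v : E).

Lemma derive_partials f x v : differentiable f x ->
  'D_v f x = \sum_(i < n) v ord0 i * partial i f x.
Proof.
move=> df; rewrite deriveE// [in LHS](row_sum_delta v) raddf_sum.
by apply: eq_bigr => i _; rewrite [LHS]linearZ /= /partial deriveE.
Qed.

Lemma smooth_diff f x : smooth f -> differentiable f x.
Proof. by move=> /(_ [::] x). Qed.

Lemma smooth_cont f : smooth f -> continuous f.
Proof. by move=> sf x; apply: differentiable_continuous; exact: smooth_diff. Qed.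

Lemma smooth_partial i f : smooth f -> smooth (partial i f).
Proof. by move=> sf s x; have := sf (rcons s i) x; rewrite foldr_rcons. Qed.

(** Coinduction for smoothness: a class of differentiable functions that is stable under partial
    derivatives. *)
Lemma smooth_coind (P : (E -> R) -> Prop) :
  (forall f, P f -> forall x, differentiable f x) ->
  (forall f i, P f -> P (partial i f)) -> forall f, P f -> smooth f.
Proof.
move=> Pd Pp f Pf s x; apply: Pd; elim/last_ind: s f Pf => [//|s i IH] f Pf.
by rewrite foldr_rcons; apply: IH; exact: Pp.
Qed.

(** Smoothness truncated at order k. Products and compositions are treated by induction on the
    order, which the lists of indices in [smooth] do not offer directly. *)
Fixpoint smoothk (k : nat) f : Prop :=
  if k is k'.+1 then (forall x, differentiable f x) /\ forall i, smoothk k' (partial i f)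
  else forall x, differentiable f x.

Lemma smoothkS k f : smoothk k.+1 f -> smoothk k f.
Proof.
elim: k f => [f []//|k IH f [df pf]]; split=> // i; apply: IH; exact: pf.
Qed.

Lemma smoothkP f : smooth f <-> forall k, smoothk k f.
Proof.
split=> [sf k|]; last first.
  apply: (smooth_coind (P := fun f => forall k, smoothk k f)).
  - by move=> g hg; exact: hg 0%N.
  - by move=> g i hg k; exact: (proj2 (hg k.+1)).
elim: k f sf => [f sf x|k IH f sf]; first exact: smooth_diff.
by split=> [x|i]; [exact: smooth_diff|apply: IH; exact: smooth_partial].
Qed.

Lemma partialD i f g : (forall x, differentiable f x) -> (forall x, differentiable g x) ->
  partial i (fun x => f x + g x) = fun x => partial i f x + partial i g x.
Proof.
move=> df dg; apply/funext => x; rewrite /partial.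
by rewrite [LHS](@deriveD _ _ _ f g)//; exact: diff_derivable.
Qed.

Lemma partialM i f g : (forall x, differentiable f x) -> (forall x, differentiable g x) ->
  partial i (fun x => f x * g x) = fun x => f x * partial i g x + g x * partial i f x.
Proof.
move=> df dg; apply/funext => x; rewrite /partial.
by rewrite [LHS](@deriveM _ _ f g)//; exact: diff_derivable.
Qed.

Lemma partial_cst i (a : R) : partial i (fun _ : E => a) = fun _ => 0.
Proof. by apply/funext => x; exact: derive_cst. Qed.

Lemma partialZ i (a : R) f : (forall x, differentiable f x) ->
  partial i (fun x => a * f x) = fun x => a * partial i f x.
Proof.
move=> df; rewrite (@partialM i (fun=> a) f)//.
by rewrite partial_cst; apply/funext => x; rewrite mulr0 addr0.
Qed.

Lemma partialN i f : (forall x, differentiable f x) ->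
  partial i (fun x => - f x) = fun x => - partial i f x.
Proof.
move=> df; have := partialZ i (-1) df.
by under eq_fun do rewrite mulN1r; move=> ->; apply/funext => x; rewrite mulN1r.
Qed.

Lemma partialB i f g : (forall x, differentiable f x) -> (forall x, differentiable g x) ->
  partial i (fun x => f x - g x) = fun x => partial i f x - partial i g x.
Proof.
move=> df dg; rewrite (partialD _ df); last by move=> x; exact: differentiableN.
by rewrite partialN.
Qed.

Lemma partial_sum i (I : Type) (s : seq I) (F : I -> E -> R) :
  (forall j x, differentiable (F j) x) ->
  partial i (fun x => \sum_(j <- s) F j x) = fun x => \sum_(j <- s) partial i (F j) x.
Proof.
move=> dF; elim: s => [|a s IH].
  under eq_fun do rewrite big_nil; rewrite partial_cst.
  by apply/funext => x; rewrite big_nil.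
under eq_fun do rewrite big_cons; rewrite partialD//; last first.
  elim: s {IH} => [|b s IH2] x; first by under eq_fun do rewrite big_nil; exact: differentiable_cst.
  by under eq_fun do rewrite big_cons; apply: differentiableD.
by rewrite IH; apply/funext => x; rewrite big_cons.
Qed.

Lemma differentiable_comp1 (h : R -> R) f x :
  derivable h (f x) 1 -> differentiable f x -> differentiable (fun y => h (f y)) x.
Proof.
move=> dh df; apply: (@differentiable_comp _ _ _ _ f h) => //.
exact/derivable1_diffP.
Qed.

Lemma partial_comp i (h : R -> R) f : (forall x, derivable h (f x) 1) ->
  (forall x, differentiable f x) ->
  partial i (fun x => h (f x)) = fun x => derive1 h (f x) * partial i f x.
Proof.
move=> dh df; apply/funext => x.
have dh' : differentiable h (f x) by exact/derivable1_diffP.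
rewrite /partial deriveE; last exact: differentiable_comp1.
rewrite -[fun x => h (f x)]/(h \o f) diff_comp//= derive1E' // deriveE//.
by rewrite -[X in 'd h _ X = _]mulr1 [LHS]linearZ mulrC.
Qed.

Lemma smoothk_cst k (a : R) : smoothk k (fun _ => a).
Proof.
elim: k a => [|k IH] a; first by move=> x; exact: differentiable_cst.
by split=> [x|i]; [exact: differentiable_cst|rewrite partial_cst; exact: IH].
Qed.

Lemma smoothkD k f g : smoothk k f -> smoothk k g -> smoothk k (fun x => f x + g x).
Proof.
elim: k f g => [f g df dg x|k IH f g [df pf] [dg pg]]; first exact: differentiableD.
by split=> [x|i]; [exact: differentiableD|by rewrite partialD//; apply: IH; [exact: pf|exact: pg]].
Qed.

Lemma smoothkM k f g : smoothk k f -> smoothk k g -> smoothk k (fun x => f x * g x).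
Proof.
elim: k f g => [f g df dg x|k IH f g sf sg]; first exact: differentiableM.
have [df pf] := sf; have [dg pg] := sg.
split=> [x|i]; first exact: differentiableM.
rewrite partialM//; apply: smoothkD; apply: IH.
- exact: smoothkS sf.
- exact: pg.
- exact: smoothkS sg.
- exact: pf.
Qed.

Lemma smooth_cst (a : R) : smooth (fun _ : E => a).
Proof. by apply/smoothkP => k; exact: smoothk_cst. Qed.

Lemma smoothD f g : smooth f -> smooth g -> smooth (fun x => f x + g x).
Proof.
by move=> /smoothkP sf /smoothkP sg; apply/smoothkP => k; exact: smoothkD.
Qed.

Lemma smoothM f g : smooth f -> smooth g -> smooth (fun x => f x * g x).
Proof.
by move=> /smoothkP sf /smoothkP sg; apply/smoothkP => k; exact: smoothkM.
Qed.

Lemma smoothZ (a : R) f : smooth f -> smooth (fun x => a * f x).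
Proof. by move=> sf; apply: smoothM => //; exact: smooth_cst. Qed.

Lemma smoothN f : smooth f -> smooth (fun x => - f x).
Proof. by move=> sf; under eq_fun do rewrite -mulN1r; exact: smoothZ. Qed.

Lemma smoothB f g : smooth f -> smooth g -> smooth (fun x => f x - g x).
Proof. by move=> sf sg; apply: smoothD => //; exact: smoothN. Qed.

Lemma smooth_sum (I : Type) (s : seq I) (F : I -> E -> R) :
  (forall j, smooth (F j)) -> smooth (fun x => \sum_(j <- s) F j x).
Proof.
move=> sF; elim: s => [|a s IH]; first by under eq_fun do rewrite big_nil; exact: smooth_cst.
by under eq_fun do rewrite big_cons; exact: smoothD.
Qed.

(* Smoothness is propagated order by order along a differential equation. *)
Lemma smooth_step (P : (E -> R) -> Prop) :
  (forall f, P f -> forall x, differentiable f x) ->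
  (forall k f i, P f -> (forall g, P g -> smoothk k g) -> smoothk k (partial i f)) ->
  forall f, P f -> smooth f.
Proof.
move=> Pd Pp f Pf; apply/smoothkP => k; elim: k f Pf => [f Pf|k IH f Pf]; first exact: Pd.
by split=> [|i]; [exact: Pd|apply: Pp].
Qed.

Lemma coord_diff i x : differentiable (fun y : E => y ord0 i) x.
Proof. exact: differentiable_coord. Qed.

Lemma partial_coord i j : partial i (fun y : E => y ord0 j) = fun=> (i == j)%:R.
Proof.
apply/funext => x; rewrite /partial.
have := derive_mx (@derivable_id _ _ x (delta_mx ord0 i : E)).
rewrite derive_id => /matrixP /(_ ord0 j); rewrite !mxE eqxx /= eq_sym => ->.
by [].
Qed.

Lemma smooth_coord i : smooth (fun y : E => y ord0 i).
Proof.
apply/smoothkP; case=> [|k]; first by move=> x; exact: coord_diff.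
by split=> [x|j]; [exact: coord_diff|rewrite partial_coord; exact: smoothk_cst].
Qed.

Lemma partial_affine i (r : R) (h : E) f : (forall x, differentiable f x) ->
  partial i (fun x => f (r *: x + h)) = fun x => r * partial i f (r *: x + h).
Proof.
move=> df; apply/funext => x.
have e v : 'D_v (fun x => f (r *: x + h)) x = 'D_(r *: v) f (r *: x + h).
  rewrite /derive; set d := (fun _ : R => _); set d' := (fun _ : R => _).
  suff -> : d = d' by []; rewrite funeqE => k; rewrite /d /d' /=.
  congr (_ *: (f _ - _)); rewrite scalerDr !scalerA addrA; congr (_ *: _ + _ + _).
  exact: mulrC.
by rewrite /partial e !deriveE// [LHS]linearZ.
Qed.

Lemma differentiable_affine (r : R) (h : E) f : (forall x, differentiable f x) ->
  forall x, differentiable (fun x => f (r *: x + h)) x.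
Proof.
move=> df x; have cid : is_diff x (fun y : E => r *: y + h) (fun y : E => r *: y).
  have -> : (fun y : E => r *: y) = (r \*: (id : E -> E)) \+ (0 : E -> E).
    by apply/funext => y /=; rewrite addr0.
  exact: is_diffD.
by apply: (@differentiable_comp _ _ _ _ (fun y : E => r *: y + h) f).
Qed.

Lemma smooth_affine (r : R) (h : E) f : smooth f -> smooth (fun x => f (r *: x + h)).
Proof.
move=> /smoothkP sf; apply/smoothkP => k; elim: k f sf => [f sf|k IH f sf].
  exact: differentiable_affine (sf 0%N).
split=> [|i]; first exact: differentiable_affine (sf 0%N).
rewrite partial_affine; last exact: sf 0%N.
apply: smoothkM; first exact: smoothk_cst.
by apply: IH => m; exact: (proj2 (sf m.+1)).
Qed.

End smooth_functions.

(** * Smooth functions with compact support *)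

Section compactly_supported.
Context {R : realType} {n : nat}.
Local Notation E := 'rV[R]_n.
Local Notation mu := (@lebesgue_rV R n).
Implicit Types (f g : E -> R) (x v h : E) (K : set E).

Definition suppin K f := forall x, ~ K x -> f x = 0.

Lemma partial_supp K f i : closed K -> suppin K f -> suppin K (partial i f).
Proof.
move=> cK fK x Kx; rewrite /partial (@near_eq_derive _ _ _ f (cst 0)) ?derive_cst//.
have : nbhs x (~` K) by apply: open_nbhs_nbhs; split => //; exact: closed_openC.
by apply: filterS => y; exact: fK.
Qed.

Lemma supp_bounded K f : compact K -> suppin K f -> continuous f ->
  exists2 C, 0 <= C & forall x, `|f x| <= C.
Proof.
move=> cK fK cf.
have : compact (f @` K).
  by apply: continuous_compact => //; exact: continuous_subspaceT.
move=> /compact_bounded [M [_ hM]]; exists (`|M| + 1); first by rewrite addr_ge0.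
move=> x; have [Kx|Kx] := pselect (K x); last by rewrite fK// normr0 addr_ge0.
apply: (hM (`|M| + 1)); last by exists x.
by rewrite (le_lt_trans (ler_norm M))// ltrDl.
Qed.

Lemma suppin_far K f : compact K -> suppin K f ->
  exists2 M, 0 < M & forall x, M < `|x| -> f x = 0.
Proof.
move=> /compact_bounded_rV[M M0 KM] fK; exists M => // x Mx; apply: fK => Kx.
by have := KM x Kx; rewrite leNgt Mx.
Qed.

Lemma cont_supp_itg K f : compact K -> suppin K f -> continuous f -> itg mu f.
Proof.
move=> cK fK cf; have [C _ fC] := supp_bounded cK fK cf.
have [M _ hM] := suppin_far cK fK.
apply: (itg_bounded_supp _ fC hM).
exact: continuous_rV_measurable.
Qed.

Lemma line_derive f x h t : differentiable f (x + t *: h) ->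
  is_derive t 1 (fun t : R => f (x + t *: h)) ('D_h f (x + t *: h)).
Proof.
move=> df.
have e : (fun s : R => s^-1 *: (((fun t : R => f (x + t *: h)) \o shift t) (s *: 1) -
     f (x + t *: h))) =
   (fun s : R => s^-1 *: ((f \o shift (x + t *: h)) (s *: h) - f (x + t *: h))).
  rewrite funeqE => s /=; congr (_ *: (f _ - _)).
  by rewrite [s *: 1]mulr1 scalerDl addrCA.
split; first by rewrite /derivable e; exact: diff_derivable.
by rewrite /derive e.
Qed.

Lemma line_MVT f x h : (forall y, differentiable f y) ->
  exists2 t : R, 0 <= t <= 1 & f (x + h) - f x = 'D_h f (x + t *: h).
Proof.
move=> df; have dl t := line_derive (df (x + t *: h)).
have [] := @MVT_segment R (fun t => f (x + t *: h)) (fun t => 'D_h f (x + t *: h)) 0 1 ler01.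
- apply: continuous_subspaceT => t; apply: differentiable_continuous.
  by apply/derivable1_diffP; case: (dl t).
- move=> t; rewrite in_itv /= => t01; rewrite scale0r addr0 scale1r subr0 mulr1 => e.
  by exists t.
Qed.

Lemma sum_abs_bound (a b : 'I_n -> R) A B : (forall i, `|a i| <= A) -> (forall i, `|b i| <= B) ->
  `|\sum_i a i * b i| <= n%:R * (A * B).
Proof.
move=> ha hb; apply: (le_trans (ler_norm_sum _ _ _)).
apply: (@le_trans _ _ (\sum_(i < n) A * B)).
  by apply: ler_sum => i _; rewrite normrM ler_pM.
by rewrite sumr_const card_ord mulr_natl.
Qed.

Lemma smooth_lip K f : compact K -> suppin K f -> smooth f ->
  exists2 C, 0 <= C & forall x h, `|f (x + h) - f x| <= C * `|h|.
Proof.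
move=> cK fK sf; have clK := compact_closed (@norm_hausdorff _ _) cK.
have /choice [C hC] : forall i : 'I_n, exists C, 0 <= C /\ forall x, `|partial i f x| <= C.
  move=> i; have [C C0 hC] := supp_bounded cK (partial_supp i clK fK) (smooth_cont (smooth_partial i sf)).
  by exists C.
pose B := \sum_i C i.
have hB i x : `|partial i f x| <= B.
  apply: (le_trans (proj2 (hC i) x)); rewrite /B (bigD1 i)//= lerDl.
  by apply: sumr_ge0 => j _; exact: (proj1 (hC j)).
have B0 : 0 <= B by apply: sumr_ge0 => j _; exact: (proj1 (hC j)).
exists (n%:R * B); first by rewrite mulr_ge0.
move=> x h; have df y : differentiable f y by exact: smooth_diff.
have [t _ ->] := line_MVT x h df.
rewrite derive_partials; last exact: smooth_diff.
rewrite -mulrA [B * _]mulrC; apply: sum_abs_bound => // i; exact: coord_le_norm.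
Qed.

(** Mean value theorem on the segment, then the Lipschitz bound for the partial derivatives; compact
    support makes the constant uniform in x. *)
Lemma smooth_taylor K f : compact K -> suppin K f -> smooth f ->
  exists2 C, 0 <= C & forall x h,
   `|f (x + h) - f x - \sum_i h ord0 i * partial i f x| <= C * `|h| ^+ 2.
Proof.
move=> cK fK sf; have clK := compact_closed (@norm_hausdorff _ _) cK.
have /choice [C hC] : forall i : 'I_n, exists C, 0 <= C /\
    forall x h, `|partial i f (x + h) - partial i f x| <= C * `|h|.
  move=> i; have [C C0 hC] := smooth_lip cK (partial_supp i clK fK) (smooth_partial i sf).
  by exists C.
pose B := \sum_i C i.
have hB i x h : `|partial i f (x + h) - partial i f x| <= B * `|h|.
  apply: (le_trans (proj2 (hC i) x h)); rewrite ler_wpM2r// /B (bigD1 i)//= lerDl.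
  by apply: sumr_ge0 => j _; exact: (proj1 (hC j)).
have B0 : 0 <= B by apply: sumr_ge0 => j _; exact: (proj1 (hC j)).
exists (n%:R * B); first by rewrite mulr_ge0.
move=> x h; have df y : differentiable f y by exact: smooth_diff.
have [t /andP[t0 t1] ->] := line_MVT x h df.
rewrite derive_partials; last exact: smooth_diff.
rewrite -sumrB; under eq_bigr do rewrite -mulrBr.
have -> : n%:R * B * `|h| ^+ 2 = n%:R * (`|h| * (B * `|h|)) by ring.
apply: sum_abs_bound => i; first exact: coord_le_norm.
apply: (le_trans (hB _ _ _)); rewrite ler_wpM2l// normrZ ger0_norm//.
by rewrite ler_piMl.
Qed.

Lemma delta_norm i : `|delta_mx ord0 i : E| <= 1.
Proof.
rewrite -[leLHS]/(mx_norm _) mx_normrE; apply: bigmax_le => // -[a b] _ /=.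
by rewrite mxE; case: (_ && _); rewrite ?normr1 ?normr0.
Qed.

(** By translation invariance f(x + t e_i) - f(x) has integral 0. Taylor's formula then bounds t
    times the integral of the derivative by a multiple of t^2. *)
Lemma RI_partial0 K f i : compact K -> suppin K f -> smooth f ->
  RI mu (partial i f) = 0.
Proof.
move=> cK fK sf; have clK := compact_closed (@norm_hausdorff _ _) cK.
have [C C0 hC] := smooth_taylor cK fK sf.
have [M M0 KM] := compact_bounded_rV cK.
have far x : M < `|x| -> ~ K x by move=> Mx /KM; rewrite leNgt Mx.
have iff := cont_supp_itg cK fK (smooth_cont sf).
have ip := cont_supp_itg cK (partial_supp i clK fK) (smooth_cont (smooth_partial i sf)).
(* Contains the support of f and of its translates by vectors of length at most 1. *)
pose B : set E := [set x | `|x| <= M + 1].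
have mB : measurable B.
  apply: closed_rV_measurable; have -> : B = Num.norm @^-1` [set y | y <= M + 1] by [].
  by apply: closed_comp => [x _|]; [exact: norm_continuous|exact: closed_le].
have iB : itg mu (\1_B) by apply: itg_indic => //; apply: (@mu_bounded_lty _ _ _ (M + 1)).
have B0 : 0 <= RI mu (\1_B) by apply: RI_ge0 => x; rewrite indicE.
have key t : 0 < t -> t <= 1 -> `|RI mu (partial i f)| <= t * (C * RI mu (\1_B)).
  move=> t0 t1; pose d : E := t *: delta_mx ord0 i.
  have dt : `|d| <= t by rewrite normrZ gtr0_norm// ler_piMr ?delta_norm ?ltW.
  have itd : itg mu (fun x => f (x + d)) by exact: itg_translate.
  have e0 : RI mu (fun x => f (x + d) - f x - t * partial i f x) = - (t * RI mu (partial i f)).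
    rewrite RI_B ?RI_B ?RI_Z ?RI_translate ?subrr ?sub0r//; [exact: itgB|exact: itgZ].
  have bd x : `|f (x + d) - f x - t * partial i f x| <= t ^+ 2 * C * \1_B x.
    have [Bx|Bx] := pselect (B x).
      rewrite indicE mem_set// mulr1.
      have -> : t * partial i f x = \sum_j d ord0 j * partial j f x.
        rewrite (bigD1 i)//= big1 ?addr0.
          by rewrite /d !mxE !eqxx mulr1.
        by move=> j ji; rewrite /d !mxE (negbTE ji) andbF mulr0 mul0r.
      apply: (le_trans (hC x d)); rewrite mulrC ler_wpM2r// ler_sqr ?nnegrE//.
      exact: ltW.
    have xM : M + 1 < `|x| by rewrite ltNge; apply/negP.
    have xd : M < `|x + d|.
      have := lerB_dist x (- d); rewrite opprK normrN; lra.
    rewrite fK; last exact: far.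
    rewrite fK; last by apply: far; lra.
    rewrite (partial_supp i clK fK); last by apply: far; lra.
    by rewrite mulr0 !subr0 normr0 mulr_ge0 ?mulr_ge0 ?exprn_ge0 ?(ltW t0)// indicE.
  have := RI_abs (itgB (itgB itd iff) (itgZ t ip)).
  rewrite e0 normrN normrM gtr0_norm// => h1.
  rewrite -(ler_pM2l t0); apply: (le_trans h1).
  have -> : t * (t * (C * RI mu \1_B)) = RI mu (fun x => t ^+ 2 * C * \1_B x).
    by rewrite RI_Z//; ring.
  apply: RI_le => //; first exact/itg_abs/itgB/itgZ/ip/itgB.
  exact: itgZ.
apply/normr0_eq0/le_anti; rewrite normr_ge0 andbT.
apply/ler_addgt0Pl => e e0; rewrite addr0.
have D0 : 0 < C * RI mu (\1_B) + 1 by rewrite ltr_wpDl// mulr_ge0.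
pose t := Num.min 1 (e / (C * RI mu (\1_B) + 1)).
have t0 : 0 < t by rewrite lt_min ltr01 divr_gt0.
have t1 : t <= 1 by rewrite ge_min lexx.
apply: (le_trans (key t t0 t1)).
have te : t <= e / (C * RI mu (\1_B) + 1) by rewrite ge_min lexx orbT.
apply: (@le_trans _ _ (t * (C * RI mu (\1_B) + 1))).
  by rewrite ler_wpM2l ?(ltW t0)// lerDl.
by rewrite -ler_pdivlMr.
Qed.

End compactly_supported.

(** * The functions t^-m exp(-1/t) *)

Section exponential_bump.
Context {R : realType}.

(** The whole family is needed because it is closed under differentiation up to linear combinations:
    the derivative of [em m] is -m [em (m+1)] + [em (m+2)]. *)
Definition em (m : nat) (t : R) : R := if 0 < t then t^-1 ^+ m * expR (- t^-1) else 0.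

Lemma em_gt0 m t : 0 < t -> 0 < em m t.
Proof. by move=> t0; rewrite /em t0 mulr_gt0 ?expR_gt0// exprn_gt0// invr_gt0. Qed.

Lemma em_le0 m t : t <= 0 -> em m t = 0.
Proof. by move=> t0; rewrite /em ltNge t0. Qed.

Lemma em_ge0 m t : 0 <= em m t.
Proof. by have [/(em_gt0 m)/ltW//|/em_le0 ->] := ltP 0 t. Qed.

(** The exponential series gives exp(1/t) >= t^-(m+2) / (m+2)!. A quadratic bound is what makes the
    derivative at 0 exist and vanish. *)
Lemma em_sqr m : exists2 C : R, 0 <= C & forall t, `|em m t| <= C * t ^+ 2.
Proof.
exists ((m.+2)`!%:R) => // t; have [t0|t0] := ltP 0 t; last first.
  by rewrite em_le0// normr0 mulr_ge0// sqr_ge0.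
rewrite ger0_norm ?em_ge0// /em t0 expRN.
have ti : 0 <= t^-1 by rewrite invr_ge0 ltW.
have := expR_ge1Dxn m.+1 ti; set F := (_`!%:R : R) => h.
have F0 : 0 < F by rewrite ltr0n fact_gt0.
have h2 : t^-1 ^+ m.+2 / F <= expR t^-1 by apply: le_trans h; rewrite lerDr.
apply: (@le_trans _ _ (t^-1 ^+ m * (t^-1 ^+ m.+2 / F)^-1)).
  rewrite ler_wpM2l ?exprn_ge0// lef_pV2 ?posrE ?expR_gt0// divr_gt0//.
  by rewrite exprn_gt0// invr_gt0.
rewrite -addn2 exprD; set z := t^-1 ^+ m.
have z0 : z != 0 by rewrite expf_neq0// invr_eq0 gt_eqF.
rewrite exprVn le_eqVlt; apply/orP; left; apply/eqP; field.
by rewrite z0 !gt_eqF.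
Qed.

Lemma is_derive0_sqr (f : R -> R) C : 0 <= C -> (forall t, `|f t| <= C * t ^+ 2) ->
  is_derive (0 : R) 1 f 0.
Proof.
move=> C0 hf; have f0 : f 0 = 0.
  by apply/normr0_eq0/le_anti; rewrite normr_ge0 andbT (le_trans (hf 0))// expr0n mulr0.
have h : (fun h : R => h^-1 *: ((f \o shift 0) (h *: (1 : R^o)) - f 0)) @ 0^' --> (0 : R).
  apply/cvgrPdist_le => e e0; near=> t.
  rewrite /= sub0r normrN f0 subr0 addr0 normrM normfV.
  have t0 : t != 0 by near: t; exact: nbhs_dnbhs_neq.
  rewrite -[t *: _]/(t * 1) mulr1 mulrC ler_pdivrMr ?normr_gt0//.
  apply: (le_trans (hf t)).
  rewrite -(real_normK (num_real t)) expr2 mulrA ler_wpM2r//.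
  have te : `|t| <= e / (C + 1).
    near: t; apply: dnbhs0_le; rewrite divr_gt0//; lra.
  apply: (@le_trans _ _ ((C + 1) * `|t|)); first by rewrite ler_wpM2r//; lra.
  by rewrite mulrC -ler_pdivlMr//; lra.
by split; [apply/cvg_ex; exists 0|apply/cvg_lim].
Unshelve. all: by end_near. Qed.

Lemma is_derive_em m (t : R) : is_derive t 1 (em m) (- m%:R * em m.+1 t + em m.+2 t).
Proof.
have [t0|t0|->] := ltgtP t 0.
- rewrite !em_le0 ?ltW// mulr0 addr0.
  apply: (@near_eq_is_derive _ _ _ (cst 0)) => //.
  have : nbhs t [set s | s < 0] by apply: open_nbhs_nbhs; split => //; exact: lray_open.
  by apply: filterS => s s0; rewrite em_le0 ?ltW.
- have d1 : is_derive t 1 (fun s : R => s^-1) (- t ^- 2).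
    have := @is_deriveV _ id t 1 1 (lt0r_neq0 t0) (is_derive_id _ _).
    by rewrite [_ *: 1]mulr1.
  have d2 : is_derive t 1 (fun s : R => - s^-1) (t ^- 2).
    by have := is_deriveN d1; rewrite opprK.
  have d3 := @is_derive1_comp R expR (fun s : R => - s^-1) t _ _ (is_derive_expR _) d2.
  have d4 := is_deriveX m d1.
  have d5 := is_deriveM d4 d3.
  have -> : - m%:R * em m.+1 t + em m.+2 t = (((fun s : R => s^-1) ^+ m) t *: (expR (- t^-1) * t ^- 2) +
     (expR \o (fun s : R => - s^-1)) t *: ((m%:R * t^-1 ^+ m.-1) *: - t ^- 2)).
    rewrite /em t0 /= /GRing.scale /= fctE.
    case: m {d4 d5} => [|m] /=; rewrite !exprS ?expr0 ?mulr0n; field; rewrite ?lt0r_neq0//.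
  apply: (@near_eq_is_derive _ _ _ ((fun s : R => s^-1) ^+ m * (expR \o (fun s : R => - s^-1)))) => //.
  have : nbhs t [set s | 0 < s] by apply: open_nbhs_nbhs; split => //; exact: rray_open.
  by apply: filterS => s /= s0; rewrite /em s0 !fctE.
- rewrite !em_le0// mulr0 addr0.
  by have [C C0 hC] := em_sqr m; exact: is_derive0_sqr hC.
Qed.

Context {n : nat}.
Local Notation E := 'rV[R]_n.

Lemma smooth_em m (f : E -> R) : smooth f -> smooth (fun x => em m (f x)).
Proof.
move=> sf; apply: (smooth_step (P := fun g => exists m, g = fun x => em m (f x))); last by exists m.
- move=> _ [k ->] x; apply: differentiable_comp1; last exact: smooth_diff.
  by case: (is_derive_em k (f x)).
- move=> k _ i [j ->] IH; rewrite partial_comp; first last.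
  + by move=> x; exact: smooth_diff.
  + by move=> x; case: (is_derive_em j (f x)).
  have -> : (fun x => derive1 (em j) (f x) * partial i f x) =
      fun x => (- j%:R * em j.+1 (f x) + em j.+2 (f x)) * partial i f x.
    by apply/funext => x; rewrite derive1E; case: (is_derive_em j (f x)) => _ ->.
  apply: smoothkM; last by move/smoothkP: (smooth_partial i sf); exact.
  apply: smoothkD; last by apply: IH; exists j.+2.
  by apply: smoothkM; [exact: smoothk_cst|apply: IH; exists j.+1].
Qed.

Lemma partialV i (f : E -> R) : (forall x, differentiable f x) -> (forall x, f x != 0) ->
  partial i (fun x => (f x)^-1) = fun x => - (f x) ^- 2 * partial i f x.
Proof.
move=> df f0; apply/funext => x; rewrite /partial.
by rewrite [LHS](@deriveV _ _ f x _ (f0 x))//; exact: diff_derivable.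
Qed.

Lemma smoothV (f : E -> R) : smooth f -> (forall x, f x != 0) -> smooth (fun x => (f x)^-1).
Proof.
move=> sf f0; have df x : differentiable f x by exact: smooth_diff.
apply: (smooth_step (P := fun g => g = fun x => (f x)^-1)) => //.
- by move=> _ -> x; apply: differentiableV.
- move=> k _ i -> IH; rewrite partialV//.
  have -> : (fun x => - (f x) ^- 2 * partial i f x) =
    fun x => -1 * ((f x)^-1 * ((f x)^-1 * partial i f x)).
    by apply/funext => x; rewrite mulN1r mulrA -expr2 exprVn mulNr.
  apply: smoothkM; first exact: smoothk_cst.
  apply: smoothkM; first exact: IH.
  apply: smoothkM; first exact: IH.
  by move/smoothkP: (smooth_partial i sf); exact.
Qed.

End exponential_bump.

(** * The Euclidean norm and its balls *)

Section euclid.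
Context {R : realType} {n : nat}.
Local Notation E := 'rV[R]_n.
Local Notation mu := (@lebesgue_rV R n).
Implicit Types (x y : E).

Definition sq x : R := \sum_(i < n) x ord0 i ^+ 2.

Lemma sq_ge0 x : 0 <= sq x.
Proof. by apply: sumr_ge0 => i _; exact: sqr_ge0. Qed.

Lemma sq0 : sq (0 : E) = 0.
Proof. by rewrite /sq big1// => i _; rewrite mxE expr0n. Qed.

Lemma sqZ (r : R) x : sq (r *: x) = r ^+ 2 * sq x.
Proof. by rewrite /sq mulr_sumr; apply: eq_bigr => i _; rewrite mxE exprMn. Qed.

Lemma sqN x : sq (- x) = sq x.
Proof. by apply: eq_bigr => i _; rewrite mxE sqrrN. Qed.

Lemma norm_le_sq x : `|x| ^+ 2 <= sq x.
Proof.
have [->|x0] := eqVneq `|x| 0; first by rewrite expr0n sq_ge0.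
have [[a i] e] := @mx_norm_neq0 R _ _ x x0.
rewrite -[`|x|]/(mx_norm x) e /= (ord1 a) real_normK ?num_real// /sq (bigD1 i)//= lerDl.
by apply: sumr_ge0 => j _; exact: sqr_ge0.
Qed.

Lemma sq_le_norm x : sq x <= n%:R * `|x| ^+ 2.
Proof.
apply: (@le_trans _ _ (\sum_(i < n) `|x| ^+ 2)); last by rewrite sumr_const card_ord mulr_natl.
apply: ler_sum => i _; rewrite -real_normK ?num_real// ler_sqr ?nnegrE//.
exact: coord_le_norm.
Qed.

Lemma l2norm_sqr x : l2norm x ^+ 2 = sq x.
Proof. by rewrite /l2norm sqr_sqrtr// sq_ge0. Qed.

Lemma l2norm_ge0 x : 0 <= l2norm x.
Proof. exact: sqrtr_ge0. Qed.

Lemma l2norm_lt x (r : R) : 0 < r -> (l2norm x < r) = (sq x < r ^+ 2).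
Proof. by move=> r0; rewrite -l2norm_sqr ltr_sqr ?nnegrE ?l2norm_ge0// ltW. Qed.

Lemma l2norm_le x (r : R) : 0 <= r -> (l2norm x <= r) = (sq x <= r ^+ 2).
Proof. by move=> r0; rewrite -l2norm_sqr ler_sqr ?nnegrE ?l2norm_ge0// ltW. Qed.

Lemma sq_CS (a b : E) : (\sum_i a ord0 i * b ord0 i) ^+ 2 <= sq a * sq b.
Proof.
rewrite /sq; have [|s0] := eqVneq (\sum_(i < n) b ord0 i ^+ 2) 0.
  move=> /eqP; rewrite psumr_eq0 => [/allP b0|i _]; last exact: sqr_ge0.
  rewrite [X in X ^+ 2]big1; last first.
    by move=> i _; have /eqP := b0 i (mem_index_enum i); move=> /eqP; rewrite sqrf_eq0 => /eqP ->; rewrite mulr0.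
  by rewrite expr0n mulr_ge0// sq_ge0.
set A := \sum_i a ord0 i ^+ 2; set B := \sum_i b ord0 i ^+ 2 in s0 *.
set X := \sum_i _ * _.
have B0 : 0 < B by rewrite lt_def s0 sq_ge0.
have : 0 <= \sum_i (B * a ord0 i - X * b ord0 i) ^+ 2 by apply: sumr_ge0 => i _; exact: sqr_ge0.
have -> : \sum_i (B * a ord0 i - X * b ord0 i) ^+ 2 = B * (A * B - X ^+ 2).
  rewrite (eq_bigr (fun i => B ^+ 2 * a ord0 i ^+ 2 - 2 * B * X * (a ord0 i * b ord0 i) +
    X ^+ 2 * b ord0 i ^+ 2)); last by move=> i _; ring.
  by rewrite big_split sumrB /= -!mulr_sumr -/A -/B -/X; ring.
by rewrite pmulr_rge0// subr_ge0.
Qed.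

Lemma l2normD x y : l2norm (x + y) <= l2norm x + l2norm y.
Proof.
rewrite -ler_sqr ?nnegrE ?addr_ge0 ?l2norm_ge0// sqrrD !l2norm_sqr.
have -> : sq (x + y) = sq x + 2 * (\sum_i x ord0 i * y ord0 i) + sq y.
  rewrite /sq mulr_sumr -!big_split /=; apply: eq_bigr => i _; rewrite mxE; ring.
rewrite lerD2r lerD2l -[leRHS]mulr_natl ler_wpM2l//.
apply: (le_trans (ler_norm _)).
rewrite -ler_sqr ?nnegrE ?mulr_ge0 ?l2norm_ge0// exprMn !l2norm_sqr real_normK ?num_real//.
exact: sq_CS.
Qed.

Lemma l2normZ (r : R) x : l2norm (r *: x) = `|r| * l2norm x.
Proof. by rewrite /l2norm -/(sq (r *: x)) sqZ sqrtrM ?sqr_ge0// sqrtr_sqr. Qed.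

Lemma l2normN x : l2norm (- x) = l2norm x.
Proof. by rewrite /l2norm -/(sq (- x)) sqN. Qed.

Lemma l2norm0 : l2norm (0 : E) = 0.
Proof. by rewrite /l2norm -/(sq 0) sq0 sqrtr0. Qed.

Lemma norm_le_l2 x : `|x| <= l2norm x.
Proof. by rewrite -ler_sqr ?nnegrE ?l2norm_ge0// l2norm_sqr norm_le_sq. Qed.

Lemma l2_le_norm x : l2norm x <= (n%:R + 1) * `|x|.
Proof.
rewrite l2norm_le ?mulr_ge0 ?addr_ge0//; apply: (le_trans (sq_le_norm x)).
rewrite exprMn ler_wpM2r ?sqr_ge0//; have : (0 : R) <= n%:R by [].
nra.
Qed.

Lemma smooth_sq : smooth (sq : E -> R).
Proof.
apply: smooth_sum => i; under eq_fun do rewrite expr2.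
by apply: smoothM; exact: smooth_coord.
Qed.

Lemma partial_sq i : partial i (sq : E -> R) = fun x => 2 * x ord0 i.
Proof.
rewrite /sq partial_sum; last first.
  by move=> j x; under eq_fun do rewrite expr2; apply: differentiableM; exact: coord_diff.
apply/funext => x; rewrite (bigD1 i)//= big1.
  under eq_fun do rewrite expr2; rewrite partialM; try by move=> y; exact: coord_diff.
  by rewrite partial_coord eqxx /= addr0; ring.
move=> j ji; under eq_fun do rewrite expr2; rewrite partialM; try by move=> y; exact: coord_diff.
by rewrite partial_coord eq_sym (negbTE ji) /=; ring.
Qed.

Lemma cont_sq : continuous (sq : E -> R).
Proof. exact: smooth_cont smooth_sq. Qed.

Lemma cont_l2norm : continuous (@l2norm R n).
Proof.
move=> x; apply: (@continuous_comp _ _ _ (@sq) Num.sqrt); first exact: cont_sq.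
exact: sqrt_continuous.
Qed.

Definition cball (x0 : E) (r : R) : set E := [set x | l2norm (x - x0) <= r].

Lemma cont_l2normB x0 : continuous (fun x : E => l2norm (x - x0)).
Proof.
have -> : (fun x : E => l2norm (x - x0)) = fun x => Num.sqrt (sq (1 *: x + - x0)).
  by apply/funext => x; rewrite scale1r.
move=> x; apply: (@continuous_comp _ _ _ (fun x => sq (1 *: x + - x0)) Num.sqrt).
  by apply: smooth_cont; apply: (smooth_affine 1 (- x0)); exact: smooth_sq.
exact: sqrt_continuous.
Qed.

Lemma open_l2ball (x0 : E) r : open (l2ball x0 r).
Proof.
have -> : l2ball x0 r = (fun x => l2norm (x - x0)) @^-1` [set y | y < r] by [].
by apply: open_comp => [x _|]; [exact: cont_l2normB|exact: open_lt].
Qed.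

Lemma closed_cball (x0 : E) r : closed (cball x0 r).
Proof.
have -> : cball x0 r = (fun x => l2norm (x - x0)) @^-1` [set y | y <= r] by [].
by apply: closed_comp => [x _|]; [exact: cont_l2normB|exact: closed_le].
Qed.

Lemma compact_cball (x0 : E) r : compact (cball x0 r).
Proof.
apply: bounded_closed_compact; last exact: closed_cball.
exists (`|x0| + `|r|); split; first exact: num_real.
move=> M hM x /= xr; apply: le_trans (ltW hM).
rewrite -[x](subrK x0) (le_trans (ler_normD _ _))// addrC lerD2l.
by rewrite (le_trans (norm_le_l2 _))// (le_trans xr)// ler_norm.
Qed.

Lemma measurable_l2ball (x0 : E) r : measurable (l2ball x0 r).
Proof. apply: open_rV_measurable; exact: open_l2ball. Qed.

Lemma measurable_cball (x0 : E) r : measurable (cball x0 r).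
Proof. apply: closed_rV_measurable; exact: closed_cball. Qed.

Lemma mu_cball_lty (x0 : E) r : (mu (cball x0 r) < +oo)%E.
Proof.
have [M _ hM] := compact_bounded_rV (@compact_cball x0 r).
exact: mu_bounded_lty (measurable_cball _ _) hM.
Qed.

Lemma cball_l2ball (x0 : E) r s : r < s -> cball x0 r `<=` l2ball x0 s.
Proof. by move=> rs x; rewrite /cball /l2ball /= => h; exact: le_lt_trans h rs. Qed.

Lemma l2ball_cball (x0 : E) r : l2ball x0 r `<=` cball x0 r.
Proof. by move=> x /ltW. Qed.

Lemma test_fun_intro (Omega K : set E) (f : E -> R) :
  smooth f -> compact K -> K `<=` Omega -> suppin K f -> test_function Omega f.
Proof.
move=> sf cK KO fK; have clK := compact_closed (@norm_hausdorff _ _) cK.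
have sK : closure [set x | f x != 0] `<=` K.
  rewrite [X in _ `<=` X](closure_id K).1//; apply: closure_subset => x /= /eqP fx.
  by apply: contrapT => /fK.
split => //; last exact: subset_trans sK KO.
by apply: subclosed_compact sK => //; exact: closed_closure.
Qed.

Lemma test_fun_supp (Omega : set E) (f : E -> R) : test_function Omega f ->
  suppin (closure [set x | f x != 0]) f.
Proof.
move=> _ x hx; apply/eqP; apply: contrapT => /negP fx; apply: hx.
exact: subset_closure.
Qed.

End euclid.

(** * Continuity of translations in L^2 *)

Section translation_continuity.
Context {R : realType} {n : nat}.
Local Notation E := 'rV[R]_n.
Local Notation mu := (@lebesgue_rV R n).
Implicit Types (f g : E -> R) (x h : E).

Definition tcont f := sqi mu f /\ forall e : R, 0 < e -> exists2 d : R, 0 < d &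
  forall h, `|h| <= d -> RI mu (fun x => (f (x + h) - f x) ^+ 2) <= e.

Lemma sqi_shift_diff f h : sqi mu f -> sqi mu (fun x => f (x + h) - f x).
Proof. by move=> sf; apply: sqiB => //; exact: sqi_translate. Qed.

Lemma tcontD f g : tcont f -> tcont g -> tcont (fun x => f x + g x).
Proof.
move=> [sf tf] [sg tg]; split; first exact: sqiD.
move=> e e0; have e4 : 0 < e / 4 by rewrite divr_gt0.
have [d1 d10 h1] := tf _ e4; have [d2 d20 h2] := tg _ e4.
exists (Num.min d1 d2); first by rewrite lt_min d10.
move=> h; rewrite le_min => /andP[hd1 hd2].
have -> : (fun x => (f (x + h) + g (x + h) - (f x + g x)) ^+ 2) =
   (fun x => ((f (x + h) - f x) + (g (x + h) - g x)) ^+ 2).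
  by apply/funext => x; ring.
apply: (le_trans (RI_sqD (sqi_shift_diff h sf) (sqi_shift_diff h sg))).
have := h1 h hd1; have := h2 h hd2; lra.
Qed.

Lemma tcontZ (a : R) f : tcont f -> tcont (fun x => a * f x).
Proof.
move=> [sf tf]; split; first exact: sqiZ.
move=> e e0; have e4 : 0 < e / (a ^+ 2 + 1) by rewrite divr_gt0// ltr_wpDl ?sqr_ge0.
have [d d0 hd] := tf _ e4; exists d => // h /hd; set X := RI _ _ => hX.
have -> : (fun x => (a * f (x + h) - a * f x) ^+ 2) = (fun x => a ^+ 2 * (f (x + h) - f x) ^+ 2).
  by apply/funext => x; ring.
rewrite RI_Z; last exact: (proj2 (sqi_shift_diff h sf)).
rewrite -/X; have X0 : 0 <= X by exact: RI_sqr_ge0.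
move: hX; rewrite ler_pdivlMr ?ltr_wpDl ?sqr_ge0// => hX.
by apply: le_trans hX; rewrite mulrC ler_wpM2l// lerDl.
Qed.

Lemma tcontB f g : tcont f -> tcont g -> tcont (fun x => f x - g x).
Proof.
move=> tf tg; apply: tcontD => //.
by under eq_fun do rewrite -mulN1r; exact: tcontZ.
Qed.

Lemma tcont0 : tcont (fun _ => 0).
Proof.
split; first exact: sqi0.
move=> e e0; exists 1 => // h _; under eq_fun do rewrite subrr expr0n.
by rewrite RI_0 ltW.
Qed.

Lemma tcont_sum (I : Type) (s : seq I) (F : I -> E -> R) :
  (forall i, tcont (F i)) -> tcont (fun x => \sum_(i <- s) F i x).
Proof.
move=> tF; elim: s => [|a s IH]; first by under eq_fun do rewrite big_nil; exact: tcont0.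
by under eq_fun do rewrite big_cons; exact: tcontD.
Qed.

Lemma tcont_lim f : sqi mu f ->
  (forall e, 0 < e -> exists2 g, tcont g & RI mu (fun x => (f x - g x) ^+ 2) <= e) ->
  tcont f.
Proof.
move=> sf hf; split=> // e e0; have e8 : 0 < e / 16 by rewrite divr_gt0.
have [g [sg tg] fg] := hf _ e8; have [d d0 hd] := tg _ e8.
exists d => // h /hd hX.
have sfg := sqiB sf sg; have stfg := sqi_translate h sfg.
have e1 : RI mu (fun x => (f (x + h) - g (x + h)) ^+ 2) = RI mu (fun x => (f x - g x) ^+ 2).
  by apply: (@RI_translate _ _ h (fun x => (f x - g x) ^+ 2)); exact: (proj2 sfg).
have -> : (fun x => (f (x + h) - f x) ^+ 2) =
   (fun x => (((f (x + h) - g (x + h)) - (f x - g x)) + (g (x + h) - g x)) ^+ 2).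
  by apply/funext => x; ring.
have h1 := RI_sqD (sqiB stfg sfg) (sqi_shift_diff h sg).
have h2 := RI_sqD stfg (sqiN sfg).
have h3 : RI mu (fun x => (- (f x - g x)) ^+ 2) = RI mu (fun x => (f x - g x) ^+ 2).
  by congr (RI _ _); apply/funext => x; rewrite sqrrN.
apply: (le_trans h1); move: h2; rewrite e1 h3 => h2.
apply: (@le_trans _ _ (2 * (4 * RI mu (fun x => (f x - g x) ^+ 2)) + 2 * RI mu (fun x => (g (x + h) - g x) ^+ 2))).
  by rewrite lerD2r ler_pM2l//; apply: (le_trans h2); lra.
lra.
Qed.

(** Otherwise there are shifts h_k tending to 0 that violate the bound. As A is open, 1_A(x) 1_A(x +
    h_k) tends to 1_A(x) everywhere, and dominated convergence contradicts the violation. *)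
Lemma tcont_open (A : set E) M : open A -> (forall x, A x -> `|x| <= M) -> tcont (\1_A).
Proof.
move=> oA AM; have mA := open_rV_measurable oA.
have iA : itg mu (\1_A) by apply: itg_indic => //; exact: mu_bounded_lty mA AM.
have sq1 (x : E) : \1_A x ^+ 2 = \1_A x :> R.
  by rewrite indicE; case: (_ \in _); rewrite ?expr1n ?expr0n.
have sA : sqi mu (\1_A) by split => //; under eq_fun do rewrite sq1.
split=> // e e0; apply: contrapT => H.
have /choice [hh Hh] : forall k : nat, exists h, `|h| <= k.+1%:R^-1 /\
    e < RI mu (fun x => (\1_A (x + h) - \1_A x) ^+ 2).
  move=> k; apply: contrapT => Hk; apply: H; exists k.+1%:R^-1; first by rewrite invr_gt0.
  by move=> h hk; rewrite leNgt; apply/negP => he; apply: Hk; exists h.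
have mtr k : measurable_fun setT (fun x : E => \1_A (x + hh k) : R).
  by have [] := sqi_translate (hh k) sA.
have [_ /cvg_evP lim] : itg mu (\1_A) /\ (fun k => RI mu (fun x => \1_A x * \1_A (x + hh k))) @ \oo --> RI mu (\1_A).
  apply: (@RI_dom _ _ _ mu (fun k x => \1_A x * \1_A (x + hh k)) (\1_A) (\1_A)) => //.
  - by move=> k; apply: measurable_funM.
  - move=> k x; rewrite !indicE.
    by case: (x \in A); case: (_ \in A); rewrite ?mulr1 ?mul0r ?mulr0 ?normr1 ?normr0.
  - move=> x; apply: cvg_sub0P => d d0; have [xA|xA] := pselect (A x); last first.
      by exists 0%N => k _; rewrite !indicE (memNset xA) mul0r subr0 normr0 ltW.
    have /nbhs_ballP[r /= r0 hr] := open_nbhs_nbhs (conj oA xA).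
    have [K _ hK] := near_infty_natSinv_lt (PosNum r0).
    exists K => k /hK /= kr; rewrite !indicE (mem_set xA) mem_set ?mulr1 ?subrr ?normr0 ?ltW//.
    apply: hr; rewrite -ball_normE /= opprD addNKr normrN.
    exact: le_lt_trans (proj1 (Hh k)) kr.
have e4 : 0 < e / 4 by rewrite divr_gt0.
have [K /(_ K (leqnn K))] := lim _ e4.
rewrite ler_norml => /andP[h1 _].
have := proj2 (Hh K).
have -> : (fun x => (\1_A (x + hh K) - \1_A x) ^+ 2 : R) =
   (fun x => \1_A (x + hh K) + \1_A x - 2 * (\1_A x * \1_A (x + hh K))).
  by apply/funext => x; rewrite -{2}(sq1 x) -{2}(sq1 (x + hh K)); ring.
have it := itg_translate (hh K) iA.
have im : itg mu (fun x => \1_A x * \1_A (x + hh K)) by apply: sqi_mul => //; exact: sqi_translate.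
rewrite RI_B ?RI_D ?RI_Z ?(RI_translate (hh K) iA)//; [lra|exact: itgD|exact: itgZ].
Qed.

(** The sets C for which 1_(C and B) has the property form a lambda-system that contains the open
    sets. The intersection with the bounded [B] keeps all indicators square integrable. *)
Lemma tcont_indic (A B : set E) M : measurable A -> open B -> (forall x, B x -> `|x| <= M) ->
  tcont (\1_(A `&` B)).
Proof.
move=> mA oB BM; have mB := open_rV_measurable oB.
have sqB (C : set E) : measurable C -> sqi mu (\1_(C `&` B)).
  move=> mC; have mCB : measurable (C `&` B) by exact: measurableI.
  split=> //; have -> : (fun x : E => \1_(C `&` B) x ^+ 2 : R) = \1_(C `&` B).
    by apply/funext => x; rewrite indicE; case: (_ \in _); rewrite ?expr1n ?expr0n.
  by apply: itg_indic => //; apply: (mu_bounded_lty (M := M)) => // x [_ /BM].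
pose H : set (set E) := [set C | measurable C /\ tcont (\1_(C `&` B))].
suff : H A by case.
have sub : <<s setT, [set C : set E | open C] >> `<=` H.
  apply: lambda_system_subset => //.
  - by move=> C D oC oD; exact: openI.
  - split=> //.
    + by split=> //; rewrite setTI; exact: tcont_open BM.
    + move=> C D DC [mC tC] [mD tD]; split; first exact: measurableD.
      have -> : \1_((C `\` D) `&` B) = (fun x => \1_(C `&` B) x - \1_(D `&` B) x) :> (E -> R).
        apply/funext => x; rewrite !indicE.
        have [xD|xD] := pselect (D x); have [xB|xB] := pselect (B x);
          have [xC|xC] := pselect (C x); try by have := DC _ xD.
        * rewrite memNset; last by move=> [[]].
          by rewrite !mem_set// subrr.
        * by rewrite !memNset ?subrr// => -[].
        * by rewrite mem_set// mem_set// memNset ?subr0// => -[].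
        * by rewrite !memNset ?subrr// => -[] // [].
        * by rewrite !memNset ?subrr// => -[].
        * by rewrite !memNset ?subrr// => -[].
      exact: tcontB.
    + move=> F ndF HF; have mF : measurable (\bigcup_i F i).
        by apply: bigcupT_measurable => i; case: (HF i).
      split=> //; apply: tcont_lim => [|e e0]; first exact: sqB.
      have [_ /cvg_evP lim] : itg mu (fun=> 0) /\ (fun k => RI mu (fun x => (\1_((\bigcup_i F i) `&` B) x - \1_(F k `&` B) x) ^+ 2)) @ \oo --> RI mu (fun _ : E => 0 : R).
        apply: (@RI_dom _ _ _ mu _ _ (\1_((\bigcup_i F i) `&` B))).
        * move=> k; apply: measurable_funX; apply: measurable_funB => //.
            by case: (sqB _ mF).
          by case: (sqB _ (proj1 (HF k))).
        * exact: measurable_cst.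
        * move=> k x; rewrite !indicE !in_setI; case: (x \in B); rewrite ?andbT ?andbF ?subrr ?expr0n ?normr0//=.
          have [xF|xF] := boolP (x \in F k).
            have -> : x \in \bigcup_i F i by apply/mem_set; exists k => //; exact: set_mem.
            by rewrite subrr expr0n normr0.
          by case: (_ \in _); rewrite subr0 ?expr1n ?expr0n ?normr1 ?normr0.
        * have [mm it] := sqB _ mF.
          by move: it; congr (itg mu _); apply/funext => x; rewrite indicE; case: (_ \in _); rewrite ?expr1n ?expr0n.
        * move=> x; apply: cvg_sub0P => d d0; have [[K _ xK]|xF] := pselect ((\bigcup_i F i) x).
            exists K => k Kk; rewrite !indicE !in_setI.
            have -> : x \in F k by apply/mem_set; move/subsetPset: (ndF _ _ Kk); exact.
            have -> : x \in \bigcup_i F i by apply/mem_set; exists K.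
            by rewrite !subrr expr0n subr0 normr0 ltW.
          exists 0%N => k _; rewrite !indicE !in_setI (memNset xF).
          have -> : x \in F k = false by apply: memNset => xk; apply: xF; exists k.
          by rewrite !subrr expr0n subr0 normr0 ltW.
      have [K /(_ K (leqnn K))] := lim _ e0; rewrite RI_0 subr0 => hK.
      exists (\1_(F K `&` B)); first by case: (HF K).
      exact: le_trans (ler_norm _) hK.
  - move=> C oC; split; first exact: open_rV_measurable.
    by apply: (tcont_open (M := M)) => [|x [_ /BM]//]; exact: openI.
apply: sub; move: A mA.
apply: smallest_sub; first exact: smallest_sigma_algebra.
rewrite -bigcup_seq => _ [i _] [Y mY <-]; rewrite setTI.
have : measurable_fun (setT : set (g_sigma_algebraType [set C : set E | open C])) (fun x : E => x ord0 i : R).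
  apply: (measurability _ (RGenOInfty.measurableE R)).
  move=> _ [_ [a ->] <-]; rewrite setTI; apply: sub_sigma_algebra => /=.
  apply: open_comp; last exact: rray_open.
  by move=> x _; exact: coord_continuous.
by move=> /(_ measurableT Y mY); rewrite setTI.
Qed.

Import HBNNSimple.

Lemma tcont_nonneg f (B : set E) M : sqi mu f -> (forall x, 0 <= f x) -> open B ->
  (forall x, B x -> `|x| <= M) -> (forall x, ~ B x -> f x = 0) -> tcont f.
Proof.
move=> sf f0 oB BM fB; have mf : measurable_fun setT (EFin \o f).
  by apply/measurable_EFinP; case: sf.
pose g := nnsfun_approx measurableT mf.
have gf k x : g k x <= f x.
  have := @le_approx _ _ _ setT (EFin \o f) k x (fun x _ => f0 x : (0 <= (EFin \o f) x)%E) I.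
  by rewrite lee_fin /g nnsfun_approxE.
have g0 k x : 0 <= g k x by [].
have gcvg x : (g k x) @[k --> \oo] --> f x.
  have /fine_cvgP[_] : (EFin \o g k) x @[k --> \oo] --> (f x)%:E.
    by apply: (@cvg_nnsfun_approx _ _ _ _ measurableT _ mf) => // y _; rewrite lee_fin.
  by [].
apply: tcont_lim => // e e0.
have [_ /cvg_evP lim] : itg mu (fun=> 0) /\ (fun k => RI mu (fun x => (f x - g k x) ^+ 2)) @ \oo --> RI mu (fun _ : E => 0 : R).
  apply: (@RI_dom _ _ _ mu _ _ (fun x => f x ^+ 2)).
  - by move=> k; apply: measurable_funX; apply: measurable_funB => //; case: sf.
  - exact: measurable_cst.
  - move=> k x; rewrite ger0_norm ?sqr_ge0// ler_sqr ?nnegrE ?subr_ge0//.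
    by rewrite lerBlDr lerDl.
  - by case: sf.
  - move=> x; rewrite (_ : 0 = (f x - f x) ^+ 2); last by rewrite subrr expr0n.
    have h : (f x - g k x) @[k --> \oo] --> f x - f x by apply: cvgB => //; exact: cvg_cst.
    by rewrite expr2; under eq_fun do rewrite expr2; exact: cvgM.
have [K /(_ K (leqnn K))] := lim _ e0; rewrite RI_0 subr0 => hK.
exists (g K); last exact: le_trans (ler_norm _) hK.
(* Each level set may be cut with [B]: outside [B] the approximation lies between 0 and f = 0. *)
have -> : (g K : E -> R) = fun x => \sum_(y <- finmap.enum_fset (fset_set (range (g K)))) y * \1_((g K @^-1` [set y]) `&` B) x.
  apply/funext => x; rewrite fimfunE fsbig_finite//=.
  apply: eq_bigr => y _; rewrite !indicE in_setI.
  have [xB|xB] := boolP (x \in B); first by rewrite andbT.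
  rewrite andbF mulr0; have [/set_mem/= gy|_] := boolP (x \in _); last by rewrite mulr0.
  rewrite mulr1 -gy; apply/le_anti; rewrite g0 andbT (le_trans (gf K x))// fB//.
  by move=> h; move/negP: xB; apply; exact: mem_set.
apply: tcont_sum => y; apply: tcontZ; apply: (tcont_indic (M := M)) => //.
Qed.

Lemma tcont_sqi f M : sqi mu f -> (forall x, M <= `|x| -> f x = 0) -> tcont f.
Proof.
move=> sf fM; have [mf _] := sf.
pose B : set E := [set x | `|x| < M].
have oB : open B.
  have -> : B = Num.norm @^-1` [set y | y < M] by [].
  by apply: open_comp => [x _|]; [exact: norm_continuous|exact: open_lt].
have mp : measurable_fun setT (fun x => Num.max (f x) 0) by apply: measurable_maxr.
have mn : measurable_fun setT (fun x => Num.max (- f x) 0).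
  by apply: measurable_maxr => //; exact: measurableT_comp.
have fB x : ~ B x -> f x = 0 by move=> /negP; rewrite -leNgt; exact: fM.
have -> : f = fun x => Num.max (f x) 0 - Num.max (- f x) 0.
  apply/funext => x; have [h|/ltW h] := leP (f x) 0.
    by rewrite max_l ?oppr_ge0// sub0r opprK.
  by rewrite max_r ?oppr_le0// subr0.
apply: tcontB; apply: (@tcont_nonneg _ B M) => //.
- by apply: sqi_le sf => // x; rewrite /Num.max; case: ltP => h; rewrite ?normr0.
- by move=> x; rewrite le_max lexx orbT.
- by move=> x /ltW.
- by move=> x /fB ->; rewrite maxxx.
- by apply: sqi_le sf => // x; rewrite /Num.max; case: ltP => h; rewrite ?normr0 ?normrN.
- by move=> x; rewrite le_max lexx orbT.
- by move=> x /ltW.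
- by move=> x /fB ->; rewrite oppr0 maxxx.
Qed.

End translation_continuity.

(** * Convolution and mollifiers *)

Section mollification.
Context {R : realType} {n : nat}.
Local Notation E := 'rV[R]_n.
Local Notation mu := (@lebesgue_rV R n).
Implicit Types (f g : E -> R) (x y h : E).

Lemma differentiable_quad f x (a : 'I_n -> R) (C : R) :
  (forall h, `|f (x + h) - f x - \sum_i h ord0 i * a i| <= C * `|h| ^+ 2) ->
  differentiable f x /\ forall i, partial i f x = a i.
Proof.
move=> hf; pose L (h : E) : R^o := \sum_i h ord0 i * a i.
have lL : linear L.
  move=> k u v; rewrite /L scaler_sumr -big_split /=; apply: eq_bigr => i _.
  by rewrite !mxE mulrDl -mulrA.
pose lLm := GRing.isLinear.Build _ _ _ _ _ lL.
pose LL : {linear E -> R^o} := HB.pack L lLm.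
have cL : continuous LL.
  have cc : continuous (fun h : E => \sum_i h ord0 i * a i).
    by apply: smooth_cont; apply: smooth_sum => i; apply: smoothM;
      [exact: smooth_coord|exact: smooth_cst].
  exact: cc.
have e1 : (f : E -> R^o) \o shift x = cst (f x) + (LL : E -> R^o) +o_ (0 : E) id.
  apply/eqaddoP => e e0; near=> h.
  rewrite /= !fctE /= [h + x]addrC opprD addrA.
  apply: (le_trans (hf h)); rewrite expr2 mulrA ler_wpM2r//.
  have he : `|h| <= e / (`|C| + 1).
    near: h; apply/nbhs_ballP; exists (e / (`|C| + 1)); first by rewrite /= divr_gt0// ltr_wpDl.
    by move=> y; rewrite -ball_normE /= sub0r normrN => /ltW.
  apply: (@le_trans _ _ (`|C| * `|h|)); first by rewrite ler_wpM2r// ler_norm.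
  apply: (@le_trans _ _ ((`|C| + 1) * `|h|)); first by rewrite ler_wpM2r// lerDl.
  by rewrite mulrC -ler_pdivlMr// ltr_wpDl.
have e2 := diff_unique cL e1.
have df : differentiable (f : E -> R^o) x.
  by apply/diff_locallyP; rewrite e2; split.
split => // i; rewrite /partial deriveE// e2 /= /L (bigD1 i)//= big1 ?addr0.
  by rewrite mxE !eqxx mul1r.
by move=> j ji; rewrite mxE (negbTE ji) andbF mul0r.
Unshelve. all: by end_near. Qed.

(** The kernel is evaluated at y - x, so that it is a translate of [k] as a function of y, and
    derivatives in x fall on [k] with a minus sign. *)
Definition conv (k f : E -> R) : E -> R := fun x => RI mu (fun y => k (y - x) * f y).

Lemma smooth_shift (k : E -> R) x : smooth k -> smooth (fun y => k (y - x)).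
Proof. by move=> /(smooth_affine 1 (- x)); under eq_fun do rewrite scale1r. Qed.

Lemma partial_shift i (k : E -> R) x : smooth k ->
  partial i (fun y => k (y - x)) = fun y => partial i k (y - x).
Proof.
move=> sk; have := @partial_affine _ _ i 1 (- x) k (fun y => smooth_diff y sk).
under eq_fun do rewrite scale1r; move=> ->; apply/funext => y.
by rewrite mul1r scale1r.
Qed.

Lemma conv_itg (k f : E -> R) K x : smooth k -> compact K -> suppin K k -> itg mu f ->
  itg mu (fun y => k (y - x) * f y).
Proof.
move=> sk cK kK hf; have [C C0 hC] := supp_bounded cK kK (smooth_cont sk).
apply: (itg_bM _ (fun y => hC (y - x)) hf).
exact: continuous_rV_measurable (smooth_cont (smooth_shift x sk)).
Qed.

Lemma conv_deriv (k f : E -> R) K x : smooth k -> compact K -> suppin K k -> itg mu f ->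
  differentiable (conv k f) x /\
  forall i, partial i (conv k f) x = conv (fun y => - partial i k y) f x.
Proof.
move=> sk cK kK hf; have clK := compact_closed (@norm_hausdorff _ _) cK.
have [C C0 hC] := smooth_taylor cK kK sk.
have ha := itg_abs hf.
have ip i z := conv_itg z (smoothN (smooth_partial i sk)) cK
   (fun y hy => eq_trans (congr1 _ (partial_supp i clK kK hy)) (oppr0 R)) hf.
apply: (differentiable_quad (a := fun i => conv (fun y => - partial i k y) f x)
   (C := C * RI mu (fun y => `|f y|))) => h.
have -> : conv k f (x + h) - conv k f x - \sum_i h ord0 i * conv (fun y => - partial i k y) f x =
   RI mu (fun y => (k (y - (x + h)) - k (y - x) - \sum_i h ord0 i * (- partial i k (y - x))) * f y).
  under [X in _ - _ - X]eq_bigr do rewrite /conv -(RI_Z _ (ip _ _)).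
  rewrite -RI_sum; last by move=> i; apply: itgZ; exact: ip.
  rewrite -!RI_B; first last.
  - exact: (conv_itg _ sk cK kK hf).
  - exact: (conv_itg _ sk cK kK hf).
  - by apply: itg_sum => i; apply: itgZ; exact: ip.
  - by apply: itgB; exact: (conv_itg _ sk cK kK hf).
  congr (RI _ _); apply/funext => y; rewrite !mulrBl mulr_suml; congr (_ - _).
  by apply: eq_bigr => i _; rewrite mulrA.
have bd y : `|k (y - (x + h)) - k (y - x) - \sum_i h ord0 i * (- partial i k (y - x))| <= C * `|h| ^+ 2.
  have := hC (y - x) (- h); rewrite normrN opprD addrA.
  by under eq_bigr do rewrite mxE mulNr -mulrN.
have mm : measurable_fun setT (fun y => k (y - (x + h)) - k (y - x) - \sum_i h ord0 i * (- partial i k (y - x))).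
  apply: continuous_rV_measurable; apply: smooth_cont; apply: smoothB.
    by apply: smoothB; exact: smooth_shift.
  apply: smooth_sum => i; apply: smoothZ; apply: smoothN.
  by apply: smooth_shift; exact: smooth_partial.
have ii := itg_bM mm bd hf.
apply: (le_trans (RI_abs ii)); rewrite mulrAC -(RI_Z _ ha).
apply: RI_le; [exact: itg_abs|exact: itgZ|].
by move=> y; rewrite normrM ler_wpM2r.
Qed.

Lemma conv_smooth (k f : E -> R) K : smooth k -> compact K -> suppin K k -> itg mu f ->
  smooth (conv k f).
Proof.
move=> sk cK kK hf; have clK := compact_closed (@norm_hausdorff _ _) cK.
apply: (smooth_coind (P := fun g => exists k, [/\ smooth k, suppin K k & g = conv k f])).
- by move=> _ [j [sj jK ->]] x; case: (conv_deriv x sj cK jK hf).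
- move=> _ i [j [sj jK ->]]; exists (fun y => - partial i j y); split.
  + exact/smoothN/smooth_partial.
  + by move=> y hy; rewrite (partial_supp i clK jK hy) oppr0.
  + by apply/funext => x; case: (conv_deriv x sj cK jK hf).
- by exists k.
Qed.

(** The variance of g under the probability density w is nonnegative. *)
Lemma jensen (w g : E -> R) : (forall x, 0 <= w x) -> itg mu w -> RI mu w = 1 ->
  itg mu (fun x => w x * g x) -> itg mu (fun x => w x * g x ^+ 2) ->
  RI mu (fun x => w x * g x) ^+ 2 <= RI mu (fun x => w x * g x ^+ 2).
Proof.
move=> w0 iw w1 ig ig2; set m := RI _ _.
have : 0 <= RI mu (fun x => w x * (g x - m) ^+ 2).
  by apply: RI_ge0 => x; rewrite mulr_ge0// sqr_ge0.
have -> : (fun x => w x * (g x - m) ^+ 2) =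
   (fun x => w x * g x ^+ 2 + ((- 2 * m) * (w x * g x) + m ^+ 2 * w x)).
  by apply/funext => x; ring.
rewrite RI_D//; last by apply: itgD; exact: itgZ.
rewrite RI_lin2// w1 -/m; lra.
Qed.

Lemma open_mu_gt0 (A : set E) x : open A -> A x -> (0 < mu A)%E.
Proof.
move=> oA Ax; have /nbhs_ballP[e /= e0 xeA] := open_nbhs_nbhs (conj oA Ax).
pose B : set E := [set y | forall i, [set` `](x ord0 i - e / 2), (x ord0 i + e / 2)[] (y ord0 i)].
have mB : measurable B by apply: (@measurable_box R n (fun i => [set` `](x ord0 i - e / 2), (x ord0 i + e / 2)[])).
apply: (@lt_le_trans _ _ (mu B)); last first.
  apply: le_measure; rewrite ?inE//; first exact: open_rV_measurable.
  move=> y yB; apply: xeA; apply/rV_ball_coordP => // i; have := yB i.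
  by rewrite /= in_itv /= => /andP[? ?]; rewrite ltr_norml; apply/andP; split; lra.
apply: (@lt_le_trans _ _ (\prod_(i < n) e%:E)%E).
  by rewrite -(big_morph EFin EFinM (erefl _)) prodr_const card_ord lte_fin exprn_gt0.
rewrite le_eqVlt; apply/orP; left; apply/eqP/esym.
apply: etrans (@lebesgue_rV_box R n (fun i => [set` `](x ord0 i - e / 2), (x ord0 i + e / 2)[]) (fun i => measurable_itv _)) _.
apply: eq_bigr => i _; rewrite lebesgue_measure_itv /= lte_fin ifT; last by lra.
by rewrite -EFinB; congr (_%:E); lra.
Qed.

Definition bump0 : E -> R := fun x => em 0 (1 - sq x).

Lemma smooth_bump0 : smooth bump0.
Proof.
apply: smooth_em; apply: smoothB; [exact: smooth_cst|exact: smooth_sq].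
Qed.

Lemma bump0_ge0 x : 0 <= bump0 x. Proof. exact: em_ge0. Qed.

Lemma bump0_supp : suppin (cball 0 1) bump0.
Proof.
move=> x; rewrite /cball /= subr0 => /negP; rewrite -ltNge => x1.
apply: em_le0; rewrite subr_le0 -l2norm_sqr -(expr1n _ 2%N) ler_sqr ?nnegrE ?l2norm_ge0//.
exact: ltW.
Qed.

Lemma itg_bump0 : itg mu bump0.
Proof.
exact: cont_supp_itg (@compact_cball _ _ _ _) bump0_supp (smooth_cont smooth_bump0).
Qed.

Lemma RI_bump0 : 0 < RI mu bump0.
Proof.
rewrite lt_neqAle RI_ge0 ?andbT; last exact: bump0_ge0.
apply/eqP => h; have := RI_eq0 itg_bump0 bump0_ge0 (esym h) => -[N [mN N0 hN]].
have : (mu (l2ball 0 1 : set E) <= mu N)%E.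
  apply: le_measure; rewrite ?inE//; first exact: measurable_l2ball.
  move=> x x1; apply: hN => /=; apply/eqP; rewrite gt_eqF//; apply: em_gt0.
  by move: x1; rewrite /l2ball /= subr0 l2norm_lt// expr1n subr_gt0.
rewrite N0; apply/negP; rewrite -ltNge.
apply: (@open_mu_gt0 _ 0); first exact: open_l2ball.
by rewrite /l2ball /= subr0 l2norm0.
Qed.

Definition mol (e : R) : E -> R := fun x => (e ^+ n * RI mu bump0)^-1 * bump0 (e^-1 *: x).

Lemma mol_ge0 e x : 0 < e -> 0 <= mol e x.
Proof.
move=> e0; rewrite mulr_ge0 ?bump0_ge0// invr_ge0 mulr_ge0 ?exprn_ge0 ?(ltW e0)//.
exact/ltW/RI_bump0.
Qed.

Lemma smooth_mol e : smooth (mol e).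
Proof.
apply: smoothZ; have := smooth_affine e^-1 0 smooth_bump0.
by under eq_fun do rewrite addr0.
Qed.

Lemma mol_supp e : 0 < e -> suppin (cball 0 e) (mol e).
Proof.
move=> e0 x hx; rewrite /mol bump0_supp ?mulr0//; apply: contra_not hx.
rewrite /cball /= !subr0 l2normZ gtr0_norm ?invr_gt0// => h.
by rewrite -(ler_pM2l (_ : 0 < e^-1)) ?invr_gt0// mulVf ?gt_eqF.
Qed.

Lemma itg_mol e : 0 < e -> itg mu (mol e).
Proof.
move=> e0; exact: cont_supp_itg (@compact_cball _ _ _ _) (mol_supp e0) (smooth_cont (smooth_mol e)).
Qed.

Lemma RI_mol e : 0 < e -> RI mu (mol e) = 1.
Proof.
move=> e0; have ei : 0 < e^-1 by rewrite invr_gt0.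
have := RI_affine 0 ei itg_bump0; under eq_fun do rewrite addr0; move=> h.
have i0 := itg_affine 0 ei itg_bump0; move: i0; under eq_fun do rewrite addr0; move=> i0.
rewrite /mol RI_Z// h exprVn invrK.
have := RI_bump0; set X := RI _ _ => X0.
by rewrite mulVf// mulf_neq0 ?expf_neq0 ?gt_eqF.
Qed.

Lemma conv_translate (k f : E -> R) x : itg mu (fun y => k (y - x) * f y) ->
  conv k f x = RI mu (fun z => k z * f (x + z)).
Proof.
move=> /(RI_translate x); rewrite /conv => <-; congr (RI _ _); apply/funext => z.
by rewrite addrK [z + x]addrC.
Qed.

Lemma sqi_supp_itg (f : E -> R) K : compact K -> suppin K f -> sqi mu f -> itg mu f.
Proof.
move=> cK fK sf; have [M M0 KM] := compact_bounded_rV cK.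
have clK := compact_closed (@norm_hausdorff _ _) cK.
have mK := closed_rV_measurable clK.
have iK : itg mu (\1_K) by apply: itg_indic => //; exact: mu_bounded_lty KM.
have s1 : sqi mu (\1_K).
  split=> //; have -> : (fun x : E => \1_K x ^+ 2 : R) = \1_K => //.
  by apply/funext => x; rewrite indicE; case: (_ \in _); rewrite ?expr1n ?expr0n.
have := sqi_mul sf s1; congr (itg _ _); apply/funext => x; rewrite indicE.
have [xK|xK] := pselect (K x); first by rewrite mem_set// mulr1.
by rewrite fK// mul0r.
Qed.

(** Jensen's inequality for the density [mol e] and Tonelli's theorem bound the error by an average
    over |z| <= e of the squared L^2 norms of f(x + z) - f(x). *)
Lemma conv_approx (f : E -> R) K : compact K -> suppin K f -> sqi mu f ->
  forall d : R, 0 < d -> exists2 e0 : R, 0 < e0 & forall e, 0 < e -> e <= e0 ->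
    RI mu (fun x => (conv (mol e) f x - f x) ^+ 2) <= d.
Proof.
move=> cK fK sf d d0; have [M M0 fM] := suppin_far cK fK.
have [_ /(_ d d0) [e0 e00 he0]] : tcont f.
  by apply: (tcont_sqi (M := M + 1) sf) => x h; apply: fM; lra.
have itf := sqi_supp_itg cK fK sf.
have [mf if2] := sf.
exists e0 => // e e1 ee0.
have cmol := @compact_cball R n 0 e.
have [C C0 hC] := supp_bounded cmol (mol_supp e1) (smooth_cont (smooth_mol e)).
have mmol : measurable_fun setT (mol e : E -> R) by exact: continuous_rV_measurable (smooth_cont (smooth_mol e)).
have icm x : itg mu (fun z => mol e z * f (x + z)).
  apply: (itg_bM mmol hC); under eq_fun do rewrite addrC; exact: itg_translate.
have ig1 x : itg mu (fun z => mol e z * (f (x + z) - f x)).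
  under eq_fun do rewrite mulrBr; apply: itgB => //; apply: itgZr; exact: itg_mol.
have ig2 x : itg mu (fun z => mol e z * (f (x + z) - f x) ^+ 2).
  have -> : (fun z => mol e z * (f (x + z) - f x) ^+ 2) =
    (fun z => mol e z * (f (x + z)) ^+ 2 + ((- 2 * f x) * (mol e z * f (x + z)) + f x ^+ 2 * mol e z)).
    by apply/funext => z; ring.
  apply: itgD; last by apply: itgD; apply: itgZ => //; exact: itg_mol.
  apply: (itg_bM mmol hC); under eq_fun do rewrite addrC.
  exact: (@itg_translate _ _ x (fun z => f z ^+ 2)).
pose F (p : E * E) : \bar R := (mol e p.2 * (f (p.1 + p.2) - f p.1) ^+ 2)%:E.
have F0 p : (0 <= F p)%E by rewrite lee_fin mulr_ge0 ?sqr_ge0 ?mol_ge0.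
have mF : measurable_fun setT F.
  apply/measurable_EFinP; apply: measurable_funM.
    exact: measurableT_comp mmol measurable_snd.
  apply: measurable_funX; apply: measurable_funB.
    exact: measurableT_comp mf measurable_addrV.
  exact: measurableT_comp mf measurable_fst.
have pt x : (((conv (mol e) f x - f x) ^+ 2)%:E <= \int[mu]_z F (x, z))%E.
  rewrite /F /= -EFin_RI// lee_fin conv_translate; last first.
    exact: (conv_itg _ (smooth_mol e) cmol (mol_supp e1) itf).
  have -> : RI mu (fun z => mol e z * f (x + z)) - f x = RI mu (fun z => mol e z * (f (x + z) - f x)).
    rewrite -[X in _ - X]mul1r -(RI_mol e1) mulrC -RI_Z; last exact: itg_mol.
    rewrite -RI_B//; last by apply: itgZ; exact: itg_mol.
    by congr (RI _ _); apply/funext => z; ring.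
  apply: jensen => //; [by move=> z; exact: mol_ge0|exact: itg_mol|exact: RI_mol].
have scv : continuous (conv (mol e) f).
  exact: smooth_cont (conv_smooth (smooth_mol e) cmol (mol_supp e1) itf).
have mcv : measurable_fun setT (fun x => (conv (mol e) f x - f x) ^+ 2).
  by apply: measurable_funX; apply: measurable_funB => //; exact: continuous_rV_measurable.
rewrite -lee_fin; have big : (\int[mu]_x ((conv (mol e) f x - f x) ^+ 2)%:E <= d%:E)%E.
  apply: (@le_trans _ _ (\int[mu]_x \int[mu]_z F (x, z))%E).
    apply: ge0_le_integral => //.
    - by move=> x _; rewrite lee_fin sqr_ge0.
    - exact/measurable_EFinP.
    - exact: measurable_fun_fubini_tonelli_F.
  rewrite [leLHS](@fubini_tonelli _ _ _ _ _ mu mu F mF F0) /fubini_G.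
  apply: (@le_trans _ _ (\int[mu]_z (d * mol e z)%:E)%E).
    apply: ge0_le_integral => //.
    - by move=> z _; apply: integral_ge0 => x _; exact: F0.
    - exact: measurable_fun_fubini_tonelli_G.
    - by apply/measurable_EFinP; exact: measurable_funM.
    move=> z _; rewrite /F /=.
    have [hz|hz] := pselect (cball 0 e z); last first.
      rewrite (mol_supp e1 hz) mulr0; under eq_integral do rewrite mul0r.
      by rewrite integral0.
    have isq : itg mu (fun x => (f (x + z) - f x) ^+ 2) by exact: (proj2 (sqi_shift_diff z sf)).
    rewrite -EFin_RI; last exact: itgZ.
    rewrite RI_Z// lee_fin mulrC ler_wpM2r ?mol_ge0//; apply: he0.
    move: hz; rewrite /cball /= subr0 => hz.
    by rewrite (le_trans (norm_le_l2 z))// (le_trans hz).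
  rewrite -EFin_RI; last by apply: itgZ; exact: itg_mol.
  by rewrite RI_Z ?RI_mol ?mulr1//; exact: itg_mol.
rewrite /RI fineK//; apply/fin_numPlt/andP; split.
  by apply: (@lt_le_trans _ _ 0%E) => //; apply: integral_ge0 => x _; rewrite lee_fin sqr_ge0.
by apply: le_lt_trans big _; rewrite ltry.
Qed.

End mollification.

(** * Sobolev functions and minimizers *)

Section compact_sobolev.
Context {R : realType} {n : nat}.
Local Notation E := 'rV[R]_n.
Local Notation mu := (@lebesgue_rV R n).
Local Notation RI := (RI mu).
Local Notation itg := (itg mu).
Local Notation sqi := (sqi mu).
Implicit Types (u f g w phi eta : E -> R) (x : E).

Definition weakd (Om : set E) u g (i : 'I_n) : Prop :=
  forall phi, test_function Om phi ->
    RI (fun x => u x * partial i phi x) = - RI (fun x => g x * phi x).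

(* w in H^1 with weak gradient h and compact support in the ball of radius r
   about x0, as a function on the whole space. *)
Definition Hc (x0 : E) (r : R) w (h : 'I_n -> E -> R) : Prop :=
  [/\ sqi w, forall i, sqi (h i),
      exists r', [/\ r' < r, suppin (cball x0 r') w & forall i, suppin (cball x0 r') (h i)]
    & forall i, weakd setT w (h i) i].

Lemma compact_in_ball (x0 : E) r (K : set E) : compact K -> K `<=` l2ball x0 r ->
  exists2 r', r' < r & K `<=` cball x0 r'.
Proof.
move=> cK KB; have [K0|/set0P/negP/negPn/eqP K0] := pselect (K !=set0); last first.
  by exists (r - 1); [lra|rewrite K0].
have [c Kc hc] := @EVT_max_rV R n (fun x => l2norm (x - x0)) K K0 cK
  (continuous_subspaceT (@cont_l2normB R n x0)).
exists (l2norm (c - x0)); first by apply: KB; exact: set_mem.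
by move=> x Kx; apply: hc; exact: mem_set.
Qed.

Lemma test_ball_supp (x0 : E) r phi : test_function (l2ball x0 r) phi ->
  exists2 r', r' < r & suppin (cball x0 r') phi.
Proof.
move=> tp; have [sp cp hp] := tp; have [r' rr hr] := compact_in_ball cp hp.
by exists r' => // x hx; apply: (test_fun_supp tp); apply: contra_not hx; exact: hr.
Qed.

Lemma test_ball_intro (x0 : E) r r' phi : r' < r -> smooth phi -> suppin (cball x0 r') phi ->
  test_function (l2ball x0 r) phi.
Proof.
move=> rr sp hp; apply: (@test_fun_intro _ _ _ (cball x0 r')) => //.
  exact: compact_cball.
exact: cball_l2ball.
Qed.

Lemma test_funM Om phi eta : test_function Om phi -> smooth eta ->
  test_function Om (fun x => phi x * eta x).
Proof.
move=> tp se; have [sp cp hp] := tp.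
apply: (test_fun_intro _ cp hp); first exact: smoothM.
by move=> x /(test_fun_supp tp) ->; rewrite mul0r.
Qed.

Lemma test_fun_sub (A B : set E) phi : A `<=` B -> test_function A phi -> test_function B phi.
Proof. by move=> AB [? ? h]; split => //; exact: subset_trans h AB. Qed.

Lemma test_compact Om phi : test_function Om phi ->
  exists K, [/\ compact K, K `<=` Om & suppin K phi].
Proof. by move=> tp; exists (closure [set x | phi x != 0]); case: tp => ? ? ?; split => //; exact: (test_fun_supp (Omega := Om)). Qed.

Lemma test_sqi Om phi : test_function Om phi -> sqi phi.
Proof.
move=> tp; have [K [cK _ fK]] := test_compact tp; have [sp _ _] := tp.
split; first exact: continuous_rV_measurable (smooth_cont sp).
have : smooth (fun x => phi x ^+ 2) by under eq_fun do rewrite expr2; exact: smoothM.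
move=> /smooth_cont; apply: cont_supp_itg cK _.
by move=> x /fK ->; rewrite expr0n.
Qed.

Lemma test_partial Om phi i : test_function Om phi -> test_function Om (partial i phi).
Proof.
move=> tp; have [K [cK KO fK]] := test_compact tp; have [sp _ _] := tp.
apply: (test_fun_intro (smooth_partial i sp) cK KO).
by apply: partial_supp => //; apply: compact_closed => //; exact: norm_hausdorff.
Qed.

Lemma conv_mol_supp (x0 : E) r e f : 0 < e -> suppin (cball x0 r) f ->
  suppin (cball x0 (r + e)) (conv (mol e) f).
Proof.
move=> e0 hf x hx; rewrite /conv; under eq_fun => y.
  rewrite (_ : mol e (y - x) * f y = 0); last first.
    have [h1|/(hf _) ->] := pselect (cball x0 r y); last by rewrite mulr0.
    rewrite (mol_supp e0) ?mul0r// => h2; apply: hx.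
    rewrite /cball /= -[x - x0](_ : (y - x0) + (x - y) = _); last by rewrite addrC subrKA.
    apply: (le_trans (l2normD _ _)); apply: lerD => //.
    by move: h2; rewrite /cball /= subr0 -l2normN opprB.
  over.
by rewrite RI_0.
Qed.

(** The weak derivative is tested against the kernel centred at x, which moves the derivative from
    the kernel to w. *)
Lemma Hc_conv (x0 : E) r w h i e x : 0 < e -> Hc x0 r w h ->
  partial i (conv (mol e) w) x = conv (mol e) (h i) x.
Proof.
move=> e0 [sw sh [r' [_ w0 h0]] hw].
have cmol := @compact_cball R n 0 e; have cB := @compact_cball R n x0 r'.
have iw := sqi_supp_itg cB w0 sw; have ih := sqi_supp_itg cB (h0 i) (sh i).
have [_ ->] := conv_deriv x (smooth_mol e) cmol (mol_supp e0) iw.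
have sx : smooth (fun y => mol e (y - x)) by apply: smooth_shift; exact: smooth_mol.
have tx : test_function setT (fun y => mol e (y - x)).
  apply: (@test_fun_intro _ _ _ (cball x e)) => //; first exact: compact_cball.
  move=> y hy; apply: (mol_supp e0); apply: contra_not hy.
  by rewrite /cball /= subr0.
have := hw i _ tx; rewrite partial_shift; last exact: smooth_mol.
rewrite /conv => h1.
have -> : (fun y => - partial i (mol e) (y - x) * w y) = (fun y => - (w y * partial i (mol e) (y - x))).
  by apply/funext => y; rewrite mulNr mulrC.
rewrite RI_N ?h1 ?opprK; last first.
  have := conv_itg x (smooth_partial i (smooth_mol e)) cmol (partial_supp i (@closed_cball _ _ _ _) (mol_supp e0)) iw.
  by congr (itg _); apply/funext => y; rewrite mulrC.
by congr RI; apply/funext => y; rewrite mulrC.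
Qed.

Lemma Hc_approx (x0 : E) r w h : Hc x0 r w h -> exists2 r', r' < r &
  forall d : R, 0 < d -> exists phi, [/\ smooth phi, suppin (cball x0 r') phi,
     RI (fun x => (phi x - w x) ^+ 2) <= d &
     forall i, RI (fun x => (partial i phi x - h i x) ^+ 2) <= d].
Proof.
move=> H; have [sw sh [r' [rr w0 h0]] hw] := H.
exists ((r' + r) / 2); first by lra.
move=> d d0; have cB := @compact_cball R n x0 r'.
have [e1 e10 he1] := conv_approx cB w0 sw d0.
have /choice [ee hee] : forall i, exists e, 0 < e /\ forall e', 0 < e' -> e' <= e ->
    RI (fun x => (conv (mol e') (h i) x - h i x) ^+ 2) <= d.
  by move=> i; have [e e0 he] := conv_approx cB (h0 i) (sh i) d0; exists e.
(* One scale has to serve w and all its derivatives, and to be at most (r - r') / 2, which keeps the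
   support within radius (r' + r) / 2. *)
pose e2 := \big[Num.min/Num.min e1 ((r - r') / 2)]_i ee i.
have e20 : 0 < e2.
  rewrite /e2; elim/big_ind : _ => //; first by rewrite lt_min e10; lra.
  - by move=> a b a0 b0; rewrite lt_min a0.
  - by move=> i _; case: (hee i).
have e2m : e2 <= Num.min e1 ((r - r') / 2) by exact: bigmin_le_id.
move: (e2m); rewrite le_min => /andP[e21 e2r].
have cmol := @compact_cball R n 0 e2.
have iw := sqi_supp_itg cB w0 sw.
exists (conv (mol e2) w); split.
- exact: conv_smooth (smooth_mol _) cmol (mol_supp e20) iw.
- move=> x hx; apply: (conv_mol_supp e20 w0); apply: contra_not hx.
  by rewrite /cball /= => /le_trans; apply; lra.
- exact: he1.
- move=> i; under eq_fun do rewrite (Hc_conv _ _ e20 H).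
  apply: (proj2 (hee i)) => //; exact: bigmin_le_cond.
Qed.

(** The way in which approximation arguments conclude below: an identity that fails by a quantity of
    square O(d), for all d > 0, is exact. *)
Lemma sqr_small0 (X A : R) : 0 <= A -> (forall d, 0 < d -> X ^+ 2 <= A * d) -> X = 0.
Proof.
move=> A0 h; apply/eqP; rewrite -sqrf_eq0; apply/eqP/le_anti; rewrite sqr_ge0 andbT.
apply/ler_addgt0Pl => e e0; rewrite addr0.
have A1 : 0 < A + 1 by lra.
apply: (le_trans (h (e / (A + 1)) _)); first by rewrite divr_gt0.
by rewrite mulrCA ler_piMr ?ltW// ltr_pdivrMr// mul1r ltrDl.
Qed.

(** For the smooth approximations of w this is the definition of the weak derivative; both errors
    are controlled by Cauchy-Schwarz. *)
Lemma Hc_ibp (x0 : E) r u g w h i : sqi u -> sqi g -> weakd (l2ball x0 r) u g i ->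
  Hc x0 r w h -> RI (fun x => u x * h i x) = - RI (fun x => g x * w x).
Proof.
move=> su sg hu H; have [sw sh _ _] := H; have [r' rr ha] := Hc_approx H.
apply/eqP; rewrite -subr_eq0 opprK; apply/eqP.
apply: (@sqr_small0 _ (2 * (RI (fun x => u x ^+ 2) + RI (fun x => g x ^+ 2)))).
  by rewrite mulr_ge0// addr_ge0// RI_sqr_ge0.
move=> d d0; have [phi [sp p0 hp hdp]] := ha d d0.
have tp := test_ball_intro rr sp p0.
have sphi := test_sqi tp; have sdp := test_sqi (test_partial i tp).
have -> : RI (fun x => u x * h i x) + RI (fun x => g x * w x) =
   - RI (fun x => u x * (partial i phi x - h i x)) - RI (fun x => g x * (phi x - w x)).
  have -> : (fun x => u x * (partial i phi x - h i x)) = (fun x => u x * partial i phi x - u x * h i x).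
    by apply/funext => x; rewrite mulrBr.
  have -> : (fun x => g x * (phi x - w x)) = (fun x => g x * phi x - g x * w x).
    by apply/funext => x; rewrite mulrBr.
  rewrite !RI_B ?hu//; try exact: sqi_mul; ring.
have c1 := RI_CS su (sqiB sdp (sh i)); have c2 := RI_CS sg (sqiB sphi sw).
have U0 : 0 <= RI (fun x => u x ^+ 2) by exact: RI_sqr_ge0.
have G0 : 0 <= RI (fun x => g x ^+ 2) by exact: RI_sqr_ge0.
move: c1 c2; set X := RI (fun x => u x * _); set Y := RI (fun x => g x * _) => c1 c2.
have c3 : X ^+ 2 <= RI (fun x => u x ^+ 2) * d by apply: (le_trans c1); rewrite ler_wpM2l.
have c4 : Y ^+ 2 <= RI (fun x => g x ^+ 2) * d by apply: (le_trans c2); rewrite ler_wpM2l.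
have : (- X - Y) ^+ 2 <= 2 * X ^+ 2 + 2 * Y ^+ 2.
  by have := sqr_ge0 (X - Y); nra.
lra.
Qed.

Lemma Hc_prod (x0 : E) (r r' : R) u (g : 'I_n -> E -> R) eta : sqi u -> (forall i, sqi (g i)) ->
  (forall i, weakd (l2ball x0 r) u (g i) i) -> smooth eta -> r' < r ->
  suppin (cball x0 r') eta ->
  Hc x0 r (fun x => eta x * u x) (fun i x => eta x * g i x + u x * partial i eta x).
Proof.
move=> su sg hu se rr e0; have te := test_ball_intro rr se e0.
have cB := @compact_cball R n x0 r'.
have [C _ hC] := supp_bounded cB e0 (smooth_cont se).
have me : measurable_fun setT eta by exact: continuous_rV_measurable (smooth_cont se).
have pe0 i := partial_supp i (@closed_cball _ _ _ _) e0.
have spe i : sqi (fun x => u x * partial i eta x).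
  have [C' _ hC'] := supp_bounded cB (pe0 i) (smooth_cont (smooth_partial i se)).
  under eq_fun do rewrite mulrC; apply: (sqi_bM _ hC') => //.
  exact: continuous_rV_measurable (smooth_cont (smooth_partial i se)).
split.
- exact: sqi_bM me hC su.
- by move=> i; apply: sqiD => //; exact: sqi_bM me hC (sg i).
- exists r'; split => // [x hx|i x hx]; first by rewrite e0// mul0r.
  by rewrite e0// mul0r pe0// mulr0 addr0.
move=> i phi tp; have [sp _ _] := tp.
have tep := test_funM te sp; have := hu i _ tep.
rewrite partialM; try by move=> y; exact: smooth_diff.
have ip := test_sqi (test_partial i tp); have ip0 := test_sqi tp.
have -> : (fun x => u x * (eta x * partial i phi x + phi x * partial i eta x)) =
  (fun x => eta x * u x * partial i phi x + (u x * partial i eta x) * phi x).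
  by apply/funext => x; ring.
rewrite RI_D; [|apply: sqi_mul => //; exact: sqi_bM me hC su|exact: sqi_mul].
have -> : (fun x => (eta x * g i x + u x * partial i eta x) * phi x) =
  (fun x => g i x * (eta x * phi x) + (u x * partial i eta x) * phi x).
  by apply/funext => x; ring.
rewrite RI_D; [|apply: sqi_mul => //; exact: test_sqi tep|exact: sqi_mul].
by move=> h; rewrite opprD -h addrK.
Qed.

Lemma HcD (x0 : E) r w1 h1 w2 h2 : Hc x0 r w1 h1 -> Hc x0 r w2 h2 ->
  Hc x0 r (fun x => w1 x + w2 x) (fun i x => h1 i x + h2 i x).
Proof.
move=> [sw1 sh1 [r1 [rr1 w10 h10]] hw1] [sw2 sh2 [r2 [rr2 w20 h20]] hw2]; split.
- exact: sqiD.
- by move=> i; exact: sqiD.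
- have sub1 x : ~ cball x0 (Num.max r1 r2) x -> ~ cball x0 r1 x.
    by apply: contra_not; rewrite /cball /= le_max => ->.
  have sub2 x : ~ cball x0 (Num.max r1 r2) x -> ~ cball x0 r2 x.
    by apply: contra_not; rewrite /cball /= le_max => ->; rewrite orbT.
  exists (Num.max r1 r2); split; first by rewrite gt_max rr1.
    by move=> x hx; rewrite w10 ?w20 ?addr0//; [exact: sub2|exact: sub1].
  by move=> i x hx; rewrite h10 ?h20 ?addr0//; [exact: sub2|exact: sub1].
- move=> i phi tp; have ip := test_sqi (test_partial i tp); have ip0 := test_sqi tp.
  under eq_fun do rewrite mulrDl; under [in RHS]eq_fun do rewrite mulrDl.
  by rewrite !RI_D ?hw1 ?hw2 ?opprD//; exact: sqi_mul.
Qed.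

Lemma HcZ (x0 : E) r (a : R) w h : Hc x0 r w h ->
  Hc x0 r (fun x => a * w x) (fun i x => a * h i x).
Proof.
move=> [sw sh [r' [rr w0 h0]] hw]; split.
- exact: sqiZ.
- by move=> i; exact: sqiZ.
- by exists r'; split=> // [x /w0 ->|i x /h0 ->]; rewrite mulr0.
- move=> i phi tp; have ip := test_sqi (test_partial i tp); have ip0 := test_sqi tp.
  under eq_fun do rewrite -mulrA; under [in RHS]eq_fun do rewrite -mulrA.
  by rewrite !RI_Z ?hw ?mulrN//; exact: sqi_mul.
Qed.

Lemma Hc_test (x0 : E) r r' phi : smooth phi -> r' < r -> suppin (cball x0 r') phi ->
  Hc x0 r phi (fun i => partial i phi).
Proof.
move=> sp rr p0; have tp := test_ball_intro rr sp p0; split.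
- exact: test_sqi tp.
- by move=> i; exact: test_sqi (test_partial i tp).
- by exists r'; split => // i; apply: partial_supp => //; exact: closed_cball.
- move=> i psi [ss _ _].
  have cB := @compact_cball R n x0 r'.
  have := RI_partial0 i cB (_ : suppin (cball x0 r') (fun x => phi x * psi x)) (smoothM sp ss).
  rewrite partialM; try by move=> y; exact: smooth_diff.
  move=> h; have sup x : ~ cball x0 r' x -> phi x * psi x = 0 by move=> /p0 ->; rewrite mul0r.
  have i1 : itg (fun x => phi x * partial i psi x).
    apply: (cont_supp_itg cB); first by move=> x /p0 ->; rewrite mul0r.
    by apply: smooth_cont; apply: smoothM => //; exact: smooth_partial.
  have i2 : itg (fun x => psi x * partial i phi x).
    apply: (cont_supp_itg cB); last by apply: smooth_cont; apply: smoothM => //; exact: smooth_partial.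
    by move=> x hx; rewrite (partial_supp i (@closed_cball _ _ _ _) p0 hx) mulr0.
  have := h sup; rewrite RI_D// => /eqP; rewrite addr_eq0 => /eqP ->.
  by congr (- _); congr RI; apply/funext => x; rewrite mulrC.
Qed.

End compact_sobolev.

(** * Sobolev functions on a ball, extended by zero *)

Section bridge.
Context {R : realType} {n : nat}.
Local Notation E := 'rV[R]_n.
Local Notation mu := (@lebesgue_rV R n).
Local Notation RI := (RI mu).
Local Notation itg := (itg mu).
Local Notation sqi := (sqi mu).
Implicit Types (u f g w phi eta : E -> R) (x : E) (Om : set E).

Definition ext Om f : E -> R := fun x => \1_Om x * f x.

Lemma ext_in Om f x : Om x -> ext Om f x = f x.
Proof. by move=> h; rewrite /ext indicE mem_set// mul1r. Qed.

Lemma ext_out Om f x : ~ Om x -> ext Om f x = 0.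
Proof. by move=> h; rewrite /ext indicE memNset// mul0r. Qed.

Lemma extE Om f : ext Om f = f \_ Om.
Proof.
apply/funext => x; rewrite patchE; case: ifPn => [/set_mem|/negP] h; first exact: ext_in.
by rewrite ext_out// => h2; apply: h; exact: mem_set.
Qed.

Lemma ext_id Om f : suppin Om f -> ext Om f = f.
Proof.
move=> f0; apply/funext => x; have [h|h] := pselect (Om x); first exact: ext_in.
by rewrite ext_out// f0.
Qed.

Lemma int_ext Om f : (\int[mu]_(x in Om) (f x)%:E = \int[mu]_x (ext Om f x)%:E)%E.
Proof.
rewrite integral_mkcond; apply: eq_integral => x _.
by rewrite extE !patchE; case: ifP.
Qed.

Lemma meas_ext Om f : measurable Om -> (measurable_fun Om f <-> measurable_fun setT (ext Om f)).
Proof.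
move=> mOm; rewrite extE; split => h.
  by apply/(measurable_restrictT _ mOm).
by apply/(measurable_restrictT _ mOm).
Qed.

Lemma L2P Om f : measurable Om -> L2 Om f <-> sqi (ext Om f).
Proof.
move=> mOm; rewrite /L2 meas_ext//.
have e : (fun x => ext Om f x ^+ 2) = (fun x => f x ^+ 2) \_ Om.
  by apply/funext => x; rewrite extE !patchE; case: ifP; rewrite ?expr0n.
split => -[mf h]; split => //.
  have := (integrable_mkcond _ mOm).1 h; rewrite (restrict_EFin (fun x => f x ^+ 2)) => h2.
  by rewrite e.
apply: (integrable_mkcond _ mOm).2; rewrite (restrict_EFin (fun x => f x ^+ 2)).
by rewrite e in h.
Qed.

Lemma ext_mul_test Om f phi : test_function Om phi -> (fun x => ext Om f x * phi x) = ext Om (fun x => f x * phi x).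
Proof. by move=> tp; apply/funext => x; rewrite /ext mulrA. Qed.

Lemma weak_gradP Om u G : measurable Om -> L2 Om u ->
  is_weak_grad Om u G <-> forall i, sqi (ext Om (fun x => G x ord0 i)) /\
    weakd Om (ext Om u) (ext Om (fun x => G x ord0 i)) i.
Proof.
move=> mOm Lu; have su := (L2P _ mOm).1 Lu.
have eqv i (hG : sqi (ext Om (fun x => G x ord0 i))) phi : test_function Om phi ->
  ((\int[mu]_(x in Om) (u x * partial i phi x)%:E =
       - \int[mu]_(x in Om) (G x ord0 i * phi x)%:E)%E <->
   RI (fun x => ext Om u x * partial i phi x) = - RI (fun x => ext Om (fun x => G x ord0 i) x * phi x)).
  move=> tp.
  rewrite (int_ext Om (fun x => u x * partial i phi x)) (int_ext Om (fun x => G x ord0 i * phi x)).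
  rewrite -(ext_mul_test u (test_partial i tp)) -(ext_mul_test (fun x => G x ord0 i) tp).
  have i1 := sqi_mul su (test_sqi (test_partial i tp)).
  have i2 := sqi_mul hG (test_sqi tp).
  rewrite -!EFin_RI// -EFinN; split=> [[]//|->//].
split=> h i; have [h1 h2] := h i; split.
- exact: (L2P _ mOm).1 h1.
- by move=> phi tp; apply: (proj1 (eqv i ((L2P _ mOm).1 h1) phi tp)); exact: h2.
- exact: (L2P _ mOm).2 h1.
- by move=> phi tp; apply: (proj2 (eqv i h1 phi tp)); exact: h2.
Qed.

(** The mollification of eta g at x is the integral of g against the test function eta mol(. - x),
    that is 0. Hence eta g = 0 almost everywhere, with eta positive on a smaller ball. *)
Lemma fund_lemma (x0 : E) r g : 0 < r -> sqi g -> suppin (l2ball x0 r) g ->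
  (forall phi, test_function (l2ball x0 r) phi -> RI (fun x => g x * phi x) = 0) ->
  {ae mu, forall x, g x = 0}.
Proof.
move=> r0 sg g0 hg.
have key (s : R) : 0 < s -> s < r -> {ae mu, forall x, l2ball x0 s x -> g x = 0}.
  move=> s0 sr; pose eta : E -> R := fun x => em 0 (s ^+ 2 - sq (x - x0)).
  have se : smooth eta.
    apply: smooth_em; apply: smoothB; first exact: smooth_cst.
    by apply: (@smooth_shift R n (@sq R n)); exact: smooth_sq.
  have e0 : suppin (cball x0 s) eta.
    move=> x /negP; rewrite -ltNge => h; apply: em_le0; rewrite subr_le0 -l2norm_sqr.
    by rewrite ler_sqr ?nnegrE ?l2norm_ge0 ?ltW.
  have cB := @compact_cball R n x0 s.
  have [C _ hC] := supp_bounded cB e0 (smooth_cont se).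
  have me : measurable_fun setT eta by exact: continuous_rV_measurable (smooth_cont se).
  have sf : sqi (fun x => eta x * g x) by exact: sqi_bM me hC sg.
  have f0 : suppin (cball x0 s) (fun x => eta x * g x) by move=> x /e0 ->; rewrite mul0r.
  have z : RI (fun x => (eta x * g x) ^+ 2) = 0.
    apply/le_anti; rewrite RI_sqr_ge0 andbT; apply/ler_addgt0Pl => d d0; rewrite addr0.
    have [e e00 /(_ e e00 (lexx e))] := conv_approx cB f0 sf d0.
    congr (_ <= _); congr RI; apply/funext => x.
    rewrite (_ : conv _ _ _ = 0) ?sub0r ?sqrrN// /conv.
    have tp : test_function (l2ball x0 r) (fun y => eta y * mol e (y - x)).
      apply: test_funM; first exact: test_ball_intro sr se e0.
      by apply: smooth_shift; exact: smooth_mol.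
    rewrite -[RHS](hg _ tp); congr RI; apply/funext => y; ring.
  have [_ i2] := sf; have := RI_eq0 i2 (fun x => sqr_ge0 _) z.
  apply: filterS => x /eqP; rewrite sqrf_eq0 mulf_eq0 => /orP[/eqP ex|/eqP//] xs.
  have : 0 < eta x.
    apply: em_gt0; rewrite subr_gt0 -l2norm_sqr ltr_sqr ?nnegrE ?l2norm_ge0 ?ltW//.
  by rewrite ex ltxx.
(* Countably many radii r (1 - 1/(k+2)) exhaust the ball; k + 2 rather than k + 1 keeps them
   positive. *)
have all : {ae mu, forall x, forall k : nat, l2ball x0 (r * (1 - k.+2%:R^-1)) x -> g x = 0}.
  apply: ae_foralln => k; apply: key.
    by rewrite mulr_gt0// subr_gt0 invf_lt1// ltr1n.
  by rewrite gtr_pMr// ltrBlDr ltrDl invr_gt0.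
apply: filterS all => x hx; have [xr|/g0//] := pselect (l2ball x0 r x).
have d0 : 0 < (r - l2norm (x - x0)) / r by rewrite divr_gt0// subr_gt0.
have [k _ hk] := near_infty_natSinv_lt (PosNum d0).
apply: (hx k); rewrite /l2ball /=; have := hk k.+1 (leqnSn k) => /=.
by rewrite ltr_pdivlMr// => h; rewrite mulrBr mulr1 ltrBrDr -ltrBrDl mulrC.
Qed.

Lemma ae_ord (m : nat) (P : 'I_m -> E -> Prop) : (forall i, {ae mu, forall x, P i x}) ->
  {ae mu, forall x, forall i, P i x}.
Proof.
move=> h; have : {ae mu, forall x, forall k : nat, forall i : 'I_m, i = k :> nat -> P i x}.
  apply: ae_foralln => k; have [km|km] := ltnP k m.
    by apply: filterS (h (Ordinal km)) => x hx i ik; rewrite (_ : i = Ordinal km)//; exact: val_inj.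
  by apply: aeW => x i ik; have := ltn_ord i; rewrite ik ltnNge km.
by apply: filterS => x hx i; exact: (hx i i).
Qed.

Lemma weak_gradE (x0 : E) r u G : 0 < r -> L2 (l2ball x0 r) u -> is_weak_grad (l2ball x0 r) u G ->
  is_weak_grad (l2ball x0 r) u (weak_grad (l2ball x0 r) u) /\
  {ae mu, forall x, l2ball x0 r x -> weak_grad (l2ball x0 r) u x = G x}.
Proof.
move=> r0 Lu hG; set Om := l2ball x0 r; have mOm : measurable Om by exact: measurable_l2ball.
have hW : is_weak_grad Om u (weak_grad Om u) by apply: (xgetPex (cst 0)); exists G.
split => //; have := (weak_gradP _ mOm Lu).1 hG; have := (weak_gradP _ mOm Lu).1 hW => {}hW {}hG.
have : {ae mu, forall x, forall i, ext Om (fun x => weak_grad Om u x ord0 i) x - ext Om (fun x => G x ord0 i) x = 0}.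
  apply: ae_ord => i; have [s1 d1] := hW i; have [s2 d2] := hG i.
  apply: (fund_lemma (x0 := x0) (r := r) r0); first exact: sqiB.
    by move=> x hx; rewrite !ext_out ?subrr.
  move=> phi tp; under eq_fun do rewrite mulrBl.
  rewrite RI_B; try by apply: sqi_mul => //; exact: test_sqi tp.
  by apply/eqP; rewrite -[RI (fun x => ext Om (fun x => weak_grad _ _ _ _ _) x * _)]opprK -d1// d2// opprK subrr.
apply: filterS => x hx xO; apply/rowP => i; apply/eqP; rewrite -subr_eq0.
by have := hx i; rewrite !ext_in// => ->.
Qed.

Lemma is_weak_grad_sub (x0 : E) r w (h : 'I_n -> E -> R) phi : let Om := l2ball x0 r in
  Hc x0 r w h -> test_function Om phi ->
  L2 Om (fun x => w x - phi x) /\ is_weak_grad Om (fun x => w x - phi x) (fun x => \row_i (h i x - partial i phi x)).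
Proof.
move=> Om [sw sh [r' [rr w0 h0]] hw] tp; have mOm : measurable Om by exact: measurable_l2ball.
have sp := test_sqi tp; have tps := test_fun_supp tp; have [smp cp pO] := tp.
have e1 : ext Om (fun x => w x - phi x) = fun x => w x - phi x.
  apply: ext_id => x hx; rewrite w0 ?tps ?subrr//.
    by move=> h'; apply: hx; exact: pO.
  by move=> h'; apply: hx; exact: (cball_l2ball rr).
have LL : L2 Om (fun x => w x - phi x) by apply/L2P => //; rewrite e1; exact: sqiB.
split=> //; apply/weak_gradP => // i.
have e2 : ext Om (fun x => (\row_i (h i x - partial i phi x)) ord0 i) = fun x => h i x - partial i phi x.
  under eq_fun do rewrite mxE; apply: ext_id => x hx.
  rewrite h0 ?(test_fun_supp (test_partial i tp)) ?subrr//.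
    by have [_ _ pO'] := test_partial i tp; move=> h'; apply: hx; exact: pO'.
  by move=> h'; apply: hx; exact: (cball_l2ball rr).
rewrite e1 e2; split; first by apply: sqiB => //; exact: test_sqi (test_partial i tp).
move=> psi tpsi; have tpsi' : test_function setT psi by exact: test_fun_sub tpsi.
have [r1 rr1 p1] := test_ball_supp tp.
have [_ _ _ hphi] := Hc_test smp rr1 p1.
have spsi := test_sqi tpsi; have sdpsi := test_sqi (test_partial i tpsi).
have sdphi := test_sqi (test_partial i tp).
under eq_fun do rewrite mulrBl; under [in RHS]eq_fun do rewrite mulrBl.
by rewrite !RI_B ?hw ?hphi ?opprB ?opprK 1?addrC//; exact: sqi_mul.
Qed.

(** The mollifications of w are test functions in the ball, because w has compact support in it. *)
Lemma Hc_H10 (x0 : E) r w (h : 'I_n -> E -> R) : 0 < r -> Hc x0 r w h -> H10 (l2ball x0 r) w.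
Proof.
move=> r0 H; have [sw sh [r' [rr w0 h0]] hw] := H.
set Om := l2ball x0 r; have mOm : measurable Om by exact: measurable_l2ball.
have t0 : test_function Om (fun=> 0).
  apply: (@test_fun_intro _ _ _ set0) => //; [exact: smooth_cst|exact: compact0].
split.
  have [] := is_weak_grad_sub H t0; under eq_fun do rewrite subr0.
  by move=> L G; split => //; exists (fun x => \row_i (h i x - partial i (fun=> 0) x)).
move=> e e0; have [r2 rr2 ha] := Hc_approx H.
(* The squared norm has n + 1 terms, so that n + 2 in the denominator leaves the inequality
   strict. *)
have d0 : 0 < e / (n.+2%:R) by rewrite divr_gt0.
have [phi [sp p0 hp hdp]] := ha _ d0.
have tp : test_function Om phi by exact: test_ball_intro rr2 sp p0.
exists phi => //; rewrite /H1_normsq.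
have [LL GG] := is_weak_grad_sub H tp.
have [G1 aeG] := weak_gradE r0 LL GG.
have spd i : sqi (fun x => h i x - partial i phi x) by apply: sqiB => //; exact: test_sqi (test_partial i tp).
have sd : sqi (fun x => w x - phi x) by apply: sqiB => //; exact: test_sqi tp.
pose F x := (w x - phi x) ^+ 2 + \sum_i (h i x - partial i phi x) ^+ 2.
have iF : itg F.
  by apply: itgD; [case: sd|apply: itg_sum => i; case: (spd i)].
have F0 x : 0 <= F x by rewrite addr_ge0 ?sqr_ge0// sumr_ge0// => i _; exact: sqr_ge0.
rewrite int_ext.
have -> : (\int[mu]_x (ext Om (fun x => (w \- phi) x ^+ 2 + l2norm (weak_grad Om (w \- phi) x) ^+ 2) x)%:E =
  \int[mu]_x (ext Om F x)%:E)%E.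
  apply: ae_eq_integral => //.
  - apply/measurable_EFinP.
    have -> : ext Om (fun x => (w \- phi) x ^+ 2 + l2norm (weak_grad Om (w \- phi) x) ^+ 2) =
      fun x => \1_Om x * (w x - phi x) ^+ 2 + \sum_i (ext Om (fun y => weak_grad Om (w \- phi) y ord0 i) x) ^+ 2.
      apply/funext => x; have [xO|xO] := pselect (Om x).
        rewrite ext_in// indicE mem_set// mul1r l2norm_sqr; congr (_ + _).
        by apply: eq_bigr => i _; rewrite ext_in.
      rewrite ext_out// indicE memNset// mul0r add0r big1// => i _.
      by rewrite ext_out// expr0n.
    apply: measurable_funD.
      by apply: measurable_funM => //; apply: measurable_funX; case: sd.
    apply: measurable_sum => i; apply: measurable_funX.
    by have [[]] := (weak_gradP _ mOm LL).1 G1 i.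
  - apply/measurable_EFinP; apply: measurable_funM => //; exact: itg_meas iF.
  - apply: filterS aeG => x hx _ /=; congr (_%:E).
    have [xO|xO] := pselect (Om x); last by rewrite !ext_out.
    rewrite !ext_in// hx// l2norm_sqr /F; congr (_ + _).
    by apply: eq_bigr => i _; rewrite mxE.
apply: (@le_lt_trans _ _ (RI F)%:E).
  rewrite EFin_RI//; apply: ge0_le_integral => //.
  - by move=> x _; rewrite lee_fin mulr_ge0// indicE.
  - by apply/measurable_EFinP; apply: measurable_funM => //; exact: itg_meas iF.
  - by apply/measurable_EFinP; exact: itg_meas iF.
  - move=> x _; rewrite lee_fin /ext indicE; case: (_ \in _); rewrite ?mul1r ?mul0r//.
rewrite lte_fin /F RI_D; [|by case: sd|by apply: itg_sum => i; case: (spd i)].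
rewrite RI_sum; last by move=> i; case: (spd i).
have b1 : RI (fun x => (w x - phi x) ^+ 2) <= e / n.+2%:R.
  by apply: le_trans hp; rewrite le_eqVlt; apply/orP; left; apply/eqP; congr RI; apply/funext => x; ring.
have b2 : \sum_(i < n) RI (fun x => (h i x - partial i phi x) ^+ 2) <= \sum_(i < n) (e / n.+2%:R).
  apply: ler_sum => i _; apply: le_trans (hdp i).
  by rewrite le_eqVlt; apply/orP; left; apply/eqP; congr RI; apply/funext => x; ring.
apply: (le_lt_trans (lerD b1 b2)); rewrite sumr_const card_ord -mulrS -[ltLHS]mulr_natr.
by rewrite mulrAC ltr_pdivrMr// ltr_pM2l// ltr_nat.
Qed.

End bridge.

(** * The functional as an integral over the whole space *)

Section functional_bridge.
Context {R : realType} {n N : nat}.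
Local Notation E := 'rV[R]_n.
Local Notation mu := (@lebesgue_rV R n).
Local Notation RI := (RI mu).
Local Notation itg := (itg mu).
Local Notation sqi := (sqi mu).
Implicit Types (x : E) (Om : set E) (U V : E -> 'rV[R]_N).

Definition ordered (v : 'rV[R]_N) : Prop :=
  forall i j : 'I_N, j = i.+1 :> nat -> v ord0 j <= v ord0 i.

(** The energy density takes the gradient as a separate argument: functions have weak gradients
    only, and each competitor comes with its own. *)
Definition en U (G : 'I_N -> 'I_n -> E -> R) : E -> R :=
  fun x => \sum_i \sum_a G i a x ^+ 2 + W (U x).

Lemma W_ge0 (v : 'rV[R]_N) : 0 <= W v.
Proof. by apply: sumr_ge0 => i _; apply: sumr_ge0 => j _; exact: ler0n. Qed.

Lemma W_le (v : 'rV[R]_N) : W v <= N%:R ^+ 2.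
Proof.
apply: (@le_trans _ _ (\sum_(i < N) \sum_(j < N) (1 : R))).
  apply: ler_sum => i _; rewrite big_mkcond; apply: ler_sum => j _.
  by case: ifP => // _; rewrite lern1; case: (_ < _).
by under eq_bigr do rewrite sumr_const card_ord; rewrite sumr_const card_ord -[leLHS]mulr_natr expr2.
Qed.

Lemma W0 : W (0 : 'rV[R]_N) = 0.
Proof. by rewrite /W big1// => i _; rewrite big1// => j _; rewrite !mxE ltxx. Qed.

Lemma measurable_W U : (forall i, measurable_fun setT (fun x => U x ord0 i)) ->
  measurable_fun setT (fun x => W (U x)).
Proof.
move=> mU; apply: measurable_sum => i; under eq_fun do rewrite big_mkcond.
apply: measurable_sum => j; case: (nat_of_ord j == i.+1) => //.
have -> : (fun x => (U x ord0 j < U x ord0 i)%R%:R : R) = \1_[set x | U x ord0 j < U x ord0 i].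
  apply/funext => x; rewrite indicE.
  suff -> : (x \in [set x | U x ord0 j < U x ord0 i]) = (U x ord0 j < U x ord0 i) by [].
  by apply/idP/idP => [/set_mem//|h]; exact/mem_set.
apply: measurable_indic; rewrite -[X in measurable X]setTI.
by apply: measurable_fun_ltr.
Qed.

Definition extV Om V : E -> 'rV[R]_N := fun x => \row_i ext Om (component V i) x.

Lemma extV_in Om V x : Om x -> extV Om V x = V x.
Proof. by move=> h; apply/rowP => i; rewrite mxE ext_in. Qed.

Lemma extV_out Om V x : ~ Om x -> extV Om V x = 0.
Proof. by move=> h; apply/rowP => i; rewrite !mxE ext_out. Qed.

Lemma extV_coord Om V i : (fun x => extV Om V x ord0 i) = ext Om (component V i).
Proof. by apply/funext => x; rewrite mxE. Qed.

Lemma itg_W (x0 : E) r U : (forall i, measurable_fun setT (fun x => U x ord0 i)) ->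
  (forall x, ~ l2ball x0 r x -> U x = 0) -> itg (fun x => W (U x)).
Proof.
move=> mU U0; have mW := measurable_W mU.
have mB : measurable (cball x0 r) by exact: measurable_cball.
apply: (@itg_le _ _ _ _ (fun x => N%:R ^+ 2 * \1_(cball x0 r) x)) => //.
  move=> x; rewrite ger0_norm ?W_ge0// indicE.
  have [h|h] := pselect (l2ball x0 r x).
    by rewrite mem_set ?mulr1 ?W_le//; exact: l2ball_cball.
  by rewrite U0// W0 mulr_ge0// sqr_ge0.
by apply: itgZ; apply: itg_indic => //; exact: mu_cball_lty.
Qed.

Lemma itg_en (x0 : E) r U G : (forall i, measurable_fun setT (fun x => U x ord0 i)) ->
  (forall x, ~ l2ball x0 r x -> U x = 0) -> (forall i a, sqi (G i a)) -> itg (en U G).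
Proof.
move=> mU U0 sG; apply: itgD; last exact: itg_W mU U0.
by apply: itg_sum => i; apply: itg_sum => a; case: (sG i a).
Qed.

Lemma J_RI (x0 : E) r V (Ga : 'I_N -> E -> 'rV[R]_n) : 0 < r -> let Om := l2ball x0 r in
  (forall i, L2 Om (component V i)) -> (forall i, is_weak_grad Om (component V i) (Ga i)) ->
  J Om V = (RI (en (extV Om V) (fun i a => ext Om (fun x => Ga i x ord0 a))))%:E.
Proof.
move=> r0 Om LV GV; have mOm : measurable Om by exact: measurable_l2ball.
have sV i : sqi (ext Om (component V i)) by apply: (L2P _ mOm).1.
have mV i : measurable_fun setT (fun x => extV Om V x ord0 i) by rewrite extV_coord; case: (sV i).
have sG i a : sqi (ext Om (fun x => Ga i x ord0 a)).
  by have [] := (weak_gradP _ mOm (LV i)).1 (GV i) a.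
have ie := itg_en (x0 := x0) (r := r) mV (fun x => @extV_out Om V x) sG.
rewrite EFin_RI// /J int_ext.
have aeG : {ae mu, forall x, forall i, Om x -> weak_grad Om (component V i) x = Ga i x}.
  by apply: ae_ord => i; have [_] := weak_gradE r0 (LV i) (GV i).
have sW i a : sqi (ext Om (fun x => weak_grad Om (component V i) x ord0 a)).
  have [h _] := weak_gradE r0 (LV i) (GV i).
  by have [] := (weak_gradP _ mOm (LV i)).1 h a.
have e : ext Om (fun x => \sum_i l2norm (weak_grad Om (component V i) x) ^+ 2 + W (V x)) =
   en (extV Om V) (fun i a => ext Om (fun x => weak_grad Om (component V i) x ord0 a)).
  apply/funext => x; rewrite /en; have [xO|xO] := pselect (Om x).
    rewrite ext_in// extV_in//; congr (_ + _); apply: eq_bigr => i _.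
    by rewrite l2norm_sqr; apply: eq_bigr => a _; rewrite ext_in.
  rewrite ext_out// extV_out// W0 addr0 big1// => i _; rewrite big1// => a _.
  by rewrite ext_out// expr0n.
rewrite e; apply: ae_eq_integral => //.
- by apply/measurable_EFinP; apply: itg_meas; exact: itg_en mV (fun x => @extV_out Om V x) sW.
- by apply/measurable_EFinP; exact: itg_meas ie.
- apply: filterS aeG => x hx _ /=; congr (_%:E); congr (_ + _).
  apply: eq_bigr => i _; apply: eq_bigr => a _.
  have [xO|xO] := pselect (Om x); last by rewrite !ext_out.
  by rewrite !ext_in// hx.
Qed.

(* U and its weak gradient G are extended by 0 outside the ball, so that all
   integrals are over the whole space; the competitors are U + w. *)
Record is_min (rho : R) U (G : 'I_N -> 'I_n -> E -> R) : Prop := IsMin {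
  im_u : forall i, sqi (fun x => U x ord0 i);
  im_g : forall i a, sqi (G i a);
  im_u0 : forall x, ~ l2ball 0 rho x -> U x = 0;
  im_g0 : forall i a, suppin (l2ball 0 rho) (G i a);
  im_w : forall i a, weakd (l2ball 0 rho) (fun x => U x ord0 i) (G i a) a;
  im_ord : {ae mu, forall x, ordered (U x)};
  im_cont : forall x, l2ball 0 rho x -> {for x, continuous U};
  im_min : forall (w : 'I_N -> E -> R) (h : 'I_N -> 'I_n -> E -> R),
    (forall i, Hc 0 rho (w i) (h i)) ->
    {ae mu, forall x, ordered (U x + \row_i w i x)} ->
    RI (en U G) <= RI (en (fun x => U x + \row_i w i x) (fun i a x => G i a x + h i a x))
}.

(** The weak gradients of U are chosen once. A perturbation with compact support in the ball is
    admissible by [Hc_H10], and its gradient is added to the chosen one. *)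
Lemma minimizer_is_min (U0 : E -> 'rV[R]_N) (rho : R) : 0 < rho ->
  continuous_minimizer (l2ball 0 rho) U0 ->
  exists G, is_min rho (extV (l2ball 0 rho) U0) G.
Proof.
move=> r0 [cU [[HU oU] mU]]; set Om := l2ball 0 rho.
have mOm : measurable Om by exact: measurable_l2ball.
have oOm : open Om by exact: open_l2ball.
pose Gw i := weak_grad Om (component U0 i).
have LU i : L2 Om (component U0 i) by case: (HU i).
have GU i : is_weak_grad Om (component U0 i) (Gw i).
  by have [_ [G hG]] := HU i; have [] := weak_gradE r0 (LU i) hG.
have wU i := (weak_gradP _ mOm (LU i)).1 (GU i).
exists (fun i a => ext Om (fun x => Gw i x ord0 a)).
have sU i : sqi (ext Om (component U0 i)) by apply: (L2P _ mOm).1.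
split.
- by move=> i; rewrite extV_coord.
- by move=> i a; case: (wU i a).
- by move=> x hx; exact: extV_out.
- by move=> i a x hx; exact: ext_out.
- by move=> i a; rewrite extV_coord; case: (wU i a).
- apply: filterS oU => x hx i j ij; have [xO|xO] := pselect (Om x).
    by rewrite extV_in//; exact: hx.
  by rewrite extV_out// !mxE.
- move=> x xO; have cx : {for x, continuous U0}.
    by move: cU; rewrite continuous_open_subspace// => /(_ x); rewrite inE; exact.
  have : \forall y \near x, U0 y = extV Om U0 y.
    have : nbhs x Om by exact: open_nbhs_nbhs.
    by apply: filterS => y yO; rewrite extV_in.
  move=> h; suff : extV Om U0 y @[y --> x] --> U0 x by rewrite -(extV_in U0 xO).
  move=> A hA; have h3 : nbhs x (U0 @^-1` A) by exact: cx.
  have h4 : nbhs x (extV Om U0 @^-1` A).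
    have h5 : nbhs x [set y | U0 y = extV Om U0 y] by exact: h.
    apply: filterS (filterI h3 h5) => y [/= h6 h7].
    by rewrite /preimage /mkset -h7.
  exact: h4.
- move=> w h Hw ow; pose V x := U0 x + \row_i w i x.
  have Vi i : component V i = fun x => component U0 i x + w i x.
    by apply/funext => x; rewrite /component !mxE.
  have wsup i x : ~ Om x -> w i x = 0 /\ forall a, h i a x = 0.
    have [_ _ [r' [rr w0 h0]] _] := Hw i.
    move=> hx; have hx' : ~ cball 0 r' x by move=> h'; apply: hx; exact: (cball_l2ball rr).
    by rewrite w0//; split => // a; rewrite h0.
  have eV i : ext Om (component V i) = fun x => ext Om (component U0 i) x + w i x.
    apply/funext => x; rewrite Vi; have [xO|xO] := pselect (Om x); first by rewrite !ext_in.
    by rewrite !ext_out// (proj1 (wsup i x xO)) addr0.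
  have LV i : L2 Om (component V i).
    by apply/L2P => //; rewrite eV; apply: sqiD => //; case: (Hw i).
  pose Ga i x : 'rV[R]_n := Gw i x + \row_a h i a x.
  have eG i a : ext Om (fun x => Ga i x ord0 a) = fun x => ext Om (fun x => Gw i x ord0 a) x + h i a x.
    apply/funext => x; have [xO|xO] := pselect (Om x); first by rewrite !ext_in// !mxE.
    by rewrite !ext_out// (proj2 (wsup i x xO)) addr0.
  have GV i : is_weak_grad Om (component V i) (Ga i).
    apply/weak_gradP => // a; rewrite eV eG; have [sw sh _ hw] := Hw i; have [s1 d1] := wU i a.
    split; first exact: sqiD.
    move=> phi tp; have tp' : test_function setT phi by exact: test_fun_sub tp.
    have st := test_sqi tp; have sdt := test_sqi (test_partial a tp).
    under eq_fun do rewrite mulrDl; under [in RHS]eq_fun do rewrite mulrDl.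
    by rewrite !RI_D ?d1 ?hw ?opprD//; exact: sqi_mul.
  have := mU V; rewrite (J_RI r0 LU GU) (J_RI r0 LV GV) lee_fin.
  have -> : extV Om V = fun x => extV Om U0 x + \row_i w i x.
    by apply/funext => x; apply/rowP => i; rewrite !mxE eV.
  have -> : (fun i a => ext Om (fun x => Ga i x ord0 a)) =
      fun i a x => ext Om (fun x => Gw i x ord0 a) x + h i a x.
    by apply/funext => i; apply/funext => a; exact: eG.
  apply.
  + split; first by move=> i; split => //; exists (Ga i).
    apply: filterS ow => x hx xO i j ij; have := hx i j ij.
    by rewrite extV_in.
  + move=> i; have -> : (component V i \- component U0 i)%R = w i.
      by apply/funext => x /=; rewrite Vi addrC addKr.
    exact: Hc_H10 (Hw i).
Qed.

End functional_bridge.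

(** * First variations and mean values *)

Section variations.
Context {R : realType} {n N : nat}.
Local Notation E := 'rV[R]_n.
Local Notation mu := (@lebesgue_rV R n).
Local Notation RI := (RI mu).
Local Notation itg := (itg mu).
Local Notation sqi := (sqi mu).
Implicit Types (x : E) (phi eta : E -> R) (h G : 'I_N -> 'I_n -> E -> R) (w : 'I_N -> E -> R).

(** [Bf] and [Qf] are the terms of first and second order in |G + h|^2 = |G|^2 + 2 G.h + |h|^2. *)
Definition Bf G h : R := \sum_i \sum_a RI (fun x => G i a x * h i a x).
Definition Qf h : R := \sum_i \sum_a RI (fun x => h i a x ^+ 2).

Lemma Qf_ge0 h : 0 <= Qf h.
Proof. by apply: sumr_ge0 => i _; apply: sumr_ge0 => a _; exact: RI_sqr_ge0. Qed.

(** The inequality at t and at -t gives |X| <= t Y for every small t > 0. *)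
Lemma quad_zero (X Y t0 : R) : 0 < t0 -> (forall t, `|t| <= t0 -> 0 <= t * X + t ^+ 2 * Y) -> X = 0.
Proof.
move=> t00 h; have h1 : 0 <= `|X| - `|X| by rewrite subrr.
apply/normr0_eq0/le_anti; rewrite normr_ge0 andbT; apply/ler_addgt0Pl => e e0; rewrite addr0.
pose t := Num.min t0 (e / (`|Y| + 1)).
have Y1 : 0 < `|Y| + 1 by rewrite ltr_wpDl.
have t0' : 0 < t by rewrite lt_min t00 divr_gt0.
have tt0 : t <= t0 by rewrite ge_min lexx.
have te : t * `|Y| <= e.
  have : t <= e / (`|Y| + 1) by rewrite ge_min lexx orbT.
  rewrite ler_pdivlMr// => /(le_trans _); apply; rewrite ler_wpM2l ?(ltW t0')// lerDl//.
have := h t; have := h (- t); rewrite normrN gtr0_norm// => /(_ tt0) k1 /(_ tt0) k2.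
have XY : `|X| <= t * Y.
  rewrite ler_norml; apply/andP; split; rewrite -(ler_pM2l t0'); nra.
by apply: (le_trans XY); apply: le_trans te; rewrite ler_wpM2l ?(ltW t0')// ler_norm.
Qed.

Variables (rho : R) (U : E -> 'rV[R]_N) (G : 'I_N -> 'I_n -> E -> R).
Hypothesis (rho0 : 0 < rho) (H : is_min rho U G).
Local Notation u i := (fun x => U x ord0 i).

Lemma RI_sum2 (F : 'I_N -> 'I_n -> E -> R) : (forall i a, itg (F i a)) ->
  RI (fun x => \sum_i \sum_a F i a x) = \sum_i \sum_a RI (F i a).
Proof.
move=> iF; rewrite RI_sum => [|i]; last exact: itg_sum.
by apply: eq_bigr => i _; rewrite RI_sum.
Qed.

Lemma min_var w h : (forall i, Hc 0 rho (w i) (h i)) ->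
  {ae mu, forall x, ordered (U x + \row_i w i x)} ->
  RI (fun x => W (U x)) <= 2 * Bf G h + Qf h + RI (fun x => W (U x + \row_i w i x)).
Proof.
move=> Hw ow; have := im_min H Hw ow.
have sh i a : sqi (h i a) by case: (Hw i).
have sG := im_g H; have su := im_u H.
have mU i : measurable_fun setT (u i) by case: (su i).
have mV i : measurable_fun setT (fun x => (U x + \row_i w i x) ord0 i).
  under eq_fun do rewrite !mxE; apply: measurable_funD => //.
  by case: (Hw i) => -[].
have V0 x : ~ l2ball 0 rho x -> U x + \row_i w i x = 0.
  move=> hx; rewrite (im_u0 H hx) add0r; apply/rowP => i; rewrite !mxE.
  have [_ _ [r' [rr w0 _]] _] := Hw i; apply: w0 => h'; apply: hx.
  exact: (cball_l2ball rr).
have iW := itg_W mU (im_u0 H); have iW' := itg_W mV V0.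
have iG : itg (fun x => \sum_i \sum_a G i a x ^+ 2).
  by apply: itg_sum => i; apply: itg_sum => a; case: (sG i a).
have iGh : itg (fun x => \sum_i \sum_a (G i a x + h i a x) ^+ 2).
  by apply: itg_sum => i; apply: itg_sum => a; case: (sqiD (sG i a) (sh i a)).
rewrite /en !RI_D//.
have -> : RI (fun x => \sum_i \sum_a (G i a x + h i a x) ^+ 2) =
    RI (fun x => \sum_i \sum_a G i a x ^+ 2) + (2 * Bf G h + Qf h).
  have e1 i a : RI (fun x => (G i a x + h i a x) ^+ 2) =
     RI (fun x => G i a x ^+ 2) + (2 * RI (fun x => G i a x * h i a x) + RI (fun x => h i a x ^+ 2)).
    have -> : (fun x => (G i a x + h i a x) ^+ 2) = (fun x => G i a x ^+ 2 +
       (2 * (G i a x * h i a x) + h i a x ^+ 2)) by apply/funext => x; ring.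
    have i1 : itg (fun x => G i a x ^+ 2) by case: (sG i a).
    have i2 : itg (fun x => h i a x ^+ 2) by case: (sh i a).
    have i3 := sqi_mul (sG i a) (sh i a).
    rewrite RI_D ?RI_D ?RI_Z//; [exact: itgZ|by apply: itgD => //; exact: itgZ].
  rewrite !RI_sum2; [|by move=> i a; case: (sG i a)|by move=> i a; case: (sqiD (sG i a) (sh i a))].
  rewrite /Bf /Qf mulr_sumr -!big_split /=; apply: eq_bigr => i _.
  rewrite mulr_sumr -!big_split /=; apply: eq_bigr => a _; exact: e1.
lra.
Qed.

Lemma ordered_scale (c : R) (v : 'rV[R]_N) : 0 <= c -> ordered v -> ordered (c *: v).
Proof. by move=> c0 ov i j ij; rewrite !mxE ler_wpM2l// ov. Qed.

Lemma orderedD (v v' : 'rV[R]_N) : ordered v -> ordered v' -> ordered (v + v').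
Proof. by move=> ov ov' i j ij; rewrite !mxE lerD// ?ov// ov'. Qed.

Lemma W_scale (c : R) (v : 'rV[R]_N) : 0 < c -> W (c *: v) = W v.
Proof.
move=> c0; apply: eq_bigr => i _; apply: eq_bigr => j _.
by rewrite !mxE ltr_pM2l.
Qed.

Lemma Hc_phi r' phi : smooth phi -> r' < rho -> suppin (cball 0 r') phi -> forall i,
  Hc 0 rho (fun x => phi x * u i x) (fun a x => phi x * G i a x + u i x * partial a phi x).
Proof.
move=> sp rr p0 i; apply: (Hc_prod (im_u H i) (im_g H i) _ sp rr p0).
by move=> a; exact: (im_w H i a).
Qed.

(* The competitors (1 + t phi) U have the same W, for small |t|. *)
Lemma first_var r' phi : smooth phi -> r' < rho -> suppin (cball 0 r') phi ->
  Bf G (fun i a x => phi x * G i a x + u i x * partial a phi x) = 0.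
Proof.
move=> sp rr p0; have cB := @compact_cball R n 0 r'.
have [C C0 hC] := supp_bounded cB p0 (smooth_cont sp).
have HH := Hc_phi sp rr p0; set h := fun i a x => _ + _.
suff /eqP : 2 * Bf G h = 0 by rewrite mulf_eq0 pnatr_eq0 /= => /eqP.
(* For these t the factor 1 + t phi is at least 1/2, so the competitor is ordered and has the same
   [W]. *)
apply: (@quad_zero _ (Qf h) (2 * (C + 1))^-1); first by rewrite invr_gt0; lra.
move=> t ht; have Hw i := HcZ t (HH i).
have tp x : 0 < 1 + t * phi x.
  have : `|t * phi x| <= 2^-1.
    rewrite normrM; apply: (@le_trans _ _ ((2 * (C + 1))^-1 * (C + 1))).
      by rewrite ler_pM// (le_trans (hC x))// lerDl.
    by rewrite invfM -mulrA mulVf ?mulr1// gt_eqF//; lra.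
  rewrite ler_norml => /andP[? _]; lra.
have e x : U x + \row_i (t * (phi x * U x ord0 i)) = (1 + t * phi x) *: U x.
  by apply/rowP => i; rewrite !mxE; ring.
have := min_var Hw.
have -> : (fun x => W (U x + \row_i (t * (phi x * U x ord0 i)))) = (fun x => W (U x)).
  by apply/funext => x; rewrite e W_scale.
have -> : Qf (fun i a x => t * h i a x) = t ^+ 2 * Qf h.
  rewrite /Qf mulr_sumr; apply: eq_bigr => i _; rewrite mulr_sumr; apply: eq_bigr => a _.
  under eq_fun do rewrite exprMn; rewrite RI_Z//; have [_ s _ _] := HH i; by case: (s a).
have -> : Bf G (fun i a x => t * h i a x) = t * Bf G h.
  rewrite /Bf mulr_sumr; apply: eq_bigr => i _; rewrite mulr_sumr; apply: eq_bigr => a _.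
  under eq_fun do rewrite mulrCA; rewrite RI_Z//; have [_ s _ _] := HH i.
  exact: sqi_mul (im_g H i a) (s a).
move=> hm; suff : RI (fun x => W (U x)) <= 2 * (t * Bf G h) + t ^+ 2 * Qf h + RI (fun x => W (U x)).
  by move=> h1; lra.
apply: hm; apply: filterS (im_ord H) => x ox; rewrite e; apply: ordered_scale => //; exact: ltW.
Qed.

(* U + w is ordered when w is, and costs at most N^2 on the support of w. *)
Lemma min_lsup s0 x0 w h : (forall i, Hc 0 rho (w i) (h i)) -> (forall i, suppin (cball x0 s0) (w i)) ->
  {ae mu, forall x, ordered (\row_i w i x)} ->
  - 2 * Bf G h <= Qf h + N%:R ^+ 2 * RI (\1_(cball x0 s0)).
Proof.
move=> Hw sw ow; have ow' : {ae mu, forall x, ordered (U x + \row_i w i x)}.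
  by apply: filterS2 (im_ord H) ow => x; exact: orderedD.
have := min_var Hw ow'.
have mU i : measurable_fun setT (u i) by case: (im_u H i).
have mV i : measurable_fun setT (fun x => (U x + \row_i w i x) ord0 i).
  under eq_fun do rewrite !mxE; apply: measurable_funD => //.
  by case: (Hw i) => -[].
have V0 x : ~ l2ball 0 rho x -> U x + \row_i w i x = 0.
  move=> hx; rewrite (im_u0 H hx) add0r; apply/rowP => i; rewrite !mxE.
  have [_ _ [r' [rr w0 _]] _] := Hw i; apply: w0 => h'; apply: hx.
  exact: (cball_l2ball rr).
have iW := itg_W mU (im_u0 H); have iW' := itg_W mV V0.
have i1 : itg (\1_(cball x0 s0)).
  by apply: itg_indic; [exact: measurable_cball|exact: mu_cball_lty].
have : RI (fun x => W (U x + \row_i w i x)) <= RI (fun x => W (U x) + N%:R ^+ 2 * \1_(cball x0 s0) x).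
  apply: RI_le => //; first by apply: itgD => //; exact: itgZ.
  move=> x; rewrite indicE; have [xs|xs] := pselect (cball x0 s0 x).
    by rewrite mem_set// mulr1 (le_trans (W_le _))// lerDr W_ge0.
  have -> : \row_i w i x = 0 by apply/rowP => i; rewrite !mxE sw.
  by rewrite addr0 lerDl mulr_ge0 ?sqr_ge0.
rewrite RI_D ?RI_Z//; last exact: itgZ.
lra.
Qed.

Definition lap phi : E -> R := fun x => \sum_a partial a (partial a phi) x.

Definition D2 (phi : E -> R) : R := \sum_i \sum_a RI (fun x => phi x * G i a x ^+ 2).

Lemma supp_sq r' eta (f g : E -> R) : suppin (cball 0 r') eta -> continuous eta -> sqi f -> sqi g ->
  itg (fun x => eta x * (f x * g x)).
Proof.
move=> e0 ce sf sg; have [C _ hC] := supp_bounded (@compact_cball R n 0 r') e0 ce.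
by apply: (itg_bM _ hC); [exact: continuous_rV_measurable|exact: sqi_mul].
Qed.

(** The weak form of D(u^2) = 2 u Du, from integration by parts of u against psi u. *)
Lemma grad_sq r' psi i a : smooth psi -> r' < rho -> suppin (cball 0 r') psi ->
  RI (fun x => u i x ^+ 2 * partial a psi x) = - 2 * RI (fun x => psi x * (u i x * G i a x)).
Proof.
move=> sp rr p0; have HH := Hc_phi sp rr p0 i.
have := Hc_ibp (im_u H i) (im_g H i a) (im_w H i a) HH.
have pp0 := partial_supp a (@closed_cball _ _ _ _) p0.
have i1 := supp_sq p0 (smooth_cont sp) (im_u H i) (im_g H i a).
have i2 := supp_sq pp0 (smooth_cont (smooth_partial a sp)) (im_u H i) (im_u H i).
have -> : (fun x => u i x * (psi x * G i a x + u i x * partial a psi x)) =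
  (fun x => psi x * (u i x * G i a x) + partial a psi x * (u i x * u i x)).
  by apply/funext => x; ring.
have -> : (fun x => G i a x * (psi x * u i x)) = (fun x => psi x * (u i x * G i a x)).
  by apply/funext => x; ring.
rewrite RI_D//.
have -> : (fun x => u i x ^+ 2 * partial a psi x) = (fun x => partial a psi x * (u i x * u i x)).
  by apply/funext => x; ring.
lra.
Qed.

(** The mixed term of [first_var] is u Du . D phi. By [grad_sq] for the partial derivatives of phi,
    it integrates to minus one half of |U|^2 Delta phi. *)
Lemma subharmonic r' phi : smooth phi -> r' < rho -> suppin (cball 0 r') phi ->
  RI (fun x => sq (U x) * lap phi x) = 2 * D2 phi.
Proof.
move=> sp rr p0; have := first_var sp rr p0.
have cl0 := @closed_cball R n 0 r'.
have pp0 a := partial_supp a cl0 p0.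
have i1 i a := supp_sq p0 (smooth_cont sp) (im_g H i a) (im_g H i a).
have i2 i a := supp_sq (pp0 a) (smooth_cont (smooth_partial a sp)) (im_u H i) (im_g H i a).
have i3 i a := supp_sq (partial_supp a cl0 (pp0 a)) (smooth_cont (smooth_partial a (smooth_partial a sp))) (im_u H i) (im_u H i).
have -> : Bf G (fun i a x => phi x * G i a x + u i x * partial a phi x) =
   D2 phi + \sum_i \sum_a RI (fun x => partial a phi x * (u i x * G i a x)).
  rewrite /D2 -big_split /=; apply: eq_bigr => i _; rewrite -big_split /=; apply: eq_bigr => a _.
  have -> : (fun x => phi x * G i a x ^+ 2) = (fun x => phi x * (G i a x * G i a x)).
    by apply/funext => x; ring.
  rewrite -RI_D//; congr RI; apply/funext => x; ring.
have -> : RI (fun x => sq (U x) * lap phi x) = \sum_i \sum_a RI (fun x => u i x ^+ 2 * partial a (partial a phi) x).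
  have i3' i a : itg (fun x => u i x ^+ 2 * partial a (partial a phi) x).
    by have := i3 i a; congr (itg _); apply/funext => x; ring.
  have i3'' i : itg (fun x => \sum_a u i x ^+ 2 * partial a (partial a phi) x) by apply: itg_sum.
  under [RHS]eq_bigr do rewrite -RI_sum//.
  rewrite -RI_sum//; congr RI; apply/funext => x; rewrite /sq mulr_suml; apply: eq_bigr => i _.
  by rewrite /lap mulr_sumr.
under [X in _ -> X = _]eq_bigr do under eq_bigr do rewrite (grad_sq _ _ (smooth_partial _ sp) rr (pp0 _)).
under [X in _ -> X = _]eq_bigr do rewrite -mulr_sumr; rewrite -mulr_sumr.
lra.
Qed.

(* Competitor (1 - eta) U. *)
Lemma nondeg_var r' eta : smooth eta -> r' < rho -> suppin (cball 0 r') eta -> (forall x, 0 <= eta x <= 1) ->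
  RI (fun x => W (U x)) - RI (fun x => W ((1 - eta x) *: U x)) <=
  \sum_i \sum_a RI (fun x => partial a eta x ^+ 2 * u i x ^+ 2).
Proof.
move=> sp rr p0 e01; have fv := first_var sp rr p0.
have HH := Hc_phi sp rr p0; set h := fun i a x => _ + _ in fv.
have Hw i := HcZ (-1) (HH i).
have := min_var Hw.
have e x : U x + \row_i (-1 * (eta x * U x ord0 i)) = (1 - eta x) *: U x.
  by apply/rowP => i; rewrite !mxE; ring.
have -> : (fun x => W (U x + \row_i (-1 * (eta x * U x ord0 i)))) = (fun x => W ((1 - eta x) *: U x)).
  by apply/funext => x; rewrite e.
have ow : {ae mu, forall x, ordered (U x + \row_i (-1 * (eta x * U x ord0 i)))}.
  apply: filterS (im_ord H) => x ox; rewrite e; apply: ordered_scale => //.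
  by have /andP[_] := e01 x; rewrite subr_ge0.
move=> /(_ ow) hm.
have sh i a : sqi (h i a) by have [_ s _ _] := HH i; exact: s.
have eB : Bf G (fun i a x => -1 * h i a x) = 0.
  rewrite -[RHS](mulr0 (-1)) -fv /Bf mulr_sumr; apply: eq_bigr => i _; rewrite mulr_sumr; apply: eq_bigr => a _.
  under eq_fun do rewrite mulrCA; rewrite RI_Z//.
  exact: sqi_mul (im_g H i a) (sh i a).
(* The expansion of |eta DU + U D eta|^2 is |U|^2 |D eta|^2 plus the first variation in the
   direction eta^2, which vanishes. *)
have sp2 : smooth (fun x => eta x * eta x) by exact: smoothM.
have p02 : suppin (cball 0 r') (fun x => eta x * eta x) by move=> x /p0 ->; rewrite mul0r.
have fv2 := first_var sp2 rr p02.
have eQ : Qf (fun i a x => -1 * h i a x) = \sum_i \sum_a RI (fun x => partial a eta x ^+ 2 * u i x ^+ 2).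
  rewrite -[RHS]addr0 -[X in _ = _ + X]fv2 /Qf /Bf.
  transitivity (\sum_i \sum_a (RI (fun x => partial a eta x ^+ 2 * u i x ^+ 2) +
    RI (fun x => G i a x * (eta x * eta x * G i a x + u i x * partial a (fun x => eta x * eta x) x)))); last first.
    by under eq_bigr do rewrite big_split /=; rewrite big_split.
  apply: eq_bigr => i _; apply: eq_bigr => a _.
  have [_ s2 _ _] := Hc_phi sp2 rr p02 i.
  have pp0 := partial_supp a (@closed_cball R n 0 r') p0.
  have spa := smooth_partial a sp.
  rewrite -RI_D; first last.
  - exact: sqi_mul (im_g H i a) (s2 a).
  - have := supp_sq (eta := fun x => partial a eta x * partial a eta x)
      (fun x hx => eq_trans (congr1 (fun z => z * _) (pp0 x hx)) (mul0r _))
      (smooth_cont (smoothM spa spa)) (im_u H i) (im_u H i).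
    by congr (itg _); apply/funext => x; ring.
  congr RI; apply/funext => x; rewrite partialM; try by move=> y; exact: smooth_diff.
  rewrite /h; ring.
by move: hm; rewrite eB eQ mulr0 add0r lerBlDr.
Qed.

End variations.

(** * Dilations and mean values *)

Section mean_value.
Context {R : realType} {n : nat}.
Local Notation E := 'rV[R]_n.
Local Notation mu := (@lebesgue_rV R n).
Local Notation RI := (RI mu).
Local Notation itg := (itg mu).
Implicit Types (x : E) (f v : E -> R).

Definition dil (s : R) (x0 : E) f : E -> R := fun x => f (s^-1 *: (x - x0)).

Lemma dilE s x0 f : dil s x0 f = fun x => f (s^-1 *: x + (- (s^-1 *: x0))).
Proof. by apply/funext => x; rewrite /dil scalerBr. Qed.

Lemma smooth_dil s x0 f : smooth f -> smooth (dil s x0 f).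
Proof. by move=> sf; rewrite dilE; exact: smooth_affine. Qed.

Lemma partial_dil s x0 i f : smooth f -> partial i (dil s x0 f) = fun x => s^-1 * dil s x0 (partial i f) x.
Proof.
move=> sf; rewrite dilE partial_affine; last by move=> x; exact: smooth_diff.
by apply/funext => x; rewrite dilE.
Qed.

Lemma lap_dil s x0 f : smooth f -> lap (dil s x0 f) = fun x => s ^- 2 * dil s x0 (lap f) x.
Proof.
move=> sf; apply/funext => x; rewrite /lap /dil mulr_sumr; apply: eq_bigr => a _.
rewrite (partial_dil _ _ _ sf) partialZ; last first.
  by move=> y; apply: smooth_diff; apply: smooth_dil; exact: smooth_partial.
by rewrite partial_dil ?mulrA -?invfM -?expr2//; exact: smooth_partial.
Qed.

Lemma dil_supp s x0 f : 0 < s -> suppin (cball 0 1) f -> suppin (cball x0 s) (dil s x0 f).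
Proof.
move=> s0 f0 x hx; apply: f0; apply: contra_not hx; rewrite /cball /= subr0 l2normZ gtr0_norm ?invr_gt0//.
by rewrite mulrC ler_pdivrMr// mul1r.
Qed.

Lemma itg_dil s x0 f : 0 < s -> itg f -> itg (dil s x0 f).
Proof. by move=> s0 hf; rewrite dilE; apply: itg_affine => //; rewrite invr_gt0. Qed.

Lemma RI_dil s x0 f : 0 < s -> itg f -> RI (dil s x0 f) = s ^+ n * RI f.
Proof.
by move=> s0 hf; rewrite dilE RI_affine ?invr_gt0// exprVn invrK.
Qed.

(** The Euler operator x.D, which is what differentiation in the dilation parameter produces. *)
Definition eul f : E -> R := fun x => \sum_i x ord0 i * partial i f x.

Lemma smooth_eul f : smooth f -> smooth (eul f).
Proof.
move=> sf; apply: smooth_sum => i; apply: smoothM; first exact: smooth_coord.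
exact: smooth_partial.
Qed.

Lemma eul_supp K f : closed K -> suppin K f -> suppin K (eul f).
Proof.
move=> cK f0 x hx; rewrite /eul big1// => i _.
by rewrite (partial_supp i cK f0 hx) mulr0.
Qed.

Lemma is_derive_dil f (x0 x : E) (s : R) : smooth f -> 0 < s ->
  is_derive s 1 (fun s => dil s x0 f x) (- (s^-1 * dil s x0 (eul f) x)).
Proof.
move=> sf s0; set y := x - x0.
have d1 : is_derive s 1 (fun s : R => s^-1) (- s ^- 2).
  have := @is_deriveV _ id s 1 1 (lt0r_neq0 s0) (is_derive_id _ _).
  by rewrite [_ *: 1]mulr1.
have d2 : is_derive s^-1 1 (fun t : R => f (0 + t *: y)) ('D_y f (0 + s^-1 *: y)).
  by apply: line_derive; exact: smooth_diff.
have := @is_derive1_comp R (fun t : R => f (0 + t *: y)) (fun s : R => s^-1) s _ _ d2 d1.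
have -> : (fun t => f (0 + t *: y)) \o (fun s => s^-1) = fun s => dil s x0 f x.
  by apply/funext => t; rewrite /= add0r.
rewrite add0r derive_partials; last exact: smooth_diff.
move=> h; apply: (is_derive_eq h).
rewrite mulrN [_ * s ^- 2]mulrC /dil /eul !mulr_sumr; congr (- _); apply: eq_bigr => i _.
by rewrite -/y !mxE; field; rewrite lt0r_neq0.
Qed.

Lemma dil_itg K f v s x0 : 0 < s -> smooth f -> compact K -> suppin K f -> itg v ->
  itg (fun x => dil s x0 f x * v x).
Proof.
move=> s0 sf cK f0 iv; have [C C0 hC] := supp_bounded cK f0 (smooth_cont sf).
apply: (itg_bM _ (fun x => hC _) iv).
by apply: continuous_rV_measurable; apply: smooth_cont; exact: smooth_dil.
Qed.

Lemma is_derive_RI_dil K f v x0 (s : R) : smooth f -> compact K -> suppin K f -> itg v -> 0 < s ->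
  is_derive s 1 (fun s => RI (fun x => dil s x0 f x * v x))
    (- (s^-1 * RI (fun x => dil s x0 (eul f) x * v x))).
Proof.
move=> sf cK f0 iv s0; have clK := compact_closed (@norm_hausdorff _ _) cK.
have se := smooth_eul sf; have ef0 := eul_supp clK f0.
have [C C0 hC] := supp_bounded cK ef0 (smooth_cont se).
pose F s x := dil s x0 f x * v x.
have dF (t : R) x : 0 < t -> is_derive t 1 (F^~ x) (- (t^-1 * dil t x0 (eul f) x) * v x).
  move=> t0; have := is_deriveM (is_derive_dil x0 x sf t0) (is_derive_cst (v x) t 1).
  move=> h; apply: (is_derive_eq h).
  by rewrite /GRing.scale /= mulr0 add0r mulrC.
(* On this interval 1/t is at most 2/s, which gives a dominating function independent of t. *)
have Is : `](s / 2), (2 * s)[%classic s by rewrite /= in_itv /=; apply/andP; split; lra.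
have Ipos t : `](s / 2), (2 * s)[%classic t -> s / 2 < t by rewrite /= in_itv /= => /andP[].
have iF t : `](s / 2), (2 * s)[%classic t -> mu.-integrable setT (EFin \o F t).
  by move=> /Ipos t0; apply: (dil_itg (K := K)) => //; lra.
have dF1 t x : `](s / 2), (2 * s)[%classic t -> setT x -> derivable (F^~ x) t 1.
  move=> /Ipos t0 _; have t00 : 0 < t by lra.
  by case: (dF t x t00).
have iG : itg (fun x => (2 / s * C) * `|v x|) by apply: itgZ; exact: itg_abs.
have G0 x : 0 <= (2 / s * C) * `|v x| by rewrite !mulr_ge0// invr_ge0 ltW.
have e1 t x : s / 2 < t -> derive1 (F^~ x) t = - (t^-1 * dil t x0 (eul f) x) * v x.
  by move=> t0; have [_ <-] := dF t x ltac:(lra); rewrite derive1E.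
have hG t x : `](s / 2), (2 * s)[%classic t -> setT x -> `|partial1of2 F t x| <= (2 / s * C) * `|v x|.
  move=> /Ipos t0 _; rewrite /partial1of2 e1// normrM normrN ler_wpM2r// normrM.
  have t00 : 0 < t by lra.
  apply: ler_pM => //; last exact: hC.
  by rewrite gtr0_norm ?invr_gt0// -[X in _ <= X]invf_div lef_pV2 ?posrE ?ltW// divr_gt0.
have dd := derivable_under_integral measurableT Is iF dF1 G0 iG hG.
have ee := differentiation_under_integral measurableT Is iF dF1 G0 iG hG.
split; first exact: dd.
rewrite -derive1E; apply: etrans ee _.
rewrite -RI_Z; last exact: dil_itg cK ef0 iv.
rewrite -RI_N; last by apply: itgZ; exact: dil_itg cK ef0 iv.
congr (fine _); apply: eq_integral => x _; congr (_%:E).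
by rewrite /partial1of2 e1; [ring|lra].
Qed.

(** Fixed by D [bump0] = - x [psi0]: the derivative of [em 0] is [em 2], and the factor 2 comes from
    the gradient of |x|^2. *)
Definition psi0 : E -> R := fun x => 2 * em 2 (1 - sq x).

Lemma psi0_ge0 x : 0 <= psi0 x.
Proof. by rewrite mulr_ge0// em_ge0. Qed.

Lemma smooth_psi0 : smooth psi0.
Proof.
apply: smoothZ; apply: smooth_em; apply: smoothB; [exact: smooth_cst|exact: smooth_sq].
Qed.

Lemma psi0_supp : suppin (cball 0 1) psi0.
Proof.
move=> x; rewrite /cball /= subr0 => /negP; rewrite -ltNge => x1.
rewrite /psi0 em_le0 ?mulr0// subr_le0 -l2norm_sqr -(expr1n _ 2%N) ler_sqr ?nnegrE ?l2norm_ge0//.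
exact: ltW.
Qed.

Lemma psi0_gt0 x : l2norm x < 1 -> 0 < psi0 x.
Proof.
by move=> x1; rewrite mulr_gt0// em_gt0// subr_gt0 -l2norm_sqr -(expr1n _ 2%N) ltr_sqr ?nnegrE ?l2norm_ge0.
Qed.

Lemma itg_psi0 : itg psi0.
Proof.
exact: cont_supp_itg (@compact_cball _ _ _ _) psi0_supp (smooth_cont smooth_psi0).
Qed.

Lemma RI_psi0 : 0 < RI psi0.
Proof.
rewrite lt_neqAle RI_ge0 ?andbT; last exact: psi0_ge0.
apply/eqP => h; have := RI_eq0 itg_psi0 psi0_ge0 (esym h) => -[N [mN N0 hN]].
have : (mu (l2ball 0 1 : set E) <= mu N)%E.
  apply: le_measure; rewrite ?inE//; first exact: measurable_l2ball.
  move=> x /= x1; apply: hN => /= e; have := @psi0_gt0 x; rewrite e ltxx.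
  by move: x1; rewrite /l2ball /= subr0 => x1 /(_ x1).
have o : (0 < mu (l2ball 0 1 : set E))%E.
  by apply: (@open_mu_gt0 _ _ _ 0); [exact: open_l2ball|rewrite /l2ball /= subr0 l2norm0].
by rewrite N0 => /(lt_le_trans o); rewrite ltxx.
Qed.

Lemma partial_bump0 i : partial i (bump0 : E -> R) = fun x => - (x ord0 i * psi0 x).
Proof.
rewrite /bump0 partial_comp; first last.
- move=> x; apply: smooth_diff; apply: smoothB; [exact: smooth_cst|exact: smooth_sq].
- by move=> x; case: (is_derive_em 0 (1 - sq x)).
apply/funext => x; rewrite derive1E; have [_ ->] := is_derive_em 0 (1 - sq x).
rewrite (@partialB _ _ i (fun=> 1)) ?partial_cst ?partial_sq /psi0 ?oppr0 ?mul0r.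
- ring.
- by move=> y; apply: smooth_diff; exact: smooth_cst.
- by move=> y; apply: smooth_diff; exact: smooth_sq.
Qed.

Lemma lap_bump0 : lap (bump0 : E -> R) = fun x => - (n%:R * psi0 x + eul psi0 x).
Proof.
apply/funext => x; rewrite /lap; transitivity (\sum_(a < n) (- (psi0 x + x ord0 a * partial a psi0 x))).
  apply: eq_bigr => a _; rewrite partial_bump0 partialN; last first.
    by move=> y; apply: differentiableM; [exact: coord_diff|apply: smooth_diff; exact: smooth_psi0].
  rewrite (@partialM _ _ a (fun y => y ord0 a) psi0) ?partial_coord ?eqxx ?mulr1 1?addrC//.
    by move=> y; exact: coord_diff.
  by move=> y; apply: smooth_diff; exact: smooth_psi0.
by rewrite sumrN big_split /= sumr_const card_ord mulr_natl.
Qed.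

(* [d/ds (s^-n psi0((x - x0)/s)) = s^(1-n) Delta (bump0((x - x0)/s))] *)
Lemma is_derive_mean v x0 (s : R) : itg v -> 0 < s ->
  is_derive s 1 (fun s => s ^- n * RI (fun x => dil s x0 psi0 x * v x))
    (s ^- n * (s * RI (fun x => v x * lap (dil s x0 bump0) x))).
Proof.
move=> iv s0; have cB := @compact_cball R n 0 1.
have d1 : is_derive s 1 (fun s : R => s^-1) (- s ^- 2).
  have := @is_deriveV _ id s 1 1 (lt0r_neq0 s0) (is_derive_id _ _).
  by rewrite [_ *: 1]mulr1.
have d2 := is_deriveX n d1.
have d3 := is_derive_RI_dil x0 smooth_psi0 cB psi0_supp iv s0.
have := is_deriveM d2 d3.
have -> : (fun s : R => s^-1) ^+ n * (fun s => RI (fun x => dil s x0 psi0 x * v x)) =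
   (fun s => s ^- n * RI (fun x => dil s x0 psi0 x * v x)).
  by apply/funext => t; rewrite !fctE exprVn.
have i1 := dil_itg x0 s0 smooth_psi0 cB psi0_supp iv.
have i2 := dil_itg x0 s0 (smooth_eul smooth_psi0) cB (eul_supp (@closed_cball _ _ _ _) psi0_supp) iv.
set I1 := RI (fun x => dil s x0 psi0 x * v x); set I2 := RI (fun x => dil s x0 (eul psi0) x * v x).
have -> : RI (fun x => v x * lap (dil s x0 bump0) x) = s ^- 2 * - (n%:R * I1 + I2).
  rewrite -!RI_Z// -RI_D//; last exact: itgZ.
  rewrite -RI_N; last by apply: itgD => //; exact: itgZ.
  rewrite -RI_Z; last by apply: itgN; apply: itgD => //; exact: itgZ.
  congr RI; apply/funext => x; rewrite lap_dil ?lap_bump0; last exact: smooth_bump0.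
  rewrite /dil; ring.
move=> h; apply: (is_derive_eq h).
rewrite /GRing.scale /= fctE -/I1 -/I2; case: (n) => [|k] /=; rewrite ?mulr0n ?exprVn ?exprS ?expr0.
  by field; rewrite lt0r_neq0.
field; rewrite ?expf_neq0 ?lt0r_neq0//.
Qed.

(** By hypothesis the psi-average plus K s is nondecreasing in s. Continuity of v at x0 identifies
    its limit at 0. *)
Lemma mean_value v x0 (s0 K : R) : 0 < s0 -> 0 <= K -> itg v -> {for x0, continuous v} ->
  (forall s : R, 0 < s -> s < s0 -> - (K * s ^+ n) <= s * RI (fun x => v x * lap (dil s x0 bump0) x)) ->
  forall s : R, 0 < s -> s < s0 ->
  RI psi0 * v x0 <= s ^- n * RI (fun x => dil s x0 psi0 x * v x) + K * s.
Proof.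
move=> s00 K0 iv cv hK s s_gt0 ss0.
pose A s := s ^- n * RI (fun x => dil s x0 psi0 x * v x) + K * s.
pose dA s := s ^- n * (s * RI (fun x => v x * lap (dil s x0 bump0) x)) + K.
have DA (t : R) : 0 < t -> is_derive t 1 A (dA t).
  move=> t0; have h1 := is_derive_mean x0 iv t0.
  have h2 : is_derive t 1 (fun t => K * t) K.
    have := is_deriveM (is_derive_cst K t 1) (is_derive_id t 1).
    by rewrite /GRing.scale /= mulr1 mulr0 addr0.
  exact: is_deriveD h1 h2.
have dA0 (t : R) : 0 < t -> t < s0 -> 0 <= dA t.
  move=> t0 ts; rewrite /dA -lerBlDr sub0r -(ler_pM2l (exprn_gt0 n t0)) mulVKf; last first.
    by rewrite expf_neq0// gt_eqF.
  by rewrite mulrN mulrC; exact: hK.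
have mono (t : R) : 0 < t -> t <= s -> A t <= A s.
  move=> t0 ts; rewrite -subr_ge0.
  have [||c + ->] := @MVT_segment R A dA t s ts.
  - by move=> y; rewrite in_itv /= => /andP[ty _]; apply: DA; lra.
  - apply: derivable_within_continuous => y; rewrite in_itv /= => /andP[ty _].
    by have [] := DA y ltac:(lra).
  by rewrite in_itv /= => /andP[tc cs]; rewrite mulr_ge0 ?subr_ge0// dA0//; lra.
rewrite -/(A s).
apply/ler_addgt0Pr => e e0; set c := RI psi0; have c0 : 0 < c by exact: RI_psi0.
have e1 : 0 < e / c by rewrite divr_gt0.
have /cvgrPdist_le/(_ _ e1) := cv; rewrite nearE => /nbhs_ballP[d /= d0 hd].
(* On the support of the kernel of scale t, v is at least v(x0) - e/c. *)
pose t := Num.min s (d / 2).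
have t0 : 0 < t by rewrite lt_min s_gt0 divr_gt0.
have ts : t <= s by rewrite ge_min lexx.
have td : t < d by apply: (@le_lt_trans _ _ (d / 2)); [rewrite ge_min lexx orbT|lra].
apply: (@le_trans _ _ (A t + e)); last by rewrite lerD2r; exact: mono.
rewrite /A -addrA [K * t + e]addrC addrA; apply: (@le_trans _ _ (t ^- n * RI (fun x => dil t x0 psi0 x * v x) + e)); last first.
  by rewrite lerDl mulr_ge0// ltW.
have cB := @compact_cball R n 0 1.
have i1 := dil_itg x0 t0 smooth_psi0 cB psi0_supp iv.
have i2 := itg_dil x0 t0 itg_psi0.
have : RI (fun x => (v x0 - e / c) * dil t x0 psi0 x) <= RI (fun x => dil t x0 psi0 x * v x).
  apply: RI_le => //; first exact: itgZ.
  move=> x; rewrite mulrC; have [hx|hx] := pselect (cball x0 t x); last first.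
    by rewrite (dil_supp t0 psi0_supp hx) !mul0r.
  rewrite ler_wpM2l//; first exact: psi0_ge0.
  have /hd : ball x0 d x.
    rewrite -ball_normE /= -normrN opprB; apply: le_lt_trans (norm_le_l2 _) _.
    exact: le_lt_trans hx td.
  by rewrite /= ler_norml => /andP[h1 h2]; lra.
rewrite RI_Z// RI_dil//; last exact: itg_psi0.
rewrite -/c => h; rewrite -lerBlDr -(ler_pM2l (exprn_gt0 n t0)) mulVKf; last first.
  by rewrite expf_neq0// gt_eqF.
apply: le_trans h; have -> : (v x0 - e / c) * (t ^+ n * c) = t ^+ n * (c * v x0 - e).
  by field; rewrite lt0r_neq0.
by [].
Qed.

End mean_value.

(** * Rescaled minimizers *)

Section zooming.
Context {R : realType} {n N : nat}.
Local Notation E := 'rV[R]_n.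
Local Notation mu := (@lebesgue_rV R n).
Local Notation RI := (RI mu).
Local Notation itg := (itg mu).
Local Notation sqi := (sqi mu).

(** Truncated at radius s because [is_min] asks a minimizer to vanish outside its ball. *)
Definition zoomU (x0 : E) (r s : R) (U : E -> 'rV[R]_N) : E -> 'rV[R]_N :=
  fun x => \1_(l2ball 0 s) x *: (r^-1 *: U (r *: x + x0)).

(** There is no factor 1/r: the gradient of U(rx + x0)/r is DU(rx + x0). *)
Definition zoomG (x0 : E) (r s : R) (G : 'I_N -> 'I_n -> E -> R) : 'I_N -> 'I_n -> E -> R :=
  fun i a x => \1_(l2ball 0 s) x * G i a (r *: x + x0).

Lemma zoomU_in x0 r s U x : l2ball 0 s x -> zoomU x0 r s U x = r^-1 *: U (r *: x + x0).
Proof. by move=> h; rewrite /zoomU indicE mem_set// scale1r. Qed.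

Lemma zoomU_out x0 r s U x : ~ l2ball 0 s x -> zoomU x0 r s U x = 0.
Proof. by move=> h; rewrite /zoomU indicE memNset// scale0r. Qed.

Lemma dil_affine r x0 (f : E -> R) x : 0 < r -> dil r x0 f (r *: x + x0) = f x.
Proof. by move=> r0; rewrite /dil addrK scalerA mulVf ?gt_eqF// scale1r. Qed.

Lemma affine_ball (x0 : E) (r s rho : R) x : 0 < r -> l2norm x0 + r * s <= rho ->
  l2ball 0 s x -> l2ball 0 rho (r *: x + x0).
Proof.
rewrite /l2ball /= !subr0 => r0 hr xs; apply: (le_lt_trans (l2normD _ _)).
rewrite l2normZ gtr0_norm// addrC; apply: lt_le_trans hr.
by rewrite ltrD2l ltr_pM2l.
Qed.

Lemma suppin_dil_ball (x0 : E) (r s : R) (f : E -> R) : 0 < r -> suppin (cball 0 s) f ->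
  suppin (cball 0 (l2norm x0 + r * s)) (dil r x0 f).
Proof.
move=> r0 f0 x hx; rewrite /dil f0//; apply: contra_not hx; rewrite /cball /= !subr0 => h.
rewrite -[x](subrK x0) addrC; apply: (le_trans (l2normD _ _)); rewrite lerD2l.
rewrite -(ler_pM2l (_ : 0 < r^-1)) ?invr_gt0// mulrA mulVf ?gt_eqF// mul1r.
by move: h; rewrite l2normZ gtr0_norm ?invr_gt0.
Qed.

Lemma sqi_dil r x0 f : 0 < r -> sqi f -> sqi (dil r x0 f).
Proof. by move=> r0 sf; rewrite dilE; apply: sqi_affine => //; rewrite invr_gt0. Qed.

(* Testing against phi is testing the undilated function against the
   inversely dilated phi. *)
Lemma Hc_dil (x0 : E) (r s rho : R) w (h : 'I_n -> E -> R) : 0 < r -> l2norm x0 + r * s <= rho ->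
  Hc 0 s w h -> Hc 0 rho (fun x => r * dil r x0 w x) (fun a => dil r x0 (h a)).
Proof.
move=> r0 hr [sw sh [s' [ss w0 h0]] hw]; split.
- by apply: sqiZ; exact: sqi_dil.
- by move=> a; exact: sqi_dil.
- exists (l2norm x0 + r * s'); split.
  + by apply: lt_le_trans hr; rewrite ltrD2l ltr_pM2l.
  + by move=> x hx; rewrite (suppin_dil_ball r0 w0) ?mulr0.
  + by move=> a; exact: suppin_dil_ball.
- move=> a phi tp; pose p := fun x => phi (r *: x + x0).
  have [sp cp _] := tp; have [K [cK _ pK]] := test_compact tp.
  have sp' : smooth p by exact: smooth_affine.
  have [M M0 KM] := compact_bounded_rV cK.
  have tp' : test_function setT p.
    apply: (@test_fun_intro _ _ _ (cball 0 (r^-1 * (l2norm x0 + (n%:R + 1) * M)))) => //; first exact: compact_cball.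
    move=> x hx; apply: pK; apply: contra_not hx => /KM kx; rewrite /cball /= subr0.
    rewrite -(ler_pM2l r0) mulrA mulfV ?gt_eqF// mul1r.
    have -> : r * l2norm x = l2norm ((r *: x + x0) - x0) by rewrite addrK l2normZ gtr0_norm.
    rewrite (le_trans (l2normD _ _))// l2normN addrC lerD2l.
    by apply: (le_trans (l2_le_norm _)); rewrite ler_wpM2l.
  have := hw a _ tp'.
  have s1 := test_sqi tp; have s2 := test_sqi (test_partial a tp).
  have i1 : itg (fun x => dil r x0 w x * partial a phi x).
    by apply: sqi_mul => //; exact: sqi_dil.
  have i2 : itg (fun x => dil r x0 (h a) x * phi x).
    by apply: sqi_mul => //; exact: sqi_dil.
  have e1 := RI_affine x0 r0 i1; have e2 := RI_affine x0 r0 i2.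
  have -> : (fun x => r * dil r x0 w x * partial a phi x) = (fun x => r * (dil r x0 w x * partial a phi x)).
    by apply/funext => x; rewrite mulrA.
  rewrite RI_Z// /p partial_affine; last by move=> x; exact: smooth_diff.
  have -> : (fun x => w x * (r * partial a phi (r *: x + x0))) =
    (fun x => r * (dil r x0 w (r *: x + x0) * partial a phi (r *: x + x0))).
    by apply/funext => x; rewrite dil_affine//; ring.
  rewrite RI_Z; last exact: itg_affine i1.
  rewrite e1; have -> : (fun x => h a x * phi (r *: x + x0)) =
    (fun x => dil r x0 (h a) (r *: x + x0) * phi (r *: x + x0)).
    by apply/funext => x; rewrite dil_affine.
  rewrite e2 mulrCA -mulrN => /(mulfI _); apply.
  by rewrite invr_eq0 expf_neq0// gt_eqF.
Qed.

Variables (rho : R) (U : E -> 'rV[R]_N) (G : 'I_N -> 'I_n -> E -> R).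
Hypothesis (H : is_min rho U G).

(** A perturbation w of the zoomed function is the perturbation r w((x - x0)/r) of U. Gradients are
    transported unchanged and [W] ignores positive factors, so energies only change by the factor
    r^n of the volume. *)
Lemma is_min_zoom (x0 : E) (r s : R) : 0 < r -> l2norm x0 + r * s <= rho ->
  is_min s (zoomU x0 r s U) (zoomG x0 r s G).
Proof.
move=> r0 hr; set B := l2ball (0 : E) s; have mB : measurable B by exact: measurable_l2ball.
have mI : measurable_fun setT (\1_B : E -> R) by exact: measurable_indic.
have I1 (x : E) : `|\1_B x : R| <= 1 by rewrite indicE; case: (_ \in _); rewrite ?normr1 ?normr0.
have sU i : sqi (fun x => zoomU x0 r s U x ord0 i).
  have := sqi_bM mI I1 (sqiZ r^-1 (sqi_affine x0 r0 (im_u H i))).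
  by congr sqi; apply/funext => x; rewrite !mxE.
have sG i a : sqi (zoomG x0 r s G i a).
  exact: sqi_bM mI I1 (sqi_affine x0 r0 (im_g H i a)).
split.
- exact: sU.
- exact: sG.
- by move=> x; exact: zoomU_out.
- by move=> i a x hx; rewrite /zoomG indicE memNset// mul0r.
- move=> i a phi tp; have [s' ss p0] := test_ball_supp tp; have [sp _ _] := tp.
  have tp' : test_function (l2ball 0 rho) (dil r x0 phi).
    apply: (test_ball_intro (r' := l2norm x0 + r * s')).
    - by apply: lt_le_trans hr; rewrite ltrD2l ltr_pM2l.
    - exact: smooth_dil.
    - exact: suppin_dil_ball.
  have hw := im_w H i a tp'.
  have i1 := sqi_mul (im_u H i) (test_sqi (test_partial a tp')).
  have i2 := sqi_mul (im_g H i a) (test_sqi tp').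
  have e1 := RI_affine x0 r0 i1; have e2 := RI_affine x0 r0 i2.
  have pB x : ~ B x -> phi x = 0.
    by move=> hx; apply: p0; apply: contra_not hx; exact: cball_l2ball.
  have pB' x : ~ B x -> partial a phi x = 0.
    move=> hx; have := partial_supp a (@closed_cball _ _ _ _) p0; apply.
    by apply: contra_not hx; exact: cball_l2ball.
  have -> : (fun x => zoomU x0 r s U x ord0 i * partial a phi x) =
      (fun x => U (r *: x + x0) ord0 i * partial a (dil r x0 phi) (r *: x + x0)).
    apply/funext => x; rewrite partial_dil// dil_affine//.
    have [hx|hx] := pselect (B x); last by rewrite pB'// !mulr0.
    by rewrite zoomU_in// mxE mulrCA mulrA.
  rewrite e1 hw mulrN -e2; congr (- _); congr RI; apply/funext => x; rewrite dil_affine//.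
  have [hx|hx] := pselect (B x); last by rewrite pB// !mulr0.
  by rewrite /zoomG indicE mem_set// mul1r.
- have ri : 0 <= r^-1 by rewrite invr_ge0 ltW.
  apply: filterS (ae_affine x0 r0 (im_ord H)) => x ox.
  by do 2 (apply: ordered_scale => //); rewrite indicE; case: (_ \in _).
- move=> x xB; have c1 := im_cont H (affine_ball r0 hr xB).
  have c2 : {for x, continuous (fun y : E => r^-1 *: U (r *: y + x0))}.
    apply: continuousZr; apply: (@continuous_comp _ _ _ (fun y : E => r *: y + x0) U) => //.
    by apply: continuousD; [apply: continuousZr; exact: cvg_id|exact: cst_continuous].
  have e : \forall y \near x, r^-1 *: U (r *: y + x0) = zoomU x0 r s U y.
    have : nbhs x B by apply: open_nbhs_nbhs; split => //; exact: open_l2ball.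
    by apply: filterS => y yB; rewrite zoomU_in.
  move=> A; rewrite [nbhs _ _]/= zoomU_in// => hA.
  have h3 := c2 _ hA.
  apply: (filterS2 _ _ e h3) => y /= ey; rewrite /preimage /mkset ey.
  exact.
- move=> w h Hw ow; pose w' i x := r * dil r x0 (w i) x; pose h' i a := dil r x0 (h i a).
  have Hw' i : Hc 0 rho (w' i) (h' i) by exact: Hc_dil r0 hr (Hw i).
  have wB i x : ~ B x -> w i x = 0 /\ forall a, h i a x = 0.
    have [_ _ [s' [ss w0 h0]] _] := Hw i; move=> hx.
    have hx' : ~ cball 0 s' x by move=> k; apply: hx; exact: (cball_l2ball ss).
    by rewrite w0//; split => // a; rewrite h0.
  have eV x : B x -> U (r *: x + x0) + \row_i w' i (r *: x + x0) = r *: (zoomU x0 r s U x + \row_i w i x).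
    move=> xB; rewrite zoomU_in//; apply/rowP => i; rewrite !mxE /w' dil_affine//.
    by rewrite mulrDr mulrA mulfV ?gt_eqF// mul1r.
  have ow' : {ae mu, forall x, ordered (U x + \row_i w' i x)}.
    have ri : 0 < r^-1 by rewrite invr_gt0.
    apply: filterS2 (im_ord H) (ae_affine (- (r^-1 *: x0)) ri ow) => y oU o2.
    set x := _ - _ in o2; have ey : y = r *: x + x0.
      by rewrite scalerBr !scalerA mulfV ?gt_eqF// !scale1r subrK.
    have [xB|xB] := pselect (B x); first by rewrite ey eV//; apply: ordered_scale => //; exact: ltW.
    suff -> : \row_i w' i y = 0 by rewrite addr0.
    by apply/rowP => i; rewrite !mxE {1}ey /w' dil_affine// (proj1 (wB i _ xB)) mulr0.
  have := im_min H Hw' ow'.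
  set e1 := en U G; set e2 := en _ _ => h12.
  have mU i : measurable_fun setT (fun x => U x ord0 i) by case: (im_u H i).
  have i1 : itg e1 by exact: itg_en mU (im_u0 H) (im_g H).
  have i2 : itg e2.
    apply: (@itg_en _ _ _ 0 rho).
    - move=> i; under eq_fun do rewrite !mxE; apply: measurable_funD => //.
      by case: (Hw' i) => -[].
    - move=> x hx; rewrite (im_u0 H)// add0r; apply/rowP => i; rewrite !mxE.
      have [_ _ [s' [ss w0 h0]] _] := Hw' i; apply: w0 => k; apply: hx.
      exact: (cball_l2ball ss).
    - by move=> i a; apply: sqiD; [exact: im_g H i a|case: (Hw' i)].
  have j1 := itg_affine x0 r0 i1; have j2 := itg_affine x0 r0 i2.
  have : RI (fun x => e1 (r *: x + x0)) <= RI (fun x => e2 (r *: x + x0)).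
    by rewrite !RI_affine// ler_wpM2l// invr_ge0 exprn_ge0// ltW.
  have k1 := itg_bM mI I1 j1; have k2 := itg_bM mI I1 j2.
  have b1 : en (zoomU x0 r s U) (zoomG x0 r s G) = fun x => \1_B x * e1 (r *: x + x0).
    apply/funext => x; rewrite /e1 /en indicE; have [xB|xB] := pselect (B x).
      rewrite mem_set// mul1r zoomU_in// W_scale ?invr_gt0//; congr (_ + _).
      by apply: eq_bigr => i _; apply: eq_bigr => a _; rewrite /zoomG indicE mem_set// mul1r.
    rewrite memNset// mul0r zoomU_out// W0 addr0 big1// => i _; rewrite big1// => a _.
    by rewrite /zoomG indicE memNset// mul0r expr0n.
  have b2 : en (fun x => zoomU x0 r s U x + \row_i w i x) (fun i a x => zoomG x0 r s G i a x + h i a x) =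
      fun x => \1_B x * e2 (r *: x + x0).
    apply/funext => x; rewrite /e2 /en indicE; have [xB|xB] := pselect (B x).
      rewrite mem_set// mul1r eV// W_scale//; congr (_ + _).
      by apply: eq_bigr => i _; apply: eq_bigr => a _; rewrite /zoomG indicE mem_set// mul1r /h' dil_affine.
    rewrite memNset// mul0r zoomU_out// add0r (_ : \row_i w i x = 0) ?W0 ?addr0; last first.
      by apply/rowP => i; rewrite !mxE (proj1 (wB i x xB)).
    rewrite big1// => i _; rewrite big1// => a _.
    by rewrite /zoomG indicE memNset// mul0r (proj2 (wB i x xB)) addr0 expr0n.
  rewrite b1 b2.
  (* Outside the ball both densities agree, so the inequality over the whole space is one over the
     ball. *)
  have -> : (fun x => e2 (r *: x + x0)) = (fun x => e1 (r *: x + x0) + (\1_B x * e2 (r *: x + x0) - \1_B x * e1 (r *: x + x0))).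
    apply/funext => x; rewrite indicE; have [xB|xB] := pselect (B x); first by rewrite mem_set// !mul1r [RHS]addrC subrK.
    rewrite memNset// !mul0r subr0 addr0 /e1 /e2 /en.
    have -> : \row_i w' i (r *: x + x0) = 0.
      by apply/rowP => i; rewrite !mxE /w' dil_affine// (proj1 (wB i x xB)) mulr0.
    rewrite addr0; congr (_ + _).
    apply: eq_bigr => i _; apply: eq_bigr => a _.
    by rewrite /h' dil_affine// (proj2 (wB i x xB)) addr0.
  by rewrite (RI_D j1 (itgB k2 k1)) (RI_B k2 k1) lerDl subr_ge0.
Qed.

End zooming.

(** * Growth and nondegeneracy *)

Section estimates.
Context {R : realType} {n N : nat}.
Local Notation E := 'rV[R]_n.
Local Notation mu := (@lebesgue_rV R n).
Local Notation RI := (RI mu).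
Local Notation itg := (itg mu).
Local Notation sqi := (sqi mu).

Definition ball_vol : R := RI (\1_(cball (0 : E) 1)).
Definition bump_energy : R := \sum_a RI (fun x => partial a (bump0 : E -> R) x ^+ 2).

Lemma ball_vol_ge0 : 0 <= ball_vol.
Proof. by apply: RI_ge0 => x; rewrite indicE. Qed.

Lemma bump_energy_ge0 : 0 <= bump_energy.
Proof. by apply: sumr_ge0 => a _; exact: RI_sqr_ge0. Qed.

Lemma RI_cball (x0 : E) s : 0 < s -> RI (\1_(cball x0 s)) = s ^+ n * ball_vol.
Proof.
move=> s0; rewrite /ball_vol -(RI_dil x0 s0); last first.
  by apply: itg_indic; [exact: measurable_cball|exact: mu_cball_lty].
congr RI; apply/funext => x; rewrite /dil !indicE; congr (_%:R); apply: congr1.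
apply/idP/idP => /set_mem h; apply/mem_set; move: h; rewrite /cball /= subr0 l2normZ gtr0_norm ?invr_gt0//.
  by rewrite mulrC ler_pdivrMr// mul1r.
by rewrite mulrC ler_pdivrMr// mul1r.
Qed.

Lemma psi0_bounded : exists2 C : R, 0 < C & forall x : E, psi0 x <= C.
Proof.
have [C C0 hC] := supp_bounded (@compact_cball R n 0 1) psi0_supp (smooth_cont smooth_psi0).
exists (C + 1) => [|x]; first by rewrite ltr_wpDl.
by have := hC x; rewrite ger0_norm ?psi0_ge0//; lra.
Qed.

Lemma l2norm_cont_at (U : E -> 'rV[R]_N) x : {for x, continuous U} ->
  {for x, continuous (fun y => l2norm (U y))}.
Proof. by move=> cU; apply: (continuous_comp cU); exact: cont_l2norm. Qed.

Lemma coord_cont_at (U : E -> 'rV[R]_N) x k : {for x, continuous U} ->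
  {for x, continuous (fun y => U y ord0 k)}.
Proof.
move=> cU; apply: (@continuous_comp _ _ _ U (fun v : 'rV[R]_N => v ord0 k)) => //.
exact: coord_continuous.
Qed.

Lemma itg_psi0M (v : E -> R) s x0 : 0 < s -> itg v -> itg (fun x => dil s x0 psi0 x * v x).
Proof.
by move=> s0; apply: dil_itg s0 smooth_psi0 (@compact_cball R n 0 1) psi0_supp.
Qed.

Lemma psi0_lower : exists2 m : R, 0 < m & forall x : E, l2norm x <= 1 / 2 -> m <= psi0 x.
Proof.
(* For |x| <= 1/2 the number 1 / (1 - |x|^2) lies between 1 and 2. *)
exists (expR (- 2)) => [|x hx]; first exact: expR_gt0.
have q1 : sq x <= 1 / 4.
  move: hx; rewrite l2norm_le ?divr_ge0// => hx; apply: (le_trans hx).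
  by rewrite le_eqVlt; apply/orP; left; apply/eqP; field.
have q0 := sq_ge0 x; rewrite /psi0 /em; set t := 1 - sq x.
have t0 : 0 < t by rewrite /t; lra.
rewrite t0; have ti : 1 <= t^-1 by rewrite invf_ge1//; rewrite /t; lra.
have t2 : t^-1 <= 2.
  by rewrite -[leRHS]invrK lef_pV2 ?posrE//; rewrite /t; lra.
have ee : expR (- 2) <= expR (- t^-1) by rewrite ler_expR; lra.
have e0 : 0 <= expR (- 2 : R) by exact: expR_ge0.
have tt : 1 <= t^-1 ^+ 2 by rewrite -(expr1n _ 2%N) ler_sqr ?nnegrE//; lra.
nra.
Qed.

Lemma sq_cont_at (U : E -> 'rV[R]_N) x : {for x, continuous U} ->
  {for x, continuous (fun y => sq (U y))}.
Proof. by move=> cU; apply: (continuous_comp cU); exact: cont_sq. Qed.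

Variables (rho : R) (U : E -> 'rV[R]_N) (G : 'I_N -> 'I_n -> E -> R).
Hypothesis (rho0 : 0 < rho) (H : is_min rho U G).
Local Notation u i := (fun x => U x ord0 i).

Lemma bump_ball x0 s : 0 < s -> l2norm x0 + s < rho ->
  suppin (cball (0 : E) (l2norm x0 + s)) (dil s x0 bump0).
Proof. by move=> s0 _; rewrite -[X in _ + X]mulr1; apply: suppin_dil_ball => //; exact: bump0_supp. Qed.

Lemma D2_ge0 (phi : E -> R) : (forall x, 0 <= phi x) -> 0 <= D2 G phi.
Proof.
move=> p0; apply: sumr_ge0 => i _; apply: sumr_ge0 => a _; apply: RI_ge0 => x.
by rewrite mulr_ge0// sqr_ge0.
Qed.

Lemma itg_u i : itg (u i).
Proof.
apply: (sqi_supp_itg (@compact_cball R n 0 rho) _ (im_u H i)) => x hx.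
by rewrite (im_u0 H) ?mxE// => h; apply: hx; exact: l2ball_cball.
Qed.

Lemma itg_sqU : itg (fun x => sq (U x)).
Proof. by apply: itg_sum => i; case: (im_u H i). Qed.

Lemma meas_l2U : measurable_fun setT (fun x => l2norm (U x)).
Proof.
rewrite (_ : (fun x => _) = Num.sqrt \o (fun x => sq (U x)))//.
by apply: measurableT_comp; [apply: continuous_measurable_fun; exact: sqrt_continuous|exact: itg_meas itg_sqU].
Qed.

Lemma itg_l2U : itg (fun x => l2norm (U x)).
Proof.
apply: (@itg_le _ _ _ _ (fun x => \1_(cball 0 rho) x + sq (U x))).
- exact: meas_l2U.
- move=> x; rewrite ger0_norm ?l2norm_ge0// indicE.
  have [h|h] := pselect (cball 0 rho x).
    rewrite mem_set// -l2norm_sqr (_ : true%:R = 1)//; have := sqr_ge0 (l2norm (U x) - 1).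
    have := l2norm_ge0 (U x); set q := l2norm _ => q0 q1; nra.
  rewrite (im_u0 H) ?l2norm0 ?sq0 ?addr0// => k; apply: h; exact: l2ball_cball.
- apply: itgD itg_sqU.
  by apply: itg_indic; [exact: measurable_cball|exact: mu_cball_lty].
Qed.

Lemma in_ball0 (x : E) : l2norm x < rho -> l2ball 0 rho x.
Proof. by rewrite /l2ball /= subr0. Qed.

(** [mean_value] with K = 0, as the Laplacian of |U|^2 is nonnegative by [subharmonic]. *)
Lemma sup_bound x0 s : 0 < s -> l2norm x0 + s < rho ->
  RI psi0 * sq (U x0) <= s ^- n * RI (fun x => dil s x0 psi0 x * sq (U x)).
Proof.
move=> s0 hs; have xr : 0 <= l2norm x0 by exact: l2norm_ge0.
have := @mean_value _ _ (fun x => sq (U x)) x0 (rho - l2norm x0) 0 _ _ itg_sqU _ _ s s0 _.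
rewrite mul0r addr0; apply => //; try lra.
  by apply: sq_cont_at; apply: (im_cont H); apply: in_ball0; lra.
move=> t t0 ht; rewrite mul0r oppr0 mulr_ge0 ?(ltW t0)//.
have ht' : l2norm x0 + t < rho by lra.
rewrite (subharmonic H (smooth_dil t x0 smooth_bump0) ht' (bump_ball t0 ht')).
by rewrite mulr_ge0// D2_ge0// => x; exact: bump0_ge0.
Qed.

(** By continuity a violation of the order would hold on an open set, which has positive measure. *)
Lemma ord_all x : l2ball 0 rho x -> ordered (U x).
Proof.
move=> xB i j ij; rewrite leNgt; apply/negP => lt.
have cx := im_cont H xB.
have cc k : {for x, continuous (fun y => U y ord0 k)}.
  exact: coord_cont_at.
have /nbhs_ballP[e /= e0 he] : nbhs x [set y | 0 < U y ord0 j - U y ord0 i].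
  have : {for x, continuous (fun y => U y ord0 j - U y ord0 i)} by apply: continuousB.
  move=> /(_ [set t | 0 < t]) c; apply: c; apply: open_nbhs_nbhs.
  by split; [exact: open_gt|rewrite /= subr_gt0].
have [A [mA A0 hA]] := im_ord H.
have : (mu (ball x e) <= mu A)%E.
  apply: le_measure; rewrite ?inE//; first by apply: open_rV_measurable; exact: ball_open.
  by move=> y /he /=; rewrite subr_gt0 => lty; apply: hA => /= /(_ i j ij); rewrite leNgt lty.
rewrite A0 => h; have := @open_mu_gt0 _ _ (ball x e) x (ball_open x e) (ballxx x e0).
by move=> /lt_le_trans /(_ h); rewrite ltxx.
Qed.

Lemma ordered_le (v : 'rV[R]_N) (i j : 'I_N) : ordered v -> (i <= j)%N -> v ord0 j <= v ord0 i.
Proof.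
move=> ov; have [k] := ubnP (j : nat); elim: k j => // k IH j jk ij.
have [->//|ne] := eqVneq i j; have lt : (i < j)%N by rewrite ltn_neqAle ij andbT.
case: j => -[|j] hj // in jk ij ne lt *.
have hj' : (j < N)%N by exact: ltnW.
apply: (@le_trans _ _ (v ord0 (Ordinal hj'))); first by apply: ov.
by apply: IH.
Qed.

(* Maximum of (r - |y|)^n |U(y)|: the mean value inequality for |U|^2 bounds the
   sup by the L^2 norm on a ball, and the weight turns L^2 into L^1. *)
Lemma sup_L1 Cs r : (0 < n)%N -> (forall x : E, psi0 x <= Cs) -> 0 < r -> r < rho -> forall y, l2norm y <= r ->
  RI psi0 * ((r - l2norm y) ^+ n * l2norm (U y)) <=
  4 ^+ n * Cs * RI (fun x => \1_(cball 0 r) x * l2norm (U x)).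
Proof.
move=> n0 hC r0 rr; set I1 := RI (fun x => \1_ _ x * _).
pose g (y : E) := (r - l2norm y) ^+ n * l2norm (U y).
have cg : {within cball 0 r, continuous g}.
  apply: continuous_in_subspaceT => y /set_mem; rewrite /cball /= subr0 => yr.
  apply: (@continuousM _ _ (fun y : E => (r - l2norm y) ^+ n) (fun y => l2norm (U y))); last first.
    by apply: l2norm_cont_at; apply: (im_cont H); apply: in_ball0; lra.
  apply: (@continuous_comp _ _ _ (fun y : E => r - l2norm y) (fun t : R => t ^+ n)).
    by apply: continuousB; [exact: cst_continuous|exact: cont_l2norm].
  exact: exprn_continuous.
have ne : (cball (0 : E) r) !=set0 by exists 0; rewrite /cball /= subr0 l2norm0 ltW.
have [y0 /set_mem y0B ymax] := compact_EVT_max ne (@compact_cball R n 0 r) cg.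
have I10 : 0 <= I1 by apply: RI_ge0 => x; rewrite mulr_ge0 ?l2norm_ge0// indicE.
have Cs0 : 0 <= Cs by apply: le_trans (hC 0); exact: psi0_ge0.
suff h0 : RI psi0 * g y0 <= 4 ^+ n * Cs * I1.
  move=> y yr; apply: le_trans h0; rewrite ler_wpM2l ?(ltW RI_psi0)//.
  by apply: ymax; apply/mem_set; rewrite /cball /= subr0.
move: y0B; rewrite /cball /= subr0 => y0B.
have g0 : 0 <= g y0 by rewrite mulr_ge0 ?l2norm_ge0// exprn_ge0// subr_ge0.
have [gz|gp] := leP (g y0) 0.
  have -> : g y0 = 0 by apply/le_anti; rewrite gz g0.
  by rewrite mulr0 !mulr_ge0// exprn_ge0.
have y0r : l2norm y0 < r.
  rewrite lt_neqAle y0B andbT; apply/eqP => e; move: gp.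
  by rewrite /g e subrr expr0n gtn_eqF//= mul0r ltxx.
set M := g y0 in g0 gp *.
(* On the ball of radius t about the maximum point the weight is at least t^n, so |U| <= M / t^n
   there; at the centre the weight is (2t)^n. *)
pose t := (r - l2norm y0) / 2.
have t0 : 0 < t by rewrite /t; lra.
have tn0 : 0 < t ^+ n by exact: exprn_gt0.
have tr : l2norm y0 + t < rho by rewrite /t; lra.
have := sup_bound t0 tr; rewrite -l2norm_sqr.
have -> : l2norm (U y0) = M / (2 ^+ n * t ^+ n).
  have -> : 2 ^+ n * t ^+ n = (r - l2norm y0) ^+ n by rewrite -exprMn /t; congr (_ ^+ _); lra.
  by rewrite /M /g mulrAC mulfV ?mul1r// expf_neq0// subr_eq0 gt_eqF.
have i1 : itg (fun x => \1_(cball 0 r) x * l2norm (U x)).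
  apply: (@itg_bM _ _ _ _ 1 _ _ _ _ itg_l2U); first by apply: measurable_indic; exact: measurable_cball.
  by move=> x; rewrite indicE; case: (_ \in _); rewrite ?normr1 ?normr0.
have : RI (fun x => dil t y0 psi0 x * sq (U x)) <= RI (fun x => (Cs * (M / t ^+ n)) * (\1_(cball 0 r) x * l2norm (U x))).
  apply: RI_le; [|exact: itgZ|].
    exact: itg_psi0M itg_sqU.
  move=> x; rewrite indicE; have [hx|hx] := pselect (cball y0 t x); last first.
    have MT : 0 <= M / t ^+ n by rewrite divr_ge0 // ltW.
    rewrite (dil_supp t0 psi0_supp hx) mul0r; apply: mulr_ge0; first exact: mulr_ge0.
    by rewrite mulr_ge0 ?l2norm_ge0//; case: (_ \in _).
  have xr : l2norm x <= r - t.
    rewrite -[x](subrK y0) (le_trans (l2normD _ _))//; move: hx; rewrite /cball /= /t; lra.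
  rewrite mem_set ?mul1r; last by rewrite /cball /= subr0; lra.
  rewrite -l2norm_sqr expr2 mulrA; apply: ler_wpM2r; first exact: l2norm_ge0.
  apply: ler_pM; rewrite ?psi0_ge0 ?l2norm_ge0//; first exact: hC.
  rewrite ler_pdivlMr// mulrC; apply: (@le_trans _ _ (g x)); last first.
    by apply: ymax; apply/mem_set; rewrite /cball /= subr0; lra.
  rewrite /g ler_wpM2r ?l2norm_ge0// ler_pXn2r ?nnegrE//; lra.
rewrite RI_Z// -/I1; set J1 := RI (fun x => dil _ _ _ _ * _); set c := RI psi0 => h1 h2.
have h3 : c * (M / (2 ^+ n * t ^+ n)) ^+ 2 <= t ^- n * (Cs * (M / t ^+ n) * I1).
  by apply: (le_trans h2); rewrite ler_wpM2l// invr_ge0 ltW.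
have e4 : 4 ^+ n = 2 ^+ n * 2 ^+ n :> R by rewrite -exprMn; congr (_ ^+ _); lra.
rewrite -(ler_pM2l gp) e4.
have p2 : 0 < 2 ^+ n :> R by exact: exprn_gt0.
set p := 2 ^+ n in h3 p2 *; set q := t ^+ n in h3 tn0 *.
have := ler_wpM2l (ltW (mulr_gt0 (mulr_gt0 p2 p2) (mulr_gt0 tn0 tn0))) h3.
have -> : p * p * (q * q) * (c * (M / (p * q)) ^+ 2) = M * (c * M) by field; rewrite !gt_eqF.
have -> : p * p * (q * q) * (q^-1 * (Cs * (M / q) * I1)) = M * (p * p * Cs * I1) by field; rewrite !gt_eqF.
by [].
Qed.

Lemma ibp_lap r' phi i : smooth phi -> r' < rho -> suppin (cball 0 r') phi ->
  RI (fun x => u i x * lap phi x) = - \sum_a RI (fun x => G i a x * partial a phi x).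
Proof.
move=> sp rr p0; rewrite -sumrN; have cl := @closed_cball R n 0 r'.
have tp a : test_function (l2ball 0 rho) (partial a phi).
  exact: test_ball_intro rr (smooth_partial a sp) (partial_supp a cl p0).
transitivity (\sum_a RI (fun x => u i x * partial a (partial a phi) x)).
  rewrite -RI_sum; last by move=> a; apply: sqi_mul (im_u H i) (test_sqi (test_partial a (tp a))).
  by congr RI; apply/funext => x; rewrite /lap mulr_sumr.
by apply: eq_bigr => a _; exact: (im_w H i a (tp a)).
Qed.

Definition osc_const : R := bump_energy + N%:R ^+ 2 * ball_vol.

(* min_lsup with w = s bump (e_1 - e_N). *)
Lemma osc_lap (i0 i1 : 'I_N) x0 s : i0 = 0%N :> nat -> i1.+1 = N -> (1 < N)%N ->
  0 < s -> l2norm x0 + s < rho ->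
  s * RI (fun x => (u i0 x - u i1 x) * lap (dil s x0 bump0) x) <= osc_const * s ^+ n.
Proof.
move=> e0 e1 N1 s0 hs; have sb := smooth_dil s x0 (@smooth_bump0 R n).
have b0 := bump_ball s0 hs.
pose e (i : 'I_N) : R := (i == i0)%:R - (i == i1)%:R.
have ne01 : i0 != i1.
  apply/eqP => h; move: N1; rewrite -e1 -h e0; by [].
pose w i x := e i * s * dil s x0 bump0 x.
pose h i a x := e i * s * partial a (dil s x0 bump0) x.
have Hw i : Hc 0 rho (w i) (h i) by apply: HcZ; exact: Hc_test hs b0.
have ow : {ae mu, forall x, ordered (\row_i w i x)}.
  apply: aeW => x i j ij; rewrite !mxE /w /e.
  have -> : (j == i0) = false by apply/eqP => k; move: ij; rewrite k e0.
  have -> : (i == i1) = false.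
    by apply/eqP => k; have := ltn_ord j; rewrite ij k e1 ltnn.
  rewrite !ler_wpM2r ?bump0_ge0 ?(ltW s0)//.
  by case: (j == i1); case: (i == i0); rewrite /=; lra.
have ws i : suppin (cball x0 s) (w i).
  by move=> x hx; rewrite /w (dil_supp s0 (@bump0_supp R n) hx) mulr0.
have := min_lsup H Hw ws ow.
have tp a : test_function (l2ball 0 rho) (partial a (dil s x0 bump0)).
  exact: test_ball_intro hs (smooth_partial a sb) (partial_supp a (@closed_cball _ _ _ _) b0).
have -> : Bf G h = - (s * RI (fun x => (u i0 x - u i1 x) * lap (dil s x0 bump0) x)).
  have il i : itg (fun x => u i x * lap (dil s x0 bump0) x).
    have -> : (fun x => u i x * lap (dil s x0 bump0) x) = (fun x => \sum_a u i x * partial a (partial a (dil s x0 bump0)) x).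
      by apply/funext => x; rewrite /lap mulr_sumr.
    by apply: itg_sum => a; apply: sqi_mul (im_u H i) (test_sqi (test_partial a (tp a))).
  have -> : (fun x => (u i0 x - u i1 x) * lap (dil s x0 bump0) x) =
    (fun x => u i0 x * lap (dil s x0 bump0) x - u i1 x * lap (dil s x0 bump0) x).
    by apply/funext => x; rewrite mulrBl.
  rewrite RI_B//; transitivity (\sum_i (e i * s) * (- RI (fun x => u i x * lap (dil s x0 bump0) x))).
    apply: eq_bigr => i _; rewrite (ibp_lap i sb hs b0) opprK mulr_sumr; apply: eq_bigr => a _.
    rewrite -RI_Z; last exact: sqi_mul (im_g H i a) (test_sqi (tp a)).
    by congr RI; apply/funext => x; rewrite /h; ring.
  rewrite (bigD1 i0)//= (bigD1 i1)//= 1?eq_sym// big1 ?addr0; last first.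
    by move=> i /andP[/negPf h1 /negPf h2]; rewrite /e h1 h2 subrr !mul0r.
  by rewrite /e !eqxx (negPf ne01) eq_sym (negPf ne01) /=; ring.
(* The factor 2 is the squared length of e_1 - e_N. *)
have -> : Qf h = 2 * (s ^+ n * bump_energy).
  have q a : RI (fun x => partial a (dil s x0 bump0) x ^+ 2) * s ^+ 2 = s ^+ n * RI (fun x => partial a (bump0 : E -> R) x ^+ 2).
    have i2 : itg (fun x => partial a (bump0 : E -> R) x ^+ 2).
      have l12 : 1 < 2 :> R by lra.
      by case: (test_sqi (test_partial a (test_ball_intro l12 (@smooth_bump0 R n) (@bump0_supp R n)))).
    rewrite -(RI_dil x0 s0 i2) mulrC -RI_Z; last by case: (test_sqi (tp a)).
    congr RI; apply/funext => x; rewrite partial_dil; last exact: smooth_bump0.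
    by rewrite /dil exprMn mulrA -exprMn mulfV ?expr1n ?mul1r// gt_eqF.
  transitivity (\sum_i (e i) ^+ 2 * (s ^+ n * bump_energy)).
    apply: eq_bigr => i _; rewrite /bump_energy !mulr_sumr; apply: eq_bigr => a _.
    rewrite -q [_ * s ^+ 2]mulrC mulrA -exprMn -RI_Z; last by case: (test_sqi (tp a)).
    by congr RI; apply/funext => x; rewrite /h; ring.
  rewrite (bigD1 i0)//= (bigD1 i1)//= 1?eq_sym// big1 ?addr0; last first.
    by move=> i /andP[/negPf h1 /negPf h2]; rewrite /e h1 h2 subrr expr0n mul0r.
  by rewrite /e !eqxx (negPf ne01) eq_sym (negPf ne01) /=; ring.
rewrite RI_cball// /osc_const; set I := RI _.
have := ball_vol_ge0; have : 0 <= s ^+ n by rewrite exprn_ge0// ltW.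
set X := ball_vol; set Y := s ^+ n; set Z := bump_energy; have := sqr_ge0 (N%:R : R); set M := N%:R ^+ 2.
move=> M0 Y0 X0; have : 0 <= M * (Y * X) by rewrite !mulr_ge0.
lra.
Qed.

(** [mean_value] for -(u_1 - u_N). It bounds an average by the value at the centre, in the direction
    opposite to [sup_bound]; the two together give growth. *)
Lemma osc_bound (i0 i1 : 'I_N) x0 s : i0 = 0%N :> nat -> i1.+1 = N -> (1 < N)%N ->
  0 < s -> l2norm x0 + s < rho ->
  s ^- n * RI (fun x => dil s x0 psi0 x * (u i0 x - u i1 x)) <=
  RI psi0 * (u i0 x0 - u i1 x0) + osc_const * s.
Proof.
move=> e0 e1 N1 s0 hs; have xr : 0 <= l2norm x0 by exact: l2norm_ge0.
have iv : itg (fun x => u i0 x - u i1 x) by apply: itgB; exact: itg_u.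
have ipv : itg (fun x => dil s x0 psi0 x * (u i0 x - u i1 x)).
  exact: itg_psi0M.
have K0 : 0 <= osc_const.
  by rewrite addr_ge0 ?bump_energy_ge0// mulr_ge0 ?sqr_ge0 ?ball_vol_ge0.
have p1 : 0 < rho - l2norm x0 by lra.
have p2 : s < rho - l2norm x0 by lra.
have xr0 : l2norm x0 < rho by lra.
have := @mean_value _ _ (fun x => - (u i0 x - u i1 x)) x0 _ osc_const p1 K0 (itgN iv) _ _ s s0 p2.
have -> : RI (fun x => dil s x0 psi0 x * - (u i0 x - u i1 x)) = - RI (fun x => dil s x0 psi0 x * (u i0 x - u i1 x)).
  by rewrite -RI_N//; congr RI; apply/funext => x; rewrite mulrN.
rewrite !mulrN => h.
suff : - (RI psi0 * (u i0 x0 - u i1 x0)) <= - (s ^- n * RI (fun x => dil s x0 psi0 x * (u i0 x - u i1 x))) + osc_const * s.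
  set A := RI psi0 * _; set B := s ^- n * _; lra.
apply: h.
  have cx := im_cont H (in_ball0 xr0).
  apply: continuousN; apply: (@continuousB _ _ _ (fun x => u i0 x) (fun x => u i1 x));
  exact: coord_cont_at.
move=> t t0 ht; have ht' : l2norm x0 + t < rho by lra.
have := osc_lap e0 e1 N1 t0 ht'.
have -> : (fun x => - (u i0 x - u i1 x) * lap (dil t x0 bump0) x) =
   (fun x => (-1) * ((u i0 x - u i1 x) * lap (dil t x0 bump0) x)) by apply/funext => x; ring.
rewrite RI_Z; first by set A := RI _; lra.
have sl : smooth (lap (dil t x0 (@bump0 R n))).
  apply: smooth_sum => a; do 2 apply: smooth_partial; apply: smooth_dil; exact: smooth_bump0.
have [C C0 hC] : exists2 C, 0 <= C & forall x, `|lap (dil t x0 bump0) x| <= C.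
  apply: (supp_bounded (@compact_cball R n x0 t)); last exact: smooth_cont.
  move=> x hx; rewrite /lap big1// => a _.
  have cl := @closed_cball R n x0 t.
  exact: partial_supp a cl (partial_supp a cl (dil_supp t0 (@bump0_supp R n))) x hx.
have := itg_bM (continuous_rV_measurable (smooth_cont sl)) hC iv.
by congr (itg _); apply/funext => x; rewrite mulrC.
Qed.

Hypothesis (n0 : (0 < n)%N) (N1 : (1 < N)%N) (sum0 : forall x, \sum_i U x ord0 i = 0).

(** Order and zero sum give u_N <= 0 <= u_1, so the oscillation u_1 - u_N bounds every component. *)
Lemma osc_coord x (i0 i1 i : 'I_N) : i0 = 0%N :> nat -> i1.+1 = N -> ordered (U x) ->
  `|U x ord0 i| <= U x ord0 i0 - U x ord0 i1.
Proof.
move=> e0 e1 ox; have le0 j : U x ord0 j <= U x ord0 i0 by apply: ordered_le => //; rewrite e0.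
have le1 j : U x ord0 i1 <= U x ord0 j by apply: ordered_le => //; rewrite -ltnS e1.
have s := sum0 x.
have p0 : 0 <= U x ord0 i0.
  rewrite leNgt; apply/negP => lt; have : \sum_i U x ord0 i < 0.
    rewrite (bigD1 i0)//= -[ltRHS]addr0 ltr_leD//; apply: sumr_le0 => j _.
    by rewrite (le_trans (le0 j))// ltW.
  by rewrite s ltxx.
have p1 : U x ord0 i1 <= 0.
  rewrite leNgt; apply/negP => lt; have : 0 < \sum_i U x ord0 i.
    rewrite (bigD1 i1)//= -[ltLHS]addr0 ltr_leD//; apply: sumr_ge0 => j _.
    by rewrite (le_trans _ (le1 j))// ltW.
  by rewrite s ltxx.
have h0 := le0 i; have h1 := le1 i.
by rewrite ler_norml; apply/andP; split; lra.
Qed.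

Lemma l2_osc x (i0 i1 : 'I_N) : i0 = 0%N :> nat -> i1.+1 = N -> ordered (U x) ->
  l2norm (U x) <= N%:R * (U x ord0 i0 - U x ord0 i1).
Proof.
move=> e0 e1 ox; have v0 := osc_coord i0 e0 e1 ox.
have vp : 0 <= U x ord0 i0 - U x ord0 i1 by exact: le_trans v0.
rewrite l2norm_le ?mulr_ge0// /sq; set v := _ - _ in vp *.
apply: (@le_trans _ _ (\sum_(i < N) v ^+ 2)).
  apply: ler_sum => i _; rewrite -real_normK ?num_real//.
  by rewrite ler_sqr ?nnegrE//; exact: osc_coord.
rewrite sumr_const card_ord -[leLHS]mulr_natl exprMn ler_wpM2r ?sqr_ge0//.
rewrite expr2 ler_peMl// ler1n; exact: ltnW.
Qed.

(** The value at x is bounded by the L^1 norm of U on the ball of radius 2|x|, this one by a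
    psi-average of u_1 - u_N about 0, and the average by a multiple of |x| since U vanishes at 0. *)
Lemma growth_aux Cs m : (forall x : E, psi0 x <= Cs) -> 0 < m ->
  (forall x : E, l2norm x <= 1 / 2 -> m <= psi0 x) -> U 0 = 0 -> forall x, 4 * l2norm x < rho ->
  RI psi0 * l2norm (U x) <= (4 ^+ n * Cs * N%:R * osc_const * 4 ^+ n * 4 / m) * l2norm x.
Proof.
move=> hC m0 hm U0 x hx; have x0 := l2norm_ge0 x.
have i0P : (0 < N)%N by exact: ltnW.
have i1P : (N.-1 < N)%N by rewrite prednK.
pose i0 := Ordinal i0P; pose i1 := Ordinal i1P.
have e1 : (i1 : nat).+1 = N by rewrite /= prednK.
have [xz|xp] := leP (l2norm x) 0.
  have x00 : l2norm x = 0 by apply/le_anti; rewrite xz x0.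
  have -> : x = 0.
    by apply/eqP; rewrite -normr_le0; apply: (le_trans (norm_le_l2 _)); rewrite x00.
  by rewrite U0 !l2norm0 !mulr0.
set X := l2norm x in hx x0 xp *.
have Cs0 : 0 <= Cs by apply: le_trans (hC 0); exact: psi0_ge0.
have r4 : l2norm (0 : E) + 4 * X < rho by rewrite l2norm0 add0r.
have X4 : 0 < 4 * X by lra.
(* The scale 4|x| makes the kernel at least m on the ball of radius 2|x|. *)
have := osc_bound (i0 := i0) erefl e1 N1 X4 r4.
rewrite U0 !mxE subrr mulr0 add0r => h1.
have := @sup_L1 Cs (2 * X) n0 hC ltac:(lra) ltac:(lra) x ltac:(rewrite -/X; lra).
have -> : 2 * X - l2norm x = X by rewrite -/X; lra.
set I1 := RI _ in h1; set I2 := RI (fun x => \1_ _ x * _) => h2.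
have i1' : itg (fun x => dil (4 * X) 0 psi0 x * (u i0 x - u i1 x)).
  by apply: itg_psi0M => //; apply: itgB; exact: itg_u.
have I21 : I2 <= (N%:R / m) * I1.
  rewrite -RI_Z//; apply: RI_le; [|exact: itgZ|].
    apply: (@itg_bM _ _ _ _ 1 _ _ _ _ itg_l2U); first by apply: measurable_indic; exact: measurable_cball.
    by move=> y; rewrite indicE; case: (_ \in _); rewrite ?normr1 ?normr0.
  move=> y; have oy : l2ball 0 rho y -> ordered (U y) by exact: ord_all.
  have oy' : ordered (U y).
    by have [/oy//|/(im_u0 H) ->] := pselect (l2ball 0 rho y); move=> i j _; rewrite !mxE.
  have lo := l2_osc (i0 := i0) erefl e1 oy'.
  have vp : 0 <= u i0 y - u i1 y.
    have ho := @osc_coord y i0 i1 i0 erefl e1 oy'; exact: le_trans (normr_ge0 _) ho.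
  have := @psi0_ge0 R n ((4 * X)^-1 *: (y - 0)); rewrite -/(dil (4 * X) 0 psi0 y) => dp.
  rewrite indicE; have [hy|hy] := pselect (cball 0 (2 * X) y); last first.
    by rewrite memNset// mul0r; apply: mulr_ge0; [rewrite divr_ge0// ltW|exact: mulr_ge0].
  rewrite mem_set// mul1r; apply: (le_trans lo).
  have hd : m <= dil (4 * X) 0 psi0 y.
    rewrite /dil subr0; apply: hm; rewrite l2normZ gtr0_norm ?invr_gt0//.
    rewrite mulrC ler_pdivrMr//; move: hy; rewrite /cball /= subr0; lra.
  rewrite -[X in _ <= X]mulrA ler_wpM2l// ler_pdivlMl//.
  by rewrite mulrC [X in _ <= X]mulrC ler_wpM2l.
have p1 : 0 < X ^+ n by exact: exprn_gt0.
have p4 : 0 < (4 * X) ^+ n by exact: exprn_gt0.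
have h3 : I1 <= osc_const * (4 * X) * (4 * X) ^+ n.
  by move: h1; rewrite mulrC ler_pdivrMr.
have h4 : X ^+ n * (RI psi0 * l2norm (U x)) <= 4 ^+ n * Cs * (N%:R / m * (osc_const * (4 * X) * (4 * X) ^+ n)).
  rewrite mulrCA; apply: (le_trans h2); apply: ler_wpM2l; first by rewrite mulr_ge0// exprn_ge0.
  apply: (le_trans I21); apply: ler_wpM2l => //.
  by rewrite divr_ge0// ltW.
rewrite -(ler_pM2l p1); apply: (le_trans h4); rewrite exprMn le_eqVlt; apply/orP; left; apply/eqP.
by field; rewrite gt_eqF.
Qed.

End estimates.

(** * A smooth cutoff *)

Section cutoff.
Context {R : realType} {n : nat}.
Local Notation E := 'rV[R]_n.

(** The quotient makes the function exactly 1 on the unit ball. It vanishes for |x|^2 >= 2, in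
    particular beyond 3/2. *)
Definition cut : E -> R := fun x => em 0 (2 - sq x) * (em 0 (2 - sq x) + em 0 (sq x - 1))^-1.

Lemma cut_den (x : E) : 0 < em 0 (2 - sq x) + em 0 (sq x - 1).
Proof.
have [h|h] := ltP (sq x) 2.
  by rewrite ltr_pwDl ?em_ge0// em_gt0// subr_gt0.
by rewrite ltr_wpDl ?em_ge0// em_gt0//; lra.
Qed.

Lemma smooth_cut : smooth cut.
Proof.
have s1 : smooth (fun x : E => em 0 (2 - sq x)).
  by apply: smooth_em; apply: smoothB; [exact: smooth_cst|exact: smooth_sq].
have s2 : smooth (fun x : E => em 0 (sq x - 1)).
  by apply: smooth_em; apply: smoothB; [exact: smooth_sq|exact: smooth_cst].
apply: smoothM => //; apply: smoothV; first exact: smoothD.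
by move=> x; rewrite gt_eqF// cut_den.
Qed.

Lemma cut01 x : 0 <= cut x <= 1.
Proof.
have d0 := cut_den x; rewrite /cut divr_ge0 ?em_ge0 ?(ltW d0)//= ler_pdivrMr// mul1r lerDl.
exact: em_ge0.
Qed.

Lemma cut1 x : l2norm x <= 1 -> cut x = 1.
Proof.
rewrite l2norm_le// expr1n => h; rewrite /cut [em 0 (sq x - 1)]em_le0 ?addr0; last by lra.
by rewrite mulfV// gt_eqF// em_gt0//; lra.
Qed.

Lemma cut_supp : suppin (cball 0 (3 / 2)) cut.
Proof.
move=> x; rewrite /cball /= subr0 => /negP; rewrite -ltNge => h.
rewrite /cut em_le0 ?mul0r//; rewrite -l2norm_sqr; set q := l2norm x in h *; nra.
Qed.

Lemma dil_cut1 (s : R) (x : E) : 0 < s -> l2norm x <= s -> dil s 0 cut x = 1.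
Proof.
move=> s0 xs; rewrite /dil subr0 cut1// l2normZ gtr0_norm ?invr_gt0// mulrC ler_pdivrMr//.
by rewrite mul1r.
Qed.

Lemma dil_cut_supp (s : R) : 0 < s -> suppin (cball (0 : E) (3 / 2 * s)) (dil s 0 cut).
Proof.
move=> s0; have := suppin_dil_ball (x0 := 0) s0 cut_supp.
by rewrite l2norm0 add0r mulrC.
Qed.

Lemma smooth_dcut (s : R) : smooth (dil s 0 cut).
Proof. by apply: smooth_dil; exact: smooth_cut. Qed.

End cutoff.

(** * Small minimizers vanish near the centre *)

Section nondegeneracy.
Context {R : realType} {n N : nat}.
Local Notation E := 'rV[R]_n.
Local Notation mu := (@lebesgue_rV R n).
Local Notation RI := (RI mu).
Local Notation itg := (itg mu).
Local Notation sqi := (sqi mu).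

(** An ordered vector without strict gap is constant, hence 0 when its sum is 0. *)
Lemma W_ge1 (v : 'rV[R]_N) : ordered v -> \sum_i v ord0 i = 0 -> v != 0 -> 1 <= W v.
Proof.
move=> ov s0 vn; have [[i [j [ij lt]]]|hn] := pselect (exists i j : 'I_N, j = i.+1 :> nat /\ v ord0 j < v ord0 i).
  rewrite /W (bigD1 i)//= (bigD1 j) ?ij ?eqxx//= lt -addrA lerDl addr_ge0//.
    by apply: sumr_ge0 => k _; exact: ler0n.
  by apply: sumr_ge0 => k _; apply: sumr_ge0 => l _; exact: ler0n.
exfalso; move/eqP: vn; apply; apply/rowP => i; rewrite mxE.
have onv : ordered (- v).
  move=> k j kj; rewrite !mxE lerN2 leNgt; apply/negP => lt; apply: hn.
  by exists k, j.
have eqv k j : v ord0 k = v ord0 j.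
  wlog kj : k j / (k <= j)%N.
    by move=> h; have /orP[/h//|/h ->//] := leq_total k j.
  apply/le_anti; rewrite (ordered_le ov kj) andbT.
  by have := ordered_le onv kj; rewrite !mxE lerN2.
have : \sum_j v ord0 j = \sum_(j < N) v ord0 i by apply: eq_bigr.
rewrite s0 sumr_const card_ord => /esym/eqP; rewrite mulrn_eq0 => /orP[|/eqP//].
by move=> /eqP N0; have := leq_trans (ltn_ord i) (eq_leq N0).
Qed.

Definition cut_energy (s : R) : R := \sum_a RI (fun x => partial a (dil s 0 (cut : E -> R)) x ^+ 2).

Lemma cut_energy_ge0 s : 0 <= cut_energy s.
Proof. by apply: sumr_ge0 => a _; exact: RI_sqr_ge0. Qed.

Lemma grad_mass (U : E -> 'rV[R]_N) G rho r (phi : E -> R) M : is_min rho U G ->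
  smooth phi -> r < rho -> suppin (cball 0 r) phi ->
  (forall x, l2norm x <= r -> sq (U x) <= M) ->
  \sum_i \sum_a RI (fun x => partial a phi x ^+ 2 * U x ord0 i ^+ 2) <=
  M * \sum_a RI (fun x => partial a phi x ^+ 2).
Proof.
move=> H sp rr p0 hM; rewrite exchange_big mulr_sumr /=; apply: ler_sum => a _.
have pp0 := partial_supp a (@closed_cball _ _ _ _) p0.
have spa := smooth_partial a sp.
have i1 i : itg (fun x => partial a phi x ^+ 2 * U x ord0 i ^+ 2).
  have := supp_sq (eta := fun x => partial a phi x * partial a phi x)
      (fun x hx => eq_trans (congr1 (fun z => z * _) (pp0 x hx)) (mul0r _))
      (smooth_cont (smoothM spa spa)) (im_u H i) (im_u H i).
  by congr (itg _); apply/funext => x; ring.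
have i2 : itg (fun x => partial a phi x ^+ 2).
  by case: (test_sqi (test_partial a (test_ball_intro rr sp p0))).
rewrite -RI_sum// -RI_Z//; apply: RI_le; [exact: itg_sum|exact: itgZ|].
move=> x; rewrite -mulr_sumr mulrC; have [hx|hx] := pselect (cball 0 r x); last first.
  by rewrite pp0// expr0n !mulr0.
by rewrite ler_wpM2r ?sqr_ge0//; apply: hM; move: hx; rewrite /cball /= subr0.
Qed.

(* The competitor vanishing on a half ball shows that {U <> 0} has measure at most
   C sup |U|^2 there; the mean value inequality then makes |U|^2 quadratically small. *)
Lemma nondeg_step : exists2 e0 : R, 0 < e0 & forall (V : E -> 'rV[R]_N) G,
  is_min 2 V G -> (forall x, \sum_i V x ord0 i = 0) ->
  (forall x, l2norm x <= 1 -> l2norm (V x) <= e0) ->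
  forall x, l2norm x <= 1 / 4 -> l2norm (V x) <= e0 / 4.
Proof.
have [Cs Cs0 hC] := @psi0_bounded R n.
have h20 : 0 < 1 / 2 :> R by lra.
set K := 4 ^+ n * Cs * cut_energy (1 / 2) / RI psi0.
have c0 := @RI_psi0 R n.
have K0 : 0 <= K by rewrite divr_ge0 ?(ltW c0)// !mulr_ge0 ?cut_energy_ge0 ?exprn_ge0// ltW.
have K40 : 0 < 4 * (K + 1) by lra.
exists (4 * (K + 1))^-1 => [|V G H s0]; first by rewrite invr_gt0.
set e := _^-1 => hV x hx; have e0 : 0 < e by rewrite invr_gt0.
(* K e^2 is the factor gained on |V|^2 by one step; 1/16 means a factor 1/4 on |V|. *)
have Ke : K * e ^+ 2 <= 1 / 16.
  have : 4 * (K + 1) * e = 1 by rewrite mulfV// gt_eqF.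
  nra.
have rr : 3 / 2 * (1 / 2) < 2 :> R by lra.
set eta := dil (1 / 2) 0 (cut : E -> R).
have seta : smooth eta by exact: smooth_dcut.
have eta0 : suppin (cball 0 (3 / 2 * (1 / 2))) eta by exact: dil_cut_supp.
have e01 y : 0 <= eta y <= 1 by exact: cut01.
have hM y : l2norm y <= 3 / 2 * (1 / 2) -> sq (V y) <= e ^+ 2.
  by move=> hy; rewrite -l2norm_le ?(ltW e0)//; apply: hV; lra.
have r20 : 0 < 2 :> R by lra.
have h1 := le_trans (nondeg_var H seta rr eta0 e01) (grad_mass H seta rr eta0 hM).
have mV i : measurable_fun setT (fun y => V y ord0 i) by case: (im_u H i).
have iW := itg_W mV (im_u0 H).
have iW' : itg (fun y => W ((1 - eta y) *: V y)).
  apply: (@itg_W _ _ _ 0 2) => [i|y hy]; last by rewrite (im_u0 H hy) scaler0.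
  under eq_fun do rewrite mxE; apply: measurable_funM => //.
  by apply: measurable_funB => //; exact: continuous_rV_measurable (smooth_cont seta).
move: h1; rewrite -RI_B//; set D := fun y => _ - _ => h1.
have iD : itg D by exact: itgB.
have oV y : ordered (V y).
  have [/(ord_all H)//|/(im_u0 H) ->] := pselect (l2ball 0 2 y); by move=> i j _; rewrite !mxE.
have D0 y : 0 <= D y.
  rewrite /D subr_ge0; have [_ e1] := andP (e01 y); have [lt|ge] := ltP (eta y) 1.
    by rewrite W_scale// subr_gt0.
  have -> : eta y = 1 by apply/le_anti; rewrite e1 ge.
  by rewrite subrr scale0r W0 W_ge0.
(* The competitor is 0 on the half ball, so [D] is [W] there, which is at least 1 wherever V is
   nonzero. *)
have DV y : l2norm y <= 1 / 2 -> sq (V y) <= e ^+ 2 * D y.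
  move=> hy; have [->|vn] := eqVneq (V y) 0; first by rewrite sq0 mulr_ge0 ?sqr_ge0.
  have -> : D y = W (V y) by rewrite /D /eta dil_cut1// subrr scale0r W0 subr0.
  apply: (@le_trans _ _ (e ^+ 2)); first by apply: hM; lra.
  by rewrite ler_peMr ?sqr_ge0//; exact: W_ge1.
have q4 : 0 < 1 / 4 :> R by lra.
have xr : l2norm x + 1 / 4 < 2 by lra.
have := sup_bound H q4 xr.
have : RI (fun y => dil (1 / 4) x psi0 y * sq (V y)) <= RI (fun y => (Cs * e ^+ 2) * D y).
  apply: RI_le; [by apply: itg_psi0M => //; exact: itg_sqU H|exact: itgZ|].
  move=> y; have [hy|hy] := pselect (cball x (1 / 4) y); last first.
    rewrite (dil_supp q4 psi0_supp hy) mul0r mulr_ge0// mulr_ge0 ?sqr_ge0//; exact: ltW.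
  rewrite -mulrA; apply: ler_pM; rewrite ?sq_ge0 ?psi0_ge0//; first exact: hC.
  apply: DV; rewrite -[y](subrK x); apply: (le_trans (l2normD _ _)).
  by move: hy; rewrite /cball /=; lra.
rewrite RI_Z// => h2 h3.
have e16 : 0 <= e / 4 by lra.
rewrite l2norm_le// -(ler_pM2l c0); apply: (le_trans h3).
have h14 : (1 / 4 : R) ^- n = 4 ^+ n by rewrite -exprVn; congr (_ ^+ _); field.
rewrite h14; have p4 : 0 <= 4 ^+ n :> R by exact: exprn_ge0.
apply: (le_trans (ler_wpM2l p4 h2)).
have CC : 0 <= Cs * e ^+ 2 by rewrite mulr_ge0 ?sqr_ge0// ltW.
apply: (le_trans (ler_wpM2l p4 (ler_wpM2l CC h1))).
have -> : 4 ^+ n * (Cs * e ^+ 2 * (e ^+ 2 * cut_energy (1 / 2))) = RI psi0 * (K * e ^+ 2 * e ^+ 2).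
  by rewrite /K; field; rewrite gt_eqF.
rewrite ler_wpM2l ?(ltW c0)//; have := sqr_ge0 e; rewrite expr_div_n; nra.
Qed.

(** By [nondeg_step] the zoom by 1/4 is again bounded by e0 on the unit ball, while its value at 0
    is 4 V(0). The induction records the weaker bound k |V(0)| <= e0, which already forces V(0) =
    0. *)
Lemma nondeg_zero : exists2 e0 : R, 0 < e0 & forall (V : E -> 'rV[R]_N) G,
  is_min 2 V G -> (forall x, \sum_i V x ord0 i = 0) ->
  (forall x, l2norm x <= 1 -> l2norm (V x) <= e0) -> V 0 = 0.
Proof.
have [e0 e00 step] := nondeg_step; exists e0 => // V G H s0 hV.
suff hk k : forall (V : E -> 'rV[R]_N) G, is_min 2 V G -> (forall x, \sum_i V x ord0 i = 0) ->
    (forall x, l2norm x <= 1 -> l2norm (V x) <= e0) -> l2norm (V 0) * k%:R <= e0.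
  apply/eqP; rewrite -normr_le0; apply: (le_trans (norm_le_l2 _)).
  rewrite leNgt; apply/negP => lt0; have := hk (Num.truncn (e0 / l2norm (V 0))).+1 V G H s0 hV.
  rewrite mulrC -ler_pdivlMr// leNgt => /negP; apply.
  by have /andP[] := truncn_itv (divr_ge0 (ltW e00) (ltW lt0)).
elim: k => [|k IH] {H s0 hV G}V G H s0 hV; first by rewrite mulr0 ltW.
have q4 : 0 < 1 / 4 :> R by lra.
have hz : l2norm (0 : E) + 1 / 4 * 2 <= 2 by rewrite l2norm0; lra.
have b0 : l2ball (0 : E) 2 0 by rewrite /l2ball /= subr0 l2norm0; lra.
have := IH _ _ (is_min_zoom H q4 hz).
rewrite zoomU_in// scaler0 add0r l2normZ gtr0_norm ?invr_gt0//.
have -> : (1 / 4 : R)^-1 = 4 by field.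
move=> h; have {}h : 4 * l2norm (V 0) * k%:R <= e0.
  apply: h => [x|x hx].
    have [xB|xB] := pselect (l2ball 0 2 x); last first.
      by rewrite zoomU_out// big1// => i _; rewrite mxE.
    by rewrite zoomU_in//; under eq_bigr do rewrite mxE; rewrite -mulr_sumr s0 mulr0.
  rewrite zoomU_in; last by rewrite /l2ball /= subr0; lra.
  rewrite l2normZ gtr0_norm ?invr_gt0// addr0.
  have -> : (1 / 4 : R)^-1 = 4 by field.
  have : l2norm (V ((1 / 4) *: x)) <= e0 / 4.
    by apply: (step _ _ H s0 hV); rewrite l2normZ gtr0_norm//; lra.
  lra.
have v0 := l2norm_ge0 (V 0); have k0 : 0 <= k%:R :> R by exact: ler0n.
have : l2norm (V 0) <= e0 / 4 by apply: (step _ _ H s0 hV); rewrite l2norm0 divr_ge0.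
rewrite -[k.+1%:R]natr1 mulrDr mulr1; move: h; rewrite -mulrA; set vk := l2norm _ * k%:R; lra.
Qed.

Lemma small_min_vanishes : exists2 c : R, 0 < c & forall (U : E -> 'rV[R]_N) G rho r,
  is_min rho U G -> (forall x, \sum_i U x ord0 i = 0) -> 0 < r -> r <= rho ->
  (forall x, l2norm x < r -> l2norm (U x) <= c * r) ->
  forall y, l2norm y < r / 2 -> U y = 0.
Proof.
(* The zoom at y of ratio r/5 has its ball of radius 2 inside the ball of radius r, and the bound c
   r becomes 5 c = e0. *)
have [e0 e00 hz] := nondeg_zero; exists (e0 / 5) => [|U G rho r H s0 r0 rr hU y hy].
  by rewrite divr_gt0.
have r5 : 0 < r / 5 by lra.
have hr : l2norm y + r / 5 * 2 <= rho by lra.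
have b0 : l2ball (0 : E) 2 0 by rewrite /l2ball /= subr0 l2norm0; lra.
have := hz _ _ (is_min_zoom H r5 hr).
rewrite zoomU_in// scaler0 add0r => h; have : (r / 5)^-1 *: U y = 0.
  apply: h => [x|x hx].
    have [xB|xB] := pselect (l2ball 0 2 x); last first.
      by rewrite zoomU_out// big1// => i _; rewrite mxE.
    by rewrite zoomU_in//; under eq_bigr do rewrite mxE; rewrite -mulr_sumr s0 mulr0.
  rewrite zoomU_in; last by rewrite /l2ball /= subr0; lra.
  rewrite l2normZ gtr0_norm ?invr_gt0// mulrC ler_pdivrMr//.
  have -> : e0 * (r / 5) = e0 / 5 * r by ring.
  apply: hU; apply: (le_lt_trans (l2normD _ _)); rewrite l2normZ gtr0_norm//; nra.
by move=> /eqP; rewrite scaler_eq0 invr_eq0 gt_eqF//= => /eqP.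
Qed.

End nondegeneracy.

(** * Equicontinuity *)

Section equicontinuity.
Context {R : realType} {n N : nat}.
Local Notation E := 'rV[R]_n.
Local Notation mu := (@lebesgue_rV R n).
Local Notation RI := (RI mu).
Local Notation itg := (itg mu).
Local Notation sqi := (sqi mu).

Lemma tdiff_double (f : E -> R) k : sqi f ->
  RI (fun x => (f (x + (k + k)) - f x) ^+ 2) <= 4 * RI (fun x => (f (x + k) - f x) ^+ 2).
Proof.
move=> sf; have s1 := sqi_shift_diff k sf; have s2 := sqi_translate k s1.
have := RI_sqD s2 s1; have [_ i1] := s1; have := RI_translate k i1; move=> -> h.
have -> : (fun x => (f (x + (k + k)) - f x) ^+ 2) =
   (fun x => (f (x + k + k) - f (x + k) + (f (x + k) - f x)) ^+ 2).
  by apply/funext => x; rewrite addrA; congr (_ ^+ _); ring.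
by apply: (le_trans h); set z := RI _; lra.
Qed.

(** Taylor's formula gives the bound up to an error of order |h|^4. For the shift h / 2^j the error
    is 16^-j times smaller, and the j doublings that lead back to h cost 4^j only. *)
Lemma tdiff_smooth K (f : E -> R) h : compact K -> suppin K f -> smooth f ->
  RI (fun x => (f (x + h) - f x) ^+ 2) <= 2 * n%:R * `|h| ^+ 2 * \sum_a RI (fun x => partial a f x ^+ 2).
Proof.
move=> cK f0 sf; have clK := compact_closed (@norm_hausdorff _ _) cK.
have [C C0 hC] := smooth_taylor cK f0 sf.
have [M M0 KM] := compact_bounded_rV cK.
have sqf : sqi f.
  apply: (@test_sqi _ _ setT); exact: (test_fun_intro sf cK).
have sp a : sqi (partial a f).
  apply: (@test_sqi _ _ setT); apply: test_partial; exact: (test_fun_intro sf cK).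
pose B := cball (0 : E) ((n%:R + 1) * (M + `|h|)).
have iB : itg (\1_B) by apply: itg_indic; [exact: measurable_cball|exact: mu_cball_lty].
set S := \sum_a _; set b := RI (\1_B).
have b0 : 0 <= b by apply: RI_ge0 => x; rewrite indicE.
have main k : `|k| <= `|h| -> RI (fun x => (f (x + k) - f x) ^+ 2) <=
    2 * (n%:R * `|k| ^+ 2 * S) + 2 * (C ^+ 2 * `|k| ^+ 4 * b).
  move=> kh; pose l x := \sum_a k ord0 a * partial a f x.
  have sl : sqi l by apply: sqi_sum => a; exact: sqiZ.
  have se := sqiB (sqi_shift_diff k sqf) sl.
  have := RI_sqD sl se; have -> : (fun x => (l x + (f (x + k) - f x - l x)) ^+ 2) =
     (fun x => (f (x + k) - f x) ^+ 2) by apply/funext => x; congr (_ ^+ _); ring.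
  move=> h1; apply: (le_trans h1); apply: lerD; rewrite ler_wpM2l//.
    have ip a : itg (fun x => partial a f x ^+ 2) by case: (sp a).
    rewrite /S -RI_sum// -RI_Z; last exact: itg_sum.
    apply: RI_le; [by case: sl|by apply: itgZ; exact: itg_sum|].
    move=> x; have := sq_CS k (\row_a partial a f x); rewrite /l.
    have -> : \sum_i k ord0 i * (\row_a partial a f x) ord0 i = \sum_a k ord0 a * partial a f x.
      by apply: eq_bigr => a _; rewrite mxE.
    move=> /le_trans; apply; have -> : sq (\row_a partial a f x) = \sum_a partial a f x ^+ 2.
      by apply: eq_bigr => a _; rewrite mxE.
    by rewrite ler_wpM2r ?sumr_ge0 ?sq_le_norm// => a _; exact: sqr_ge0.
  rewrite -RI_Z//; apply: RI_le; [by case: se|exact: itgZ|].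
  move=> x; have eC := hC x k; rewrite indicE; have [xB|xB] := pselect (B x).
    rewrite mem_set// mulr1 -real_normK ?num_real//.
    have -> : C ^+ 2 * `|k| ^+ 4 = (C * `|k| ^+ 2) ^+ 2 by ring.
    by rewrite ler_sqr ?nnegrE// mulr_ge0// sqr_ge0.
  have xfar : M + `|h| < `|x|.
    rewrite ltNge; apply/negP => xM; apply: xB; rewrite /B /cball /= subr0.
    by apply: (le_trans (l2_le_norm _)); rewrite ler_wpM2l.
  have fx : f x = 0 by apply: f0 => /KM; have := normr_ge0 h; lra.
  have fxk : f (x + k) = 0.
    apply: f0 => /KM; have := ler_normB (x + k) k; rewrite addrK; lra.
  have -> : l x = 0.
    rewrite /l big1// => a _; rewrite (partial_supp a clK f0) ?mulr0// => /KM.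
    have := normr_ge0 h; lra.
  by rewrite fx fxk !subr0 expr0n/= mulr_ge0// mulr_ge0 ?sqr_ge0// exprn_ge0.
have dbl j : RI (fun x => (f (x + h) - f x) ^+ 2) <=
    4 ^+ j * RI (fun x => (f (x + (2 ^+ j)^-1 *: h) - f x) ^+ 2).
  elim: j => [|j IH]; first by rewrite !expr0 invr1 scale1r mul1r.
  apply: (le_trans IH); rewrite exprSr -mulrA ler_wpM2l ?exprn_ge0//.
  have := tdiff_double ((2 ^+ j.+1)^-1 *: h) sqf; rewrite -scalerDl.
  have -> : (2 ^+ j.+1)^-1 + (2 ^+ j.+1)^-1 = (2 ^+ j)^-1 :> R.
    by rewrite exprS; field; rewrite expf_neq0.
  by [].
apply/ler_addgt0Pr => e e0.
pose A := 2 * (C ^+ 2 * `|h| ^+ 4 * b).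
have A0 : 0 <= A by rewrite !mulr_ge0 ?sqr_ge0// exprn_ge0.
have [j hj] : exists j : nat, A / e <= 4 ^+ j.
  exists (Num.truncn (A / e)).+1; apply: (@le_trans _ _ (Num.truncn (A / e)).+1%:R).
    by apply/ltW; have /andP[] := truncn_itv (divr_ge0 A0 (ltW e0)).
  by rewrite -natrX ler_nat ltnW// ltn_expl.
apply: (le_trans (dbl j)).
have p2 : 0 < 2 ^+ j :> R by exact: exprn_gt0.
have nk : `|(2 ^+ j)^-1 *: h| = (2 ^+ j)^-1 * `|h| by rewrite normrZ gtr0_norm// invr_gt0.
have p21 : 1 <= 2 ^+ j :> R by rewrite exprn_ege1//; lra.
have := main ((2 ^+ j)^-1 *: h); rewrite nk => hm.
have {}hm := hm ltac:(rewrite mulrC ler_pdivrMr// ler_peMr//).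
have p4 : 4 ^+ j = (2 ^+ j) ^+ 2 :> R by rewrite -exprM mulnC exprM; congr (_ ^+ _); lra.
rewrite p4; apply: (le_trans (ler_wpM2l (sqr_ge0 _) hm)).
set p := 2 ^+ j in p2 p4 *.
have -> : p ^+ 2 * (2 * (n%:R * (p^-1 * `|h|) ^+ 2 * S) + 2 * (C ^+ 2 * (p^-1 * `|h|) ^+ 4 * b)) =
   2 * n%:R * `|h| ^+ 2 * S + A / p ^+ 2 by rewrite /A; field; rewrite gt_eqF.
rewrite lerD2l ler_pdivrMr ?exprn_gt0// mulrC -ler_pdivrMr//.
by rewrite -p4.
Qed.

Lemma tdiff_Hc (x0 : E) r w (g : 'I_n -> E -> R) h : Hc x0 r w g ->
  RI (fun x => (w (x + h) - w x) ^+ 2) <= 24 * n%:R * `|h| ^+ 2 * \sum_a RI (fun x => g a x ^+ 2).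
Proof.
move=> H; have [r' rr happ] := Hc_approx H; have [sw sg _ _] := H.
apply/ler_addgt0Pr => e e0.
(* Collects the coefficients of d, so that the total error is at most e. *)
pose A := 10 + 24 * n%:R * `|h| ^+ 2 * n%:R.
have A0 : 0 < A by rewrite ltr_wpDr// !mulr_ge0// sqr_ge0.
pose d := e / A; have d0 : 0 < d by rewrite divr_gt0.
have [phi [sp p0 h1 h2]] := happ _ d0.
have cB := @compact_cball R n x0 r'.
have st := tdiff_smooth h cB p0 sp.
have tp : test_function setT phi by exact: (test_fun_intro sp cB).
have sphi := test_sqi tp; have spa a := test_sqi (test_partial a tp).
have sd := sqiB sphi sw.
have k1 : RI (fun x => (w (x + h) - w x) ^+ 2) <=
    2 * RI (fun x => (phi (x + h) - phi x) ^+ 2) + 2 * RI (fun x => ((phi x - w x) - (phi (x + h) - w (x + h))) ^+ 2).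
  have s1 := sqi_shift_diff h sphi; have s2 := sqiB sd (sqi_translate h sd).
  have := RI_sqD s1 s2; congr (_ <= _); congr RI; apply/funext => x; congr (_ ^+ _); ring.
have k2 : RI (fun x => ((phi x - w x) - (phi (x + h) - w (x + h))) ^+ 2) <= 4 * d.
  have s2 := sqiN (sqi_translate h sd).
  apply: (le_trans (RI_sqD sd s2)).
  have -> : (fun x => (- (phi (x + h) - w (x + h))) ^+ 2) = (fun x => (phi (x + h) - w (x + h)) ^+ 2).
    by apply/funext => x; rewrite sqrrN.
  have [_ i1] := sd; have := RI_translate h i1; move=> ->; lra.
have k3 : \sum_a RI (fun x => partial a phi x ^+ 2) <= 2 * (\sum_a RI (fun x => g a x ^+ 2)) + 2 * (n%:R * d).
  have -> : n%:R * d = \sum_(a < n) d by rewrite sumr_const card_ord mulr_natl.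
  rewrite !mulr_sumr -big_split /=; apply: ler_sum => a _.
  have := RI_sqD (sg a) (sqiB (spa a) (sg a)).
  have -> : (fun x => (g a x + (partial a phi x - g a x)) ^+ 2) = (fun x => partial a phi x ^+ 2).
    by apply/funext => x; congr (_ ^+ _); ring.
  by move=> k; apply: (le_trans k); have := h2 a; lra.
set S := \sum_a RI (fun x => g a x ^+ 2) in k3 *; set S' := \sum_a _ in st k3.
have ed : e = d * A by rewrite /d mulfVK// gt_eqF.
have q0 : 0 <= n%:R * `|h| ^+ 2 by rewrite mulr_ge0// sqr_ge0.
have S0 : 0 <= S by apply: sumr_ge0 => a _; exact: RI_sqr_ge0.
have n0 : 0 <= n%:R :> R by exact: ler0n.
have k4 : 2 * n%:R * `|h| ^+ 2 * S' <= 2 * (n%:R * `|h| ^+ 2) * (2 * S + 2 * (n%:R * d)).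
  by rewrite -[2 * n%:R * _]mulrA; apply: ler_wpM2l => //; rewrite mulr_ge0.
rewrite ed /A.
apply: (le_trans k1); apply: (@le_trans _ _ (2 * (2 * (n%:R * `|h| ^+ 2) * (2 * S + 2 * (n%:R * d))) + 2 * (4 * d))).
  by apply: lerD; rewrite ler_wpM2l//; apply: le_trans k4.
set q := n%:R * `|h| ^+ 2 in q0 *.
have -> : 24 * n%:R * `|h| ^+ 2 * S = 24 * (q * S) by rewrite /q; ring.
have -> : 24 * n%:R * `|h| ^+ 2 * n%:R = 24 * (q * n%:R) by rewrite /q; ring.
have qS : 0 <= q * S by exact: mulr_ge0.
have qn : 0 <= q * n%:R * d.
  by apply: mulr_ge0; [exact: mulr_ge0|exact: ltW].
nra.
Qed.

End equicontinuity.

(** * Comparison of two minimizers *)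

Section two_minimizers.
Context {R : realType} {n N : nat}.
Local Notation E := 'rV[R]_n.
Local Notation mu := (@lebesgue_rV R n).
Local Notation RI := (RI mu).
Local Notation itg := (itg mu).
Local Notation sqi := (sqi mu).

(** Caccioppoli's inequality: phi^2 <= phi, and [subharmonic] turns the energy weighted by phi into
    the integral of |U|^2 Delta phi. *)
Lemma Qf_bound (U : E -> 'rV[R]_N) G rho r phi M : is_min rho U G ->
  smooth phi -> r < rho -> suppin (cball 0 r) phi -> (forall x, 0 <= phi x <= 1) ->
  (forall x, l2norm x <= r -> sq (U x) <= M) -> 0 <= M ->
  Qf (fun i a x => phi x * G i a x + U x ord0 i * partial a phi x) <=
  M * (RI (fun x => `|lap phi x|) + 2 * \sum_a RI (fun x => partial a phi x ^+ 2)).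
Proof.
move=> H sp rr p0 p01 hM M0; have gm := grad_mass H sp rr p0 hM.
have cl := @closed_cball R n 0 r; have cB := @compact_cball R n 0 r.
have pp0 a := partial_supp a cl p0.
have sl : smooth (lap phi) by apply: smooth_sum => a; do 2 apply: smooth_partial.
have l0 : suppin (cball 0 r) (lap phi).
  by move=> x hx; rewrite /lap big1// => a _; exact: partial_supp (pp0 a) x hx.
have il : itg (lap phi) by exact: cont_supp_itg cB l0 (smooth_cont sl).
have sb := subharmonic H sp rr p0.
have h1 : 2 * D2 G phi <= M * RI (fun x => `|lap phi x|).
  rewrite -sb -RI_Z; last exact: itg_abs.
  have [C C0 hC] := supp_bounded cB l0 (smooth_cont sl).
  apply: RI_le; last first.
  - move=> x; have [hx|hx] := pselect (cball 0 r x); last by rewrite l0// normr0 !mulr0.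
    have sM : sq (U x) <= M by apply: hM; move: hx; rewrite /cball /= subr0.
    apply: (@le_trans _ _ (sq (U x) * `|lap phi x|)).
      by rewrite ler_wpM2l ?sq_ge0// ler_norm.
    by rewrite ler_wpM2r.
  - by apply: itgZ; exact: itg_abs.
  - have := itg_bM (continuous_rV_measurable (smooth_cont sl)) hC (itg_sqU H).
    by congr (itg _); apply/funext => x; rewrite mulrC.
have sphiG i a : sqi (fun x => phi x * G i a x).
  have [C C0 hC] := supp_bounded cB p0 (smooth_cont sp).
  exact: sqi_bM (continuous_rV_measurable (smooth_cont sp)) hC (im_g H i a).
have sUp i a : sqi (fun x => U x ord0 i * partial a phi x).
  have spa := smooth_partial a sp.
  have [C C0 hC] := supp_bounded cB (pp0 a) (smooth_cont spa).
  have := sqi_bM (continuous_rV_measurable (smooth_cont spa)) hC (im_u H i).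
  by congr (sqi _); apply/funext => x; rewrite mulrC.
apply: (@le_trans _ _ (2 * D2 G phi + 2 * (\sum_i \sum_a RI (fun x => partial a phi x ^+ 2 * U x ord0 i ^+ 2)))); last first.
  by rewrite mulrDr lerD// mulrCA ler_wpM2l.
rewrite /Qf /D2 !mulr_sumr -big_split /=; apply: ler_sum => i _.
rewrite !mulr_sumr -big_split /=; apply: ler_sum => a _.
apply: (le_trans (RI_sqD (sphiG i a) (sUp i a))); apply: lerD; rewrite ler_wpM2l//.
  apply: RI_le; [by case: (sphiG i a)| |].
    have := supp_sq p0 (smooth_cont sp) (im_g H i a) (im_g H i a).
    by congr (itg _); apply/funext => x; rewrite expr2.
  move=> x; rewrite exprMn ler_wpM2r ?sqr_ge0//; have /andP[] := p01 x.
  by set q := phi x => q0 q1; nra.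
by rewrite le_eqVlt; apply/orP; left; apply/eqP; congr RI; apply/funext => x; rewrite exprMn mulrC.
Qed.

Variables (rho : R) (V V' : E -> 'rV[R]_N) (G G' : 'I_N -> 'I_n -> E -> R).
Hypothesis (H : is_min rho V G) (H' : is_min rho V' G').

(* min_lsup for V with w = lam phi V', and for V' with w = lam phi V. *)
Lemma two_min r x0 s phi lam : smooth phi -> r < rho -> suppin (cball 0 r) phi ->
  suppin (cball x0 s) phi -> (forall x, 0 <= phi x) -> 0 < lam ->
  - (lam * (Qf (fun i a x => phi x * G i a x + V x ord0 i * partial a phi x) +
            Qf (fun i a x => phi x * G' i a x + V' x ord0 i * partial a phi x))
     + 2 / lam * (N%:R ^+ 2 * RI (\1_(cball x0 s)))) <=
  RI (fun x => sq (V x - V' x) * lap phi x).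
Proof.
move=> sp rr p0 ps pge0 l0.
set h := fun i a x => phi x * G i a x + _; set h' := fun i a x => phi x * G' i a x + _.
have Hw := Hc_phi H sp rr p0; have Hw' := Hc_phi H' sp rr p0.
have cl := @closed_cball R n 0 r; have pp0 a := partial_supp a cl p0.
have ow (X : E -> 'rV[R]_N) : {ae mu, forall x, ordered (X x)} ->
    {ae mu, forall x, ordered (\row_i (lam * (phi x * X x ord0 i)))}.
  apply: filterS => x ox; have -> : \row_i (lam * (phi x * X x ord0 i)) = (lam * phi x) *: X x.
    by apply/rowP => i; rewrite !mxE mulrA.
  by apply: ordered_scale => //; rewrite mulr_ge0// ltW.
have ws (X : E -> 'rV[R]_N) i : suppin (cball x0 s) (fun x => lam * (phi x * X x ord0 i)).
  by move=> x hx; rewrite ps// mul0r mulr0.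
have m1 := min_lsup H (fun i => HcZ lam (Hw' i)) (ws V') (ow _ (im_ord H')).
have m2 := min_lsup H' (fun i => HcZ lam (Hw i)) (ws V) (ow _ (im_ord H)).
have sh i a : sqi (h i a) by case: (Hw i) => _ s1 _ _; exact: s1.
have sh' i a : sqi (h' i a) by case: (Hw' i) => _ s1 _ _; exact: s1.
have QZ (k : 'I_N -> 'I_n -> E -> R) : (forall i a, sqi (k i a)) -> Qf (fun i a x => lam * k i a x) = lam ^+ 2 * Qf k.
  move=> sk; rewrite /Qf mulr_sumr; apply: eq_bigr => i _; rewrite mulr_sumr; apply: eq_bigr => a _.
  by rewrite -RI_Z; [congr RI; apply/funext => x; rewrite exprMn|case: (sk i a)].
have BZ (F k : 'I_N -> 'I_n -> E -> R) : (forall i a, sqi (F i a)) -> (forall i a, sqi (k i a)) -> Bf F (fun i a x => lam * k i a x) = lam * Bf F k.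
  move=> sF sk; rewrite /Bf mulr_sumr; apply: eq_bigr => i _; rewrite mulr_sumr; apply: eq_bigr => a _.
  rewrite -RI_Z; last exact: sqi_mul.
  by congr RI; apply/funext => x; rewrite mulrCA.
move: m1 m2; rewrite !QZ// (BZ _ _ (im_g H) sh') (BZ _ _ (im_g H') sh).
have P2 (F F' : 'I_N -> 'I_n -> E -> R) : (forall i a, sqi (F i a)) -> (forall i a, sqi (F' i a)) ->
    forall i a, itg (fun x => phi x * (F i a x * F' i a x)).
  by move=> sF sF' i a; apply: (supp_sq p0 (smooth_cont sp)).
pose X := \sum_i \sum_a RI (fun x => phi x * (G i a x * G' i a x)).
pose Y := \sum_i RI (fun x => V x ord0 i * V' x ord0 i * lap phi x).
have iVV i a : itg (fun x => V x ord0 i * V' x ord0 i * partial a (partial a phi) x).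
  have spp := smooth_partial a (smooth_partial a sp).
  have := supp_sq (partial_supp a cl (pp0 a)) (smooth_cont spp) (im_u H i) (im_u H' i).
  by congr (itg _); apply/funext => x; rewrite mulrC.
have iVl i : itg (fun x => V x ord0 i * V' x ord0 i * lap phi x).
  by under eq_fun do rewrite /lap mulr_sumr; exact: itg_sum.
have Yl i : RI (fun x => V x ord0 i * V' x ord0 i * lap phi x) =
    \sum_a RI (fun x => V x ord0 i * V' x ord0 i * partial a (partial a phi) x).
  by rewrite -RI_sum//; congr RI; apply/funext => x; rewrite /lap mulr_sumr.
(* The terms with D phi add up to the derivative of V.V' against D phi, whose integral is -Y. *)
have eB : Bf G h' + Bf G' h = 2 * X - Y.
  rewrite /Bf /X /Y mulr_sumr -sumrB -big_split /=; apply: eq_bigr => i _.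
  rewrite Yl mulr_sumr -sumrB -big_split /=; apply: eq_bigr => a _.
  have spa := smooth_partial a sp.
  have := Hc_ibp (im_u H i) (im_g H i a) (im_w H i a) (Hc_phi H' spa rr (pp0 a) i).
  have j1 := supp_sq (pp0 a) (smooth_cont spa) (im_u H i) (im_g H' i a).
  have j2 := supp_sq (pp0 a) (smooth_cont spa) (im_u H' i) (im_g H i a).
  have -> : (fun x => V x ord0 i * (partial a phi x * G' i a x + V' x ord0 i * partial a (partial a phi) x)) =
     (fun x => partial a phi x * (V x ord0 i * G' i a x) + V x ord0 i * V' x ord0 i * partial a (partial a phi) x).
    by apply/funext => x; ring.
  have -> : (fun x => G i a x * (partial a phi x * V' x ord0 i)) = (fun x => partial a phi x * (V' x ord0 i * G i a x)).
    by apply/funext => x; ring.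
  rewrite RI_D// => e1.
  have j3 := P2 _ _ (im_g H) (im_g H') i a.
  have -> : (fun x => G i a x * h' i a x) = (fun x => phi x * (G i a x * G' i a x) + partial a phi x * (V' x ord0 i * G i a x)).
    by apply/funext => x; rewrite /h'; ring.
  have -> : (fun x => G' i a x * h i a x) = (fun x => phi x * (G i a x * G' i a x) + partial a phi x * (V x ord0 i * G' i a x)).
    by apply/funext => x; rewrite /h; ring.
  rewrite !RI_D//; move: e1; set a1 := RI _; set a2 := RI _; set a3 := RI _; set a4 := RI _; lra.
(* Expansion of |V - V'|^2, with [subharmonic] for the two squares. *)
have eS : RI (fun x => sq (V x - V' x) * lap phi x) = 2 * D2 G phi + 2 * D2 G' phi - 2 * Y.
  rewrite -(subharmonic H sp rr p0) -(subharmonic H' sp rr p0) /Y mulr_sumr.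
  have sl : smooth (lap phi) by apply: smooth_sum => a; do 2 apply: smooth_partial.
  have l0' : suppin (cball 0 r) (lap phi).
    by move=> x hx; rewrite /lap big1// => a _; exact: partial_supp (pp0 a) x hx.
  have [C C0 hC] := supp_bounded (@compact_cball R n 0 r) l0' (smooth_cont sl).
  have i1 (X1 : E -> 'rV[R]_N) G1 : is_min rho X1 G1 -> itg (fun x => sq (X1 x) * lap phi x).
    move=> H1; have := itg_bM (continuous_rV_measurable (smooth_cont sl)) hC (itg_sqU H1).
    by congr (itg _); apply/funext => x; rewrite mulrC.
  under [X in _ = _ - X]eq_bigr do rewrite -RI_Z//.
  rewrite -RI_sum; last by move=> i; exact: itgZ.
  rewrite -RI_D; [|exact: i1 H|exact: i1 H'].
  rewrite -RI_B; [|by apply: itgD; [exact: i1 H|exact: i1 H']|by apply: itg_sum => i; exact: itgZ].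
  congr RI; apply/funext => x.
  have -> : \sum_i 2 * (V x ord0 i * V' x ord0 i * lap phi x) = (\sum_i 2 * (V x ord0 i * V' x ord0 i)) * lap phi x.
    by rewrite mulr_suml; apply: eq_bigr => i _; rewrite mulrA.
  rewrite -mulrDl -mulrBl; congr (_ * _); rewrite /sq -big_split -sumrB /=; apply: eq_bigr => i _.
  by rewrite !mxE; ring.
(* This is the integral of phi |DV - DV'|^2. *)
have Dp : 0 <= D2 G phi + D2 G' phi - 2 * X.
  rewrite /D2 /X mulr_sumr -big_split -sumrB /=; apply: sumr_ge0 => i _.
  rewrite mulr_sumr -big_split -sumrB /=; apply: sumr_ge0 => a _.
  have k1 := P2 _ _ (im_g H) (im_g H) i a; have k2 := P2 _ _ (im_g H') (im_g H') i a.
  have k3 := P2 _ _ (im_g H) (im_g H') i a.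
  rewrite -RI_Z//; have -> : (fun x => phi x * G i a x ^+ 2) = (fun x => phi x * (G i a x * G i a x)).
    by apply/funext => x; rewrite expr2.
  have -> : (fun x => phi x * G' i a x ^+ 2) = (fun x => phi x * (G' i a x * G' i a x)).
    by apply/funext => x; rewrite expr2.
  rewrite -RI_D// -RI_B; [|exact: itgD|exact: itgZ].
  apply: RI_ge0 => x; have := pge0 x; have := sqr_ge0 (G i a x - G' i a x).
  set b := phi x; set c := G i a x; set d := G' i a x => b0 c0; nra.
rewrite eS; move: eB Dp; set b1 := Bf G h'; set b2 := Bf G' h; set q1 := Qf h; set q2 := Qf h'.
set K := N%:R ^+ 2 * RI _ => eB Dp m1 m2.
(* By [Dp] the quantity in [eS] is at least 4 X - 2 Y, twice the sum of the two first variations;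
   these are bounded by the two inequalities divided by lam. *)
have m3 : - 2 * (b1 + b2) <= lam * (q1 + q2) + 2 / lam * K.
  rewrite -(ler_pM2l l0); have -> : lam * (lam * (q1 + q2) + 2 / lam * K) = lam ^+ 2 * q1 + lam ^+ 2 * q2 + 2 * K.
    by field; rewrite gt_eqF.
  lra.
move: m3; rewrite eB; set z := lam * _ + _; lra.
Qed.

End two_minimizers.

(** * A modulus of continuity *)

Section modulus.
Context {R : realType} {n N : nat}.
Local Notation E := 'rV[R]_n.
Local Notation mu := (@lebesgue_rV R n).
Local Notation RI := (RI mu).
Local Notation itg := (itg mu).
Local Notation sqi := (sqi mu).

Definition bump_lap : R := RI (fun x => `|lap (bump0 : E -> R) x|).

Lemma bump_lap_facts : [/\ smooth (lap (bump0 : E -> R)), suppin (cball 0 1) (lap (bump0 : E -> R)) &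
  itg (fun x => `|lap (bump0 : E -> R) x|)].
Proof.
have cl := @closed_cball R n 0 1.
have sl : smooth (lap (bump0 : E -> R)).
  by apply: smooth_sum => a; do 2 apply: smooth_partial; exact: smooth_bump0.
have l0 : suppin (cball 0 1) (lap (bump0 : E -> R)).
  move=> x hx; rewrite /lap big1// => a _.
  exact: partial_supp a cl (partial_supp a cl (@bump0_supp R n)) x hx.
by split => //; apply: itg_abs; exact: cont_supp_itg (@compact_cball R n 0 1) l0 (smooth_cont sl).
Qed.

Lemma bump0_le1 (x : E) : bump0 x <= 1.
Proof.
rewrite /bump0 /em; case: ifP => // h; rewrite expr0 mul1r -[leRHS]expR0 ler_expR oppr_le0 invr_ge0.
exact: ltW.
Qed.

(** With phi the bump of scale t and lam = t, the two errors of [two_min] balance: multiplied by t,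
    both are of order t^n, as [mean_value] asks. *)
Lemma diff_mean (V V' : E -> 'rV[R]_N) G G' M : is_min 2 V G -> is_min 2 V' G' -> 0 <= M ->
  (forall x, l2norm x <= 1 -> sq (V x) <= M) -> (forall x, l2norm x <= 1 -> sq (V' x) <= M) ->
  forall s : R, 0 < s -> s < 1 ->
  RI psi0 * sq (V 0 - V' 0) <= s ^- n * RI (fun x => dil s 0 psi0 x * sq (V x - V' x)) +
    (2 * M * (bump_lap + 2 * bump_energy (n := n)) + 2 * (N%:R ^+ 2 * ball_vol (n := n))) * s.
Proof.
move=> H H' M0 hV hV' s s0 s1; have [sl l0 il] := bump_lap_facts.
set K := 2 * M * _ + _.
have BL0 : 0 <= bump_lap by apply: RI_ge0 => x; exact: normr_ge0.
have BE0 := @bump_energy_ge0 R n; have BV0 := @ball_vol_ge0 R n.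
have K0 : 0 <= K.
  apply: addr_ge0; first by rewrite !mulr_ge0// addr_ge0// mulr_ge0.
  by rewrite !mulr_ge0// sqr_ge0.
have iv : itg (fun x => sq (V x - V' x)).
  apply: itg_sum => i; have [_] := sqiB (im_u H i) (im_u H' i).
  by congr (itg _); apply/funext => x; rewrite !mxE.
have b0 : l2ball (0 : E) 2 0 by rewrite /l2ball /= subr0 l2norm0; lra.
have cv : {for 0, continuous (fun x => sq (V x - V' x))}.
  apply: (@sq_cont_at _ _ _ (fun x => V x - V' x)).
  by apply: continuousB; [exact: im_cont H _ b0|exact: im_cont H' _ b0].
apply: (mean_value ltr01 K0 iv cv) => // t t0 t1.
have t2 : t < 2 by lra.
have pt := dil_supp (x0 := 0) t0 (@bump0_supp R n).
have st := smooth_dil t 0 (@smooth_bump0 R n).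
have := two_min H H' st t2 pt pt (fun x => bump0_ge0 _) t0.
have p01 x : 0 <= dil t 0 (bump0 : E -> R) x <= 1 by rewrite bump0_ge0 bump0_le1.
have hVt x : l2norm x <= t -> sq (V x) <= M by move=> hx; apply: hV; lra.
have hVt' x : l2norm x <= t -> sq (V' x) <= M by move=> hx; apply: hV'; lra.
have := Qf_bound H st t2 pt p01 hVt M0; have := Qf_bound H' st t2 pt p01 hVt' M0.
have e1 : t ^+ 2 * RI (fun x => `|lap (dil t 0 (bump0 : E -> R)) x|) = t ^+ n * bump_lap.
  have -> : (fun x : E => `|lap (dil t 0 bump0) x|) = (fun x => t ^- 2 * dil t 0 (fun x => `|lap bump0 x|) x).
    apply/funext => x; rewrite lap_dil; last exact: smooth_bump0.
    by rewrite normrM ger0_norm// invr_ge0 sqr_ge0.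
  rewrite RI_Z; last exact: itg_dil.
  by rewrite RI_dil// mulVKf// expf_neq0// gt_eqF.
have e2 : t ^+ 2 * (\sum_a RI (fun x => partial a (dil t 0 (bump0 : E -> R)) x ^+ 2)) = t ^+ n * bump_energy (n := n).
  rewrite /bump_energy !mulr_sumr; apply: eq_bigr => a _.
  have l12 : 1 < 2 :> R by lra.
  have [_ i2] := test_sqi (test_partial a (test_ball_intro l12 (@smooth_bump0 R n) (@bump0_supp R n))).
  rewrite -(RI_dil 0 t0 i2) -RI_Z; last first.
    by case: (test_sqi (test_partial a (test_ball_intro t2 st pt))).
  congr RI; apply/funext => x; rewrite partial_dil; last exact: smooth_bump0.
  by rewrite /dil; field; rewrite gt_eqF.
rewrite RI_cball; last exact: t0.
set q1 := Qf _; set q2 := Qf _; set P := \sum_a _ in e2 *; set S := RI (fun x => `|_|) in e1 *.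
move=> hq1 hq2 hL.
have t20 : 0 <= t ^+ 2 by exact: sqr_ge0.
have k1 := ler_wpM2l t20 hq1; have k2 := ler_wpM2l t20 hq2.
have e3 : t ^+ 2 * (M * (S + 2 * P)) = M * (t ^+ n * bump_lap + 2 * (t ^+ n * bump_energy (n := n))).
  by rewrite -e1 -e2; ring.
rewrite e3 in k1 k2.
apply: (@le_trans _ _ (t * - (t * (q2 + q1) + 2 / t * (N%:R ^+ 2 * (t ^+ n * ball_vol (n := n)))))).
  have -> : t * - (t * (q2 + q1) + 2 / t * (N%:R ^+ 2 * (t ^+ n * ball_vol (n := n)))) =
     - (t ^+ 2 * q2 + t ^+ 2 * q1 + 2 * (N%:R ^+ 2 * (t ^+ n * ball_vol (n := n)))).
    by field; rewrite gt_eqF.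
  rewrite /K; nra.
apply: ler_wpM2l; [exact: ltW|exact: hL].
Qed.

(** [diff_mean] for V and its translate by h, whose distance in L^2 is of order |h| by [tdiff_Hc].
    The radius s stays free: it will be fixed by the tolerance before h is taken small. *)
Lemma modulus : exists2 C : R, 0 <= C & forall (V : E -> 'rV[R]_N) G M, is_min 4 V G -> 0 <= M ->
  (forall x, l2norm x <= 3 -> sq (V x) <= M) -> forall h, l2norm h <= 1 ->
  forall s : R, 0 < s -> s < 1 -> sq (V h - V 0) <= C * (M + 1) * (s ^- n * `|h| ^+ 2 + s).
Proof.
have [Cs Cs0 hC] := @psi0_bounded R n.
have c0 := @RI_psi0 R n; have [sl l0 il] := bump_lap_facts.
have BL0 : 0 <= bump_lap by apply: RI_ge0 => x; exact: normr_ge0.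
have BE0 := @bump_energy_ge0 R n; have BV0 := @ball_vol_ge0 R n.
have r2 : 0 < 2 :> R by lra.
have r34 : 3 / 2 * 2 < 4 :> R by lra.
(* The cutoff of scale 2 is 1 at x and x + h when |x| and |h| are at most 1, and its support has
   radius 3, where V is bounded. *)
have sE := smooth_dcut (n := n) (2 : R); have E0 := dil_cut_supp (n := n) r2.
set eta := dil 2 0 (cut : E -> R) in sE E0.
pose K1 := RI (fun x => `|lap eta x|) + 2 * cut_energy (n := n) 2.
have K10 : 0 <= K1.
  apply: addr_ge0; first by apply: RI_ge0 => x; exact: normr_ge0.
  by apply: mulr_ge0; [exact: ler0n|exact: cut_energy_ge0].
pose A := Cs * (24 * n%:R * K1); have A0 : 0 <= A by rewrite !mulr_ge0// ltW.
pose B := 2 * (bump_lap + 2 * bump_energy (n := n)) + 2 * (N%:R ^+ 2 * ball_vol (n := n)).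
have B0 : 0 <= B.
  by apply: addr_ge0; rewrite mulr_ge0 ?addr_ge0// mulr_ge0// sqr_ge0.
exists ((A + B) / RI psi0) => [|V G M H M0 hV h h1 s s0 s1].
  by apply: divr_ge0; [exact: addr_ge0|exact: ltW].
have z0 : l2norm (0 : E) + 1 * 2 <= 4 by rewrite l2norm0; lra.
have zh : l2norm h + 1 * 2 <= 4 by lra.
have H0 := is_min_zoom H ltr01 z0; have Hh := is_min_zoom H ltr01 zh.
have in2 (x : E) : l2norm x <= 1 -> l2ball 0 2 x by rewrite /l2ball /= subr0; lra.
have e0 x : l2norm x <= 1 -> zoomU 0 1 2 V x = V x.
  by move=> hx; rewrite zoomU_in; [rewrite invr1 !scale1r addr0|exact: in2].
have eh x : l2norm x <= 1 -> zoomU h 1 2 V x = V (x + h).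
  by move=> hx; rewrite zoomU_in; [rewrite invr1 !scale1r|exact: in2].
have b0 x : l2norm x <= 1 -> sq (zoomU 0 1 2 V x) <= M.
  by move=> hx; rewrite e0//; apply: hV; lra.
have bh x : l2norm x <= 1 -> sq (zoomU h 1 2 V x) <= M.
  move=> hx; rewrite eh//; apply: hV; apply: (le_trans (l2normD _ _)); lra.
have := diff_mean H0 Hh M0 b0 bh s0 s1.
have n01 : l2norm (0 : E) <= 1 by rewrite l2norm0.
rewrite e0// eh// add0r -sqN opprB; set K2 := 2 * M * _ + _ => hm.
have K2B : K2 <= B * (M + 1).
  rewrite /K2 /B; have : 0 <= 2 * (bump_lap + 2 * @bump_energy R n).
    by apply: mulr_ge0; [exact: ler0n|apply: addr_ge0 => //; exact: mulr_ge0].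
  have : 0 <= 2 * (N%:R ^+ 2 * @ball_vol R n) by apply: mulr_ge0; [exact: ler0n|apply: mulr_ge0; [exact: sqr_ge0|exact: BV0]].
  set x1 := 2 * (bump_lap + _); set x2 := 2 * (N%:R ^+ 2 * _).
  have -> : 2 * M * (bump_lap + 2 * bump_energy (n := n)) = M * x1 by rewrite /x1; ring.
  nra.
have Hw := Hc_phi H sE r34 E0; pose w i x := eta x * V x ord0 i.
have sw i : sqi (w i) by case: (Hw i).
have idd i : itg (fun x => (w i (x + h) - w i x) ^+ 2) by case: (sqi_shift_diff h (sw i)).
have hq : \sum_i RI (fun x => (w i (x + h) - w i x) ^+ 2) <= 24 * n%:R * `|h| ^+ 2 * (M * K1).
  apply: (@le_trans _ _ (24 * n%:R * `|h| ^+ 2 * Qf (fun i a x => eta x * G i a x + V x ord0 i * partial a eta x))).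
    by rewrite /Qf mulr_sumr; apply: ler_sum => i _; exact: tdiff_Hc (Hw i).
  rewrite ler_wpM2l ?mulr_ge0 ?sqr_ge0//.
  apply: (Qf_bound H sE r34 E0) => //; first by move=> x; exact: cut01.
  by move=> x hx; apply: hV; lra.
have h3 : RI (fun x => dil s 0 psi0 x * sq (zoomU 0 1 2 V x - zoomU h 1 2 V x)) <= Cs * (24 * n%:R * `|h| ^+ 2 * (M * K1)).
  apply: (@le_trans _ _ (Cs * \sum_i RI (fun x => (w i (x + h) - w i x) ^+ 2))); last by rewrite ler_wpM2l// ltW.
  rewrite -RI_sum// -RI_Z; last exact: itg_sum.
  apply: RI_le; last first.
  - move=> x; have [hx|hx] := pselect (cball 0 s x); last first.
      rewrite (dil_supp s0 (@psi0_supp R n) hx) mul0r mulr_ge0 ?(ltW Cs0)//.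
      by apply: sumr_ge0 => i _; exact: sqr_ge0.
    have x1 : l2norm x <= 1 by move: hx; rewrite /cball /= subr0; lra.
    have xh : l2norm (x + h) <= 2 by apply: (le_trans (l2normD _ _)); lra.
    rewrite e0// eh//; apply: ler_pM; rewrite ?psi0_ge0 ?sq_ge0//; first exact: hC.
    rewrite -sqN opprB /sq; apply: ler_sum => i _; rewrite !mxE /w /eta !dil_cut1 ?mul1r//; lra.
  - by apply: itgZ; exact: itg_sum.
  - apply: itg_psi0M => //; apply: itg_sum => i; have [_] := sqiB (im_u H0 i) (im_u Hh i).
    by congr (itg _); apply/funext => x; rewrite !mxE.
have sn : 0 <= s ^- n by rewrite invr_ge0 exprn_ge0// ltW.
have h4 := ler_wpM2l sn h3.
rewrite -(ler_pM2l c0); apply: (le_trans hm).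
have -> : RI psi0 * ((A + B) / RI psi0 * (M + 1) * (s ^- n * `|h| ^+ 2 + s)) = (A + B) * (M + 1) * (s ^- n * `|h| ^+ 2 + s).
  by field; rewrite !gt_eqF ?exprn_gt0.
have h5 : s ^- n * (Cs * (24 * n%:R * `|h| ^+ 2 * (M * K1))) = A * M * (s ^- n * `|h| ^+ 2) by rewrite /A; ring.
rewrite h5 in h4.
have t0 : 0 <= s ^- n * `|h| ^+ 2 by rewrite mulr_ge0 ?sqr_ge0.
set t := s ^- n * `|h| ^+ 2 in h4 t0 *.
have k1 : K2 * s <= B * (M + 1) * s by rewrite ler_wpM2r// ltW.
have k2 : A * M * t <= A * (M + 1) * t by rewrite ler_wpM2r// ler_wpM2l//; lra.
have k3 : 0 <= A * (M + 1) * s by rewrite !mulr_ge0//; lra.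
have k4 : 0 <= B * (M + 1) * t by rewrite !mulr_ge0//; lra.
apply: (le_trans (lerD h4 k1)); apply: (le_trans (lerD k2 (lexx _))); lra.
Qed.

End modulus.

(** * Inner variations and monotonicity *)

Section test_functions_determine.
Context {R : realType} {n : nat}.
Local Notation E := 'rV[R]_n.
Local Notation mu := (@lebesgue_rV R n).

Lemma smooth_prod (I : Type) (s : seq I) (F : I -> E -> R) :
  (forall j, smooth (F j)) -> smooth (fun x => \prod_(j <- s) F j x).
Proof.
move=> sF; elim: s => [|a s IH]; first by under eq_fun do rewrite big_nil; exact: smooth_cst.
by under eq_fun do rewrite big_cons; exact: smoothM.
Qed.

Definition obox (a b : 'I_n -> R) : set E := [set x | forall i, `]a i, b i[%classic (x ord0 i)].

Lemma measurable_obox a b : measurable (obox a b).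
Proof. exact: (@measurable_box R n (fun i => `]a i, b i[%classic) (fun i => measurable_itv _)). Qed.

Definition box_bump (a b : 'I_n -> R) : E -> R :=
  fun x => \prod_i (em 0 (x ord0 i - a i) * em 0 (b i - x ord0 i)).

Lemma smooth_box_bump a b : smooth (box_bump a b).
Proof.
apply: smooth_prod => i; apply: smoothM; apply: smooth_em; apply: smoothB;
by [exact: smooth_coord|exact: smooth_cst].
Qed.

Lemma box_bump_ge0 a b x : 0 <= box_bump a b x.
Proof. by apply: prodr_ge0 => i _; rewrite mulr_ge0 ?em_ge0. Qed.

Lemma box_bump_in a b x : obox a b x -> 0 < box_bump a b x.
Proof.
move=> xB; apply: prodr_gt0 => i _; have := xB i; rewrite /= in_itv /= => /andP[h1 h2].
by rewrite mulr_gt0// em_gt0// subr_gt0.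
Qed.

Lemma box_bump_out a b x : ~ obox a b x -> box_bump a b x = 0.
Proof.
move=> /existsNP[i]; rewrite /= in_itv /= => /negP; rewrite negb_and -!leNgt => h.
rewrite /box_bump (bigD1 i)//=; case/orP: h => h.
  by rewrite em_le0 ?mul0r// subr_le0.
by rewrite [em 0 (b i - _)]em_le0 ?mulr0 ?mul0r// subr_le0.
Qed.

Lemma obox_cball a b : exists M : R, obox a b `<=` cball 0 M.
Proof.
exists ((n%:R + 1) * (\sum_i (`|a i| + `|b i|))) => x xB; rewrite /cball /= subr0.
apply: (le_trans (l2_le_norm _)); rewrite ler_wpM2l//.
rewrite -[leLHS]/(mx_norm _) mx_normrE; apply: bigmax_le; first by apply: sumr_ge0 => i _; rewrite addr_ge0.
move=> -[i j] _ /=; rewrite (ord1 i); have := xB j; rewrite /= in_itv /= => /andP[h1 h2].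
rewrite (bigD1 j)//=; apply: (@le_trans _ _ (`|a j| + `|b j|)).
  have := ler_norm (- a j); have := ler_norm (b j); rewrite normrN.
  have := normr_ge0 (a j); have := normr_ge0 (b j).
  by rewrite ler_norml => ? ? ? ?; apply/andP; split; lra.
by rewrite lerDl; apply: sumr_ge0 => i0 _; rewrite addr_ge0.
Qed.

(** For b the bump of the box, the functions b / (b + 1/(k+1)) increase with k to the indicator of
    the box. *)
Definition box_approx a b (k : nat) : E -> R := fun x => box_bump a b x * (box_bump a b x + k.+1%:R^-1)^-1.

Lemma box_den a b k x : 0 < box_bump a b x + k.+1%:R^-1.
Proof. by rewrite ltr_wpDl ?box_bump_ge0// invr_gt0. Qed.

Lemma box_approx_facts a b k : [/\ smooth (box_approx a b k), suppin (obox a b) (box_approx a b k),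
  forall x, 0 <= box_approx a b k x & forall x, box_approx a b k x <= box_approx a b k.+1 x].
Proof.
have sb := smooth_box_bump a b.
have d0 := box_den a b; split.
- apply: smoothM => //; apply: smoothV; last by move=> x; rewrite gt_eqF.
  by apply: smoothD => //; exact: smooth_cst.
- by move=> x hx; rewrite /box_approx box_bump_out// mul0r.
- by move=> x; rewrite mulr_ge0 ?box_bump_ge0// invr_ge0 ltW.
- move=> x; rewrite /box_approx ler_wpM2l ?box_bump_ge0// lef_pV2 ?posrE//.
  by rewrite lerD2l lef_pV2 ?posrE// ler_nat.
Qed.

Lemma box_approx_cvg a b x : box_approx a b k x @[k --> \oo] --> (\1_(obox a b) x : R).
Proof.
rewrite indicE; have [xB|xB] := pselect (obox a b x); last first.
  rewrite memNset//; apply: cvg_near_cst; apply: nearW => k.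
  by have [_ k0 _ _] := box_approx_facts a b k; exact: k0.
rewrite mem_set//; have f0 := box_bump_in xB.
have h : box_bump a b x + k.+1%:R^-1 @[k --> \oo] --> box_bump a b x + 0.
  by apply: cvgD; [exact: cvg_cst|exact: cvg_harmonic].
rewrite addr0 in h.
have -> : (true%:R : R) = box_bump a b x * (box_bump a b x)^-1 by rewrite mulfV// gt_eqF.
by apply: cvgM; [exact: cvg_cst|apply: cvgV => //; rewrite gt_eqF].
Qed.

Lemma int_obox (m : {measure set E -> \bar R}) a b :
  (m (obox a b) = limn (fun k => \int[m]_x (box_approx a b k x)%:E))%E.
Proof.
have mB := measurable_obox a b.
rewrite -(setIT (obox a b)) -integral_indic//.
rewrite -monotone_convergence//.
- apply: eq_integral => x _; apply/esym/cvg_lim => //.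
  by apply: cvg_EFin; [exact: nearW|exact: box_approx_cvg].
- move=> k; apply/measurable_EFinP; apply: continuous_rV_measurable; apply: smooth_cont.
  by have [] := box_approx_facts a b k.
- by move=> k x _; rewrite lee_fin; have [_ _ + _] := box_approx_facts a b k; apply.
- move=> x _; apply/nondecreasing_seqP => k; rewrite lee_fin.
  by have [_ _ _] := box_approx_facts a b k; apply.
Qed.

(** Open boxes form a generating pi-system, and their indicators are increasing limits of
    nonnegative test functions. *)
Lemma measure_test_unique (m : {measure set E -> \bar R}) :
  (forall (M : R) g, smooth g -> suppin (cball 0 M) g -> (forall x, 0 <= g x) ->
     (\int[m]_x (g x)%:E = \int[mu]_x (g x)%:E)%E) ->
  forall A, measurable A -> mu A = m A.
Proof.
move=> hm A mA; pose G : set (set E) := [set B | exists a b, B = obox a b].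
pose g (k : nat) : set E := obox (fun=> - k%:R) (fun=> k%:R).
have Gm B : G B -> measurable B.
  by move=> [a [b ->]]; exact: measurable_obox.
have mG B : G B -> mu B = m B.
  move=> [a [b ->]]; rewrite !int_obox; congr (limn _); apply/funext => k; apply/esym.
  have [M hM] := obox_cball a b; have [sk k0 kge _] := box_approx_facts a b k.
  by apply: (hm M) => // x hx; apply: k0 => /hM.
apply: (measure_unique G g) => //.
- apply/seteqP; split; last by apply: smallest_sub; [exact: sigma_algebra_measurable|exact: Gm].
  apply: smallest_sub; first exact: smallest_sigma_algebra.
  rewrite -bigcup_seq => _ [i _] [Y mY <-]; rewrite setTI.
  have : measurable_fun setT (fun x : g_sigma_algebraType G => (x : E) ord0 i).
    apply: (measurability _ (RGenOInfty.measurableE R)) => _ [_ [c ->] <-]; rewrite setTI.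
    have -> : (fun x : g_sigma_algebraType G => (x : E) ord0 i) @^-1` `]c, +oo[%classic =
       \bigcup_k (obox (fun j => if j == i then c else - k%:R) (fun=> k%:R) : set (g_sigma_algebraType G)).
      apply/seteqP; split => x /=.
        rewrite in_itv /= andbT => cx; exists (Num.truncn `|x : E|).+1 => // j /=.
        have h : `|(x : E) ord0 j| < (Num.truncn `|x : E|).+1%:R.
          by apply: (le_lt_trans (coord_le_norm _ _)); exact: truncnS_gt.
        move: h; rewrite ltr_norml in_itv /= => /andP[h1 h2]; rewrite h2 andbT.
        by case: eqP => [->|].
      by move=> [k _ /(_ i)]; rewrite /= eqxx !in_itv /= andbT => /andP[].
    apply: bigcupT_measurable => k; apply: sub_sigma_algebra.
    by exists (fun j => if j == i then c else - k%:R), (fun=> k%:R).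
  move=> /(_ measurableT Y mY); rewrite setTI; exact.
- move=> _ _ [a [b ->]] [a' [b' ->]].
  exists (fun i => Num.max (a i) (a' i)), (fun i => Num.min (b i) (b' i)).
  apply/seteqP; split=> x /=.
    move=> [h1 h2] i; have := h1 i; have := h2 i; rewrite /= !in_itv /= => /andP[? ?] /andP[? ?].
    by rewrite gt_max lt_min; apply/andP; split; apply/andP.
  move=> h; split=> i; have := h i; rewrite /= !in_itv /= gt_max lt_min => /andP[/andP[? ?] /andP[? ?]];
  by apply/andP.
- by move=> k; exists (fun=> - k%:R), (fun=> k%:R).
- apply/seteqP; split=> // x _; exists (Num.truncn `|x|).+1 => // i; rewrite /= in_itv /= -ltr_norml.
  by apply: (le_lt_trans (coord_le_norm _ _)); exact: truncnS_gt.
- move=> k; apply: le_lt_trans (cube_lty k%:R); apply: le_measure; rewrite ?inE//.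
  + exact: measurable_obox.
  + exact: (@measurable_box R n (fun=> `[(- k%:R), k%:R]%classic) (fun=> measurable_itv _)).
  + by move=> x h i; have := h i; rewrite /= !in_itv /= => /andP[/ltW -> /ltW ->].
Qed.

End test_functions_determine.

(** * Deformations along one coordinate *)

Section shear.
Context {R : realType} {n : nat}.
Local Notation E := 'rV[R]_n.
Local Notation mu := (@lebesgue_rV R n).
Local Notation RI := (RI mu).
Local Notation itg := (itg mu).
Local Notation sqi := (sqi mu).

Variables (a : 'I_n) (eta : E -> R) (r : R).
Hypothesis (seta : smooth eta) (eta0 : suppin (cball 0 r) eta).
Local Notation e := (delta_mx ord0 a : E).

(** Only the coordinate a moves, so the Jacobian is 1 + t d_a eta and no determinant is expanded.
    Stationarity is linear in the field, so that other fields are reached by summing over a. *)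
Definition shear (t : R) (x : E) : E := x + t *: (eta x *: e).

Lemma shear_coord t x i : shear t x ord0 i = x ord0 i + t * (eta x * (i == a)%:R).
Proof. by rewrite !mxE eqxx. Qed.

Lemma shear_id t x : eta x = 0 -> shear t x = x.
Proof. by move=> h; rewrite /shear h scale0r scaler0 addr0. Qed.

Lemma measurable_shear t : measurable_fun setT (shear t).
Proof.
apply: measurable_fun_rV => i; under eq_fun do rewrite shear_coord.
apply: measurable_funD; first exact: measurable_coord.
apply: measurable_funM => //; apply: measurable_funM => //.
exact: continuous_rV_measurable (smooth_cont seta).
Qed.

(** The chain rule with a quadratic remainder, the form from which [differentiable_quad] yields
    differentiability. *)
Lemma shear_quad M g t x : smooth g -> suppin (cball 0 M) g ->
  exists C, forall h, `|g (shear t (x + h)) - g (shear t x) -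
     \sum_b h ord0 b * (partial b g (shear t x) + t * partial b eta x * partial a g (shear t x))| <= C * `|h| ^+ 2.
Proof.
move=> sg g0; have cM := @compact_cball R n 0 M; have cr := @compact_cball R n 0 r.
have [Cg Cg0 hg] := smooth_taylor cM g0 sg; have [Ce Ce0 he] := smooth_taylor cr eta0 seta.
have [L L0 hL] := smooth_lip cr eta0 seta.
have pg0 := partial_supp a (@closed_cball _ _ _ _) g0.
have [P P0 hP] := supp_bounded cM pg0 (smooth_cont (smooth_partial a sg)).
exists (Cg * (1 + `|t| * L) ^+ 2 + `|t| * Ce * P) => h.
pose d := eta (x + h) - eta x; pose k := h + t *: (d *: e).
have ek : shear t (x + h) = shear t x + k.
  by rewrite /shear /k /d !scalerBl !scalerBr; apply/rowP => i; rewrite !mxE; ring.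
have kn : `|k| <= (1 + `|t| * L) * `|h|.
  apply: (le_trans (ler_normD _ _)); rewrite mulrDl mul1r lerD2l !normrZ -mulrA ler_wpM2l//.
  by apply: (@le_trans _ _ `|d|); [rewrite ler_piMr//; exact: delta_norm|exact: hL].
rewrite ek; have h1 := hg (shear t x) k; have h2 := he x h.
set Y := shear t x in h1 *.
have sk : \sum_b k ord0 b * partial b g Y = \sum_b h ord0 b * partial b g Y + t * d * partial a g Y.
  transitivity (\sum_b (h ord0 b * partial b g Y + t * d * ((b == a)%:R * partial b g Y))).
    by apply: eq_bigr => b _; rewrite !mxE eqxx /=; ring.
  rewrite big_split /= -mulr_sumr; congr (_ + _ * _).
  by rewrite (bigD1 a)//= eqxx mul1r big1 ?addr0// => b /negPf ->; rewrite mul0r.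
have sh : \sum_b h ord0 b * (partial b g Y + t * partial b eta x * partial a g Y) =
   \sum_b h ord0 b * partial b g Y + t * (\sum_b h ord0 b * partial b eta x) * partial a g Y.
  rewrite -mulrA mulr_suml mulr_sumr -big_split /=; apply: eq_bigr => b _; ring.
rewrite sk in h1; rewrite sh -/d in h2 *.
set S1 := \sum_b _ in h1 *; set S2 := \sum_b _ in h2 *; set p := partial a g Y in h1 *.
have -> : g (Y + k) - g Y - (S1 + t * S2 * p) = (g (Y + k) - g Y - (S1 + t * d * p)) + t * (d - S2) * p by ring.
apply: (le_trans (ler_normD _ _)); rewrite mulrDl; apply: lerD.
  apply: (le_trans h1); rewrite -mulrA ler_wpM2l// -exprMn ler_sqr ?nnegrE//.
  by rewrite mulr_ge0// addr_ge0// mulr_ge0.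
rewrite !normrM; have -> : `|t| * Ce * P * `|h| ^+ 2 = `|t| * (Ce * `|h| ^+ 2) * P by ring.
by rewrite ler_pM// ?mulr_ge0//; [rewrite ler_wpM2l|exact: hP].
Qed.

Lemma shear_partial M g t : smooth g -> suppin (cball 0 M) g ->
  (forall x, differentiable (fun x => g (shear t x)) x) /\
  forall b, partial b (fun x => g (shear t x)) =
    fun x => partial b g (shear t x) + t * partial b eta x * partial a g (shear t x).
Proof.
move=> sg g0; split=> [x|b].
  have [C hC] := shear_quad t x sg g0.
  by have [] := @differentiable_quad R n (fun x => g (shear t x)) x _ C hC.
apply/funext => x; have [C hC] := shear_quad t x sg g0.
by have [_ ->] := @differentiable_quad R n (fun x => g (shear t x)) x _ C hC.
Qed.

Lemma smooth_shear M g t : smooth g -> suppin (cball 0 M) g -> smooth (fun x => g (shear t x)).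
Proof.
move=> sg g0; have cl := @closed_cball R n 0 M.
apply: (smooth_step (P := fun f => exists g, [/\ smooth g, suppin (cball 0 M) g & f = fun x => g (shear t x)])).
- by move=> _ [g1 [sg1 g10 ->]] x; have [] := shear_partial t sg1 g10.
- move=> k _ i [g1 [sg1 g10 ->]] IH; have [_ ->] := shear_partial t sg1 g10.
  have IHp b : smoothk k (fun x => partial b g1 (shear t x)).
    by apply: IH; exists (partial b g1); split => //; [exact: smooth_partial|exact: partial_supp].
  apply: smoothkD => //; apply: smoothkM => //; apply: smoothkM; first exact: smoothk_cst.
  by have /smoothkP := smooth_partial i seta; apply.
- by exists g.
Qed.

Lemma shear_supp M g t : 0 <= M -> suppin (cball 0 M) g ->
  suppin (cball 0 (Num.max M r)) (fun x => g (shear t x)).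
Proof.
move=> M0 g0 x hx; have hr : ~ cball 0 r x.
  by move=> h; apply: hx; rewrite /cball /=; apply: (le_trans h); rewrite le_max lexx orbT.
rewrite shear_id ?eta0// g0// => h; apply: hx; rewrite /cball /=; apply: (le_trans h).
by rewrite le_max lexx.
Qed.

(* [d/dt (g o T_t * (1 + t d_a eta)) = d_a (eta * g o T_t)] integrates to zero *)
Lemma shear_test M g t : 0 <= M -> smooth g -> suppin (cball 0 M) g ->
  itg (fun x => g (shear t x) * (1 + t * partial a eta x)) /\
  RI (fun x => g (shear t x) * (1 + t * partial a eta x)) = RI g.
Proof.
move=> M0 sg g0; have spe := smooth_partial a seta.
pose F t x := g (shear t x) * (1 + t * partial a eta x).
have cl := @closed_cball R n 0 M; have cM := @compact_cball R n 0 M; have cr := @compact_cball R n 0 r.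
set M1 := Num.max M r; have cM1 := @compact_cball R n 0 M1.
have sF s : smooth (F s).
  apply: smoothM; first exact: smooth_shear g0.
  by apply: smoothD; [exact: smooth_cst|exact: smoothZ].
have F0 s : suppin (cball 0 M1) (F s).
  by move=> x hx; rewrite /F (shear_supp s M0 g0 hx) mul0r.
have iF s : itg (F s) by exact: cont_supp_itg cM1 (F0 s) (smooth_cont (sF s)).
have spg := smooth_partial a sg; have pg0 := partial_supp a cl g0.
have dF (s : R) x : is_derive s 1 (fun s => F s x) (eta x * partial a g (shear s x) * (1 + s * partial a eta x) + g (shear s x) * partial a eta x).
  have d1 := line_derive (smooth_diff (x + s *: (eta x *: e)) sg).
  have d2 : is_derive s 1 (fun s : R => 1 + s * partial a eta x) (partial a eta x).
    have := is_deriveD (is_derive_cst (1 : R) s 1) (is_deriveM (is_derive_id s 1) (is_derive_cst (partial a eta x) s 1)).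
    by rewrite /GRing.scale /= mulr1 mulr0 !add0r.
  have := is_deriveM d1 d2.
  rewrite derive_partials; last exact: smooth_diff.
  have -> : \sum_(i < n) (eta x *: e) ord0 i * partial i g (x + s *: (eta x *: e)) = eta x * partial a g (shear s x).
    rewrite (bigD1 a)//= !mxE !eqxx mulr1 big1 ?addr0// => i /negPf ia.
    by rewrite !mxE ia andbF mulr0 mul0r.
  move=> h; apply: (is_derive_eq h); rewrite /GRing.scale /= -/(shear s x); ring.
have [Ce Ce0 hCe] := supp_bounded cr eta0 (smooth_cont seta).
have pe0 := partial_supp a (@closed_cball R n 0 r) eta0.
have [Cp Cp0 hCp] := supp_bounded cr pe0 (smooth_cont spe).
have [Cg Cg0 hCg] := supp_bounded cM g0 (smooth_cont sg).
have [Cd Cd0 hCd] := supp_bounded cM pg0 (smooth_cont spg).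
have D0 (s : R) : is_derive s 1 (fun s => RI (F s)) 0.
  have Is : `](s - 1), (s + 1)[%classic s by rewrite /= in_itv /=; apply/andP; split; lra.
  pose K := Ce * Cd * (1 + (`|s| + 1) * Cp) + Cg * Cp.
  have K0 : 0 <= K by rewrite addr_ge0 ?mulr_ge0// addr_ge0// mulr_ge0// addr_ge0.
  have iG : itg (fun x => K * \1_(cball (0 : E) r) x).
    by apply: itgZ; apply: itg_indic; [exact: measurable_cball|exact: mu_cball_lty].
  have G0 (x : E) : 0 <= K * \1_(cball (0 : E) r) x by rewrite mulr_ge0// indicE.
  have iF' (u : R) : `](s - 1), (s + 1)[%classic u -> mu.-integrable setT (EFin \o F u) by move=> _; exact: iF.
  have dF1 (u : R) x : `](s - 1), (s + 1)[%classic u -> setT x -> derivable (F^~ x) u 1.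
    by move=> _ _; case: (dF u x).
  have e1 (u : R) x : derive1 (F^~ x) u = eta x * partial a g (shear u x) * (1 + u * partial a eta x) + g (shear u x) * partial a eta x.
    by rewrite derive1E; case: (dF u x).
  have hG (u : R) x : `](s - 1), (s + 1)[%classic u -> setT x -> `|partial1of2 F u x| <= K * \1_(cball (0 : E) r) x.
    rewrite /= in_itv /= => /andP[u1 u2] _; rewrite /partial1of2 e1 indicE.
    have [hx|hx] := pselect (cball 0 r x); last first.
      by rewrite memNset// mulr0 eta0// pe0// !mul0r mulr0 addr0 normr0.
    rewrite mem_set// mulr1; apply: (le_trans (ler_normD _ _)); apply: lerD; rewrite !normrM.
      apply: ler_pM; rewrite ?mulr_ge0//; first by rewrite ler_pM.
      apply: (le_trans (ler_normD _ _)); rewrite normr1 lerD2l normrM ler_pM//.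
      have := ler_norm s; have := ler_norm (- s); rewrite normrN => ? ?.
      by rewrite ler_norml; apply/andP; split; lra.
    by rewrite ler_pM.
  have dd := derivable_under_integral measurableT Is iF' dF1 G0 iG hG.
  have ee := differentiation_under_integral measurableT Is iF' dF1 G0 iG hG.
  split; first exact: dd.
  rewrite -derive1E; apply: etrans ee _.
  have sgs : smooth (fun x => g (shear s x)) by exact: smooth_shear g0.
  have tot : suppin (cball 0 r) (fun x => eta x * g (shear s x)).
    by move=> x hx; rewrite eta0// mul0r.
  have ef : partial1of2 F s = partial a (fun x => eta x * g (shear s x)).
    apply/funext => x; rewrite /partial1of2 e1 partialM; [|by move=> y; exact: smooth_diff..].
    have [_ ->] := shear_partial s sg g0; ring.
  by rewrite ef; exact: (RI_partial0 a cr tot (smoothM seta sgs)).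
split; first exact: iF.
have := @is_derive_0_is_cst R (fun s => RI (F s)) t 0 D0; rewrite /F => ->; congr RI; apply/funext => x.
by rewrite mul0r addr0 mulr1 /shear scale0r addr0.
Qed.

Variable t : R.
Hypothesis (J0 : forall x, 0 <= 1 + t * partial a eta x).

Lemma measurable_jac : measurable_fun setT (fun x : E => 1 + t * partial a eta x).
Proof.
apply: measurable_funD => //; apply: measurable_funM => //.
exact: continuous_rV_measurable (smooth_cont (smooth_partial a seta)).
Qed.

(** [shear_test] is the change of variables for test functions, and a measure is determined by its
    integrals of nonnegative test functions. *)
Lemma shear_dmE A : measurable A ->
  density_measure mu J0 measurable_jac (measurable_shear t) A = mu A.
Proof.
move=> mA; apply/esym; apply: (measure_test_unique (m := density_measure mu J0 measurable_jac (measurable_shear t))) => // M g sg g0 gge.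
have mg := continuous_rV_measurable (smooth_cont sg).
apply: (etrans (integral_density mu J0 measurable_jac (measurable_shear t) _ _)).
- exact/measurable_EFinP.
- by move=> x; rewrite lee_fin.
have g0' : suppin (cball 0 `|M|) g.
  move=> x hx; apply: g0 => h; apply: hx; rewrite /cball /=; apply: (le_trans h).
  exact: ler_norm.
have [i1 e1] := shear_test t (normr_ge0 M) sg g0'.
have ig : itg g by exact: cont_supp_itg (@compact_cball R n 0 M) g0 (smooth_cont sg).
by rewrite -(EFin_RI ig) -e1 EFin_RI//.
Qed.

End shear.

(** * Deformed minimizers as competitors *)

Section inner_variation.
Context {R : realType} {n N : nat}.
Local Notation E := 'rV[R]_n.
Local Notation mu := (@lebesgue_rV R n).
Local Notation RI := (RI mu).
Local Notation itg := (itg mu).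
Local Notation sqi := (sqi mu).

Lemma dcut_partial0 (s : R) (a : 'I_n) (x : E) : 0 < s -> l2norm x < s -> partial a (dil s 0 cut) x = 0.
Proof.
move=> s0 xs; pose K := [set y : E | s <= l2norm y].
have cK : closed K.
  have -> : K = (@l2norm R n) @^-1` [set y | s <= y] by [].
  by apply: closed_comp => [y _|]; [exact: cont_l2norm|exact: closed_ge].
have f0 : suppin K (fun y => 1 - dil s 0 cut y).
  by move=> y /negP; rewrite -ltNge => ys; rewrite dil_cut1 ?subrr// ltW.
have := partial_supp a cK f0; rewrite partialB.
- by move=> /(_ x); rewrite partial_cst sub0r => h; apply/eqP; rewrite -oppr_eq0 h// /K /= leNgt xs.
- by move=> y; apply: smooth_diff; exact: smooth_cst.
- by move=> y; apply: smooth_diff; exact: smooth_dcut.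
Qed.

Lemma sqr3 (x y z : R) : (x + (y + z)) ^+ 2 <= 3 * (x ^+ 2 + y ^+ 2 + z ^+ 2).
Proof.
have := sqr_ge0 (x - y); have := sqr_ge0 (x - z); have := sqr_ge0 (y - z); nra.
Qed.

Section composition.
Variables (a : 'I_n) (eta : E -> R) (r t : R).
Hypothesis (seta : smooth eta) (eta0 : suppin (cball 0 r) eta).
Hypothesis (J2 : forall x, 2^-1 <= 1 + t * partial a eta x).
Local Notation T := (shear a eta t).

Let J0 x : 0 <= 1 + t * partial a eta x.
Proof. by apply: le_trans (J2 x); rewrite invr_ge0. Qed.

Let dmE := shear_dmE seta eta0 J0.

Lemma itg_shear F : itg F -> (forall x, 0 <= F x) -> itg (fun x => F (T x)) /\ RI (fun x => F (T x)) <= 2 * RI F.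
Proof.
move=> iF F0; have [i1 e1] := RI_cv dmE iF.
have b x : F (T x) <= 2 * (F (T x) * (1 + t * partial a eta x)).
  have := J2 x; have := F0 (T x); set q := F _; set j := 1 + _ => q0 hj.
  have : q * 2^-1 <= q * j by rewrite ler_wpM2l.
  lra.
have i2 : itg (fun x => F (T x)).
  apply: (itg_le _ _ (itgZ 2 i1)).
    by apply: measurableT_comp; [exact: itg_meas iF|exact: measurable_shear].
  by move=> x; rewrite ger0_norm.
by split=> //; rewrite -e1 -RI_Z//; apply: RI_le => //; exact: itgZ.
Qed.

Lemma sqi_shear F : sqi F -> sqi (fun x => F (T x)) /\ RI (fun x => F (T x) ^+ 2) <= 2 * RI (fun x => F x ^+ 2).
Proof.
move=> [mF iF]; have [i1 e1] := itg_shear iF (fun x => sqr_ge0 _).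
by split=> //; split=> //; apply: measurableT_comp => //; exact: measurable_shear.
Qed.

(** The chain rule holds for smooth functions and passes to L^2 limits: composition with the shear
    is bounded on L^2 because the Jacobian is at least 1/2. *)
Lemma weakd_shear (x0 : E) rho f g b : Hc x0 rho f g ->
  weakd setT (fun x => f (T x)) (fun x => g b (T x) + t * partial b eta x * g a (T x)) b.
Proof.
move=> H psi tp; have [sf sg _ _] := H; have [r' rr happ] := Hc_approx H.
have [spsi _ _] := tp; have s1 := test_sqi tp; have s2 := test_sqi (test_partial b tp).
have spe := smooth_partial b seta.
have pe0 := partial_supp b (@closed_cball _ _ _ _) eta0.
have [L L0 hL] := supp_bounded (@compact_cball R n 0 r) pe0 (smooth_cont spe).
have mq : measurable_fun setT (fun x : E => t * partial b eta x).
  by apply: measurable_funM => //; exact: continuous_rV_measurable (smooth_cont spe).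
have hq x : `|t * partial b eta x| <= `|t| * L by rewrite normrM ler_wpM2l.
have s3 : sqi (fun x => t * partial b eta x * psi x) by exact: sqi_bM mq hq s1.
apply/eqP; rewrite -subr_eq0 opprK; apply/eqP.
pose A := 6 * (RI (fun x => partial b psi x ^+ 2) + RI (fun x => psi x ^+ 2) + RI (fun x => (t * partial b eta x * psi x) ^+ 2)).
have p1 := RI_sqr_ge0 mu (partial b psi); have p2 := RI_sqr_ge0 mu psi.
have p3 := RI_sqr_ge0 mu (fun x => t * partial b eta x * psi x).
apply: (@sqr_small0 _ _ A); first by rewrite mulr_ge0// !addr_ge0.
move=> d d0; have [phi [sp ph0 h1 h2]] := happ _ d0.
have cB := @compact_cball R n x0 r'.
have tphi : test_function setT phi by exact: (test_fun_intro sp cB).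
have [M M0 KM] := compact_bounded_rV cB.
have ph0' : suppin (cball 0 ((n%:R + 1) * M)) phi.
  move=> x hx; apply: ph0 => /KM kx; apply: hx; rewrite /cball /= subr0.
  by apply: (le_trans (l2_le_norm _)); rewrite ler_wpM2l.
have [_ pT] := shear_partial a seta eta0 t sp ph0'.
have spT := smooth_shear a seta eta0 t sp ph0'.
pose f1 x := f x - phi x; pose g1 c x := g c x - partial c phi x.
have sf1 : sqi f1 by apply: sqiB => //; exact: test_sqi tphi.
have sg1 c : sqi (g1 c) by apply: sqiB => //; exact: test_sqi (test_partial c tphi).
have [sfT bf] := sqi_shear sf1; have [sgT bg] := sqi_shear (sg1 b); have [saT ba] := sqi_shear (sg1 a).
have hf1 : RI (fun x => f1 x ^+ 2) <= d.
  by move: h1; congr (_ <= _); congr RI; apply/funext => x; rewrite /f1 -sqrrN opprB.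
have hg1 c : RI (fun x => g1 c x ^+ 2) <= d.
  by have := h2 c; congr (_ <= _); congr RI; apply/funext => x; rewrite /g1 -sqrrN opprB.
have zero : RI (fun x => phi (T x) * partial b psi x) + RI (fun x => partial b (fun x => phi (T x)) x * psi x) = 0.
  have spp : smooth (fun x => phi (T x) * psi x) by exact: smoothM.
  have [K [cK _ pK]] := test_compact tp.
  have K0 : suppin K (fun x => phi (T x) * psi x) by move=> x /pK ->; rewrite mulr0.
  have := RI_partial0 b cK K0 spp; rewrite partialM; [|by move=> y; exact: smooth_diff..].
  rewrite RI_D; first by move=> e1; rewrite -[RHS]e1; congr (_ + RI _); apply/funext => x; rewrite mulrC.
  - have [sfp _] := sqi_shear (test_sqi tphi); exact: sqi_mul.
  - have pK' : suppin K (fun x => psi x * partial b (fun x => phi (T x)) x) by move=> x /pK ->; rewrite mul0r.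
    by apply: cont_supp_itg cK pK' (smooth_cont _); apply: smoothM => //; exact: smooth_partial.
have [sft _] := sqi_shear sf; have [sgt _] := sqi_shear (sg b); have [sat _] := sqi_shear (sg a).
have [spt _] := sqi_shear (test_sqi tphi).
have [spbt _] := sqi_shear (test_sqi (test_partial b tphi)).
have [spat _] := sqi_shear (test_sqi (test_partial a tphi)).
have e0 : RI (fun x => f (T x) * partial b psi x) +
    RI (fun x => (g b (T x) + t * partial b eta x * g a (T x)) * psi x) =
  RI (fun x => f1 (T x) * partial b psi x) + (RI (fun x => g1 b (T x) * psi x) + RI (fun x => g1 a (T x) * (t * partial b eta x * psi x))).
  have := zero; rewrite pT.
  have -> : (fun x => (partial b phi (T x) + t * partial b eta x * partial a phi (T x)) * psi x) =
    (fun x => partial b phi (T x) * psi x + partial a phi (T x) * (t * partial b eta x * psi x)).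
    by apply/funext => x; ring.
  have -> : (fun x => (g b (T x) + t * partial b eta x * g a (T x)) * psi x) =
    (fun x => g b (T x) * psi x + g a (T x) * (t * partial b eta x * psi x)).
    by apply/funext => x; ring.
  rewrite !RI_D; try exact: sqi_mul.
  have dist (F F' P : E -> R) : sqi F -> sqi F' -> sqi P -> RI (fun x => (F x - F' x) * P x) = RI (fun x => F x * P x) - RI (fun x => F' x * P x).
    by move=> k1 k2 k3; rewrite -RI_B; [congr RI; apply/funext => x; rewrite mulrBl|exact: sqi_mul..].
  rewrite /f1 /g1 (dist (fun x => f (T x)) (fun x => phi (T x)))// (dist (fun x => g b (T x)) (fun x => partial b phi (T x)))//.
  rewrite (dist (fun x => g a (T x)) (fun x => partial a phi (T x)))//.
  set y1 := RI (fun x => phi _ * _); set y2 := RI (fun x => partial b phi _ * _); set y3 := RI (fun x => partial a phi _ * _).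
  set y4 := RI (fun x => f _ * _); set y5 := RI (fun x => g b _ * _); set y6 := RI (fun x => g a _ * _).
  by move=> z0; rewrite -[LHS]subr0 -z0; ring.
rewrite e0; set X1 := RI _; set X2 := RI _; set X3 := RI _.
have c1 : X1 ^+ 2 <= 2 * d * RI (fun x => partial b psi x ^+ 2).
  apply: (le_trans (RI_CS sfT s2)); rewrite ler_wpM2r//; by apply: (le_trans bf); rewrite ler_wpM2l.
have c2 : X2 ^+ 2 <= 2 * d * RI (fun x => psi x ^+ 2).
  apply: (le_trans (RI_CS sgT s1)); rewrite ler_wpM2r//; by apply: (le_trans bg); rewrite ler_wpM2l// hg1.
have c3 : X3 ^+ 2 <= 2 * d * RI (fun x => (t * partial b eta x * psi x) ^+ 2).
  apply: (le_trans (RI_CS saT s3)); rewrite ler_wpM2r//; by apply: (le_trans ba); rewrite ler_wpM2l// hg1.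
apply: (le_trans (sqr3 _ _ _)).
apply: (@le_trans _ _ (3 * (2 * d * RI (fun x => partial b psi x ^+ 2) + 2 * d * RI (fun x => psi x ^+ 2) +
  2 * d * RI (fun x => (t * partial b eta x * psi x) ^+ 2)))).
  by rewrite ler_wpM2l//; apply: lerD c3; exact: lerD.
by rewrite /A le_eqVlt; apply/orP; left; apply/eqP; ring.
Qed.

End composition.

Variables (rho : R) (U : E -> 'rV[R]_N) (G : 'I_N -> 'I_n -> E -> R).
Hypothesis (rho0 : 0 < rho) (H : is_min rho U G).
Local Notation u i := (fun x => U x ord0 i).

(** [weakd_shear] asks for compact support, so U is first multiplied by a cutoff equal to 1 up to
    radius 3 rho / 5. Points of the ball of radius r < rho / 2 move by at most rho / 20, hence stay
    where the cutoff is 1; other points do not move. *)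
Lemma shear_competitor (a : 'I_n) (eta : E -> R) (r t L : R) : smooth eta -> suppin (cball 0 r) eta ->
  (forall x, `|eta x| <= L) -> 2 * r < rho -> `|t| * L <= rho / 20 ->
  (forall x, 2^-1 <= 1 + t * partial a eta x) ->
  RI (en U G) <= RI (en (fun x => U (shear a eta t x))
    (fun i b x => G i b (shear a eta t x) + t * partial b eta x * G i a (shear a eta t x))) /\
  itg (en (fun x => U (shear a eta t x))
    (fun i b x => G i b (shear a eta t x) + t * partial b eta x * G i a (shear a eta t x))).
Proof.
move=> seta eta0 hL hr htL J2; set T := shear a eta t.
have s0 : 0 < rho * (3 / 5) by rewrite mulr_gt0// divr_gt0.
have rr : 3 / 2 * (rho * (3 / 5)) < rho by lra.
pose chi := dil (rho * (3 / 5)) 0 (cut : E -> R).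
have Hf := Hc_phi H (smooth_dcut _) rr (dil_cut_supp s0).
have J0 x : 0 <= 1 + t * partial a eta x by apply: le_trans (J2 x); rewrite invr_ge0.
have dmE := shear_dmE seta eta0 J0.
pose f i x := chi x * U x ord0 i; pose g i b x := chi x * G i b x + U x ord0 i * partial b chi x.
have Tx x : cball 0 r x -> l2norm (T x) < rho * (3 / 5).
  rewrite /cball /= subr0 => xr; apply: (le_lt_trans (l2normD _ _)); rewrite !l2normZ.
  have d1 : l2norm (delta_mx ord0 a : E) = 1.
    rewrite /l2norm (bigD1 a)//= mxE !eqxx expr1n big1 ?addr0 ?sqrtr1// => i /negPf ia.
    by rewrite mxE ia andbF expr0n.
  have : `|t| * (`|eta x| * l2norm (delta_mx ord0 a : E)) <= rho / 20.
    by rewrite d1 mulr1; apply: le_trans htL; rewrite ler_wpM2l.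
  lra.
have in1 y : l2norm y < rho * (3 / 5) -> (forall i, f i y = U y ord0 i) /\ (forall i b, g i b y = G i b y).
  move=> hy; have c1 : chi y = 1 by apply: dil_cut1 => //; exact: ltW.
  split=> [i|i b]; first by rewrite /f c1 mul1r.
  by rewrite /g c1 mul1r [partial b chi y]dcut_partial0// mulr0 addr0.
have cl := @closed_cball R n 0 r.
have pe0 b := partial_supp b cl eta0.
have out x : ~ cball 0 r x -> T x = x /\ forall b, partial b eta x = 0.
  by move=> hx; split=> [|b]; [apply: shear_id; exact: eta0|exact: pe0].
pose w i x := f i (T x) - f i x.
pose h i b x := g i b (T x) + t * partial b eta x * g i a (T x) - g i b x.
have spe b : exists C, forall x, `|t * partial b eta x| <= C.
  have [C C0 hC] := supp_bounded (@compact_cball R n 0 r) (pe0 b) (smooth_cont (smooth_partial b seta)).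
  by exists (`|t| * C) => x; rewrite normrM ler_wpM2l.
have mpe b : measurable_fun setT (fun x : E => t * partial b eta x).
  by apply: measurable_funM => //; exact: continuous_rV_measurable (smooth_cont (smooth_partial b seta)).
have sqT F : sqi F -> sqi (fun x => F (T x)) by move=> sF; have [] := sqi_shear seta eta0 J2 sF.
have sh b (g1 : 'I_n -> E -> R) : (forall c, sqi (g1 c)) -> sqi (fun x => g1 b (T x) + t * partial b eta x * g1 a (T x)).
  move=> sg1; have [C hC] := spe b; apply: sqiD; first exact: sqT.
  exact: sqi_bM (mpe b) hC (sqT _ (sg1 a)).
have Hw i : Hc 0 rho (w i) (h i).
  have [sf sg _ wf] := Hf i; split.
  - by apply: sqiB => //; exact: sqT.
  - by move=> b; apply: sqiB; [exact: sh|exact: sg].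
  - exists r; split; first by lra.
      by move=> x /out[e1 _]; rewrite /w e1 subrr.
    by move=> b x /out[e1 e2]; rewrite /h e1 e2 mulr0 mul0r addr0 subrr.
  - move=> b psi tp; have := weakd_shear seta eta0 J2 b (Hf i) tp; have := wf b psi tp.
    have s1 := test_sqi tp; have s2 := test_sqi (test_partial b tp).
    have k1 : sqi (fun x => f i (T x)) by exact: sqT.
    have k2 := sh b (g i) sg.
    have -> : (fun x => w i x * partial b psi x) = (fun x => f i (T x) * partial b psi x - f i x * partial b psi x).
      by apply/funext => x; rewrite mulrBl.
    have -> : (fun x => h i b x * psi x) = (fun x => (g i b (T x) + t * partial b eta x * g i a (T x)) * psi x - g i b x * psi x).
      by apply/funext => x; rewrite mulrBl.
    rewrite RI_B; [|exact: sqi_mul k1 s2|exact: sqi_mul sf s2].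
    rewrite RI_B; [|exact: sqi_mul k2 s1|exact: sqi_mul (sg b) s1].
    move=> e1 e2; rewrite -/(f i) -/(g i) in e1 e2; move: e1 e2.
    by move=> -> ->; rewrite opprB addrC opprK.
have eU x : U x + \row_i w i x = U (T x).
  apply/rowP => i; rewrite !mxE /w; have [hx|hx] := pselect (cball 0 r x); last first.
    by have [-> _] := out x hx; rewrite subrr addr0.
  have hx' : l2norm x < rho * (3 / 5) by move: hx; rewrite /cball /= subr0; lra.
  have [-> _] := in1 _ (Tx x hx); have [-> _] := in1 x hx'.
  by rewrite addrC subrK.
have eG i b x : G i b x + h i b x = G i b (T x) + t * partial b eta x * G i a (T x).
  rewrite /h; have [hx|hx] := pselect (cball 0 r x); last first.
    by have [-> ->] := out x hx; rewrite !mulr0 !mul0r !addr0 subrr addr0.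
  have hx' : l2norm x < rho * (3 / 5) by move: hx; rewrite /cball /= subr0; lra.
  have [_ h1] := in1 _ (Tx x hx); have [_ h2] := in1 x hx'.
  by rewrite !h1 h2 addrC subrK.
have ow : {ae mu, forall x, ordered (U x + \row_i w i x)}.
  have Jp x : 0 < 1 + t * partial a eta x by apply: lt_le_trans (J2 x); rewrite invr_gt0.
  by apply: filterS (ae_cv dmE Jp (im_ord H)) => x; rewrite eU.
have := im_min H Hw ow.
have -> : (fun x => U x + \row_i w i x) = fun x => U (T x) by apply/funext.
have -> : (fun i b x => G i b x + h i b x) = fun i b x => G i b (T x) + t * partial b eta x * G i a (T x).
  by apply/funext => i; apply/funext => b; apply/funext => x.
split => //; apply: (@itg_en _ _ _ 0 rho).
- by move=> i; have [] := sqT _ (im_u H i).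
- move=> x hx; rewrite -eU (im_u0 H hx) add0r; apply/rowP => i; rewrite !mxE.
  have [_ _ [r' [rr' w0 _]] _] := Hw i; apply: w0 => h'; apply: hx.
  exact: (cball_l2ball rr').
- by move=> i b; apply: (sh b (G i)) => c; exact: im_g H i c.
Qed.

End inner_variation.

(** * Stationarity and the Weiss energy *)

Section inner_variation_identity.
Context {R : realType} {n N : nat}.
Local Notation E := 'rV[R]_n.
Local Notation mu := (@lebesgue_rV R n).
Local Notation RI := (RI mu).
Local Notation itg := (itg mu).
Local Notation sqi := (sqi mu).

Variables (rho : R) (U : E -> 'rV[R]_N) (G : 'I_N -> 'I_n -> E -> R).
Hypothesis (rho0 : 0 < rho) (H : is_min rho U G).
Local Notation u i := (fun x => U x ord0 i).
Local Notation F1 := (en U G).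

Definition stress (b a : 'I_n) (x : E) : R := \sum_i G i b x * G i a x.

Lemma itg_F1 : itg F1.
Proof.
by apply: (@itg_en _ _ _ 0 rho _ _ _ (im_u0 H) (im_g H)) => i; case: (im_u H i).
Qed.

Lemma F1_ge0 x : 0 <= F1 x.
Proof.
by rewrite addr_ge0 ?W_ge0//; apply: sumr_ge0 => i _; apply: sumr_ge0 => a _; exact: sqr_ge0.
Qed.

Lemma itg_stress b a : itg (stress b a).
Proof. by apply: itg_sum => i; exact: sqi_mul (im_g H i b) (im_g H i a). Qed.

Lemma sum_G_le a x : \sum_i G i a x ^+ 2 <= F1 x.
Proof.
rewrite /en -[leLHS]addr0 lerD ?W_ge0//; apply: ler_sum => i _.
by rewrite (bigD1 a)//= lerDl; apply: sumr_ge0 => b _; exact: sqr_ge0.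
Qed.

Lemma stress_le b a x : `|stress b a x| <= F1 x.
Proof.
apply: (le_trans (ler_norm_sum _ _ _)).
apply: (@le_trans _ _ (\sum_i (2^-1 * G i b x ^+ 2 + 2^-1 * G i a x ^+ 2))).
  apply: ler_sum => i _; set g := G i b x; set k := G i a x.
  have := sqr_ge0 (g - k); have := sqr_ge0 (g + k); rewrite ler_norml => ? ?.
  by apply/andP; split; nra.
rewrite big_split /= -!mulr_sumr; have := sum_G_le b x; have := sum_G_le a x.
set z1 := \sum_i _; set z2 := \sum_i _; lra.
Qed.

Lemma shear_energy a t (q : 'I_n -> R) y :
  \sum_i \sum_b (G i b y + t * q b * G i a y) ^+ 2 + W (U y) =
  F1 y + (2 * t * \sum_b q b * stress b a y + t ^+ 2 * (\sum_b q b ^+ 2) * \sum_i G i a y ^+ 2).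
Proof.
rewrite /en addrAC; congr (_ + _).
have -> : 2 * t * (\sum_b q b * stress b a y) = \sum_i \sum_b 2 * t * (q b * (G i b y * G i a y)).
  by rewrite exchange_big mulr_sumr /=; apply: eq_bigr => b _; rewrite /stress !mulr_sumr.
have -> : t ^+ 2 * (\sum_b q b ^+ 2) * \sum_i G i a y ^+ 2 = \sum_i \sum_b t ^+ 2 * (q b ^+ 2 * G i a y ^+ 2).
  by rewrite mulr_sumr; apply: eq_bigr => i _; rewrite -mulrA mulr_suml mulr_sumr.
rewrite -!big_split /=; apply: eq_bigr => i _; rewrite -!big_split /=; apply: eq_bigr => b _; ring.
Qed.

(** Here p, q are derivatives of eta at x and p', q' those at the deformed point, which differ by
    O(|t|). The density of the competitor at x is bounded by the Jacobian times a density read at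
    the deformed point, up to O(t^2). *)
Lemma shear_pointwise (t p p' L Lam F Pa : R) (q q' P : 'I_n -> R) :
  0 <= F -> 0 <= Pa -> Pa <= F -> (forall b, `|P b| <= F) -> 0 <= L -> 0 <= Lam ->
  `|p| <= L -> `|p'| <= L -> (forall b, `|q b| <= L) -> (forall b, `|q' b| <= L) ->
  `|p - p'| <= `|t| * Lam -> (forall b, `|q b - q' b| <= `|t| * Lam) -> 2^-1 <= 1 + t * p ->
  F + (2 * t * \sum_b q b * P b + t ^+ 2 * (\sum_b q b ^+ 2) * Pa) <=
  (F + (t * (2 * (\sum_b q' b * P b) - p' * F) +
    t ^+ 2 * (2 * (Lam + L ^+ 2 + 2 * (n%:R * (Lam + L ^+ 2)) + n%:R * L ^+ 2) * F))) * (1 + t * p).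
Proof.
move=> F0 Pa0 PaF PF L0 Lam0 pL pL' qL qL' pp qq J2.
have t20 := sqr_ge0 t; have at2 : `|t| * `|t| = t ^+ 2 by rewrite -expr2 real_normK ?num_real.
have h1 : - (t ^+ 2 * Lam) <= t * (p - p').
  have : `|t * (p - p')| <= t ^+ 2 * Lam by rewrite normrM -at2 -mulrA ler_wpM2l.
  by rewrite ler_norml => /andP[].
have h2 : p * p' <= L ^+ 2.
  by apply: (le_trans (ler_norm _)); rewrite normrM expr2 ler_pM.
have h4 : - (2 * (n%:R * (t ^+ 2 * (Lam + L ^+ 2))) * F) <=
    2 * t * ((1 + t * p) * (\sum_b q' b * P b) - \sum_b q b * P b).
  have -> : 2 * (n%:R * (t ^+ 2 * (Lam + L ^+ 2))) * F = \sum_(b < n) 2 * (t ^+ 2 * (Lam + L ^+ 2)) * F.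
    by rewrite sumr_const card_ord -mulr_natl; ring.
  rewrite mulr_sumr -sumrB mulr_sumr -sumrN; apply: ler_sum => b _.
  have -> : 2 * t * ((1 + t * p) * (q' b * P b) - q b * P b) =
     - (2 * ((t * (q b - q' b) - t ^+ 2 * (p * q' b)) * P b)) by ring.
  rewrite lerN2 -mulrA ler_wpM2l//; apply: (le_trans (ler_norm _)); rewrite normrM.
  apply: ler_pM => //; apply: (le_trans (ler_normB _ _)); rewrite [leRHS]mulrDr; apply: lerD.
    by rewrite normrM -at2 -mulrA ler_wpM2l.
  rewrite normrM ger0_norm// ler_wpM2l// normrM expr2.
  exact: ler_pM.
have h5 : (\sum_b q b ^+ 2) * Pa <= n%:R * L ^+ 2 * F.
  apply: ler_pM => //; first by apply: sumr_ge0 => b _; exact: sqr_ge0.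
  have -> : n%:R * L ^+ 2 = \sum_(b < n) L ^+ 2 by rewrite sumr_const card_ord mulr_natl.
  apply: ler_sum => b _; rewrite -real_normK ?num_real// ler_sqr ?nnegrE//.
set s1 := \sum_b q b * P b in h4 *; set s2 := \sum_b q' b * P b in h4 *; set s3 := \sum_b q b ^+ 2 in h5 *.
set M := 2 * (Lam + L ^+ 2 + _ + _).
have nR : 0 <= n%:R :> R by exact: ler0n.
have M0 : 0 <= M by rewrite /M !mulr_ge0// !addr_ge0 ?mulr_ge0 ?addr_ge0 ?sqr_ge0.
have k1 : - (t ^+ 2 * Lam) * F <= t * (p - p') * F by rewrite ler_wpM2r.
have k2 : t ^+ 2 * (p * p') * F <= t ^+ 2 * L ^+ 2 * F by rewrite ler_wpM2r// ler_wpM2l.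
have k3 : t ^+ 2 * (2^-1 * M * F) <= t ^+ 2 * ((1 + t * p) * M * F) by rewrite ler_wpM2l// ler_wpM2r// ler_wpM2r.
have k5 : t ^+ 2 * (s3 * Pa) <= t ^+ 2 * (n%:R * L ^+ 2 * F) by rewrite ler_wpM2l.
(* The factor 2 in M pays for the Jacobian, which is only known to be at least 1/2. *)
have eM : 2^-1 * M = Lam + L ^+ 2 + 2 * (n%:R * (Lam + L ^+ 2)) + n%:R * L ^+ 2 by rewrite /M; field.
rewrite eM in k3; rewrite -subr_ge0.
have -> : (F + (t * (2 * s2 - p' * F) + t ^+ 2 * (M * F))) * (1 + t * p) - (F + (2 * t * s1 + t ^+ 2 * s3 * Pa)) =
  t * (p - p') * F - t ^+ 2 * (p * p') * F + t ^+ 2 * ((1 + t * p) * M * F) +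
  2 * t * ((1 + t * p) * s2 - s1) - t ^+ 2 * (s3 * Pa) by ring.
lra.
Qed.

(* Stationarity under the shears x + t eta(x) e_a. *)
Lemma inner_var a eta r : smooth eta -> suppin (cball 0 r) eta -> 2 * r < rho ->
  RI (fun x => F1 x * partial a eta x) = 2 * RI (fun x => \sum_b partial b eta x * stress b a x).
Proof.
move=> seta eta0 hr; have cr := @compact_cball R n 0 r; have cl := @closed_cball R n 0 r.
have pe0 b := partial_supp b cl eta0; have spe b := smooth_partial b seta.
have [Ce Ce0 hCe] := supp_bounded cr eta0 (smooth_cont seta).
have /choice [Cb hCb] : forall b : 'I_n, exists C, 0 <= C /\ forall x, `|partial b eta x| <= C.
  by move=> b; have [C C0 hC] := supp_bounded cr (pe0 b) (smooth_cont (spe b)); exists C.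
have /choice [Lb hLb] : forall b : 'I_n, exists C, 0 <= C /\
    forall x h, `|partial b eta (x + h) - partial b eta x| <= C * `|h|.
  by move=> b; have [C C0 hC] := smooth_lip cr (pe0 b) (spe b); exists C.
pose L := Ce + \sum_b Cb b; pose L1 := \sum_b Lb b.
have sC : 0 <= \sum_b Cb b by apply: sumr_ge0 => b _; exact: (proj1 (hCb b)).
have L0 : 0 <= L by rewrite addr_ge0.
have L10 : 0 <= L1 by apply: sumr_ge0 => b _; exact: (proj1 (hLb b)).
have hL x : `|eta x| <= L by apply: (le_trans (hCe x)); rewrite lerDl.
have hLp b x : `|partial b eta x| <= L.
  apply: (le_trans (proj2 (hCb b) x)); rewrite /L (bigD1 b)//= addrCA lerDl addr_ge0//.
  by apply: sumr_ge0 => c _; exact: (proj1 (hCb c)).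
pose Lam := L1 * L; have Lam0 : 0 <= Lam by exact: mulr_ge0.
pose M := 2 * (Lam + L ^+ 2 + 2 * (n%:R * (Lam + L ^+ 2)) + n%:R * L ^+ 2).
have ib F : itg F -> forall b, itg (fun x => partial b eta x * F x).
  by move=> iF b; apply: (itg_bM _ (hLp b) iF); exact: continuous_rV_measurable (smooth_cont (spe b)).
have iF := itg_F1.
have iS : itg (fun x => \sum_b partial b eta x * stress b a x).
  by apply: itg_sum => b; apply: ib; exact: itg_stress.
have iT : itg (fun x => partial a eta x * F1 x) by exact: ib.
have eT : RI (fun x => F1 x * partial a eta x) = RI (fun x => partial a eta x * F1 x).
  by congr RI; apply/funext => x; rewrite mulrC.
rewrite eT; apply/eqP; rewrite eq_sym -subr_eq0; apply/eqP.
(* The first bound keeps the Jacobian above 1/2, the second keeps the displacement below rho /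
   20. *)
pose t0 := Num.min (2 * (L + 1))^-1 (rho / (20 * (L + 1))).
have L1p : 0 < L + 1 by rewrite ltr_wpDl.
have t00 : 0 < t0 by rewrite lt_min invr_gt0 divr_gt0 ?mulr_gt0.
apply: (@quad_zero _ _ (M * RI F1) t0) => // t tt0.
have tL2 : `|t| * L <= 2^-1.
  have : `|t| <= (2 * (L + 1))^-1 by apply: (le_trans tt0); rewrite ge_min lexx.
  move=> h; apply: (@le_trans _ _ ((2 * (L + 1))^-1 * (L + 1))).
    by apply: ler_pM => //; rewrite lerDl.
  by rewrite invfM -mulrA mulVf ?mulr1// gt_eqF.
have tLr : `|t| * L <= rho / 20.
  have : `|t| <= rho / (20 * (L + 1)) by apply: (le_trans tt0); rewrite ge_min lexx orbT.
  move=> h; apply: (@le_trans _ _ (rho / (20 * (L + 1)) * (L + 1))).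
    by apply: ler_pM => //; rewrite lerDl.
  by rewrite invfM -!mulrA mulVf ?mulr1// gt_eqF.
have J2 x : 2^-1 <= 1 + t * partial a eta x.
  have : `|t * partial a eta x| <= 2^-1.
    by rewrite normrM; apply: le_trans tL2; rewrite ler_wpM2l.
  by rewrite ler_norml => /andP[h _]; lra.
have J0 x : 0 <= 1 + t * partial a eta x by apply: le_trans (J2 x); rewrite invr_ge0.
have [hmin iV] := shear_competitor rho0 H seta eta0 hL hr tLr J2.
have dmE := shear_dmE seta eta0 J0.
(* [Psi] is read at the deformed point, so that the change of variables absorbs the Jacobian and no
   inverse of the shear appears. *)
pose Psi y := F1 y + (t * (2 * (\sum_b partial b eta y * stress b a y) - partial a eta y * F1 y) + t ^+ 2 * (M * F1 y)).
have iX : itg (fun y => 2 * (\sum_b partial b eta y * stress b a y) - partial a eta y * F1 y).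
  by apply: itgB => //; exact: itgZ.
have iPsi : itg Psi by apply: itgD => //; apply: itgD; apply: itgZ => //; exact: itgZ.
have [j1 j2] := RI_cv dmE iPsi.
have : RI F1 <= RI Psi.
  apply: (le_trans hmin); rewrite -j2; apply: RI_le => // x; rewrite [X in X <= _]/en.
  rewrite (shear_energy a t (fun b => partial b eta x)).
  have F0 := F1_ge0 (shear a eta t x).
  apply: (shear_pointwise (L := L) (Lam := Lam)) => //.
  - by apply: sumr_ge0 => i _; exact: sqr_ge0.
  - exact: sum_G_le.
  - by move=> b; exact: stress_le.
  - rewrite distrC; apply: (le_trans (proj2 (hLb a) x _)).
    rewrite !normrZ; apply: (@le_trans _ _ (L1 * (`|t| * L))); last by rewrite /Lam mulrCA.
    apply: ler_pM => //; [exact: (proj1 (hLb a))|by rewrite /L1 (bigD1 a)//= lerDl sumr_ge0// => c _; exact: (proj1 (hLb c))|].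
    by rewrite ler_wpM2l// -[leRHS]mulr1 ler_pM//; exact: delta_norm.
  - move=> b; rewrite distrC; apply: (le_trans (proj2 (hLb b) x _)).
    rewrite !normrZ; apply: (@le_trans _ _ (L1 * (`|t| * L))); last by rewrite /Lam mulrCA.
    apply: ler_pM => //; [exact: (proj1 (hLb b))|by rewrite /L1 (bigD1 b)//= lerDl sumr_ge0// => c _; exact: (proj1 (hLb c))|].
    by rewrite ler_wpM2l// -[leRHS]mulr1 ler_pM//; exact: delta_norm.
have i2 := itgZ t iX; have i3 := itgZ (t ^+ 2) (itgZ M iF).
rewrite /Psi (RI_D iF (itgD i2 i3)) (RI_D i2 i3) (RI_Z t iX) (RI_B (itgZ 2 iS) iT) (RI_Z 2 iS).
by rewrite (RI_Z _ (itgZ M iF)) (RI_Z M iF) lerDl.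
Qed.

Definition radial (i : 'I_N) (x : E) : R := \sum_a x ord0 a * G i a x.

Lemma sqi_xG i a : sqi (fun x => x ord0 a * G i a x).
Proof.
have [mg ig] := im_g H i a; apply: (@sqi_le _ _ _ _ (fun x => rho * G i a x)).
- by apply: measurable_funM => //; exact: measurable_coord.
- move=> x; rewrite !normrM; have [hx|hx] := pselect (l2ball 0 rho x); last first.
    by rewrite (im_g0 H i a hx) normr0 !mulr0.
  rewrite ler_wpM2r// (ger0_norm (ltW rho0)); apply: (le_trans (coord_le_norm x a)).
  by apply: (le_trans (norm_le_l2 _)); apply: ltW; move: hx; rewrite /l2ball /= subr0.
- exact: sqiZ (im_g H i a).
Qed.

Lemma sqi_radial i : sqi (radial i).
Proof. by apply: sqi_sum => a; exact: sqi_xG. Qed.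

Lemma partial_dbump s b : partial b (dil s 0 (bump0 : E -> R)) = fun x => - (s ^- 2 * (x ord0 b * dil s 0 psi0 x)).
Proof.
rewrite partial_dil; last exact: smooth_bump0.
apply/funext => x; rewrite /dil partial_bump0 subr0 !mxE -exprVn; ring.
Qed.

Lemma eul_dpsi s (x : E) : s != 0 -> \sum_a x ord0 a * partial a (dil s 0 (psi0 : E -> R)) x = dil s 0 (eul psi0) x.
Proof.
move=> s0; rewrite /dil /eul; apply: eq_bigr => a _; rewrite partial_dil; last exact: smooth_psi0.
by rewrite /dil subr0 !mxE; ring.
Qed.

(** The square |x.DU - U|^2 is expanded: its quadratic part comes from inner variations, its mixed
    part both from the first variation and from the divergence theorem for |U|^2. *)
Lemma weiss_identity s : 0 < s -> 2 * s < rho ->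
  2 * (s ^- 2 * RI (fun x => dil s 0 psi0 x * \sum_i (radial i x - U x ord0 i) ^+ 2)) =
  s ^- 2 * RI (fun x => sq x * dil s 0 psi0 x * F1 x) - n%:R * RI (fun x => dil s 0 bump0 x * F1 x) +
  s ^- 2 * (n.+2%:R * RI (fun x => dil s 0 psi0 x * sq (U x)) + RI (fun x => dil s 0 (eul psi0) x * sq (U x))).
Proof.
move=> s0 hs; set Phi := dil s 0 bump0; set psi := dil s 0 psi0.
have cl := @closed_cball R n 0 s; have cs := @compact_cball R n 0 s.
have sr : s < rho by lra.
have sPhi : smooth Phi by apply: smooth_dil; exact: smooth_bump0.
have spsi : smooth psi by apply: smooth_dil; exact: smooth_psi0.
have Phi0 : suppin (cball 0 s) Phi by apply: dil_supp => //; exact: bump0_supp.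
have psi0' : suppin (cball 0 s) psi by apply: dil_supp => //; exact: psi0_supp.
have sx a : smooth (fun x : E => x ord0 a) by exact: smooth_coord.
have Mul0 (f g : E -> R) : suppin (cball 0 s) g -> suppin (cball 0 s) (fun x => f x * g x).
  by move=> g0 x hx; rewrite g0// mulr0.
have bd (f F : E -> R) : smooth f -> suppin (cball 0 s) f -> itg F -> itg (fun x => f x * F x).
  move=> sf f0 iF; have [C C0 hC] := supp_bounded cs f0 (smooth_cont sf).
  exact: itg_bM (continuous_rV_measurable (smooth_cont sf)) hC iF.
have iF := itg_F1; have isq := itg_sqU H.
pose A1 := RI (fun x => Phi x * F1 x); pose A2 := RI (fun x => sq x * psi x * F1 x).
pose D := D2 G Phi; pose Q := RI (fun x => psi x * \sum_i radial i x ^+ 2).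
pose M := RI (fun x => psi x * \sum_i U x ord0 i * radial i x).
pose S0 := RI (fun x => psi x * sq (U x)); pose S1 := RI (fun x => dil s 0 (eul psi0) x * sq (U x)).
have ssq : smooth (fun x => sq x * psi x) by apply: smoothM => //; exact: smooth_sq.
have iA1 : itg (fun x => Phi x * F1 x) by exact: bd.
have iA2 : itg (fun x => sq x * psi x * F1 x) by apply: (bd (fun x => sq x * psi x)) => //; exact: Mul0.
have ir2 i : itg (fun x => radial i x ^+ 2) by case: (sqi_radial i).
have iQ : itg (fun x => psi x * \sum_i radial i x ^+ 2) by apply: bd => //; exact: itg_sum.
have iM : itg (fun x => psi x * \sum_i U x ord0 i * radial i x).
  by apply: bd => //; apply: itg_sum => i; exact: sqi_mul (im_u H i) (sqi_radial i).
have iS0 : itg (fun x => psi x * sq (U x)) by exact: bd.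
have eG2 i a : itg (fun x => Phi x * G i a x ^+ 2) by apply: bd => //; case: (im_g H i a).
(* Inner variation with the field x Phi, one coordinate at a time. *)
have I2 : n%:R * A1 - s ^- 2 * A2 = 2 * D - 2 * (s ^- 2 * Q).
  pose xi (a : 'I_n) (x : E) := x ord0 a * Phi x.
  have sxi a : smooth (xi a) by exact: smoothM.
  have xi0 a : suppin (cball 0 s) (xi a) by exact: Mul0.
  have pxi a b : partial b (xi a) = fun x => (b == a)%:R * Phi x - s ^- 2 * (x ord0 a * (x ord0 b * psi x)).
    rewrite /xi partialM; [|by move=> y; exact: smooth_diff..].
    by apply/funext => x; rewrite partial_coord /Phi partial_dbump -/Phi -/psi; ring.
  have ix a b : itg (fun x => partial b (xi a) x * F1 x).
    by apply: bd => //; [exact: smooth_partial|exact: partial_supp].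
  have ist a b : itg (fun x => partial b (xi a) x * stress b a x).
    by apply: bd; [exact: smooth_partial|exact: partial_supp|exact: itg_stress].
  have e1 : \sum_a RI (fun x => F1 x * partial a (xi a) x) = n%:R * A1 - s ^- 2 * A2.
    rewrite -!RI_Z// -RI_B; [|exact: itgZ..].
    rewrite -RI_sum; last by move=> a; have := ix a a; congr (itg _); apply/funext => x; rewrite mulrC.
    congr RI; apply/funext => x; rewrite -mulr_sumr.
    have -> : \sum_a partial a (xi a) x = n%:R * Phi x - s ^- 2 * (sq x * psi x).
      under eq_bigr do rewrite pxi eqxx mul1r.
      rewrite sumrB sumr_const card_ord mulr_natl -mulr_sumr /sq mulr_suml; congr (_ - _ * _).
      by apply: eq_bigr => a _; ring.
    ring.
  have e2 : \sum_a 2 * RI (fun x => \sum_b partial b (xi a) x * stress b a x) = 2 * D - 2 * (s ^- 2 * Q).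
    rewrite -mulr_sumr -mulrBr; congr (2 * _); rewrite -RI_sum; last by move=> a; exact: itg_sum.
    have -> : D = RI (fun x => \sum_i \sum_a Phi x * G i a x ^+ 2) by rewrite RI_sum2.
    rewrite -RI_Z// -RI_B; [|by apply: itg_sum => i; exact: itg_sum|exact: itgZ].
    congr RI; apply/funext => x.
    transitivity (\sum_a (\sum_i Phi x * G i a x ^+ 2 - s ^- 2 * (psi x * \sum_i x ord0 a * G i a x * radial i x))).
      apply: eq_bigr => a _; under eq_bigr do rewrite pxi mulrBl; rewrite sumrB; congr (_ - _).
        rewrite (bigD1 a)//= eqxx mul1r big1 ?addr0; last by move=> b /negPf ->; rewrite !mul0r.
        by rewrite /stress mulr_sumr; apply: eq_bigr => i _; rewrite expr2.
      under eq_bigr do rewrite /stress mulr_sumr.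
      rewrite exchange_big !mulr_sumr /=; apply: eq_bigr => i _.
      rewrite /radial !mulr_sumr; apply: eq_bigr => b _; ring.
    rewrite sumrB exchange_big /= -!mulr_sumr exchange_big /=; congr (_ - _ * (_ * _)).
    rewrite [LHS]exchange_big /=; apply: eq_bigr => i _.
    by rewrite -mulr_suml expr2.
  rewrite -e1 -e2; apply: eq_bigr => a _; exact: inner_var (xi0 a) hs.
(* First variation with Phi, whose gradient is - s^-2 x psi. *)
have I1 : D = s ^- 2 * M.
  have := first_var H sPhi sr Phi0.
  have -> : Bf G (fun i a x => Phi x * G i a x + U x ord0 i * partial a Phi x) = D - s ^- 2 * M.
    have -> : D - s ^- 2 * M = RI (fun x => \sum_i \sum_a (Phi x * G i a x ^+ 2 - s ^- 2 * (psi x * (U x ord0 i * (x ord0 a * G i a x))))).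
      have -> : D = RI (fun x => \sum_i \sum_a Phi x * G i a x ^+ 2) by rewrite RI_sum2.
      rewrite -RI_Z// -RI_B; [|by apply: itg_sum => i; exact: itg_sum|exact: itgZ].
      congr RI; apply/funext => x; rewrite !mulr_sumr -sumrB; apply: eq_bigr => i _.
      by rewrite sumrB /radial !mulr_sumr.
    rewrite RI_sum2; last first.
      move=> i a; apply: itgB => //; apply: itgZ; apply: bd => //.
      exact: sqi_mul (im_u H i) (sqi_xG i a).
    apply: eq_bigr => i _; apply: eq_bigr => a _; congr RI; apply/funext => x.
    rewrite /Phi partial_dbump -/Phi -/psi; ring.
  by move=> /eqP; rewrite subr_eq0 => /eqP.
(* Integration by parts of |U|^2 against the divergence of x psi. *)
have I3 : n%:R * S0 + S1 = - 2 * M.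
  have iS1 : itg (fun x => dil s 0 (eul psi0) x * sq (U x)).
    apply: bd => //; first by apply: smooth_dil; apply: smooth_eul; exact: smooth_psi0.
    by apply: dil_supp => //; apply: eul_supp; [exact: closed_cball|exact: psi0_supp].
  pose ze (a : 'I_n) (x : E) := x ord0 a * psi x.
  have sze a : smooth (ze a) by exact: smoothM.
  have ze0 a : suppin (cball 0 s) (ze a) by exact: Mul0.
  have pze a : partial a (ze a) = fun x => psi x + x ord0 a * partial a psi x.
    rewrite /ze partialM; [|by move=> y; exact: smooth_diff..].
    by apply/funext => x; rewrite partial_coord eqxx mulr1 addrC.
  have iu i a : itg (fun x => U x ord0 i ^+ 2 * partial a (ze a) x).
    have [_ i2] := im_u H i; have := bd _ _ (smooth_partial a (sze a)) (partial_supp a cl (ze0 a)) i2.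
    by congr (itg _); apply/funext => x; rewrite mulrC.
  have -> : n%:R * S0 + S1 = \sum_i \sum_a RI (fun x => U x ord0 i ^+ 2 * partial a (ze a) x).
    rewrite -RI_sum2// -RI_Z// -RI_D//; last exact: itgZ.
    congr RI; apply/funext => x; rewrite -eul_dpsi ?gt_eqF// -/psi.
    transitivity (sq (U x) * \sum_a partial a (ze a) x).
      have -> : \sum_a partial a (ze a) x = \sum_(a < n) (psi x + x ord0 a * partial a psi x).
        by apply: eq_bigr => a _; rewrite pze.
      by rewrite big_split /= sumr_const card_ord -mulr_natl; ring.
    by rewrite /sq mulr_suml; apply: eq_bigr => i _; rewrite mulr_sumr.
  have ix i a : itg (fun x => ze a x * (U x ord0 i * G i a x)).
    by apply: bd => //; exact: sqi_mul (im_u H i) (im_g H i a).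
  have -> : M = \sum_i \sum_a RI (fun x => ze a x * (U x ord0 i * G i a x)).
    rewrite -RI_sum2//; congr RI; apply/funext => x; rewrite mulr_sumr; apply: eq_bigr => i _.
    by rewrite /radial !mulr_sumr; apply: eq_bigr => a _; rewrite /ze; ring.
  rewrite mulr_sumr; apply: eq_bigr => i _; rewrite mulr_sumr; apply: eq_bigr => a _.
  by rewrite (grad_sq H i a (sze a) sr (ze0 a)).
have -> : RI (fun x => psi x * \sum_i (radial i x - U x ord0 i) ^+ 2) = Q - 2 * M + S0.
  rewrite -RI_Z// -RI_B//; last exact: itgZ.
  rewrite -RI_D//; last by apply: itgB => //; exact: itgZ.
  congr RI; apply/funext => x; rewrite /sq !mulr_sumr -sumrB -big_split /=; apply: eq_bigr => i _; ring.
rewrite -/A1 -/A2 -/S0 -/S1.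
have -> : n.+2%:R = n%:R + 2 :> R by rewrite -addn2 natrD.
have -> : s ^- 2 * A2 - n%:R * A1 = 2 * (s ^- 2 * Q) - 2 * D by rewrite -opprB I2 opprB.
have -> : (n%:R + 2) * S0 + S1 = 2 * S0 - 2 * M.
  by rewrite mulrDl addrAC I3; ring.
rewrite I1; ring.
Qed.

Lemma is_derive_pow_dil K f v (k : nat) (s : R) : smooth f -> compact K -> suppin K f -> itg v -> 0 < s ->
  is_derive s 1 (fun s => s ^- k * RI (fun x => dil s 0 f x * v x))
    (- (s ^- k * s^-1 * (k%:R * RI (fun x => dil s 0 f x * v x) + RI (fun x => dil s 0 (eul f) x * v x)))).
Proof.
move=> sf cK f0 iv s0.
have d1 : is_derive s 1 (fun s : R => s^-1) (- s ^- 2).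
  have := @is_deriveV _ id s 1 1 (lt0r_neq0 s0) (is_derive_id _ _).
  by rewrite [_ *: 1]mulr1.
have d2 := is_deriveX k d1.
have d3 := is_derive_RI_dil 0 sf cK f0 iv s0.
have := is_deriveM d2 d3.
have -> : (fun s : R => s^-1) ^+ k * (fun s => RI (fun x => dil s 0 f x * v x)) =
   (fun s => s ^- k * RI (fun x => dil s 0 f x * v x)).
  by apply/funext => t; rewrite !fctE exprVn.
move=> h; apply: (is_derive_eq h).
set I1 := RI (fun x => dil s 0 f x * v x); set I2 := RI (fun x => dil s 0 (eul f) x * v x).
rewrite /GRing.scale /= fctE -/I1 -/I2; case: (k) => [|j] /=; rewrite ?mulr0n ?exprVn ?exprS ?expr0.
  by field; rewrite lt0r_neq0.
by field; rewrite ?expf_neq0 ?lt0r_neq0.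
Qed.

Definition weiss (s : R) : R := s ^- n * RI (fun x => dil s 0 bump0 x * F1 x) -
  s ^- n.+2 * RI (fun x => dil s 0 psi0 x * sq (U x)).

(** The power n + 2 makes it scale invariant: the value at s for U is the value at 1 for U(sx)/s. *)
Definition defect (s : R) : R := s ^- n.+2 * RI (fun x => dil s 0 psi0 x * \sum_i (radial i x - U x ord0 i) ^+ 2).

Lemma is_derive_weiss (s : R) : 0 < s -> 2 * s < rho -> is_derive s 1 weiss (2 * (s^-1 * defect s)).
Proof.
move=> s0 hs; have cB := @compact_cball R n 0 1.
have d1 := is_derive_pow_dil n (@smooth_bump0 R n) cB (@bump0_supp R n) itg_F1 s0.
have d2 := is_derive_pow_dil n.+2 (@smooth_psi0 R n) cB (@psi0_supp R n) (itg_sqU H) s0.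
have := is_deriveB d1 d2; move=> h; apply: (is_derive_eq h).
have eb : dil s 0 (eul (bump0 : E -> R)) = fun x => - (s ^- 2 * (sq x * dil s 0 psi0 x)).
  apply/funext => x; rewrite /dil /eul subr0.
  under eq_bigr do rewrite partial_bump0 mxE.
  have -> : sq x = \sum_i x ord0 i * x ord0 i by apply: eq_bigr => i _; rewrite expr2.
  by rewrite !mulr_suml mulr_sumr -sumrN; apply: eq_bigr => i _; rewrite -exprVn; ring.
have wi := weiss_identity s0 hs; rewrite /defect.
set I1 := RI (fun x => _ * \sum_i _) in wi *.
set A1 := RI (fun x => dil s 0 bump0 x * F1 x) in wi *.
set S0 := RI (fun x => dil s 0 psi0 x * sq (U x)) in wi *.
set S1 := RI (fun x => dil s 0 (eul psi0) x * sq (U x)) in wi *.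
set A2 := RI (fun x => sq x * dil s 0 psi0 x * F1 x) in wi *.
have -> : RI (fun x => dil s 0 (eul bump0) x * F1 x) = - (s ^- 2 * A2).
  have ssq : smooth (fun x => sq x * dil s 0 (psi0 : E -> R) x).
    by apply: smoothM; [exact: smooth_sq|apply: smooth_dil; exact: smooth_psi0].
  have q0 : suppin (cball 0 s) (fun x => sq x * dil s 0 (psi0 : E -> R) x).
    by move=> x hx; rewrite (dil_supp s0 (@psi0_supp R n) hx) mulr0.
  have [C C0 hC] := supp_bounded (@compact_cball R n 0 s) q0 (smooth_cont ssq).
  have iA : itg (fun x => sq x * dil s 0 psi0 x * F1 x).
    exact: itg_bM (continuous_rV_measurable (smooth_cont ssq)) hC itg_F1.
  rewrite -RI_Z// -RI_N; last exact: itgZ.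
  by congr RI; apply/funext => x; rewrite eb; ring.
have sn : s ^- n.+2 = s ^- n * s ^- 2 by rewrite -addn2 exprD invfM.
rewrite sn; have -> : 2 * (s^-1 * (s ^- n * s ^- 2 * I1)) = s ^- n * s^-1 * (2 * (s ^- 2 * I1)) by ring.
rewrite wi; ring.
Qed.

Lemma defect_ge0 s : 0 < s -> 0 <= defect s.
Proof.
move=> s0; rewrite mulr_ge0 ?invr_ge0 ?exprn_ge0 ?(ltW s0)//.
apply: RI_ge0 => x; rewrite mulr_ge0//; first exact: psi0_ge0.
by apply: sumr_ge0 => i _; exact: sqr_ge0.
Qed.

Lemma halving (f : R -> R) (s1 e : R) : 0 < s1 ->
  (forall s, 0 < s -> s <= s1 -> f (s / 2) + e <= f s) -> forall k, f (s1 / 2 ^+ k) + k%:R * e <= f s1.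
Proof.
move=> s10 step; elim=> [|k IH]; first by rewrite expr0 divr1 mul0r addr0.
have p2 : 1 <= 2 ^+ k :> R by rewrite exprn_ege1// ler1n.
have p0 : 0 < 2 ^+ k :> R by exact: exprn_gt0.
have q0 : 0 < s1 / 2 ^+ k by rewrite divr_gt0.
have q1 : s1 / 2 ^+ k <= s1 by rewrite ler_pdivrMr// ler_peMr// ltW.
have := step _ q0 q1; have -> : s1 / 2 ^+ k / 2 = s1 / 2 ^+ k.+1 by rewrite exprS; field; rewrite gt_eqF.
by rewrite -[k.+1%:R]natr1 mulrDl mul1r; lra.
Qed.

(** Otherwise the Weiss energy would drop by at least e each time the radius is halved, and could
    not be bounded below. *)
Lemma defect_small (B s1 : R) : 0 < s1 -> 2 * s1 < rho -> (forall s, 0 < s -> s <= s1 -> - B <= weiss s) ->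
  forall e : R, 0 < e -> exists s, [/\ 0 < s, s <= s1 & defect s <= e].
Proof.
move=> s10 hs1 hB e e0; apply: contrapT => hn.
have big s : 0 < s -> s <= s1 -> e < defect s.
  by move=> s0 ss; rewrite ltNge; apply/negP => h; apply: hn; exists s.
have step s : 0 < s -> s <= s1 -> weiss (s / 2) + e <= weiss s.
  move=> s0 ss; have s2 : s / 2 < s by lra.
  have pos y : s / 2 <= y -> y <= s -> 0 < y /\ 2 * y < rho by move=> ? ?; split; lra.
  have [||c] := @MVT R weiss (fun s => 2 * (s^-1 * defect s)) (s / 2) s s2.
  - by move=> y; rewrite in_itv /= => /andP[/ltW y1 /ltW y2]; have [] := pos _ y1 y2; exact: is_derive_weiss.
  - apply: derivable_within_continuous => y; rewrite in_itv /= => /andP[y1 y2].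
    by have [p1 p2] := pos _ y1 y2; case: (is_derive_weiss p1 p2).
  rewrite in_itv /= => /andP[/ltW c1 /ltW c2] hc.
  have [c0 _] := pos _ c1 c2.
  have hd := big c c0 (le_trans c2 ss).
  (* The interval has length s/2 and c <= s, so the defect is multiplied by s/c >= 1. *)
  have : e <= 2 * (c^-1 * defect c) * (s - s / 2).
    have ci : 1 <= c^-1 * s by rewrite mulrC ler_pdivlMr// mul1r.
    have -> : 2 * (c^-1 * defect c) * (s - s / 2) = c^-1 * s * defect c by field; rewrite gt_eqF.
    apply: (@le_trans _ _ (defect c)); first exact: ltW.
    by rewrite ler_peMl// defect_ge0.
  by rewrite -hc lerBrDl.
have iter := halving s10 step.
pose k := (Num.truncn (`|weiss s1 + B| / e)).+1.
have hk : weiss s1 + B < k%:R * e.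
  by apply: (le_lt_trans (ler_norm _)); rewrite -ltr_pdivrMr//; exact: truncnS_gt.
have p2 : 1 <= 2 ^+ k :> R by rewrite exprn_ege1// ler1n.
have p0 : 0 < 2 ^+ k :> R by exact: exprn_gt0.
have q0 : 0 < s1 / 2 ^+ k by rewrite divr_gt0.
have q1 : s1 / 2 ^+ k <= s1 by rewrite ler_pdivrMr// ler_peMr// ltW.
have := le_trans (lerD (hB _ q0 q1) (lexx (k%:R * e))) (iter k).
by rewrite addrC lerBlDr leNgt hk.
Qed.

End inner_variation_identity.

(** * Blow-up sequences *)

Section ascoli.
Context {R : realType} {n N : nat}.
Local Notation E := 'rV[R]_n.
Local Notation V := 'rV[R]_N.

(** Ascoli's theorem gives a cluster point g for uniform convergence on compact sets. The indices
    are then chosen one by one, with explicit rate 1/(j+1) on the ball of radius j; k j >= j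
    replaces monotonicity. *)
Lemma ascoli_seq (F : nat -> E -> V) :
  (forall x (e : R), 0 < e -> exists2 d : R, 0 < d & forall k y, `|y - x| < d -> `|F k y - F k x| < e) ->
  (forall x, exists M : R, forall k, `|F k x| <= M) ->
  exists (k : nat -> nat) (g : E -> V), (forall j, (j <= k j)%N) /\
    forall j x, l2norm x <= j%:R -> `|F (k j) x - g x| < j.+1%:R^-1.
Proof.
move=> eqc bnd; pose W : set (E -> V) := range F.
have pW : precompact (W : set {family compact, E -> V}).
  apply: pointwise_precompact_equicontinuous.
  - exact: norm_hausdorff.
  - move=> x; have [M hM] := bnd x.
    apply: (@precompact_subset _ _ [set v : V | `|v| <= M]).
      by move=> _ [_ [k _ <-] <-] /=; exact: hM.
    have cM : closed [set v : V | `|v| <= M].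
      have -> : [set v : V | `|v| <= M] = (fun v : V => `|v|) @^-1` [set y | y <= M] by [].
      by apply: closed_comp => [y _|]; [exact: norm_continuous|exact: closed_le].
    rewrite precompact_closed//; apply: bounded_closed_compact => //.
    exists M; split; first exact: num_real.
    by move=> M' MM' v /= vM; apply: (le_trans vM); exact: ltW.
  - move=> x A; rewrite -entourage_ballE => -[e /= e0 heA]; have [d d0 hd] := eqc x e e0.
    apply/nbhs_ballP; exists d => // y; rewrite -ball_normE /= => xy f [k _ <-]; apply: heA => /=.
    by rewrite -ball_normE /= distrC; apply: hd; rewrite distrC.
rewrite precompactE in pW.
pose FF : set_system {family compact, E -> V} := (fun k : nat => F k : {family compact, E -> V}) @ \oo.
have FW : FF (closure (W : set {family compact, E -> V})).
  by exists 0%N => // k _; apply: subset_closure; exists k.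
have [g [_ cg]] := pW FF (fmap_proper_filter _ _) FW.
have /choice [k hk] : forall j : nat, exists k : nat, (j <= k)%N /\
    forall x, l2norm x <= j%:R -> `|F k x - g x| < j.+1%:R^-1.
  move=> j; have e0 : 0 < j.+1%:R^-1 :> R by rewrite invr_gt0.
  have A1 : FF [set h | exists2 k : nat, (j <= k)%N & h = F k].
    by apply: (filterS _ (nbhs_infty_ge j)) => k jk /=; exists k.
  have cB := @compact_cball R n 0 j%:R.
  have entE := @entourage_ball R V (PosNum e0).
  have A2 := fam_nbhs (g : {family compact, E -> V}) entE cB.
  have [h [[k jk ->] hB]] := cg _ _ A1 A2.
  exists k; split => // x xj; have := hB x; rewrite /cball /= subr0 => /(_ xj).
  by rewrite -ball_normE /= distrC.
by exists k, g; split => [j|j]; case: (hk j).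
Qed.

End ascoli.

(** * Compactness of rescalings *)

Section blow_up.
Context {R : realType} {n N : nat}.
Local Notation E := 'rV[R]_n.
Local Notation mu := (@lebesgue_rV R n).
Hypothesis (n0 : (0 < n)%N) (N1 : (1 < N)%N).

Lemma growth : exists2 C : R, 0 <= C & forall rho (U : E -> 'rV[R]_N) G, 0 < rho -> is_min rho U G ->
  (forall x, \sum_i U x ord0 i = 0) -> U 0 = 0 ->
  forall x, 4 * l2norm x < rho -> l2norm (U x) <= C * l2norm x.
Proof.
have [Cs Cs0 hC] := @psi0_bounded R n; have [m m0 hm] := @psi0_lower R n.
have c0 := @RI_psi0 R n.
have K0 : 0 <= @osc_const R n N.
  by rewrite addr_ge0 ?bump_energy_ge0// mulr_ge0 ?sqr_ge0 ?ball_vol_ge0.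
exists ((4 ^+ n * Cs * N%:R * @osc_const R n N * 4 ^+ n * 4 / m) / RI mu psi0) => [|rho U G rho0 H s0 U0 x hx].
  by rewrite !divr_ge0 ?(ltW m0) ?(ltW c0)// !mulr_ge0 ?exprn_ge0// ltW.
rewrite -(ler_pM2l c0); have h := growth_aux H n0 N1 s0 hC m0 hm U0 hx.
apply: (le_trans h).
by rewrite le_eqVlt; apply/orP; left; apply/eqP; field; rewrite !gt_eqF.
Qed.

Variables (U : E -> 'rV[R]_N) (G : 'I_N -> 'I_n -> E -> R).
Hypothesis (H : is_min 1 U G) (sum0 : forall x, \sum_i U x ord0 i = 0) (U0 : U 0 = 0).

Definition resc (r : R) (x : E) : 'rV[R]_N := r^-1 *: U (r *: x).

Lemma resc_growth C r x : (forall x, 4 * l2norm x < 1 -> l2norm (U x) <= C * l2norm x) -> 0 < r ->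
  4 * (r * l2norm x) < 1 -> l2norm (resc r x) <= C * l2norm x.
Proof.
move=> hC r0 hr; rewrite /resc l2normZ gtr0_norm ?invr_gt0// mulrC ler_pdivrMr//.
have e : l2norm (r *: x) = r * l2norm x by rewrite l2normZ gtr0_norm.
by apply: le_trans (hC _ _) _; rewrite e//; rewrite -mulrA [r * _]mulrC.
Qed.

(** [modulus] is applied to the zoom about r x0, with a bound M that is independent of r by linear
    growth. The threshold r0 depends on x0, since the ball of radius 4 about x0 must fit into the
    domain after scaling. *)
Lemma resc_equi x0 (e : R) : 0 < e -> exists d r0 : R, [/\ 0 < d, d <= 1, 0 < r0 &
  forall r, 0 < r -> r <= r0 -> forall y, `|y - x0| < d -> `|resc r y - resc r x0| < e].
Proof.
move=> e0; have [Cg Cg0 hg] := growth; have [C C0 hC] := @modulus R n N.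
have x0p := l2norm_ge0 x0.
have hU := hg 1 U G ltr01 H sum0 U0.
pose M := (Cg * (l2norm x0 + 3)) ^+ 2.
have M0 : 0 <= M by exact: sqr_ge0.
pose A := C * (M + 1); have A0 : 0 <= A by rewrite mulr_ge0// addr_ge0.
have e2 : 0 < e ^+ 2 by exact: exprn_gt0.
(* s is fixed by e, then d by s: A s and B d are each at most e^2 / 8, whence v^2 <= e^2 / 4. *)
pose s := Num.min (1 / 2) (e ^+ 2 / (8 * (A + 1))).
have A1 : 0 < 8 * (A + 1) by lra.
have s0 : 0 < s by rewrite lt_min; apply/andP; split; [lra|exact: divr_gt0].
have s1 : s < 1 by apply: (@le_lt_trans _ _ (1 / 2)); [rewrite ge_min lexx|lra].
have As : A * s <= e ^+ 2 / 8.
  have : s <= e ^+ 2 / (8 * (A + 1)) by rewrite ge_min lexx orbT.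
  rewrite ler_pdivlMr// => h; nra.
pose B := A * s ^- n; have B0 : 0 <= B by rewrite mulr_ge0// invr_ge0 exprn_ge0// ltW.
have B1 : 0 < 8 * (B + 1) by lra.
have n1 : 0 < n%:R + 1 :> R by rewrite ltr_wpDl.
pose d := Num.min (n%:R + 1)^-1 (e ^+ 2 / (8 * (B + 1))).
have d0 : 0 < d by rewrite lt_min invr_gt0 n1 divr_gt0.
have d1 : d <= (n%:R + 1)^-1 by rewrite ge_min lexx.
have d11 : d <= 1 by apply: (le_trans d1); rewrite invf_le1// lerDr.
have Bd : B * d <= e ^+ 2 / 8.
  have : d <= e ^+ 2 / (8 * (B + 1)) by rewrite ge_min lexx orbT.
  rewrite ler_pdivlMr// => h; nra.
exists d, (4 * (l2norm x0 + 4))^-1; split => //; first by rewrite invr_gt0; lra.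
move=> r r0 rr y yd.
have q0 : 0 < 4 * (l2norm x0 + 4) by lra.
have rq : r * (l2norm x0 + 4) <= 1 / 4.
  by move: rr; rewrite -[X in _ <= X]mul1r ler_pdivlMr// => h; lra.
have nr : l2norm (r *: x0) = r * l2norm x0 by rewrite l2normZ gtr0_norm.
have zr : l2norm (r *: x0) + r * 4 <= 1 by rewrite nr; lra.
have Hz := is_min_zoom H r0 zr.
have zE h : l2norm h < 4 -> zoomU (r *: x0) r 4 U h = resc r (x0 + h).
  move=> hh; rewrite zoomU_in; last by rewrite /l2ball /= subr0.
  by rewrite /resc scalerDr addrC.
have hM h : l2norm h <= 3 -> sq (zoomU (r *: x0) r 4 U h) <= M.
  move=> hh; rewrite zE; last by lra.
  have nn : l2norm (x0 + h) <= l2norm x0 + 3 by apply: (le_trans (l2normD _ _)); lra.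
  have p0 : 0 <= Cg * (l2norm x0 + 3) by rewrite mulr_ge0//; lra.
  rewrite /M -l2norm_le//; apply: (@le_trans _ _ (Cg * l2norm (x0 + h))).
    by apply: resc_growth => //; nra.
  by rewrite ler_wpM2l.
have := hC _ _ M Hz M0 hM (y - x0) _ s s0 s1.
have hn : l2norm (y - x0) <= 1.
  apply: (le_trans (l2_le_norm _)); rewrite mulrC -ler_pdivlMr// mul1r.
  by apply: le_trans d1; exact: ltW.
move=> /(_ hn); rewrite !zE ?l2norm0 ?addr0; [|lra..].
rewrite (_ : x0 + (y - x0) = y); last by rewrite addrC subrK.
move=> hs.
have := norm_le_sq (resc r y - resc r x0); set z := `|_ - _| in yd hs *; set v := `|resc r y - _| => hv.
have z0 : 0 <= z by exact: normr_ge0.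
have v0 : 0 <= v by exact: normr_ge0.
have zz : z ^+ 2 <= d by rewrite expr2; nra.
have h1 : C * (M + 1) * (s ^- n * z ^+ 2 + s) = B * z ^+ 2 + A * s by rewrite /B /A; ring.
have h2 : B * z ^+ 2 <= B * d by rewrite ler_wpM2l.
have : v ^+ 2 <= e ^+ 2 / 4 by rewrite h1 in hs; lra.
nra.
Qed.

(** Serves the finitely many indices to which [resc_equi] does not apply. *)
Lemma finite_equi (F : nat -> E -> 'rV[R]_N) x (e : R) J : 0 < e -> (forall j, {for x, continuous (F j)}) ->
  exists2 d : R, 0 < d & forall j, (j < J)%N -> forall y, `|y - x| < d -> `|F j y - F j x| < e.
Proof.
move=> e0 cF; elim: J => [|J [d d0 hd]]; first by exists 1.
have /cvgrPdist_lt /(_ _ e0) := cF J; rewrite nearE => /nbhs_ballP[d' /= d'0 hd'].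
exists (Num.min d d'); first by rewrite lt_min d0.
move=> j; rewrite ltnS leq_eqVlt => /orP[/eqP ->|jJ] y; rewrite lt_min => /andP[y1 y2]; last exact: hd.
by have := hd' y; rewrite -ball_normE /= distrC => /(_ y2); rewrite distrC.
Qed.

Lemma blow_up (r : nat -> R) : (forall j, 0 < r j) -> (forall j, r j <= j.+1%:R^-1) ->
  exists (k : nat -> nat) (Ub : E -> 'rV[R]_N), (forall j, (j <= k j)%N) /\
  forall M e : R, 0 < e -> exists J : nat, forall j, (J <= j)%N -> forall x, l2norm x <= M ->
    `|resc (r (k j)) x - Ub x| < e.
Proof.
move=> r0 rj; have [Cg Cg0 hg] := growth; have hU := hg 1 U G ltr01 H sum0 U0.
have h20 : 0 < 1 / 2 :> R by lra.
pose chi := dil (1 / 2) 0 (cut : E -> R).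
(* U is continuous in the unit ball only. The cutoff makes [F j] continuous everywhere and leaves
   the rescaling unchanged for |x| <= 1 / (2 r_j). *)
pose F j x := chi (r j *: x) *: resc (r j) x.
have FE j x : r j * l2norm x <= 1 / 2 -> F j x = resc (r j) x.
  by move=> h; rewrite /F /chi dil_cut1 ?scale1r// l2normZ gtr0_norm.
have small (c : R) : 0 < c -> exists J : nat, forall j, (J <= j)%N -> r j <= c.
  move=> c0; exists (Num.truncn c^-1) => j Jj; apply: (le_trans (rj j)).
  rewrite -[leRHS]invrK lef_pV2 ?posrE ?invr_gt0//; apply: ltW.
  by apply: (lt_le_trans (truncnS_gt _)); rewrite ler_nat.
have cF j x : {for x, continuous (F j)}.
  have clin : {for x, continuous (fun y : E => r j *: y)} by apply: continuousZr; exact: cvg_id.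
  have [lt|ge] := ltP (l2norm (r j *: x)) 1.
    have h1 : {for x, continuous (fun y : E => chi (r j *: y))}.
      apply: (@continuous_comp _ _ _ (fun y : E => r j *: y) chi) => //.
      exact: smooth_cont (smooth_dcut _) _.
    have h2 : {for x, continuous (resc (r j))}.
      apply: continuousZr; apply: (@continuous_comp _ _ _ (fun y : E => r j *: y) U) => //.
      by apply: im_cont H _ _; rewrite /l2ball /= subr0.
    exact: (continuousZ h1 h2).
  have c3 : {for x, continuous (fun y : E => l2norm (r j *: y))}.
    by apply: (continuous_comp clin); exact: cont_l2norm.
  have Fz : \forall y \near x, F j y = 0.
    have : \forall y \near x, 3 / 4 < l2norm (r j *: y).
      move: c3 => /(_ [set t | 3 / 4 < t]) c4; apply: c4; apply: open_nbhs_nbhs.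
      by split; [exact: open_gt|rewrite /=; lra].
    apply: filterS => y hy; rewrite /F /chi (dil_cut_supp h20) ?scale0r//.
    by rewrite /cball /= subr0; apply/negP; rewrite -ltNge; lra.
  have Fx : F j x = 0 by exact: nbhs_singleton Fz.
  move=> A; rewrite Fx => /nbhs_singleton A0; rewrite /= nbhs_filterE; apply: filterS Fz => y hy.
  by rewrite /= hy.
have [k [g [hk hg']]] : exists (k : nat -> nat) (g : E -> 'rV[R]_N), (forall j, (j <= k j)%N) /\
    forall j x, l2norm x <= j%:R -> `|F (k j) x - g x| < j.+1%:R^-1.
  apply: ascoli_seq => x.
    move=> e e0; have [d [r1 [d0 d1 r10 hd]]] := resc_equi x e0.
    have xp := l2norm_ge0 x; have nR : 0 <= n%:R :> R by exact: ler0n.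
    have [J hJ] := small (Num.min r1 (2 * (l2norm x + (n%:R + 1)))^-1) ltac:(rewrite lt_min r10 invr_gt0; lra).
    have [d' d'0 hd'] := finite_equi J e0 (cF^~ x).
    exists (Num.min d d'); first by rewrite lt_min d0.
    move=> j y; rewrite lt_min => /andP[y1 y2].
    have [jJ|jJ] := ltnP j J; first exact: hd'.
    have := hJ j jJ; rewrite le_min => /andP[rr1 rr2].
    have q0 : 0 < 2 * (l2norm x + (n%:R + 1)) by lra.
    have rq : r j * (l2norm x + (n%:R + 1)) <= 1 / 2.
      by move: rr2; rewrite -[X in _ <= X]mul1r ler_pdivlMr// => h; lra.
    have ny : l2norm y <= l2norm x + (n%:R + 1).
      rewrite -[y](subrK x) addrC; apply: (le_trans (l2normD _ _)); rewrite lerD2l.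
      apply: (le_trans (l2_le_norm _)); apply: ler_piMr; first by lra.
      exact: (le_trans (ltW y1) d1).
    have rjp := r0 j.
    by rewrite !FE; [exact: hd|nra|nra].
  have xp := l2norm_ge0 x.
  have [J hJ] := small ((4 * (l2norm x + 1))^-1 / 2) ltac:(by rewrite divr_gt0// invr_gt0; lra).
  exists (\sum_(j < J) `|F j x| + Cg * l2norm x) => j.
  have [jJ|jJ] := ltnP j J.
    rewrite (bigD1 (Ordinal jJ))//= -addrA lerDl addr_ge0 ?mulr_ge0//.
    by apply: sumr_ge0 => i _; exact: normr_ge0.
  have rr := hJ j jJ; have rjp := r0 j.
  have q0 : 0 < 4 * (l2norm x + 1) by lra.
  have rq : r j * (4 * (l2norm x + 1)) <= 1 / 2.
    by rewrite -ler_pdivlMr//; apply: (le_trans rr); rewrite mulrC; lra.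
  rewrite FE; last by nra.
  apply: (@le_trans _ _ (Cg * l2norm x)); last by rewrite lerDr sumr_ge0.
  by apply: (le_trans (norm_le_l2 _)); apply: resc_growth => //; nra.
exists k, g; split=> // M e e0.
have [J1 hJ1] := small (2 * (`|M| + 1))^-1 ltac:(rewrite invr_gt0; have := normr_ge0 M; lra).
pose J2 := Num.truncn `|M|; pose J3 := Num.truncn e^-1.
exists (maxn J1 (maxn J2.+1 J3)) => j; rewrite !geq_max => /andP[j1 /andP[j2 j3]] x xM.
have M0 := normr_ge0 M; have MM := ler_norm M.
have rr := hJ1 (k j) (leq_trans j1 (hk j)); have rjp := r0 (k j).
have rq : r (k j) * (`|M| + 1) <= 1 / 2.
  by move: rr; rewrite -[X in _ <= X]mul1r ler_pdivlMr; [move=> h; lra|lra].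
have xp := l2norm_ge0 x.
rewrite -FE; last by nra.
apply: (lt_le_trans (hg' j x _)).
  apply: (le_trans xM); apply: (le_trans MM); apply: ltW.
  by apply: (lt_le_trans (truncnS_gt _)); rewrite ler_nat.
rewrite -[leRHS]invrK lef_pV2 ?posrE ?invr_gt0//; apply: ltW.
by apply: (lt_le_trans (truncnS_gt _)); rewrite ler_nat.
Qed.

(** The first term is nonnegative. In the second, linear growth bounds |U|^2 by a multiple of s^2 on
    a ball of volume of order s^n, which the factor s^(-n-2) compensates. *)
Lemma weiss_lower : exists2 B : R, 0 <= B & forall s : R, 0 < s -> s <= 1 / 8 -> - B <= weiss U G s.
Proof.
have [Cg Cg0 hg] := growth; have hU := hg 1 U G ltr01 H sum0 U0.
have [Cs Cs0 hC] := @psi0_bounded R n.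
have BV0 := @ball_vol_ge0 R n.
exists (Cs * Cg ^+ 2 * ball_vol (n := n)) => [|s s0 s8].
  by rewrite !mulr_ge0 ?sqr_ge0// ltW.
have p1 : 0 <= s ^- n * RI mu (fun x => dil s 0 bump0 x * en U G x).
  rewrite mulr_ge0 ?invr_ge0 ?exprn_ge0 ?(ltW s0)//; apply: RI_ge0 => x.
  by rewrite mulr_ge0 ?bump0_ge0 ?F1_ge0.
have h : RI mu (fun x => dil s 0 psi0 x * sq (U x)) <= (Cs * (Cg * s) ^+ 2) * (s ^+ n * ball_vol (n := n)).
  rewrite -(RI_cball 0 s0) -RI_Z; last by apply: itg_indic; [exact: measurable_cball|exact: mu_cball_lty].
  apply: RI_le.
  - by apply: itg_psi0M => //; exact: itg_sqU H.
  - by apply: itgZ; apply: itg_indic; [exact: measurable_cball|exact: mu_cball_lty].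
  - move=> x; rewrite indicE; have [hx|hx] := pselect (cball 0 s x); last first.
      by rewrite (dil_supp s0 (@psi0_supp R n) hx) mul0r memNset// mulr0.
    rewrite mem_set// mulr1; have xs : l2norm x <= s by move: hx; rewrite /cball /= subr0.
    apply: ler_pM; rewrite ?psi0_ge0 ?sq_ge0//; first exact: hC.
    rewrite -l2norm_le; last by rewrite mulr_ge0// ltW.
    apply: (le_trans (hU x _)); first by lra.
    by rewrite ler_wpM2l.
rewrite /weiss; have sp : 0 < s ^- n.+2 by rewrite invr_gt0 exprn_gt0.
have h2 := ler_wpM2l (ltW sp) h.
have e : s ^- n.+2 * (Cs * (Cg * s) ^+ 2 * (s ^+ n * ball_vol (n := n))) = Cs * Cg ^+ 2 * ball_vol (n := n).
  by rewrite -addn2 exprD; field; rewrite expf_neq0 ?gt_eqF.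
rewrite e in h2; move: p1 h2; set z1 := _ * RI _ _; set z2 := _ * RI _ _; lra.
Qed.

(* The blow-up radii are smaller than the radii s with small defect by a factor
   j + 1, so that the limit is homogeneous on every ball. *)
Lemma blow_up_radii : exists r : nat -> R, [/\ forall j, 0 < r j, forall j, r j <= j.+1%:R^-1,
  forall j, j.+1%:R * r j <= 1 / 8 & forall j, j.+1%:R ^+ n.+2 * defect U G (j.+1%:R * r j) <= j.+1%:R^-1].
Proof.
have [B B0 hB] := weiss_lower.
have s8 : 0 < 1 / 8 :> R by lra.
have s8' : 2 * (1 / 8) < 1 :> R by lra.
have hd := defect_small ltr01 H s8 s8' hB.
have /choice [s hs] : forall j : nat, exists s : R, [/\ 0 < s, s <= 1 / 8 &
    defect U G s <= (j.+1%:R ^+ n.+2 * j.+1%:R)^-1].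
  by move=> j; apply: hd; rewrite invr_gt0 mulr_gt0 ?exprn_gt0.
have jp (j : nat) : 0 < j.+1%:R :> R by [].
have e j : j.+1%:R * (s j / j.+1%:R) = s j by rewrite mulrC mulfVK// gt_eqF.
exists (fun j => s j / j.+1%:R); split => j; have [h1 h2 h3] := hs j.
- by rewrite divr_gt0.
- by rewrite ler_pdivrMr// mulVf ?gt_eqF//; lra.
- by rewrite e.
- rewrite e; apply: (le_trans (ler_wpM2l (exprn_ge0 _ (ltW (jp j))) h3)).
  by rewrite invfM mulVKf// expf_neq0// gt_eqF.
Qed.

End blow_up.

(** * Limits of minimizers *)

Section l2_complete.
Context d (T : measurableType d) (R : realType) (mu : {measure set T -> \bar R}).
Local Notation itg := (itg mu).
Local Notation RI := (RI mu).
Local Notation sqi := (sqi mu).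

Lemma cvg_geometric_increments (a : nat -> R) (C : R) :
  (forall k, 4 ^+ k * (a k.+1 - a k) ^+ 2 <= C) -> cvgn a.
Proof.
move=> h; have C0 : 0 <= C by apply: le_trans (h 0%N); rewrite mulr_ge0 ?sqr_ge0 ?exprn_ge0.
have hD k : `|telescope a k| <= geometric (Num.sqrt C) 2^-1 k.
  rewrite /telescope /geometric /= -ler_sqr ?nnegrE ?mulr_ge0 ?sqrtr_ge0 ?exprn_ge0 ?invr_ge0//.
  rewrite (real_normK (num_real _)) exprMn sqr_sqrtr//.
  have -> : (2^-1 ^+ k) ^+ 2 = (4 ^+ k)^-1 :> R.
    by rewrite exprAC -exprVn; congr (_ ^+ _); field.
  rewrite ler_pdivlMr ?exprn_gt0// mulrC; exact: h.
have cT : cvgn (series (telescope a)).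
  apply: normed_cvg; apply: series_le_cvg hD _ => //.
  - by move=> k; rewrite /geometric /= mulr_ge0 ?sqrtr_ge0 ?exprn_ge0 ?invr_ge0.
  - by apply: is_cvg_geometric_series; rewrite ger0_norm ?invr_ge0// invf_lt1// ltr1n.
have -> : a = (fun k => a 0%N + series (telescope a) k) by apply/funext => k; rewrite -eq_sum_telescope.
exact: is_cvgD (is_cvg_cst _) cT.
Qed.

(** The series of 4^k |f_(k+1) - f_k|^2 has finite integral, so f_k converges almost everywhere;
    Fatou's lemma gives the rate. The last conclusion holds at every point, which preserves exact
    supports. *)
Lemma L2_complete (f : nat -> T -> R) : (forall k, sqi (f k)) ->
  (forall k m, (k <= m)%N -> RI (fun x => (f m x - f k x) ^+ 2) <= 8^-1 ^+ k) ->
  exists g, [/\ sqi g, forall k, RI (fun x => (g x - f k x) ^+ 2) <= 8^-1 ^+ k &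
    forall x, (forall k, f k x = 0) -> g x = 0].
Proof.
move=> sf hf; pose D k x := 4 ^+ k * (f k.+1 x - f k x) ^+ 2.
have iD k : itg (D k) by apply: itgZ; case: (sqiB (sf k.+1) (sf k)).
have D0 k x : 0 <= D k x by rewrite mulr_ge0 ?sqr_ge0 ?exprn_ge0.
have rD k : RI (D k) <= 2^-1 ^+ k.
  rewrite RI_Z; last by case: (sqiB (sf k.+1) (sf k)).
  apply: (@le_trans _ _ (4 ^+ k * 8^-1 ^+ k)); first by rewrite ler_wpM2l ?exprn_ge0// hf.
  by rewrite -exprMn (_ : 4 * 8^-1 = 2^-1 :> R)//; lra.
have mD k : measurable_fun setT (EFin \o D k) by apply/measurable_EFinP; exact: itg_meas.
pose S x := (\sum_(0 <= k <oo) (D k x)%:E)%E.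
have mS : measurable_fun setT S.
  apply: (@ge0_emeasurable_sum _ T R setT (fun k x => (D k x)%:E) predT) => [k x _ _|k _].
    by rewrite lee_fin.
  exact: mD.
have S0 x : (0 <= S x)%E by apply: nneseries_ge0 => k _ _; rewrite lee_fin.
have iS : (\int[mu]_x S x <= 2%:E)%E.
  rewrite integral_nneseries//; last by move=> k x _; rewrite lee_fin.
  apply: lime_le.
    by apply: is_cvg_nneseries => k _ _; apply: integral_ge0 => x _; rewrite lee_fin.
  apply: nearW => m; have b (j : nat) : \sum_(0 <= k < j) (2^-1 ^+ k : R) = 2 - 2 * 2^-1 ^+ j.
    elim: j => [|j IH]; first by rewrite big_geq// expr0; ring.
    by rewrite big_nat_recr//= IH exprS; field.
  apply: (@le_trans _ _ (\sum_(0 <= k < m) (2^-1 ^+ k : R))%:E).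
    rewrite -sumEFin; apply: lee_sum => k _.
    by rewrite -EFin_RI// lee_fin.
  by rewrite b lee_fin gerBl mulr_ge0 ?exprn_ge0 ?invr_ge0.
have aeS : {ae mu, forall x, S x \is a fin_num}.
  have : mu.-integrable setT S.
    apply/integrableP; split => //; rewrite (eq_integral S); last first.
      by move=> x _; rewrite gee0_abs.
    exact: (le_lt_trans iS (ltry _)).
  by move=> /(integrable_ae measurableT); apply: filterS => x; apply.
have cvg_ae : {ae mu, forall x, cvgn (fun k => f k x)}.
  apply: filterS aeS => x hx; apply: (@cvg_geometric_increments _ (fine (S x))) => k.
  rewrite -lee_fin fineK//; apply: le_trans (nneseries_lim_ge k.+1 _); last by move=> j _ _; rewrite lee_fin.
  rewrite big_nat_recr//= leeDr//; apply: sume_ge0 => j _; rewrite lee_fin; exact: D0.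
(* An upper limit is measurable and defined everywhere, and is 0 where all f_k are 0. *)
pose g x := fine (limn_esup (fun k => (f k x)%:E)).
have mg : measurable_fun setT g.
  apply: (measurableT_comp (@fine_measurable R setT measurableT)).
  apply: measurable_fun_limn_esup => k; apply/measurable_EFinP; exact: (proj1 (sf k)).
have ag : {ae mu, forall x, (fun k => f k x) @ \oo --> g x}.
  apply: filterS cvg_ae => x hx; have /cvg_ex[l hl] := hx.
  have e : limn_esup (fun k => (f k x)%:E) = l%:E.
    have c : (fun k => (f k x)%:E) @ \oo --> l%:E by apply: cvg_EFin => //; exact: nearW.
    by have [_ ->] := cvg_limn_einf_sup c.
  by rewrite /g e.
have mgf k : measurable_fun setT (fun x => (g x - f k x) ^+ 2).
  by apply: measurable_funX; apply: measurable_funB => //; exact: (proj1 (sf k)).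
have mff m k : measurable_fun setT (fun x => (f m x - f k x) ^+ 2).
  by apply: measurable_funX; apply: measurable_funB; [exact: (proj1 (sf m))|exact: (proj1 (sf k))].
have fat k : (\int[mu]_x ((g x - f k x) ^+ 2)%:E <= (8^-1 ^+ k)%:E)%E.
  have e : (\int[mu]_x ((g x - f k x) ^+ 2)%:E = \int[mu]_x limn_einf (fun m => ((f m x - f k x) ^+ 2)%:E))%E.
    apply: ae_eq_integral => //; first exact/measurable_EFinP.
      apply: (measurableT_comp (@oppe_measurable R setT)); apply: measurable_fun_limn_esup => m.
      apply: (measurableT_comp (@oppe_measurable R setT)); apply/measurable_EFinP.
      exact: mff.
    apply: filterS ag => x hx _.
    suff c : (fun m => ((f m x - f k x) ^+ 2)%:E) @ \oo --> ((g x - f k x) ^+ 2)%:E.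
      by have [-> _] := cvg_limn_einf_sup c.
    apply: cvg_EFin; first exact: nearW.
    have c1 : (fun m => f m x - f k x) @ \oo --> g x - f k x by apply: cvgB hx (cvg_cst _).
    exact: (cvgM c1 c1).
  rewrite e; apply: (le_trans (fatou _ measurableT _ _)).
  - by move=> m; apply/measurable_EFinP; exact: mff.
  - by move=> m x _; rewrite lee_fin sqr_ge0.
  rewrite limn_einf_lim; apply: lime_le; first exact: is_cvg_einfs.
  apply: nearW => p; apply: (@le_trans _ _ (\int[mu]_x ((f (maxn p k) x - f k x) ^+ 2)%:E)%E).
    by apply: ereal_inf_lbound; exists (maxn p k) => //=; exact: leq_maxl.
  rewrite -EFin_RI; last by case: (sqiB (sf (maxn p k)) (sf k)).
  by rewrite lee_fin hf// leq_maxr.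
have sgf k : sqi (fun x => g x - f k x).
  split; first by apply: measurable_funB => //; exact: (proj1 (sf k)).
  apply/integrableP; split; first exact/measurable_EFinP.
  apply: le_lt_trans (ltry (8^-1 ^+ k)); apply: le_trans (fat k).
  rewrite le_eqVlt; apply/orP; left; apply/eqP; apply: eq_integral => x _.
  by rewrite gee0_abs// lee_fin sqr_ge0.
exists g; split.
- have -> : g = (fun x => (g x - f 0%N x) + f 0%N x) by apply/funext => x; rewrite subrK.
  exact: sqiD.
- by move=> k; rewrite -lee_fin EFin_RI//; case: (sgf k).
- move=> x hx; have c : (fun k => (f k x)%:E) @ \oo --> (0 : R)%:E.
    by under eq_fun do rewrite hx; exact: cvg_cst.
  by rewrite /g; have [_ ->] := cvg_limn_einf_sup c.
Qed.

End l2_complete.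

(** * Convex combinations and weak limits *)

Section mazur.
Context {R : realType} {n N : nat}.
Local Notation E := 'rV[R]_n.
Local Notation mu := (@lebesgue_rV R n).
Local Notation RI := (RI mu).
Local Notation itg := (itg mu).
Local Notation sqi := (sqi mu).
Implicit Types (v ub : 'I_N -> E -> R) (h : 'I_N -> 'I_n -> E -> R).

Lemma small_pow8 (d : R) : 0 < d -> exists K : nat, forall k, (K <= k)%N -> 8^-1 ^+ k <= d.
Proof.
move=> d0; exists (Num.truncn d^-1) => k Kk; rewrite exprVn invf_ple ?posrE ?exprn_gt0//.
apply: ltW; apply: (lt_le_trans (truncnS_gt _)); rewrite -natrX ler_nat.
by apply: (leq_ltn_trans Kk); exact: ltn_expl.
Qed.

Lemma itg_wsq (eta f : E -> R) C : measurable_fun setT eta -> (forall x, 0 <= eta x <= C) ->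
  sqi f -> itg (fun x => eta x * f x ^+ 2).
Proof.
move=> me he sf; apply: (itg_bM me) (proj2 sf) => x.
by have /andP[e0 e1] := he x; rewrite ger0_norm//; exact: e1.
Qed.

(** The parallelogram identity for the weighted energy; it also contains its convexity. *)
Lemma D2_mid (eta : E -> R) C h h' : measurable_fun setT eta -> (forall x, 0 <= eta x <= C) ->
  (forall i a, sqi (h i a)) -> (forall i a, sqi (h' i a)) ->
  D2 (fun i a x => (h i a x + h' i a x) / 2) eta =
  (D2 h eta + D2 h' eta) / 2 - D2 (fun i a x => h i a x - h' i a x) eta / 4.
Proof.
move=> me he sh sh'; rewrite /D2 -big_split /= !mulr_suml -sumrB; apply: eq_bigr => i _.
rewrite -big_split /= !mulr_suml -sumrB; apply: eq_bigr => a _.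
have i1 := itg_wsq me he (sh i a); have i2 := itg_wsq me he (sh' i a).
have i3 := itg_wsq me he (sqiB (sh i a) (sh' i a)).
rewrite -(RI_D i1 i2) ![_ / _]mulrC -(RI_Z _ (itgD i1 i2)) -(RI_Z _ i3) -(RI_B (itgZ _ (itgD i1 i2)) (itgZ _ i3)).
by congr RI; apply/funext => x; field.
Qed.

Lemma Qf_D2 h : Qf h = D2 h (fun=> 1).
Proof.
apply: eq_bigr => i _; apply: eq_bigr => a _; congr RI; apply/funext => x.
by rewrite mul1r.
Qed.

Lemma Qf_comp h i a : RI (fun x => h i a x ^+ 2) <= Qf h.
Proof.
rewrite /Qf (bigD1 i)//= (bigD1 a)//= -addrA lerDl addr_ge0//.
  by apply: sumr_ge0 => b _; exact: RI_sqr_ge0.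
by apply: sumr_ge0 => j _; apply: sumr_ge0 => b _; exact: RI_sqr_ge0.
Qed.

Variables (u : nat -> 'I_N -> E -> R) (g : nat -> 'I_N -> 'I_n -> E -> R).

(** Midpoints are all that the parallelogram identity requires. Functions and gradients are combined
    together, so that the second remain weak gradients of the first. *)
Inductive hull (m : nat) : ('I_N -> E -> R) -> ('I_N -> 'I_n -> E -> R) -> Prop :=
| hull_base j : (m <= j)%N -> hull m (u j) (g j)
| hull_mid v h v' h' : hull m v h -> hull m v' h' ->
    hull m (fun i x => (v i x + v' i x) / 2) (fun i a x => (h i a x + h' i a x) / 2).

Lemma hull_sub m m' v h : (m <= m')%N -> hull m' v h -> hull m v h.
Proof.
move=> mm; elim => [j mj|*]; last exact: hull_mid.
by apply: hull_base; exact: leq_trans mj.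
Qed.

Hypothesis (sg : forall j i a, sqi (g j i a)).

Lemma hull_sqi m v h i a : hull m v h -> sqi (h i a).
Proof.
elim => [j _|v1 h1 v2 h2 _ IH1 _ IH2]; first exact: sg.
by under eq_fun do rewrite mulrC; apply: sqiZ; exact: sqiD.
Qed.

Lemma hull_D2 (eta : E -> R) C A m v h : measurable_fun setT eta -> (forall x, 0 <= eta x <= C) ->
  (forall j, (m <= j)%N -> D2 (g j) eta <= A) -> hull m v h -> D2 h eta <= A.
Proof.
move=> me he hA; elim => [j /hA//|v1 h1 v2 h2 H1 IH1 H2 IH2].
rewrite (D2_mid me he) => [|i a|i a]; [|exact: hull_sqi H1|exact: hull_sqi H2].
have : 0 <= D2 (fun i a x => h1 i a x - h2 i a x) eta.
  by apply: D2_ge0 => x; case/andP: (he x).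
lra.
Qed.

Lemma hull_weakd Om m v h i a : (forall j i, sqi (u j i)) ->
  (forall j i a, weakd Om (u j i) (g j i a) a) -> hull m v h -> sqi (v i) /\ weakd Om (v i) (h i a) a.
Proof.
move=> su wu; elim => [j _|v1 h1 v2 h2 H1 [s1 w1] H2 [s2 w2]]; first by split; [exact: su|exact: wu].
split; first by under eq_fun do rewrite mulrC; apply: sqiZ; exact: sqiD.
move=> phi tp; have st := test_sqi tp; have sd := test_sqi (test_partial a tp).
have i1 := sqi_mul s1 sd; have i2 := sqi_mul s2 sd.
have i3 := sqi_mul (hull_sqi i a H1) st; have i4 := sqi_mul (hull_sqi i a H2) st.
have -> : (fun x => (v1 i x + v2 i x) / 2 * partial a phi x) =
    fun x => 2^-1 * (v1 i x * partial a phi x + v2 i x * partial a phi x) by apply/funext => x; ring.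
have -> : (fun x => (h1 i a x + h2 i a x) / 2 * phi x) =
    fun x => 2^-1 * (h1 i a x * phi x + h2 i a x * phi x) by apply/funext => x; ring.
by rewrite (RI_Z _ (itgD i1 i2)) (RI_Z _ (itgD i3 i4)) (RI_D i1 i2) (RI_D i3 i4) w1// w2// -opprD mulrN.
Qed.

Lemma hull_near (Om : set E) ub (e : R) m v h :
  (forall j, (m <= j)%N -> forall i x, Om x -> `|u j i x - ub i x| <= e) ->
  hull m v h -> forall i x, Om x -> `|v i x - ub i x| <= e.
Proof.
move=> hu; elim => [j /hu//|v1 h1 v2 h2 _ IH1 _ IH2 i x xO].
have := IH1 i x xO; have := IH2 i x xO; rewrite !ler_norml => /andP[a1 a2] /andP[b1 b2].
by apply/andP; split; lra.
Qed.

Lemma hull_supp (Om : set E) m v h i a : (forall j i a, suppin Om (g j i a)) -> hull m v h -> suppin Om (h i a).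
Proof.
move=> hg; elim => [j _|v1 h1 v2 h2 _ IH1 _ IH2]; first exact: hg.
by move=> x hx; rewrite IH1// IH2// addr0 mul0r.
Qed.

(* Midpoints of elements of almost minimal norm in the hulls of the tails: by
   the parallelogram identity these form a Cauchy sequence. *)
Lemma hull_cauchy (M : R) : (forall j, Qf (g j) <= M) -> exists (m : nat -> nat)
    (v : nat -> 'I_N -> E -> R) (h : nat -> 'I_N -> 'I_n -> E -> R),
  [/\ forall k, (k <= m k)%N, forall k, hull (m k) (v k) (h k) &
   forall k k', (k <= k')%N -> Qf (fun i a x => h k' i a x - h k i a x) <= 8^-1 ^+ k].
Proof.
move=> hM.
(* If two energies are at most D + q/8 and that of the midpoint is at least D - q/8, the
   parallelogram identity bounds the energy of the difference by q. This explains the tolerance 8^-k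
   / 8 below. *)
have ar (I Q1 Q2 F D q q' : R) : I <= (Q2 + Q1) / 2 - F / 4 -> Q1 <= D + q / 8 -> Q2 <= D + q' / 8 ->
    D - q / 8 <= I -> q' <= q -> F <= q by lra.
pose S m : set R := [set q | exists v h, hull m v h /\ q = Qf h].
have Sn m : S m !=set0 by exists (Qf (g m)), (u m), (g m); split => //; exact: hull_base.
have Sl m : has_lbound (S m) by exists 0 => _ [v [h [_ ->]]]; exact: Qf_ge0.
have c1 (x : E) : 0 <= (1 : R) <= 1 by rewrite ler01 lexx.
have dle m v h : hull m v h -> inf (S m) <= Qf h by move=> H; apply: ge_inf => //; exists v, h.
have dM m : inf (S m) <= M by apply: (le_trans (dle m _ _ (hull_base (leqnn m)))); exact: hM.
(* The least energies over the tails increase with m and are bounded by M; D is their limit. *)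
pose D := sup (range (fun m => inf (S m))).
have Dn : range (fun m => inf (S m)) !=set0 by exists (inf (S 0%N)), 0%N.
have Du : has_ubound (range (fun m => inf (S m))) by exists M => _ [m _ <-]; exact: dM.
have dD m : inf (S m) <= D by apply: ub_le_sup => //; exists m.
have dmono m m' : (m <= m')%N -> inf (S m) <= inf (S m').
  move=> mm; apply: lb_le_inf => // _ [v [h [H ->]]]; apply: dle; exact: hull_sub H.
have sel k : exists X : nat * (('I_N -> E -> R) * ('I_N -> 'I_n -> E -> R)),
    [/\ (k <= X.1)%N, hull X.1 X.2.1 X.2.2, D - 8^-1 ^+ k / 8 <= inf (S X.1) & Qf X.2.2 <= D + 8^-1 ^+ k / 8].
  have e0 : 0 < 8^-1 ^+ k / 8 :> R by rewrite divr_gt0// exprn_gt0// invr_gt0.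
  have [_ [m _ <-] hm] := @sup_adherent _ (range (fun m => inf (S m))) _ e0 (conj Dn Du).
  have [_ [v [h [H ->]]] hq] := @inf_adherent _ (S (maxn m k)) _ e0 (conj (Sn _) (Sl _)).
  exists (maxn m k, (v, h)); split => //=; first exact: leq_maxr.
    by apply: (le_trans (ltW hm)); apply: dmono; exact: leq_maxl.
  by apply: (le_trans (ltW hq)); rewrite lerD2r; exact: dD.
have [X hX] := choice sel; exists (fun k => (X k).1), (fun k => (X k).2.1), (fun k => (X k).2.2).
split => [k|k|k k' kk]; [by case: (hX k)|by case: (hX k)|].
have [_ H1 l1 q1] := hX k; have [_ H2 l2 q2] := hX k'.
have pp : 8^-1 ^+ k' <= 8^-1 ^+ k :> R.
  by rewrite ler_wiXn2l ?invr_ge0// invf_le1// ler1n.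
pose m := minn (X k').1 (X k).1.
have lm : D - 8^-1 ^+ k / 8 <= inf (S m).
  rewrite /m; have [_|_] := leqP (X k').1 (X k).1; last exact: l1.
  by apply: le_trans l2; rewrite lerD2l lerN2 ler_pM2r ?invr_gt0.
have Hm := dle m _ _ (hull_mid (hull_sub (geq_minl _ _) H2) (hull_sub (geq_minr _ _) H1)).
have := D2_mid (measurable_cst (1 : R)) c1 (fun i a => hull_sqi i a H2) (fun i a => hull_sqi i a H1).
rewrite -!Qf_D2 => e; rewrite e in Hm.
exact: ar Hm q1 q2 lm pp.
Qed.

(* Mazur: the weak gradients gb are strong limits of convex combinations, so that
   weighted energies pass to the limit by convexity. *)
Lemma weak_compactness Om ub (M : R) : (forall j i, sqi (u j i)) ->
  (forall j i a, weakd Om (u j i) (g j i a) a) -> (forall j i a, suppin Om (g j i a)) ->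
  (forall j, Qf (g j) <= M) -> (forall i, sqi (ub i)) ->
  (forall e : R, 0 < e -> exists J, forall j, (J <= j)%N -> forall i x, Om x -> `|u j i x - ub i x| <= e) ->
  exists gb : 'I_N -> 'I_n -> E -> R, [/\ forall i a, sqi (gb i a), forall i a, suppin Om (gb i a),
    forall i a, weakd Om (ub i) (gb i a) a &
    forall (eta : E -> R) C A J, measurable_fun setT eta -> (forall x, 0 <= eta x <= C) ->
      (forall j, (J <= j)%N -> D2 (g j) eta <= A) -> D2 gb eta <= A].
Proof.
move=> su wu g0 hM sub hu; have [m [v [h [hm Hk hc]]]] := hull_cauchy hM.
have lim i a : exists f, [/\ sqi f, forall k, RI (fun x => (f x - h k i a x) ^+ 2) <= 8^-1 ^+ k &
    forall x, (forall k, h k i a x = 0) -> f x = 0].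
  apply: L2_complete => [k|k k' kk]; first exact: hull_sqi (Hk k).
  by apply: le_trans (hc k k' kk); exact: (Qf_comp (fun i a x => h k' i a x - h k i a x)).
have lim' i : exists F : 'I_n -> E -> R, forall a, [/\ sqi (F a), forall k, RI (fun x => (F a x - h k i a x) ^+ 2) <= 8^-1 ^+ k &
    forall x, (forall k, h k i a x = 0) -> F a x = 0].
  by have /choice [F hF] := lim i; exists F.
have /choice [gb hgb] := lim'.
have sgb i a : sqi (gb i a) by case: (hgb i a).
have cgb i a k : RI (fun x => (gb i a x - h k i a x) ^+ 2) <= 8^-1 ^+ k by case: (hgb i a).
have sh k i a : sqi (h k i a) := hull_sqi i a (Hk k).
exists gb; split => //.
- move=> i a x hx; have [_ _ z] := hgb i a; apply: z => k; exact: (hull_supp i a g0 (Hk k) hx).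
- move=> i a phi tp; have st := test_sqi tp; have sd := test_sqi (test_partial a tp).
  have [_ _ pO] := test_partial a tp.
  have idp : itg (fun x => `|partial a phi x|).
    have tp' := test_partial a tp; have [s1 c1 _] := tp'.
    by apply: itg_abs; apply: (cont_supp_itg c1 (test_fun_supp tp')); exact: smooth_cont.
  apply/eqP; rewrite -subr_eq0 opprK; apply/eqP.
  set A := RI (fun x => `|partial a phi x|); set B := RI (fun x => phi x ^+ 2).
  have B0 : 0 <= B by exact: RI_sqr_ge0.
  apply: (@sqr_small0 _ _ (2 * A ^+ 2 + 2 * B)); first by rewrite addr_ge0// mulr_ge0// sqr_ge0.
  move=> d d0; have [K1 hK1] := small_pow8 d0.
  have e0 : 0 < Num.sqrt d by rewrite sqrtr_gt0.
  have [J hJ] := hu _ e0; pose k := maxn K1 J.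
  have [sv wv] := hull_weakd i a su wu (Hk k).
  have near : forall x, Om x -> `|v k i x - ub i x| <= Num.sqrt d.
    apply: (hull_near _ (Hk k)) => j mj; apply: hJ; apply: leq_trans mj.
    by apply: leq_trans (hm k); exact: leq_maxr.
  have i1 := sqi_mul (sub i) sd; have i2 := sqi_mul sv sd.
  have i3 := sqi_mul (sgb i a) st; have i4 := sqi_mul (sh k i a) st.
  have e1 : RI (fun x => (ub i x - v k i x) * partial a phi x) = RI (fun x => ub i x * partial a phi x) - RI (fun x => v k i x * partial a phi x).
    by rewrite -(RI_B i1 i2); congr RI; apply/funext => x; ring.
  have e2 : RI (fun x => (gb i a x - h k i a x) * phi x) = RI (fun x => gb i a x * phi x) - RI (fun x => h k i a x * phi x).
    by rewrite -(RI_B i3 i4); congr RI; apply/funext => x; ring.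
  have -> : RI (fun x => ub i x * partial a phi x) + RI (fun x => gb i a x * phi x) =
      RI (fun x => (ub i x - v k i x) * partial a phi x) + RI (fun x => (gb i a x - h k i a x) * phi x).
    by rewrite e1 e2 wv//; ring.
  have b1 : `|RI (fun x => (ub i x - v k i x) * partial a phi x)| <= Num.sqrt d * A.
    have i5 : itg (fun x => (ub i x - v k i x) * partial a phi x) by exact: sqi_mul (sqiB (sub i) sv) sd.
    apply: (le_trans (RI_abs i5)); rewrite /A -(RI_Z _ idp); apply: RI_le; [exact: itg_abs|exact: itgZ|].
    move=> x; rewrite normrM; have [xO|xO] := pselect (Om x).
      by rewrite ler_wpM2r// distrC; exact: near.
    rewrite (_ : partial a phi x = 0) ?normr0 ?mulr0//.
    by apply: (test_fun_supp (test_partial a tp)) => h'; apply: xO; exact: pO.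
  have b2 : RI (fun x => (gb i a x - h k i a x) * phi x) ^+ 2 <= d * B.
    apply: (le_trans (RI_CS (sqiB (sgb i a) (sh k i a)) st)); rewrite ler_wpM2r//.
    by apply: (le_trans (cgb i a k)); apply: hK1; exact: leq_maxl.
  move: b1 b2; set X := RI (fun x => (ub i x - v k i x) * _); set Y := RI (fun x => (gb i a x - _) * _) => b1 b2.
  have b3 : X ^+ 2 <= d * A ^+ 2.
    rewrite -[d in leRHS](sqr_sqrtr (ltW d0)) -exprMn -[leLHS](real_normK (num_real _)).
    by rewrite ler_sqr ?nnegrE// (le_trans _ b1).
  have : (X + Y) ^+ 2 <= 2 * X ^+ 2 + 2 * Y ^+ 2 by have := sqr_ge0 (X - Y); nra.
  move: b2 b3; lra.
- move=> eta C A J me he hA; have C0 : 0 <= C by have /andP[e0 e1] := he 0; exact: le_trans e1.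
  have A0 : 0 <= A.
    by apply: le_trans (hA J (leqnn J)); apply: D2_ge0 => x; case/andP: (he x).
  (* The inequality |q|^2 <= (1 + t) |p|^2 + (1 + 1/t) |q - p|^2, with t sent to 0 at the end. *)
  have step (t : R) : 0 < t -> D2 gb eta <= (1 + t) * A.
    move=> t0; apply/ler_addgt0Pl => e e0.
    have ti : 0 < 1 + t^-1 by rewrite addr_gt0// invr_gt0.
    pose Z := (1 + t^-1) * (C * (N%:R * n%:R)); have Z0 : 0 <= Z.
      by apply: mulr_ge0; [exact: ltW|rewrite !mulr_ge0].
    have [K hK] := small_pow8 (divr_gt0 e0 (ltr_wpDl Z0 ltr01)); pose k := maxn K J.
    have Hh : D2 (h k) eta <= A.
      apply: (hull_D2 me he _ (Hk k)) => j mj; apply: hA; apply: leq_trans mj.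
      by apply: leq_trans (hm k); exact: leq_maxr.
    have b i a : RI (fun x => eta x * gb i a x ^+ 2) <= (1 + t) * RI (fun x => eta x * h k i a x ^+ 2) +
        (1 + t^-1) * (C * 8^-1 ^+ k).
      have i1 := itg_wsq me he (sgb i a); have i2 := itg_wsq me he (sh k i a).
      have [_ i3] := sqiB (sgb i a) (sh k i a).
      apply: (@le_trans _ _ ((1 + t) * RI (fun x => eta x * h k i a x ^+ 2) +
        (1 + t^-1) * (C * RI (fun x => (gb i a x - h k i a x) ^+ 2)))); last first.
        by rewrite lerD2l ler_wpM2l ?(ltW ti)// ler_wpM2l.
      rewrite mulrA -(RI_Z _ i2) -(RI_Z _ i3) -(RI_D (itgZ _ i2) (itgZ _ i3)); apply: RI_le => //.
        by apply: itgD; apply: itgZ.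
      move=> x; have /andP[x0 x1] := he x; set p := h k i a x; set q := gb i a x.
      have hq : q ^+ 2 <= (1 + t) * p ^+ 2 + (1 + t^-1) * (q - p) ^+ 2.
        rewrite -subr_ge0 (_ : _ - _ = t^-1 * (t * p - (q - p)) ^+ 2); last by field; rewrite gt_eqF.
        by rewrite mulr_ge0 ?sqr_ge0// invr_ge0 ltW.
      apply: (le_trans (ler_wpM2l x0 hq)); rewrite mulrDr; apply: lerD; first by rewrite mulrCA.
      by rewrite mulrA ler_wpM2r ?sqr_ge0// mulrC ler_wpM2l// ltW.
    have s : D2 gb eta <= \sum_(i < N) \sum_(a < n) ((1 + t) * RI (fun x => eta x * h k i a x ^+ 2) +
        (1 + t^-1) * (C * 8^-1 ^+ k)).
      by apply: ler_sum => i _; apply: ler_sum => a _; exact: b.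
    apply: (le_trans s); under eq_bigr do rewrite big_split /= -mulr_sumr sumr_const card_ord.
    rewrite big_split /= -mulr_sumr sumr_const card_ord addrC; apply: lerD; last first.
      by apply: ler_wpM2l Hh; lra.
    have cst (Y : R) : Y *+ n *+ N = Y * (N%:R * n%:R).
      by rewrite -mulrnA -[LHS]mulr_natr natrM [n%:R * _]mulrC.
    have -> : (1 + t^-1) * (C * 8^-1 ^+ k) *+ n *+ N = Z * 8^-1 ^+ k by rewrite cst /Z; ring.
    have := hK k (leq_maxl _ _); rewrite ler_pdivlMr; last by lra.
    have : 0 <= 8^-1 ^+ k :> R by rewrite exprn_ge0// invr_ge0.
    set q := 8^-1 ^+ k; lra.
  apply/ler_addgt0Pl => e e0; have A1 : 0 < A + 1 by lra.
  apply: (le_trans (step (e / (A + 1)) (divr_gt0 e0 A1))).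
  rewrite mulrDl mul1r addrC lerD2r mulrAC ler_pdivrMr//; nra.
Qed.

End mazur.

(** * Passage to the limit in the functional *)

Section limit_of_minimizers.
Context {R : realType} {n N : nat}.
Local Notation E := 'rV[R]_n.
Local Notation V := 'rV[R]_N.
Local Notation mu := (@lebesgue_rV R n).
Local Notation RI := (RI mu).
Local Notation itg := (itg mu).
Local Notation sqi := (sqi mu).

(* The part of W(vb) lost when vb is replaced by v. *)
Definition W_loss (vb v : V) : R :=
  \sum_(i < N) \sum_(k < N | k == i.+1 :> nat)
    (vb ord0 k < vb ord0 i)%R%:R * (1 - (v ord0 k < v ord0 i)%R%:R).

Lemma W_loss_ge0 vb v : 0 <= W_loss vb v.
Proof.
apply: sumr_ge0 => i _; apply: sumr_ge0 => k _; apply: mulr_ge0; first exact: ler0n.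
by case: (_ < _); rewrite ?subrr ?subr0.
Qed.

Lemma W_loss_le vb v : W_loss vb v <= N%:R ^+ 2.
Proof.
apply: (le_trans _ (W_le vb)); apply: ler_sum => i _; apply: ler_sum => k _.
by case: (vb _ _ < _); case: (v _ _ < _); rewrite ?subrr ?subr0 ?mulr0 ?mulr1.
Qed.

Lemma W_loss0 v : W_loss 0 v = 0.
Proof. by rewrite /W_loss big1// => i _; rewrite big1// => k _; rewrite !mxE ltxx mul0r. Qed.

Lemma W_le_loss vb v : W vb <= W v + W_loss vb v.
Proof.
rewrite /W /W_loss -big_split; apply: ler_sum => i _; rewrite -big_split; apply: ler_sum => k _ /=.
by case: (vb _ _ < _); case: (v _ _ < _) => /=; rewrite ?subrr ?subr0 ?mulr0 ?mulr1 ?addr0 ?add0r ?mul0r.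
Qed.

(** A convex combination has a strict gap only where one of its two vectors has one. *)
Lemma W_mix (t : R) vb v : 0 <= t <= 1 -> W ((1 - t) *: v + t *: vb) <= W v + W_loss vb v.
Proof.
move=> /andP[t0 t1]; rewrite /W /W_loss -big_split; apply: ler_sum => i _; rewrite -big_split.
apply: ler_sum => k _ /=; rewrite !mxE.
have [lb|lb] := ltP (vb ord0 k) (vb ord0 i); have [l|l] := ltP (v ord0 k) (v ord0 i);
  rewrite /= ?subrr ?subr0 ?mulr0 ?mulr1 ?addr0 ?add0r ?mul0r; try by rewrite lern1; case: (_ < _).
have : (1 - t) * v ord0 i + t * vb ord0 i <= (1 - t) * v ord0 k + t * vb ord0 k.
  by apply: lerD; apply: ler_wpM2l => //; rewrite subr_ge0.
by rewrite leNgt => /negbTE ->.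
Qed.

Lemma measurable_gap (U : E -> V) i k : (forall i, measurable_fun setT (fun x => U x ord0 i)) ->
  measurable_fun setT (fun x => (U x ord0 k < U x ord0 i)%R%:R : R).
Proof.
move=> mU; have -> : (fun x => (U x ord0 k < U x ord0 i)%R%:R : R) = \1_[set x | U x ord0 k < U x ord0 i].
  apply/funext => x; rewrite indicE.
  suff -> : (x \in [set x | U x ord0 k < U x ord0 i]) = (U x ord0 k < U x ord0 i) by [].
  by apply/idP/idP => [/set_mem//|h]; exact/mem_set.
apply: measurable_indic; rewrite -[X in measurable X]setTI.
by apply: measurable_fun_ltr.
Qed.

Lemma measurable_W_loss (U U' : E -> V) : (forall i, measurable_fun setT (fun x => U x ord0 i)) ->
  (forall i, measurable_fun setT (fun x => U' x ord0 i)) ->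
  measurable_fun setT (fun x => W_loss (U x) (U' x)).
Proof.
move=> mU mU'; apply: measurable_sum => i; under eq_fun do rewrite big_mkcond.
apply: measurable_sum => j; case: (nat_of_ord j == i.+1) => //.
apply: measurable_funM; first exact: measurable_gap.
by apply: measurable_funB => //; exact: measurable_gap.
Qed.

(** Lower semicontinuity of [W]: a strict gap persists under small perturbations, and d bounds from
    below the finitely many gaps of vb. *)
Lemma W_loss_cvg (F : nat -> V) (vb : V) :
  (forall e : R, 0 < e -> exists J, forall j, (J <= j)%N -> forall i, `|F j ord0 i - vb ord0 i| <= e) ->
  (fun j => W_loss vb (F j)) @ \oo --> (0 : R).
Proof.
move=> hF; pose d := \big[Num.min/1]_(p : 'I_N * 'I_N | vb ord0 p.2 < vb ord0 p.1) (vb ord0 p.1 - vb ord0 p.2).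
have d0 : 0 < d.
  rewrite /d; elim/big_ind : _ => // [a b a0 b0|p hp]; first by rewrite lt_min a0.
  by rewrite subr_gt0.
have d30 : 0 < d / 3 by lra.
have [J hJ] := hF _ d30; apply: cvg_sub0P => e e0; exists J => j Jj.
rewrite subr0 (_ : W_loss _ _ = 0) ?normr0 ?ltW//.
rewrite /W_loss big1// => i _; rewrite big1// => k _.
have [lb|_] := ltP (vb ord0 k) (vb ord0 i); last by rewrite mul0r.
have hd : d <= vb ord0 i - vb ord0 k.
  exact: (@bigmin_le_cond _ _ _ 1 (i, k) (fun p : 'I_N * 'I_N => vb ord0 p.2 < vb ord0 p.1) (fun p => vb ord0 p.1 - vb ord0 p.2) lb).
have := hJ j Jj i; have := hJ j Jj k; rewrite !ler_norml => /andP[a1 a2] /andP[b1 b2].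
by rewrite (_ : F j ord0 k < F j ord0 i) ?subrr ?mulr0//; lra.
Qed.

Lemma weakdB (Om : set E) (f g f' g' : E -> R) a : sqi f -> sqi g -> sqi f' -> sqi g' ->
  weakd Om f g a -> weakd Om f' g' a -> weakd Om (fun x => f x - f' x) (fun x => g x - g' x) a.
Proof.
move=> sf sg sf' sg' w w' phi tp; have st := test_sqi tp; have sd := test_sqi (test_partial a tp).
under eq_fun do rewrite mulrBl; under [in RHS]eq_fun do rewrite mulrBl.
rewrite (RI_B (sqi_mul sf sd) (sqi_mul sf' sd)) (RI_B (sqi_mul sg st) (sqi_mul sg' st)).
by rewrite w// w'// opprB opprK addrC.
Qed.

(* Convexity off the ball, where q = 0; equality inside, where e = 1. *)
Lemma mix_sqr (e t p q g gb : R) : 0 <= e <= 1 -> 0 < t -> (e = 1 \/ q = 0) ->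
  (g + (e * (gb - g) + p + q)) ^+ 2 <= g ^+ 2 - e * g ^+ 2 + e * gb ^+ 2 + ((gb + q) ^+ 2 - gb ^+ 2) +
    (t * (g ^+ 2 + gb ^+ 2 + (gb + q) ^+ 2) + (1 + t^-1) * p ^+ 2).
Proof.
move=> /andP[e0 e1] t0 he; set A := (1 - e) * g + e * gb + q.
have -> : g + (e * (gb - g) + p + q) = A + p by rewrite /A; ring.
have h1 : (A + p) ^+ 2 <= (1 + t) * A ^+ 2 + (1 + t^-1) * p ^+ 2.
  rewrite -subr_ge0 (_ : _ - _ = t^-1 * (t * A - p) ^+ 2); last by field; rewrite gt_eqF.
  by rewrite mulr_ge0 ?sqr_ge0// invr_ge0 ltW.
have g2 := sqr_ge0 g; have gb2 := sqr_ge0 gb; have gq2 := sqr_ge0 (gb + q).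
have h2 : A ^+ 2 <= g ^+ 2 - e * g ^+ 2 + e * gb ^+ 2 + ((gb + q) ^+ 2 - gb ^+ 2).
  rewrite /A; case: he => [->|q0]; first by rewrite le_eqVlt; apply/orP; left; apply/eqP; ring.
  rewrite q0 !addr0 subrr addr0 -subr_ge0 (_ : _ - _ = e * (1 - e) * (g - gb) ^+ 2); last by ring.
  by rewrite mulr_ge0 ?sqr_ge0// mulr_ge0// subr_ge0.
have h3 : A ^+ 2 <= g ^+ 2 + gb ^+ 2 + (gb + q) ^+ 2 by nra.
have h4 : t * A ^+ 2 <= t * (g ^+ 2 + gb ^+ 2 + (gb + q) ^+ 2) by rewrite ler_wpM2l// ltW.
lra.
Qed.

Lemma sum2_mix (t c : R) (A B C D F H K : 'I_N -> 'I_n -> R) :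
  \sum_i \sum_a (A i a - B i a + C i a + (D i a - F i a) + (t * (A i a + H i a + D i a) + c * K i a)) =
  \sum_i \sum_a A i a - \sum_i \sum_a B i a + \sum_i \sum_a C i a +
  (\sum_i \sum_a D i a - \sum_i \sum_a F i a) +
  (t * (\sum_i \sum_a A i a + \sum_i \sum_a H i a + \sum_i \sum_a D i a) + c * \sum_i \sum_a K i a).
Proof.
under eq_bigr do rewrite !(big_split, sumrN) /= -!mulr_sumr !big_split /=.
by rewrite !(big_split, sumrN) /= -!mulr_sumr !big_split /=.
Qed.

Variables (rho : R) (U : nat -> E -> V) (G : nat -> 'I_N -> 'I_n -> E -> R) (Ub : E -> V) (M : R).
Hypotheses (HU : forall j, is_min rho (U j) (G j)) (hM : forall j, Qf (G j) <= M)
  (sub : forall i, sqi (fun x => Ub x ord0 i)) (Ub0 : forall x, ~ l2ball 0 rho x -> Ub x = 0)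
  (hU : forall e : R, 0 < e -> exists J, forall j, (J <= j)%N -> forall i x, `|U j x ord0 i - Ub x ord0 i| <= e).

Lemma RI_W_loss : (fun j => RI (fun x => W_loss (Ub x) (U j x))) @ \oo --> (0 : R).
Proof.
have mB : measurable (cball (0 : E) rho) by exact: measurable_cball.
rewrite -(@RI_0 _ _ _ mu).
have := @RI_dom _ _ _ mu (fun j x => W_loss (Ub x) (U j x)) (fun=> 0) (fun x => N%:R ^+ 2 * \1_(cball 0 rho) x).
case.
- move=> j; apply: measurable_W_loss => i; [by case: (sub i)|by case: (im_u (HU j) i)].
- exact: measurable_cst.
- move=> j x; rewrite ger0_norm ?W_loss_ge0// indicE.
  have [h|h] := pselect (l2ball 0 rho x).
    by rewrite mem_set ?mulr1 ?W_loss_le//; exact: l2ball_cball.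
  by rewrite Ub0// W_loss0 mulr_ge0// sqr_ge0.
- by apply: itgZ; apply: itg_indic => //; exact: mu_cball_lty.
- by move=> x; apply: W_loss_cvg => e /hU[J hJ]; exists J => j Jj i; exact: hJ.
- by [].
Qed.

(* Competitor U_j + eta (Ub - U_j) + w for U_j: the energy of U_j in the layer
   where 0 < eta < 1 cancels by convexity, and W loses at most W_loss there. *)
Lemma limit_min : exists Gb : 'I_N -> 'I_n -> E -> R,
  [/\ forall i a, sqi (Gb i a), forall i a, suppin (l2ball 0 rho) (Gb i a),
      forall i a, weakd (l2ball 0 rho) (fun x => Ub x ord0 i) (Gb i a) a &
      forall x0 r w h, 0 < r -> l2norm x0 + 2 * r <= rho ->
        (forall i, Hc 0 rho (w i) (h i)) -> (forall i, suppin (l2ball x0 r) (w i)) ->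
        (forall i a, suppin (l2ball x0 r) (h i a)) ->
        {ae mu, forall x, ordered (Ub x + \row_i w i x)} ->
        RI (en Ub Gb) <= RI (en (fun x => Ub x + \row_i w i x) (fun i a x => Gb i a x + h i a x))].
Proof.
have [Gb [sGb Gb0 wGb lsc]] := @weak_compactness _ _ _ (fun j i x => U j x ord0 i) G
  (fun j => im_g (HU j)) (l2ball 0 rho) (fun i x => Ub x ord0 i) M (fun j => im_u (HU j))
  (fun j => im_w (HU j)) (fun j => im_g0 (HU j)) hM sub
  (fun e e0 => let: ex_intro J hJ := hU e0 in ex_intro _ J (fun j Jj i x _ => hJ j Jj i x)).
exists Gb; split => // x0 r w h r0 hr Hw w0 h0 ow.
pose eta := dil r x0 (cut : E -> R).
have se : smooth eta by apply: smooth_dil; exact: smooth_cut.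
have e01 x : 0 <= eta x <= 1 by exact: cut01.
have eE x : eta x = dil r 0 cut (x - x0) by rewrite /eta /dil subr0.
have e1 x : l2ball x0 r x -> eta x = 1 by move=> hx; rewrite eE dil_cut1//; exact: ltW.
(* The layer in which eta decreases from 1 to 0 fits into the room left by |x0| + 2 r <= rho. *)
pose r' := l2norm x0 + 3 / 2 * r; have rr : r' < rho by rewrite /r'; lra.
have e0 : suppin (cball 0 r') eta.
  move=> x hx; rewrite eE; apply: (dil_cut_supp r0) => h'; apply: hx; move: h'.
  rewrite /cball /= !subr0 => h'; rewrite -[x](subrK x0) addrC.
  by apply: (le_trans (l2normD _ _)); rewrite lerD2l.
have te := test_ball_intro rr se e0; have me : measurable_fun setT eta by exact: continuous_rV_measurable (smooth_cont se).
have spe a := test_sqi (test_partial a te).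
(* The term created by the derivative of the cutoff; uniform convergence makes it small in L^2. *)
pose b j i a x := (Ub x ord0 i - U j x ord0 i) * partial a eta x.
have sb j i a : sqi (b j i a).
  have [C _ hC] := supp_bounded (@compact_cball R n 0 r') (partial_supp a (@closed_cball _ _ _ _) e0) (smooth_cont (smooth_partial a se)).
  rewrite /b; under eq_fun do rewrite mulrC; apply: (sqi_bM _ hC); last exact: (sqiB (sub i) (im_u (HU j) i)).
  exact: continuous_rV_measurable (smooth_cont (smooth_partial a se)).
pose wj j i x := eta x * (Ub x ord0 i - U j x ord0 i) + w i x.
pose hj j i a x := eta x * (Gb i a x - G j i a x) + b j i a x + h i a x.
have Hj j i : Hc 0 rho (wj j i) (hj j i).
  apply: (HcD (h1 := fun a x => eta x * (Gb i a x - G j i a x) + b j i a x) _ (Hw i)).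
  apply: (Hc_prod (r' := r')) => //.
  - exact: (sqiB (sub i) (im_u (HU j) i)).
  - by move=> a; exact: (sqiB (sGb i a) (im_g (HU j) i a)).
  - by move=> a; apply: weakdB => //; [exact: im_u (HU j) i|exact: im_g (HU j) i a|exact: im_w (HU j) i a].
have case_x x : eta x = 1 \/ (w^~ x = (fun=> 0)) /\ (forall i a, h i a x = 0).
  have [hx|hx] := pselect (l2ball x0 r x); first by left; exact: e1.
  by right; split => [|i a]; [apply/funext => i; rewrite w0|rewrite h0].
have Zmix j x : U j x + \row_i wj j i x = (1 - eta x) *: U j x + eta x *: (Ub x + \row_i w i x).
  apply/rowP => i; rewrite !mxE /wj; case: (case_x x) => [->|[/(congr1 (fun f => f i)) /= -> _]]; ring.
have ordZ j : {ae mu, forall x, ordered (U j x + \row_i wj j i x)}.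
  apply: filterS2 (im_ord (HU j)) ow => x h1 h2; rewrite Zmix; have /andP[x0' x1] := e01 x.
  by apply: orderedD; apply: ordered_scale => //; rewrite subr_ge0.
have iE j : itg (en (U j) (G j)).
  by apply: (itg_en (x0 := 0) (r := rho)) => [i|x|]; [case: (im_u (HU j) i)|exact: im_u0 (HU j) x|exact: im_g (HU j)].
have iEb : itg (en Ub Gb).
  by apply: (itg_en (x0 := 0) (r := rho)) => // i; case: (sub i).
have out (w' : 'I_N -> E -> R) h' : (forall i, Hc 0 rho (w' i) (h' i)) -> forall i x, ~ l2ball 0 rho x -> w' i x = 0.
  move=> H' i x hx; have [_ _ [r1 [rr1 z _]] _] := H' i; apply: z => hb; apply: hx.
  exact: (cball_l2ball rr1).
have addrow (A : E -> V) (w' : 'I_N -> E -> R) h' : (forall i, sqi (fun x => A x ord0 i)) ->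
    (forall x, ~ l2ball 0 rho x -> A x = 0) -> (forall i, Hc 0 rho (w' i) (h' i)) ->
    (forall i, measurable_fun setT (fun x => (A x + \row_i w' i x) ord0 i)) /\
    forall x, ~ l2ball 0 rho x -> A x + \row_i w' i x = 0.
  move=> sA A0 H'; split => [i|x hx].
    under eq_fun do rewrite !mxE; have [sw _ _ _] := H' i.
    by apply: measurable_funD; [case: (sA i)|case: sw].
  by rewrite A0// add0r; apply/rowP => i; rewrite !mxE (out _ _ H').
have [mV V0] := addrow _ _ _ sub Ub0 Hw.
have iV : itg (en (fun x => Ub x + \row_i w i x) (fun i a x => Gb i a x + h i a x)).
  by apply: (itg_en (x0 := 0) (r := rho)) => // i a; apply: sqiD => //; have [_ sh _ _] := Hw i.
have sgh i a : sqi (fun x => Gb i a x + h i a x) by apply: sqiD => //; have [_ sh _ _] := Hw i.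
pose X := RI (en (fun x => Ub x + \row_i w i x) (fun i a x => Gb i a x + h i a x)) - RI (en Ub Gb).
suff : 0 <= X by rewrite subr_ge0.
pose K := M + Qf Gb + Qf (fun i a x => Gb i a x + h i a x).
have K0 : 0 <= K.
  by rewrite !addr_ge0 ?Qf_ge0// (le_trans _ (hM 0%N))// Qf_ge0.
pose CE := N%:R * \sum_a RI (fun x => partial a eta x ^+ 2).
have CE0 : 0 <= CE by rewrite mulr_ge0// sumr_ge0// => a _; exact: RI_sqr_ge0.
(* The full energy of U_j cancels from the two sides of minimality; its part weighted by eta
   remains. *)
have key (t : R) j : 0 < t -> D2 (G j) eta <= D2 Gb eta + X + (t * K + (1 + t^-1) * Qf (b j) + RI (fun x => W_loss (Ub x) (U j x))).
  move=> t0; have hm := im_min (HU j) (Hj j) (ordZ j).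
  have sG := im_g (HU j).
  pose P1 x := \sum_i \sum_a eta x * G j i a x ^+ 2; pose P2 x := \sum_i \sum_a eta x * Gb i a x ^+ 2.
  pose q1 x := \sum_i \sum_a G j i a x ^+ 2; pose q2 x := \sum_i \sum_a Gb i a x ^+ 2.
  pose q3 x := \sum_i \sum_a (Gb i a x + h i a x) ^+ 2; pose q4 x := \sum_i \sum_a b j i a x ^+ 2.
  pose WL x := W_loss (Ub x) (U j x).
  have itg2 (F : 'I_N -> 'I_n -> E -> R) : (forall i a, itg (F i a)) -> itg (fun x => \sum_i \sum_a F i a x).
    by move=> iF; apply: itg_sum => i; exact: itg_sum.
  have j1 := fun i a => itg_wsq me e01 (sG i a); have j2 := fun i a => itg_wsq me e01 (sGb i a).
  have iP1 : itg P1 := itg2 _ j1; have iP2 : itg P2 := itg2 _ j2.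
  have iq1 : itg q1 := itg2 _ (fun i a => proj2 (sG i a)); have iq2 : itg q2 := itg2 _ (fun i a => proj2 (sGb i a)).
  have iq3 : itg q3 := itg2 _ (fun i a => proj2 (sgh i a)); have iq4 : itg q4 := itg2 _ (fun i a => proj2 (sb j i a)).
  have iWL : itg WL.
    apply: (@itg_le _ _ _ _ (fun x => N%:R ^+ 2 * \1_(cball 0 rho) x)).
    - by apply: measurable_W_loss => i; [case: (sub i)|case: (im_u (HU j) i)].
    - move=> x; rewrite ger0_norm ?W_loss_ge0// indicE.
      have [hx|hx] := pselect (l2ball 0 rho x).
        by rewrite mem_set ?mulr1 ?W_loss_le//; exact: l2ball_cball.
      by rewrite /WL Ub0// W_loss0 mulr_ge0// sqr_ge0.
    - by apply: itgZ; apply: itg_indic; [exact: measurable_cball|exact: mu_cball_lty].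
  have r1 : RI P1 = D2 (G j) eta by exact: RI_sum2 j1.
  have r2 : RI P2 = D2 Gb eta by exact: RI_sum2 j2.
  have r3 : RI q1 = Qf (G j) by exact: RI_sum2 (fun i a => proj2 (sG i a)).
  have r4 : RI q2 = Qf Gb by exact: RI_sum2 (fun i a => proj2 (sGb i a)).
  have r5 : RI q3 = Qf (fun i a x => Gb i a x + h i a x) by exact: RI_sum2 (fun i a => proj2 (sgh i a)).
  have r6 : RI q4 = Qf (b j) by exact: RI_sum2 (fun i a => proj2 (sb j i a)).
  pose eV := en (fun x => Ub x + \row_i w i x) (fun i a x => Gb i a x + h i a x).
  pose F x := en (U j) (G j) x - P1 x + P2 x + (eV x - en Ub Gb x) + (t * (q1 x + q2 x + q3 x) + (1 + t^-1) * q4 x + WL x).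
  have l1 := itgB (iE j) iP1; have l2 := itgD l1 iP2; have l3 := itgB iV iEb; have l4 := itgD l2 l3.
  have l5 := itgD iq1 iq2; have l6 := itgD l5 iq3; have l7 := itgD (itgZ t l6) (itgZ (1 + t^-1) iq4).
  have l8 := itgD l7 iWL.
  have RF : RI F = RI (en (U j) (G j)) - D2 (G j) eta + D2 Gb eta + X +
      (t * (Qf (G j) + Qf Gb + Qf (fun i a x => Gb i a x + h i a x)) + (1 + t^-1) * Qf (b j) + RI WL).
    rewrite /F (RI_D l4 l8) (RI_D l2 l3) (RI_D l1 iP2) (RI_B (iE j) iP1) (RI_B iV iEb).
    rewrite (RI_D l7 iWL) (RI_D (itgZ t l6) (itgZ (1 + t^-1) iq4)) (RI_Z _ l6) (RI_Z _ iq4) (RI_D l5 iq3) (RI_D iq1 iq2).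
    by rewrite r1 r2 r3 r4 r5 r6.
  have le : RI (en (fun x => U j x + \row_i wj j i x) (fun i a x => G j i a x + hj j i a x)) <= RI F.
    apply: RI_le; last first.
    - move=> x; have cx := case_x x; rewrite /en /F /en /eV /en.
      have hW : W (U j x + \row_i wj j i x) <= W (U j x) + (W (Ub x + \row_i w i x) - W (Ub x)) + WL x.
        rewrite Zmix; case: cx => [->|[w00 _]].
          by rewrite subrr scale0r add0r scale1r; have := W_le_loss (Ub x) (U j x); rewrite /WL; lra.
        have -> : Ub x + \row_i w i x = Ub x.
          by apply/rowP => i; rewrite !mxE; have /(congr1 (fun f => f i)) /= -> := w00; rewrite addr0.
        by have := W_mix (Ub x) (U j x) (e01 x); rewrite /WL subrr addr0.
      have hG : \sum_i \sum_a (G j i a x + hj j i a x) ^+ 2 <= q1 x - P1 x + P2 x + (q3 x - q2 x) +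
          (t * (q1 x + q2 x + q3 x) + (1 + t^-1) * q4 x).
        rewrite /q1 /q2 /q3 /q4 /P1 /P2 -sum2_mix; apply: ler_sum => i _; apply: ler_sum => a _.
        apply: mix_sqr => //; case: cx => [->|[_ ->]]; [by left|by right].
      move: hW hG; rewrite /q1 /q2 /q3; set z1 := W _; set z2 := W _; set z3 := W _; set z4 := W _; set z5 := t * _; lra.
    - exact: itgD l4 l8.
    - have [mZ Z0] := addrow _ _ _ (im_u (HU j)) (im_u0 (HU j)) (Hj j).
      apply: (itg_en (x0 := 0) (r := rho)) => // i a; apply: sqiD; first exact: sG.
      by have [_ sh _ _] := Hj j i.
  have tK : t * (Qf (G j) + Qf Gb + Qf (fun i a x => Gb i a x + h i a x)) <= t * K.
    by rewrite ler_wpM2l ?(ltW t0)// /K !lerD2r.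
  have := le_trans hm le; rewrite RF /WL.
  by move: tK; set z1 := RI (en _ _); set z2 := t * _; set z3 := D2 _ _; set z4 := D2 _ _; set z5 := _ * Qf _; set z6 := RI _; lra.
have Qb (d : R) j : 0 <= d -> (forall i x, `|U j x ord0 i - Ub x ord0 i| <= d) -> Qf (b j) <= d ^+ 2 * CE.
  move=> d0 hd; apply: (@le_trans _ _ (\sum_(i < N) \sum_a d ^+ 2 * RI (fun x => partial a eta x ^+ 2))).
    apply: ler_sum => i _; apply: ler_sum => a _; have [_ ip] := spe a.
    rewrite -(RI_Z _ ip); apply: RI_le; [by case: (sb j i a)|exact: itgZ|].
    move=> x; rewrite /b exprMn ler_wpM2r ?sqr_ge0// -[leLHS](real_normK (num_real _)).
    by rewrite ler_sqr ?nnegrE// distrC.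
  by under eq_bigr do rewrite -mulr_sumr; rewrite sumr_const card_ord /CE -[leLHS]mulr_natl mulrCA.
rewrite -oppr_le0; apply/ler_addgt0Pl => e e0'; rewrite addr0 lerNl.
have K1 : 0 < 3 * (K + 1) by lra.
pose t := e / (3 * (K + 1)); have t0 : 0 < t by exact: divr_gt0.
have tK : t * K <= e / 3.
  by rewrite /t mulrAC ler_pdivrMr//; nra.
have ti : 0 < 1 + t^-1 by rewrite addr_gt0// invr_gt0.
have C1 : 0 < 3 * ((1 + t^-1) * (CE + 1)) by rewrite !mulr_gt0//; lra.
pose d2 := e / (3 * ((1 + t^-1) * (CE + 1))); have d20 : 0 < d2 by exact: divr_gt0.
have d0 : 0 < Num.sqrt d2 by rewrite sqrtr_gt0.
have e3 : 0 < e / 3 by lra.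
have [J1 hJ1] := hU d0; have [J2 hJ2] := cvg_evP RI_W_loss e3.
(* Semicontinuity applied to [key]: the weighted energy of the limit occurs on both sides and only X
   >= - e is left. *)
have : D2 Gb eta <= D2 Gb eta + X + e.
  apply: (lsc eta 1 _ (maxn J1 J2) me e01) => j; rewrite geq_max => /andP[jj1 jj2].
  apply: (le_trans (key t j t0)); rewrite lerD2l.
  have b1 := Qb _ j (ltW d0) (hJ1 j jj1); rewrite sqr_sqrtr ?(ltW d20)// in b1.
  have b2 : (1 + t^-1) * Qf (b j) <= e / 3.
    apply: (le_trans (ler_wpM2l (ltW ti) b1)).
    rewrite mulrCA /d2 mulrAC ler_pdivrMr//.
    have : (1 + t^-1) * CE <= (1 + t^-1) * (CE + 1) by rewrite ler_wpM2l ?(ltW ti)// lerDl.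
    set z1 := _ * CE; set z2 := _ * (CE + 1); nra.
  have b3 := le_trans (ler_norm _) (hJ2 j jj2); rewrite subr0 in b3.
  have := lerD (lerD tK b2) b3; rewrite (_ : e / 3 + e / 3 + e / 3 = e) //; by field.
by set z := D2 Gb eta; lra.
Qed.

End limit_of_minimizers.

(** * Back to minimality among H^1_0 perturbations *)

Section global_limit.
Context {R : realType} {n N : nat}.
Local Notation E := 'rV[R]_n.
Local Notation V := 'rV[R]_N.
Local Notation mu := (@lebesgue_rV R n).
Local Notation RI := (RI mu).
Local Notation itg := (itg mu).
Local Notation sqi := (sqi mu).

Lemma weakdD (Om : set E) (f g f' g' : E -> R) a : sqi f -> sqi g -> sqi f' -> sqi g' ->
  weakd Om f g a -> weakd Om f' g' a -> weakd Om (fun x => f x + f' x) (fun x => g x + g' x) a.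
Proof.
move=> sf sg sf' sg' w w' phi tp; have st := test_sqi tp; have sd := test_sqi (test_partial a tp).
under eq_fun do rewrite mulrDl; under [in RHS]eq_fun do rewrite mulrDl.
rewrite (RI_D (sqi_mul sf sd) (sqi_mul sf' sd)) (RI_D (sqi_mul sg st) (sqi_mul sg' st)).
by rewrite w// w'// opprD.
Qed.

Lemma weakd_sub (A B : set E) (f g : E -> R) a : A `<=` B -> weakd B f g a -> weakd A f g a.
Proof. by move=> AB w phi tp; apply: w; exact: test_fun_sub tp. Qed.

Lemma weakd_ext (Om : set E) (f g : E -> R) a : weakd Om f g a -> weakd Om (ext Om f) (ext Om g) a.
Proof.
move=> w phi tp; have out psi x : test_function Om psi -> ~ Om x -> psi x = 0.
  by move=> tpsi xO; apply: (test_fun_supp tpsi) => h; apply: xO; case: tpsi => _ _; exact.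
have := w phi tp; have -> : (fun x => ext Om f x * partial a phi x) = (fun x => f x * partial a phi x).
  apply/funext => x; have [xO|xO] := pselect (Om x); first by rewrite ext_in.
  by rewrite (out _ _ (test_partial a tp) xO) !mulr0.
suff -> : (fun x => ext Om g x * phi x) = (fun x => g x * phi x) by [].
apply/funext => x; have [xO|xO] := pselect (Om x); first by rewrite ext_in.
by rewrite (out _ _ tp xO) !mulr0.
Qed.

Lemma sqi_ext (Om : set E) (f : E -> R) : measurable Om -> sqi f -> sqi (ext Om f).
Proof.
move=> mO; apply: (@sqi_bM _ _ _ _ 1); first exact: measurable_indic.
by move=> x; rewrite indicE; case: (_ \in _); rewrite ?normr1 ?normr0.
Qed.

(** The extension by zero has a weak gradient on the whole space: this holds for the test functions
    that approximate w, and passes to the limit. A larger ball makes the support compact inside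
    it. *)
Lemma H10_Hc (x0 : E) (r rho : R) w : 0 < r -> l2norm x0 + r < rho -> H10 (l2ball x0 r) w ->
  exists h : 'I_n -> E -> R, (forall i, suppin (l2ball x0 r) (h i)) /\ Hc 0 rho (ext (l2ball x0 r) w) h.
Proof.
move=> r0 hr [[Lw [G hG]] happ].
have ar (X Y A B d : R) : X ^+ 2 <= d * A -> Y ^+ 2 <= d * B -> (X + Y) ^+ 2 <= (2 * A + 2 * B) * d.
  by have := sqr_ge0 (X - Y); nra.
 set Om := l2ball x0 r in Lw hG happ *.
have mOm : measurable Om by exact: measurable_l2ball.
have [hW _] := weak_gradE r0 Lw hG; pose h i := ext Om (fun x => weak_grad Om w x ord0 i).
have sw : sqi (ext Om w) by exact: (L2P _ mOm).1.
have wP := (weak_gradP _ mOm Lw).1 hW.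
have sh i : sqi (h i) by case: (wP i).
have wd i : weakd Om (ext Om w) (h i) i by case: (wP i).
have supp (f : E -> R) : suppin Om f -> suppin (cball 0 (l2norm x0 + r)) f.
  move=> f0 x hx; apply: f0 => hO; apply: hx; rewrite /cball /= subr0 -[x](subrK x0) addrC.
  by apply: (le_trans (l2normD _ _)); rewrite lerD2l; exact: ltW.
exists h; split; first by move=> i x; exact: ext_out.
split => //.
  exists (l2norm x0 + r); split => // [|i]; first by apply: supp => x; exact: ext_out.
  by apply: supp => x; exact: ext_out.
move=> i psi tpsi; have spsi := test_sqi tpsi; have sdpsi := test_sqi (test_partial i tpsi).
apply/eqP; rewrite -subr_eq0 opprK; apply/eqP.
apply: (@sqr_small0 _ _ (2 * RI (fun x => partial i psi x ^+ 2) + 2 * RI (fun x => psi x ^+ 2))).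
  by rewrite addr_ge0// mulr_ge0// RI_sqr_ge0.
move=> d d0; have [phi tp hphi] := happ d d0.
have sp := test_sqi tp; have spd a := test_sqi (test_partial a tp); have [smp _ _] := tp.
have p0 : suppin Om phi by move=> x xO; apply: (test_fun_supp tp) => h'; apply: xO; case: tp => _ _; exact.
have dp0 a : suppin Om (partial a phi).
  by have tp' := test_partial a tp; move=> x xO; apply: (test_fun_supp tp') => h'; apply: xO; case: tp' => _ _; exact.
have [r1 rr1 p1] := test_ball_supp tp.
have [_ _ _ hpd] := Hc_test smp rr1 p1.
have e1 : ext Om (w \- phi)%R = fun x => ext Om w x - phi x.
  apply/funext => x; have [xO|xO] := pselect (Om x); first by rewrite !ext_in.
  by rewrite !ext_out// p0// subrr.
have LL : L2 Om (w \- phi)%R by apply/L2P => //; rewrite e1; exact: sqiB.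
pose Gd x : 'rV[R]_n := \row_a (h a x - partial a phi x).
have e2 a : ext Om (fun x => Gd x ord0 a) = fun x => h a x - partial a phi x.
  under eq_fun do rewrite mxE; apply: ext_id => x xO; rewrite /h ext_out// dp0// subrr//.
have GG : is_weak_grad Om (w \- phi)%R Gd.
  apply/weak_gradP => // a; rewrite e1 e2; split; first exact: sqiB.
  by apply: weakdB => //; exact: weakd_sub (hpd a).
have [_ aeG] := weak_gradE r0 LL GG.
pose F x := (ext Om w x - phi x) ^+ 2 + \sum_a (h a x - partial a phi x) ^+ 2.
have sd : sqi (fun x => ext Om w x - phi x) by exact: sqiB.
have sda a : sqi (fun x => h a x - partial a phi x) by exact: sqiB.
have iS : itg (fun x => \sum_a (h a x - partial a phi x) ^+ 2) by apply: itg_sum => a; case: (sda a).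
have iF : itg F by apply: itgD => //; case: sd.
have FE : (H1_normsq Om (w \- phi)%R = (RI F)%:E)%E.
  rewrite /H1_normsq int_ext EFin_RI//; apply: ae_eq_integral => //.
  - apply/measurable_EFinP.
    have -> : ext Om (fun x => (w \- phi)%R x ^+ 2 + l2norm (weak_grad Om (w \- phi)%R x) ^+ 2) =
      fun x => (ext Om w x - phi x) ^+ 2 + \sum_i (ext Om (fun y => weak_grad Om (w \- phi)%R y ord0 i) x) ^+ 2.
      apply/funext => x; have [xO|xO] := pselect (Om x).
        rewrite !ext_in// l2norm_sqr; congr (_ + _).
        by apply: eq_bigr => j _; rewrite ext_in.
      rewrite !ext_out// p0// subrr expr0n add0r big1// => j _.
      by rewrite ext_out// expr0n.
    apply: measurable_funD; first by apply: measurable_funX; case: sd.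
    apply: measurable_sum => j; apply: measurable_funX.
    have [G1 _] := weak_gradE r0 LL GG.
    by have [[]] := (weak_gradP _ mOm LL).1 G1 j.
  - by apply/measurable_EFinP; exact: itg_meas iF.
  - apply: filterS aeG => x hx _ /=; congr (_%:E).
    have [xO|xO] := pselect (Om x).
      rewrite ext_in// hx// l2norm_sqr /F ext_in//; congr (_ + _).
      by apply: eq_bigr => j _; rewrite mxE.
    rewrite ext_out// /F ext_out// p0// subrr expr0n add0r big1// => j _.
    by rewrite /h ext_out// dp0// subrr expr0n.
have Fd : RI F <= d by move: hphi; rewrite FE lte_fin => /ltW.
rewrite (RI_D (proj2 sd) iS) RI_sum in Fd; last by move=> a; case: (sda a).
have S0 : 0 <= \sum_a RI (fun x => (h a x - partial a phi x) ^+ 2) by apply: sumr_ge0 => a _; exact: RI_sqr_ge0.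
have b1 : RI (fun x => (ext Om w x - phi x) ^+ 2) <= d by apply: le_trans Fd; rewrite lerDl.
have b2 : RI (fun x => (h i x - partial i phi x) ^+ 2) <= d.
  apply: le_trans Fd; rewrite (bigD1 i)//= addrCA lerDl addr_ge0 ?RI_sqr_ge0//.
  by apply: sumr_ge0 => a _; exact: RI_sqr_ge0.
have -> : RI (fun x => ext Om w x * partial i psi x) + RI (fun x => h i x * psi x) =
    RI (fun x => (ext Om w x - phi x) * partial i psi x) + RI (fun x => (h i x - partial i phi x) * psi x).
  have -> : (fun x => (ext Om w x - phi x) * partial i psi x) = (fun x => ext Om w x * partial i psi x - phi x * partial i psi x).
    by apply/funext => x; rewrite mulrBl.
  have -> : (fun x => (h i x - partial i phi x) * psi x) = (fun x => h i x * psi x - partial i phi x * psi x).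
    by apply/funext => x; rewrite mulrBl.
  rewrite (RI_B (sqi_mul sw sdpsi) (sqi_mul sp sdpsi)) (RI_B (sqi_mul (sh i) spsi) (sqi_mul (spd i) spsi)).
  rewrite (hpd i psi tpsi); ring.
have c1 := RI_CS sd sdpsi; have c2 := RI_CS (sda i) spsi.
have A0 : 0 <= RI (fun x => partial i psi x ^+ 2) by exact: RI_sqr_ge0.
have B0 : 0 <= RI (fun x => psi x ^+ 2) by exact: RI_sqr_ge0.
exact: ar (le_trans c1 (ler_wpM2r A0 b1)) (le_trans c2 (ler_wpM2r B0 b2)).
Qed.

(** A competitor differs from Ub inside the small ball only, so the energies over the rest of the
    large ball cancel. *)
Lemma limit_minimizer (rho : R) (Ub : E -> V) Gb (x0 : E) (r : R) : let U := extV (l2ball 0 rho) Ub in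
  0 < r -> l2norm x0 + 2 * r <= rho ->
  (forall x, ordered (Ub x)) -> (forall i, sqi (fun x => U x ord0 i)) ->
  (forall i a, sqi (Gb i a)) -> (forall i a, weakd (l2ball 0 rho) (fun x => U x ord0 i) (Gb i a) a) ->
  (forall w h, (forall i, Hc 0 rho (w i) (h i)) -> (forall i, suppin (l2ball x0 r) (w i)) ->
    (forall i a, suppin (l2ball x0 r) (h i a)) ->
    {ae mu, forall x, ordered (U x + \row_i w i x)} ->
    RI (en U Gb) <= RI (en (fun x => U x + \row_i w i x) (fun i a x => Gb i a x + h i a x))) ->
  minimizer (l2ball x0 r) Ub.
Proof.
move=> U r0 hr oU sU sG wG hmin; set Om := l2ball x0 r.
have mOm : measurable Om by exact: measurable_l2ball.
have OmB x : Om x -> l2ball 0 rho x.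
  move=> xO; rewrite /l2ball /= subr0 -[x](subrK x0) addrC.
  apply: (le_lt_trans (l2normD _ _)); apply: lt_le_trans hr; rewrite ltrD2l.
  by apply: lt_le_trans xO _; lra.
have U_in x : Om x -> U x = Ub x by move=> xO; rewrite /U extV_in//; exact: OmB.
have eU i : ext Om (component Ub i) = ext Om (fun x => U x ord0 i).
  by apply/funext => x; have [xO|xO] := pselect (Om x); [rewrite !ext_in// U_in|rewrite !ext_out].
have oUx x : ordered (U x).
  have [xO|xO] := pselect (l2ball 0 rho x); first by rewrite /U extV_in.
  by rewrite /U extV_out// => i j ij; rewrite !mxE.
have LU i : L2 Om (component Ub i) by apply/L2P => //; rewrite eU; exact: sqi_ext.
pose Gw i x : 'rV[R]_n := \row_a Gb i a x.
have eG i a : ext Om (fun x => Gw i x ord0 a) = ext Om (Gb i a).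
  by congr (ext Om _); apply/funext => x; rewrite mxE.
have wO i a : weakd Om (fun x => U x ord0 i) (Gb i a) a by exact: weakd_sub (wG i a).
have GU i : is_weak_grad Om (component Ub i) (Gw i).
  apply/weak_gradP => // a; rewrite eU eG; split; first exact: sqi_ext.
  exact: weakd_ext.
split.
  split; first by move=> i; split => //; exists (Gw i).
  by apply: aeW => x xO i j ij; exact: oU.
move=> Z [HZ oZ] H0.
have hr' : l2norm x0 + r < rho by apply: lt_le_trans hr; lra.
have /choice [h hh] := fun i => H10_Hc r0 hr' (H0 i).
pose w i := ext Om (component Z i \- component Ub i)%R.
have ZE x : Om x -> Z x = U x + \row_i w i x.
  by move=> xO; rewrite U_in//; apply/rowP => i; rewrite !mxE /w ext_in// /component /= addrC subrK.
have ow : {ae mu, forall x, ordered (U x + \row_i w i x)}.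
  apply: filterS oZ => x hx; have [xO|xO] := pselect (Om x).
    by rewrite -ZE// => i j ij; exact: hx.
  rewrite (_ : \row_i w i x = 0) ?addr0//.
  by apply/rowP => i; rewrite !mxE /w ext_out.
have Hw i : Hc 0 rho (w i) (h i) by case: (hh i).
have h0 i a : suppin Om (h i a) by case: (hh i).
have w0 i : suppin Om (w i) by move=> x; exact: ext_out.
have hm := hmin w h Hw w0 h0 ow.
have eZ i : ext Om (component Z i) = ext Om (fun x => U x ord0 i + w i x).
  apply/funext => x; have [xO|xO] := pselect (Om x); last by rewrite !ext_out.
  by rewrite !ext_in// /component ZE// !mxE.
have sw i : sqi (w i) by case: (Hw i).
have sh i a : sqi (h i a) by have [] := Hw i.
have LZ i : L2 Om (component Z i).
  by apply/L2P => //; rewrite eZ; apply: sqi_ext => //; exact: sqiD.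
pose Ga i x : 'rV[R]_n := \row_a (Gb i a x + h i a x).
have eGa i a : ext Om (fun x => Ga i x ord0 a) = ext Om (fun x => Gb i a x + h i a x).
  by congr (ext Om _); apply/funext => x; rewrite mxE.
have GZ i : is_weak_grad Om (component Z i) (Ga i).
  apply/weak_gradP => // a; rewrite eZ eGa; split; first by apply: sqi_ext => //; exact: sqiD.
  apply: weakd_ext; apply: weakdD => //.
  by have [_ _ _ hwd] := Hw i; exact: weakd_sub (hwd a).
rewrite (J_RI r0 LU GU) (J_RI r0 LZ GZ) lee_fin -/Om.
set A := en (extV Om Ub) _; set B := en (extV Om Z) _.
have iA : itg A.
  apply: (itg_en (x0 := x0) (r := r)) => [i|x|i a]; first by rewrite extV_coord eU; case: (sqi_ext mOm (sU i)).
    by move=> hx; exact: extV_out.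
  by rewrite eG; exact: sqi_ext.
have iB : itg B.
  apply: (itg_en (x0 := x0) (r := r)) => [i|x|i a].
  - by rewrite extV_coord eZ; case: (sqi_ext mOm (sqiD (sU i) (sw i))).
  - by move=> hx; exact: extV_out.
  - by rewrite eGa; apply: sqi_ext => //; exact: sqiD.
have iC : itg (en U Gb).
  apply: (itg_en (x0 := 0) (r := rho)) => // [i|x]; first by case: (sU i).
  by move=> hx; rewrite /U extV_out.
have iD : itg (en (fun x => U x + \row_i w i x) (fun i a x => Gb i a x + h i a x)).
  apply: (itg_en (x0 := 0) (r := rho)) => [i|x hx|i a].
  - under eq_fun do rewrite !mxE; case: (sqiD (sU i) (sw i)) => + _.
    by under eq_fun do rewrite !mxE.
  - rewrite /U extV_out// add0r; apply/rowP => i; rewrite !mxE w0// => xO; apply: hx; exact: OmB.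
  - exact: sqiD.
rewrite -subr_ge0 -(RI_B iB iA).
rewrite -subr_ge0 -(RI_B iD iC) in hm; apply: (le_trans hm); rewrite le_eqVlt; apply/orP; left; apply/eqP.
congr RI; apply/funext => x; rewrite /A /B /en; have [xO|xO] := pselect (Om x).
  rewrite !extV_in// -ZE// U_in//; congr (_ + _ - (_ + _)).
    by apply: eq_bigr => i _; apply: eq_bigr => a _; rewrite ext_in// mxE.
  by apply: eq_bigr => i _; apply: eq_bigr => a _; rewrite ext_in// mxE.
rewrite !extV_out// (_ : \row_i w i x = 0) ?addr0; last by apply/rowP => i; rewrite !mxE w0.
rewrite (_ : \sum_i \sum_a (Gb i a x + h i a x) ^+ 2 = \sum_i \sum_a Gb i a x ^+ 2); last first.
  by apply: eq_bigr => i _; apply: eq_bigr => a _; rewrite h0// addr0.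
rewrite subrr; apply/esym/eqP; rewrite subr_eq0; apply/eqP; congr (_ + _).
by apply: eq_bigr => i _; apply: eq_bigr => a _; rewrite !ext_out.
Qed.

End global_limit.

(** * Homogeneity of blow-ups *)

Section homogeneity.
Context {R : realType} {n N : nat}.
Local Notation E := 'rV[R]_n.
Local Notation V := 'rV[R]_N.
Local Notation mu := (@lebesgue_rV R n).
Local Notation RI := (RI mu).
Local Notation itg := (itg mu).
Local Notation sqi := (sqi mu).
Implicit Types (psi : E -> R) (x : E).

(** This is psi + div(x psi), the adjoint of U -> U - x.DU applied to psi. *)
Definition euler_test psi : E -> R := fun x => n.+1%:R * psi x + eul psi x.

Lemma smooth_euler_test psi : smooth psi -> smooth (euler_test psi).
Proof. by move=> sp; apply: smoothD; [exact: smoothZ|exact: smooth_eul]. Qed.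

Lemma euler_test_supp K psi : closed K -> suppin K psi -> suppin K (euler_test psi).
Proof. by move=> cK p0 x hx; rewrite /euler_test p0// (eul_supp cK p0)// mulr0 addr0. Qed.

Lemma eul_dil s psi x : 0 < s -> smooth psi -> eul (dil s 0 psi) x = dil s 0 (eul psi) x.
Proof.
move=> s0 sp; rewrite /dil /eul; apply: eq_bigr => a _; rewrite partial_dil//.
by rewrite /dil subr0 !mxE; ring.
Qed.

Lemma dil_ball_supp (s K : R) psi : 0 < s -> suppin (cball 0 K) psi -> suppin (cball 0 (s * K)) (dil s 0 psi).
Proof. by move=> s0 p0; have := suppin_dil_ball (x0 := 0) s0 p0; rewrite l2norm0 add0r. Qed.

Lemma ball_sqi (K : R) (f : E -> R) : smooth f -> suppin (cball 0 K) f -> sqi f.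
Proof. by move=> sf f0; apply: test_sqi (test_ball_intro (_ : K < K + 1) sf f0); rewrite ltrDl. Qed.

Variables (U : E -> V) (G : 'I_N -> 'I_n -> E -> R).
Hypothesis (H : is_min 1 U G).

(* The weak form of x.DU - U. *)
Lemma euler_radial i psi (r' : R) : smooth psi -> r' < 1 -> suppin (cball 0 r') psi ->
  RI (fun x => U x ord0 i * euler_test psi x) = - RI (fun x => (radial G i x - U x ord0 i) * psi x).
Proof.
move=> sp rr p0; have tp := test_ball_intro rr sp p0.
have sU := im_u H i; have sG a := im_g H i a; have spsi := test_sqi tp.
have sdp a := test_sqi (test_partial a tp).
have tc a := test_funM tp (smooth_coord a).
have sc a := test_sqi (tc a).
have sr := sqi_radial ltr01 H i.
have pM a : partial a (fun x => psi x * x ord0 a) = fun x => psi x + x ord0 a * partial a psi x.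
  rewrite partialM; [|by move=> y; exact: smooth_diff|by move=> y; exact: coord_diff].
  by rewrite partial_coord eqxx; apply/funext => x; rewrite mulr1.
have w a := im_w H i a (tc a).
have sxd a : sqi (fun x => x ord0 a * partial a psi x).
  have tpa := test_funM (test_partial a tp) (smooth_coord a).
  by have := test_sqi tpa; under eq_fun do rewrite mulrC.
have i1 a : itg (fun x => U x ord0 i * (psi x + x ord0 a * partial a psi x)) by apply: sqi_mul => //; exact: sqiD.
have i2 : itg (fun x => U x ord0 i * psi x) by exact: sqi_mul.
have e1 : RI (fun x => U x ord0 i * euler_test psi x) =
    \sum_a RI (fun x => U x ord0 i * partial a (fun x => psi x * x ord0 a) x) + RI (fun x => U x ord0 i * psi x).
  under eq_bigr do rewrite pM.
  rewrite -RI_sum// -(RI_D (itg_sum _ _ i1) i2); congr RI; apply/funext => x.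
  rewrite -mulr_sumr big_split /= sumr_const card_ord /euler_test /eul -[psi x *+ n]mulr_natl -[n.+1%:R]natr1; ring.
have i3 a : itg (fun x => G i a x * (psi x * x ord0 a)) by exact: sqi_mul.
have e2 : RI (fun x => radial G i x * psi x) = \sum_a RI (fun x => G i a x * (psi x * x ord0 a)).
  rewrite -RI_sum//; congr RI; apply/funext => x; rewrite /radial mulr_suml.
  by apply: eq_bigr => a _; ring.
have -> : (fun x => (radial G i x - U x ord0 i) * psi x) = (fun x => radial G i x * psi x - U x ord0 i * psi x).
  by apply/funext => x; rewrite mulrBl.
rewrite (RI_B (sqi_mul sr spsi) i2) e1 e2 opprB addrC; congr (_ + _).
by rewrite -sumrN; apply: eq_bigr => a _; rewrite w.
Qed.

(** On the support of psi(x/r), of radius r K <= s/2, the weight psi0(x/s) is at least m.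
    Cauchy-Schwarz then bounds the weak equation by the defect at s, and (s/r)^(n+2) is the cost of
    reading it at scale r. *)
Lemma euler_defect (m : R) i (r s : R) psi (K : R) : 0 < m -> (forall x : E, l2norm x <= 1 / 2 -> m <= psi0 x) ->
  smooth psi -> suppin (cball 0 K) psi -> 0 < r -> 0 < s -> s < 1 -> 2 * (r * K) <= s ->
  RI (fun x => resc U r x ord0 i * euler_test psi x) ^+ 2 <=
  m^-1 * ((s / r) ^+ n.+2 * defect U G s) * RI (fun x => psi x ^+ 2).
Proof.
move=> m0 hm sp p0 r0 s0 s1 hs; have rK : r * K < 1 by lra.
have hs2 : r * K <= 1 / 2 * s by lra.
have sd : smooth (dil r 0 psi) by exact: smooth_dil.
have d0 := dil_ball_supp r0 p0.
have sU := im_u H i; have sr := sqi_radial ltr01 H i.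
have tp := test_ball_intro rK sd d0; have spr := test_sqi tp.
have spsi := ball_sqi sp p0.
have main := euler_radial i sd rK d0.
have eE : euler_test (dil r 0 psi) = dil r 0 (euler_test psi).
  by apply/funext => x; rewrite /euler_test eul_dil.
have sE := smooth_euler_test sp; have E0 := euler_test_supp (@closed_cball _ _ _ _) p0.
have sEt := ball_sqi sE E0.
have sUr : sqi (fun x => U (r *: x) ord0 i).
  by have := sqi_affine 0 r0 sU; under eq_fun do rewrite addr0.
have scale : RI (fun x => U x ord0 i * euler_test (dil r 0 psi) x) =
    r ^+ n.+1 * RI (fun x => resc U r x ord0 i * euler_test psi x).
  rewrite eE; have -> : (fun x => U x ord0 i * dil r 0 (euler_test psi) x) =
      dil r 0 (fun x => U (r *: x) ord0 i * euler_test psi x).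
    by apply/funext => x; rewrite /dil scalerA subr0 mulfV ?gt_eqF// scale1r.
  rewrite RI_dil//; last exact: sqi_mul.
  have -> : (fun x => resc U r x ord0 i * euler_test psi x) =
     (fun x => r^-1 * (U (r *: x) ord0 i * euler_test psi x)).
    by apply/funext => x; rewrite /resc !mxE mulrA.
  by rewrite RI_Z ?exprSr -?mulrA ?mulVKf ?gt_eqF//; exact: sqi_mul.
pose f x := \1_(cball (0 : E) (r * K)) x * (radial G i x - U x ord0 i).
have mI : measurable_fun setT (\1_(cball (0 : E) (r * K)) : E -> R).
  by apply: measurable_indic; exact: measurable_cball.
have I1 (x : E) : `|\1_(cball (0 : E) (r * K)) x : R| <= 1.
  by rewrite indicE; case: (_ \in _); rewrite ?normr1 ?normr0.
have sf : sqi f by exact: sqi_bM mI I1 (sqiB sr sU).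
have fE : RI (fun x => (radial G i x - U x ord0 i) * dil r 0 psi x) = RI (fun x => f x * dil r 0 psi x).
  congr RI; apply/funext => x; rewrite /f indicE; have [hx|hx] := pselect (cball 0 (r * K) x).
    by rewrite mem_set// mul1r.
  by rewrite d0// !mulr0.
have idef : itg (fun x => dil s 0 psi0 x * \sum_i (radial G i x - U x ord0 i) ^+ 2).
  apply: itg_psi0M => //; apply: itg_sum => j.
  by case: (sqiB (sqi_radial ltr01 H j) (im_u H j)).
have f2 : RI (fun x => f x ^+ 2) <= m^-1 * (s ^+ n.+2 * defect U G s).
  rewrite /defect mulVKf ?expf_neq0 ?gt_eqF// -(RI_Z _ idef); apply: RI_le; [by case: sf|exact: itgZ|].
  move=> x; rewrite mulrC ler_pdivlMr// /f indicE.
  have P0 : 0 <= dil s 0 psi0 x by exact: psi0_ge0.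
  have S0 : 0 <= \sum_j (radial G j x - U x ord0 j) ^+ 2 by apply: sumr_ge0 => j _; exact: sqr_ge0.
  have [hx|hx] := pselect (cball 0 (r * K) x); last by rewrite memNset// mul0r expr0n mul0r mulr_ge0.
  rewrite mem_set// mul1r mulrC; apply: ler_pM => //; first exact: ltW.
  - exact: sqr_ge0.
  - rewrite /dil subr0; apply: hm; rewrite l2normZ gtr0_norm ?invr_gt0// mulrC ler_pdivrMr//.
    by move: hx; rewrite /cball /= subr0 => hx; exact: (le_trans hx).
  - rewrite (bigD1 i)//= lerDl; apply: sumr_ge0 => j _; exact: sqr_ge0.
have p2 : RI (fun x => dil r 0 psi x ^+ 2) = r ^+ n * RI (fun x => psi x ^+ 2).
  by have [_ ip] := spsi; rewrite -(RI_dil 0 r0 ip).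
have cs := RI_CS sf spr; rewrite -fE p2 in cs.
have B0 : 0 <= r ^+ n * RI (fun x => psi x ^+ 2) by rewrite mulr_ge0 ?RI_sqr_ge0// exprn_ge0// ltW.
have c2 := le_trans cs (ler_wpM2r B0 f2).
rewrite -sqrrN -main scale in c2.
have q0 : 0 < r ^+ n.+1 ^+ 2 by rewrite !exprn_gt0.
rewrite -(ler_pM2l q0) -exprMn; apply: (le_trans c2); rewrite le_eqVlt; apply/orP; left; apply/eqP.
rewrite expr_div_n [s ^+ n.+2]exprSr [s ^+ n.+1]exprSr [r ^+ n.+2]exprSr [r ^+ n.+1]exprSr.
field; rewrite ?expf_neq0 ?gt_eqF//.
Qed.

Variables (r : nat -> R) (k : nat -> nat) (Ub : E -> V).
Hypotheses (r0 : forall j, 0 < r j) (r8 : forall j, j.+1%:R * r j <= 1 / 8)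
  (rd : forall j, j.+1%:R ^+ n.+2 * defect U G (j.+1%:R * r j) <= j.+1%:R^-1)
  (kj : forall j, (j <= k j)%N) (cUb : continuous Ub)
  (hUb : forall M e : R, 0 < e -> exists J : nat, forall j, (J <= j)%N -> forall x, l2norm x <= M ->
    `|resc U (r (k j)) x - Ub x| < e).

Lemma euler_limit i psi (K : R) : 0 < K -> smooth psi -> suppin (cball 0 K) psi ->
  RI (fun x => Ub x ord0 i * euler_test psi x) = 0.
Proof.
move=> K0 sp p0.
have ar (X Y A B d : R) : X ^+ 2 <= d * A -> Y ^+ 2 <= d * B -> (X + Y) ^+ 2 <= (2 * A + 2 * B) * d.
  by have := sqr_ge0 (X - Y); nra.
have [m m0 hm] := @psi0_lower R n.
have cB := @compact_cball R n 0 K.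
have sE := smooth_euler_test sp; have E0 := euler_test_supp (@closed_cball _ _ _ _) p0.
have cE := smooth_cont sE.
have iE : itg (fun x => `|euler_test psi x|) by apply: itg_abs; exact: cont_supp_itg cB E0 cE.
have sEt := ball_sqi sE E0.
have iUb : itg (fun x => Ub x ord0 i * euler_test psi x).
  apply: (cont_supp_itg cB) => [x /E0 ->|x]; first by rewrite mulr0.
  apply: (@continuousM _ _ (fun y => Ub y ord0 i) (euler_test psi) x); last exact: cE.
  by apply: coord_cont_at; exact: cUb.
set T := RI _; pose A := RI (fun x => `|euler_test psi x|); pose B := m^-1 * RI (fun x => psi x ^+ 2).
have B0 : 0 <= B by rewrite mulr_ge0 ?RI_sqr_ge0// invr_ge0 ltW.
apply: (@sqr_small0 _ _ (2 * A ^+ 2 + 2 * B)); first by rewrite addr_ge0// mulr_ge0// sqr_ge0.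
move=> d d0; have e0 : 0 < Num.sqrt d by rewrite sqrtr_gt0.
have [J hJ] := hUb K e0.
(* With s = (k j + 1) r the factor (s/r)^(n+2) is the one absorbed in [rd]. The index is large
   enough for 2 K <= k j + 1 and for 1/(k j + 1) <= d. *)
pose j := maxn J (maxn (Num.truncn (2 * K)).+1 (Num.truncn d^-1)).
have jJ : (J <= j)%N by exact: leq_maxl.
have j2 : 2 * K <= (k j).+1%:R.
  apply: ltW; apply: (lt_le_trans (truncnS_gt _)); rewrite ler_nat.
  apply: leq_trans (leqnSn _); apply: leq_trans (kj j); rewrite /j leq_max leq_max leqnn orbT//.
have j3 : (k j).+1%:R^-1 <= d.
  rewrite invf_ple ?posrE//; apply: ltW; apply: (lt_le_trans (truncnS_gt _)); rewrite ler_nat ltnS.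
  by apply: leq_trans (kj j); rewrite /j !leq_max leqnn !orbT.
have rp := r0 (k j); pose s := (k j).+1%:R * r (k j).
have s0 : 0 < s by rewrite mulr_gt0.
have s1 : s < 1 by have := r8 (k j); rewrite -/s; lra.
have hs : 2 * (r (k j) * K) <= s by rewrite mulrCA mulrC /s ler_wpM2r// ltW.
have hd := euler_defect i m0 hm sp p0 rp s0 s1 hs.
have sr : s / r (k j) = (k j).+1%:R by rewrite /s mulfK// gt_eqF.
rewrite sr in hd; set Y := RI (fun x => resc U _ x ord0 i * _) in hd.
have Y2 : Y ^+ 2 <= d * B.
  apply: (le_trans hd); rewrite mulrAC mulrC; apply: ler_wpM2r => //.
  exact: le_trans (rd (k j)) j3.
pose Z x := resc U (r (k j)) x ord0 i.
have sZ : sqi Z.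
  have := sqiZ (r (k j))^-1 (sqi_affine 0 rp (im_u H i)); congr sqi; apply/funext => x.
  by rewrite /Z /resc addr0 !mxE.
have iZ : itg (fun x => Z x * euler_test psi x) by exact: sqi_mul.
have -> : T = RI (fun x => (Ub x ord0 i - Z x) * euler_test psi x) + Y.
  have -> : (fun x => (Ub x ord0 i - Z x) * euler_test psi x) =
      (fun x => Ub x ord0 i * euler_test psi x - Z x * euler_test psi x).
    by apply/funext => x; rewrite mulrBl.
  by rewrite (RI_B iUb iZ) subrK.
have iX : itg (fun x => (Ub x ord0 i - Z x) * euler_test psi x).
  by under eq_fun do rewrite mulrBl; exact: itgB.
have X1 : `|RI (fun x => (Ub x ord0 i - Z x) * euler_test psi x)| <= Num.sqrt d * A.
  apply: (le_trans (RI_abs iX)); rewrite /A -(RI_Z _ iE); apply: RI_le; [exact: itg_abs|exact: itgZ|].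
  move=> x; rewrite normrM; have [hx|hx] := pselect (cball 0 K x); last by rewrite E0// normr0 !mulr0.
  rewrite ler_wpM2r// distrC; have xK : l2norm x <= K by move: hx; rewrite /cball /= subr0.
  have := coord_le_norm (resc U (r (k j)) x - Ub x) i; rewrite !mxE => hc.
  apply: (le_trans _ (ltW (hJ j jJ x xK))); apply: le_trans hc.
  by rewrite /Z /resc !mxE.
have X2 : RI (fun x => (Ub x ord0 i - Z x) * euler_test psi x) ^+ 2 <= d * A ^+ 2.
  rewrite -[d in leRHS](sqr_sqrtr (ltW d0)) -exprMn -[leLHS](real_normK (num_real _)).
  by rewrite ler_sqr ?nnegrE// (le_trans _ X1).
exact: ar X2 Y2.
Qed.

End homogeneity.

(** * Continuous weak solutions of Euler's equation *)

Section homogeneous_function.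
Context {R : realType} {n : nat}.
Local Notation E := 'rV[R]_n.
Local Notation mu := (@lebesgue_rV R n).
Local Notation RI := (RI mu).
Local Notation itg := (itg mu).
Implicit Types (psi f g : E -> R) (x : E).

Lemma itg_test_cont (x0 : E) (K : R) psi f : smooth psi -> suppin (cball x0 K) psi -> continuous f ->
  itg (fun x => psi x * f x).
Proof.
move=> sp p0 cf; have cp := smooth_cont sp; apply: (cont_supp_itg (@compact_cball R n x0 K)).
  by move=> x /p0 ->; rewrite mul0r.
by move=> x; apply: (@continuousM _ _ psi f x); [exact: cp|exact: cf].
Qed.

(** If g were positive at x1, a dilated psi0 supported where g > g(x1)/2 would have a positive
    integral against g. *)
Lemma test_le0 g x1 : continuous g ->
  (forall psi (K : R), 0 < K -> smooth psi -> suppin (cball 0 K) psi -> RI (fun x => psi x * g x) = 0) ->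
  g x1 <= 0.
Proof.
move=> cg hg; rewrite leNgt; apply/negP => g0.
have : {for x1, continuous g} by exact: cg.
move=> /(_ [set t | g x1 / 2 < t]) c.
have /nbhs_ballP[e /= e0 he] : nbhs x1 [set y | g x1 / 2 < g y].
  by apply: c; apply: open_nbhs_nbhs; split; [exact: open_gt|rewrite /=; lra].
have d0 : 0 < e / 2 by lra.
pose psi : E -> R := dil (e / 2) x1 psi0.
have sp : smooth psi by apply: smooth_dil; exact: smooth_psi0.
have p1 : suppin (cball x1 (e / 2)) psi := dil_supp d0 (@psi0_supp R n).
have K0 : 0 < l2norm x1 + e / 2 by have := l2norm_ge0 x1; lra.
have p0 : suppin (cball 0 (l2norm x1 + e / 2)) psi.
  move=> x hx; apply: p1 => h; apply: hx; rewrite /cball /= subr0 -[x](subrK x1) addrC.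
  by apply: (le_trans (l2normD _ _)); rewrite lerD2l.
have z := hg psi _ K0 sp p0.
have ip : itg psi by apply: itg_dil => //; exact: itg_psi0.
have : g x1 / 2 * RI psi <= RI (fun x => psi x * g x).
  rewrite -(RI_Z _ ip); apply: RI_le; [exact: itgZ|exact: itg_test_cont p0 cg|].
  move=> x; rewrite mulrC; have [hx|hx] := pselect (cball x1 (e / 2) x); last by rewrite p1// !mul0r.
  rewrite ler_wpM2l ?psi0_ge0//; apply: ltW; apply: he.
  rewrite -ball_normE /= distrC; apply: (le_lt_trans (norm_le_l2 _)); apply: (le_lt_trans hx); lra.
rewrite z RI_dil//; last exact: itg_psi0.
by apply/negP; rewrite -ltNge mulr_gt0//; [lra|rewrite mulr_gt0 ?exprn_gt0//; exact: RI_psi0].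
Qed.

Lemma test_eq0 g x : continuous g ->
  (forall psi (K : R), 0 < K -> smooth psi -> suppin (cball 0 K) psi -> RI (fun x => psi x * g x) = 0) ->
  g x = 0.
Proof.
move=> cg hg; apply/eqP; rewrite eq_le test_le0//= -oppr_le0.
apply: (@test_le0 (fun y => - g y)) => [y|psi K K0 sp p0]; first by apply: continuousN; exact: cg.
under eq_fun do rewrite mulrN.
by rewrite (RI_N (itg_test_cont sp p0 cg)) (hg _ _ K0 sp p0) oppr0.
Qed.

Lemma homogeneous_of_euler f : continuous f ->
  (forall psi (K : R), 0 < K -> smooth psi -> suppin (cball 0 K) psi -> RI (fun x => f x * euler_test psi x) = 0) ->
  forall (t : R) x, 0 < t -> f (t *: x) = t * f x.
Proof.
move=> cf hf t x t0; apply/eqP; rewrite -subr_eq0; apply/eqP.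
have cft : continuous (fun y : E => f (t *: y)).
  move=> y; apply: (@continuous_comp _ _ _ (fun y : E => t *: y) f); last exact: cf.
  by apply: continuousZr; exact: cvg_id.
have cg : continuous (fun y : E => f (t *: y) - t * f y).
  move=> y; have c1 : {for y, continuous (fun y : E => f (t *: y))} by exact: cft.
  have c2 : {for y, continuous (fun y : E => t * f y)}.
    by apply: (@continuousM _ _ (fun=> t) f y); [exact: cst_continuous|exact: cf].
  exact: (continuousB c1 c2).
apply: (test_eq0 x cg) => psi K K0 sp p0.
have iE1 := itg_test_cont sp p0 cft; have iE2 := itg_test_cont sp p0 cf.
pose S := t + 1; have S0 : 0 < S by rewrite /S; lra.
have SK : 0 < S * K by exact: mulr_gt0.
(* f is cut off to become integrable, outside the supports of psi(x/s) for all s <= S = t + 1. *)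
pose v := fun y => dil (S * K) 0 (cut : E -> R) y * f y.
have iv : itg v by exact: itg_test_cont (smooth_dcut _) (dil_cut_supp SK) cf.
have vE (s : R) (q : E -> R) : 0 < s -> s <= S -> suppin (cball 0 K) q ->
    (fun y => dil s 0 q y * v y) = fun y => dil s 0 q y * f y.
  move=> s0 sS q0; apply/funext => y; have [hy|hy] := pselect (cball 0 (s * K) y).
    rewrite /v dil_cut1 ?mul1r//; move: hy; rewrite /cball /= subr0 => hy; apply: (le_trans hy).
    by rewrite ler_wpM2r// ltW.
  by rewrite (dil_ball_supp s0 q0)// !mul0r.
have cB := @compact_cball R n 0 K; have clB := @closed_cball R n 0 K.
pose B s := s ^- n.+1 * RI (fun y => dil s 0 psi y * v y).
have dB (s : R) : 0 < s -> s <= S -> is_derive s 1 B 0.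
  move=> s0 sS; have h := is_derive_pow_dil n.+1 sp cB p0 iv s0; apply: (is_derive_eq h).
  rewrite (vE _ _ s0 sS p0) (vE _ _ s0 sS (eul_supp clB p0)).
  have sd := smooth_dil s 0 sp; have d0 := dil_ball_supp s0 p0.
  have i1 := itg_test_cont sd d0 cf.
  have i2 := itg_test_cont (smooth_dil s 0 (smooth_eul sp)) (dil_ball_supp s0 (eul_supp clB p0)) cf.
  rewrite -(RI_Z _ i1) -(RI_D (itgZ _ i1) i2).
  rewrite (_ : RI _ = 0) ?mulr0 ?oppr0//.
  rewrite -[RHS](hf _ _ (mulr_gt0 s0 K0) sd d0); congr RI; apply/funext => y.
  by rewrite /euler_test eul_dil//; ring.
have Bc (a b : R) : 0 < a -> a < b -> b <= S -> B a = B b.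
  move=> a0 ab bS; have [||c _] := @MVT R B (fun=> 0) a b ab.
  - by move=> y; rewrite in_itv /= => /andP[y1 y2]; apply: dB; [exact: lt_trans y1|exact: (le_trans (ltW y2))].
  - apply: derivable_within_continuous => y; rewrite in_itv /= => /andP[y1 y2].
    by have [] := dB y (lt_le_trans a0 y1) (le_trans y2 bS).
  by rewrite mul0r => /eqP; rewrite subr_eq0 => /eqP ->.
have Bt : B t = B 1.
  have tS : t <= S by rewrite /S lerDl.
  have oS : 1 <= S by rewrite /S lerDr ltW.
  have [t1|t1|->//] := ltgtP t 1; first exact: Bc.
  by apply/esym; apply: Bc.
have o1 : 1 <= S by rewrite /S lerDr ltW.
have tS : t <= S by rewrite /S lerDl.
move: Bt; rewrite /B (vE t psi t0 tS p0) (vE 1 psi ltr01 o1 p0) expr1n invr1 mul1r.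
have -> : (fun y => dil 1 0 psi y * f y) = (fun y => psi y * f y).
  by apply/funext => y; rewrite /dil invr1 scale1r subr0.
have -> : (fun y => dil t 0 psi y * f y) = dil t 0 (fun y => psi y * f (t *: y)).
  by apply/funext => y; rewrite /dil scalerA subr0 mulfV ?gt_eqF// scale1r.
rewrite RI_dil// => h.
have -> : (fun y => psi y * (f (t *: y) - t * f y)) = (fun y => psi y * f (t *: y) - t * (psi y * f y)).
  by apply/funext => y; ring.
rewrite (RI_B iE1 (itgZ _ iE2)) (RI_Z _ iE2) -h exprSr.
by field; rewrite expf_neq0 ?gt_eqF.
Qed.

End homogeneous_function.

(** * The blow-up limit is a cone *)

Section cone.
Context {R : realType} {n N : nat}.
Local Notation E := 'rV[R]_n.
Local Notation V := 'rV[R]_N.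
Local Notation mu := (@lebesgue_rV R n).
Local Notation RI := (RI mu).
Local Notation itg := (itg mu).
Local Notation sqi := (sqi mu).
Hypotheses (n0 : (0 < n)%N) (N1 : (1 < N)%N).

Lemma inv_succ_small (r : nat -> R) (c : R) : (forall j, r j <= j.+1%:R^-1) -> 0 < c ->
  exists J : nat, forall j, (J <= j)%N -> r j <= c.
Proof.
move=> rj c0; exists (Num.truncn c^-1) => j Jj; apply: (le_trans (rj j)).
rewrite -[leRHS]invrK lef_pV2 ?posrE ?invr_gt0//; apply: ltW.
by apply: (lt_le_trans (truncnS_gt _)); rewrite ler_nat.
Qed.

Lemma sqi_ext_cont (rho : R) (f : E -> R) : 0 < rho -> continuous f -> sqi (ext (l2ball 0 rho) f).
Proof.
move=> rho0 cf; have sc := smooth_dcut (R := R) (n := n) rho; have c0 := dil_cut_supp (R := R) (n := n) rho0.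
have -> : ext (l2ball 0 rho) f = ext (l2ball 0 rho) (fun x => dil rho 0 (cut : E -> R) x * f x).
  apply/funext => x; have [hx|hx] := pselect (l2ball 0 rho x); last by rewrite !ext_out.
  by rewrite !ext_in// dil_cut1 ?mul1r//; move: hx; rewrite /l2ball /= subr0 => /ltW.
apply: sqi_ext; first exact: measurable_l2ball.
have cc : continuous (fun x => dil rho 0 (cut : E -> R) x * f x).
  by move=> x; apply: (@continuousM _ _ (dil rho 0 cut) f x); [exact: smooth_cont|exact: cf].
split; first exact: continuous_rV_measurable.
have cfc : continuous (fun x => f x * (dil rho 0 (cut : E -> R) x * f x)).
  by move=> x; apply: (@continuousM _ _ f (fun x => dil rho 0 (cut : E -> R) x * f x) x); [exact: cf|exact: cc].
have := itg_test_cont sc c0 cfc; congr (itg _); apply/funext => x; ring.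
Qed.

Variables (U : E -> V) (G : 'I_N -> 'I_n -> E -> R).
Hypothesis (H : is_min 1 U G) (sum0 : forall x, \sum_i U x ord0 i = 0) (U0 : U 0 = 0).

Lemma ordered0 : ordered (0 : V).
Proof. by move=> i j ij; rewrite !mxE. Qed.

Lemma ordered_resc s x : 0 < s -> ordered (resc U s x).
Proof.
move=> s0; apply: ordered_scale; first by rewrite invr_ge0 ltW.
have [h|h] := pselect (l2ball 0 1 (s *: x)); first exact: ord_all H _ h.
by rewrite (im_u0 H h); exact: ordered0.
Qed.

(** [subharmonic] with a cutoff bounds the energy by sup |U|^2, and linear growth makes this uniform
    in the scale s. *)
Lemma zoom_energy (rho : R) : 0 < rho -> exists M : R, forall s : R, 0 < s -> 8 * (s * rho) < 1 ->
  Qf (zoomG 0 s rho G) <= M.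
Proof.
move=> rho0; have [C C0 hg] := @growth R n N n0 N1; have hU := hg 1 U G ltr01 H sum0 U0.
pose phi : E -> R := dil rho 0 cut.
have sp : smooth phi := smooth_dcut rho.
have p0 : suppin (cball 0 (3 / 2 * rho)) phi := dil_cut_supp rho0.
have sl : smooth (lap phi) by apply: smooth_sum => a; do 2 apply: smooth_partial.
have cl := @closed_cball R n 0 (3 / 2 * rho).
have l0 : suppin (cball 0 (3 / 2 * rho)) (lap phi).
  by move=> x hx; rewrite /lap big1// => a _; rewrite (partial_supp a cl (partial_supp a cl p0) hx).
have il : itg (lap phi) by apply: cont_supp_itg (@compact_cball R n _ _) l0 (smooth_cont sl).
pose M0 := (C * (3 / 2 * rho)) ^+ 2; have M00 : 0 <= M0 by exact: sqr_ge0.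
exists (M0 * RI (fun x => `|lap phi x|)) => s s0 hs.
have rr : 3 / 2 * rho < 2 * rho by lra.
have hr1 : l2norm (0 : E) + s * (2 * rho) <= 1 by rewrite l2norm0; lra.
have Hz := is_min_zoom H s0 hr1; have sh := subharmonic Hz sp rr p0.
set U' := zoomU _ _ _ _ in Hz sh; set G' := zoomG _ _ _ _ in Hz sh.
have h1 : Qf (zoomG 0 s rho G) <= D2 G' phi.
  apply: ler_sum => i _; apply: ler_sum => a _.
  have sG' := im_g Hz i a.
  have hr2 : l2norm (0 : E) + s * rho <= 1 by rewrite l2norm0; lra.
  have sG'' := im_g (is_min_zoom H s0 hr2) i a.
  apply: RI_le; [by case: sG''| |].
    by apply: (itg_wsq (C := 1) _ _ sG') => [|x]; [exact: continuous_rV_measurable (smooth_cont sp)|exact: cut01].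
  move=> x; have /andP[c0 _] := cut01 (rho^-1 *: (x - 0)).
  rewrite /zoomG /G' /zoomG; have [hx|hx] := pselect (l2ball 0 rho x); last first.
    by rewrite !indicE (memNset hx) mul0r expr0n mulr_ge0 ?sqr_ge0.
  have xr : l2norm x < rho by move: hx; rewrite /l2ball /= subr0.
  have hx2 : l2ball 0 (2 * rho) x by rewrite /l2ball /= subr0; apply: (lt_trans xr); rewrite ltr_pMl// ltr1n.
  by rewrite !indicE !mem_set// /phi dil_cut1 ?mul1r//; exact: ltW.
have h2 : RI (fun x => sq (U' x) * lap phi x) <= M0 * RI (fun x => `|lap phi x|).
  rewrite -RI_Z; last exact: itg_abs.
  have iS : itg (fun x => sq (U' x) * lap phi x).
    have [K _ hK] := supp_bounded (@compact_cball R n _ _) l0 (smooth_cont sl).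
    under eq_fun do rewrite mulrC.
    exact: itg_bM (continuous_rV_measurable (smooth_cont sl)) hK (itg_sqU Hz).
  apply: RI_le; [exact: iS|by apply: itgZ; exact: itg_abs|].
  move=> x; have [hx|hx] := pselect (cball 0 (3 / 2 * rho) x); last by rewrite l0// normr0 !mulr0.
  apply: (le_trans (ler_norm _)); rewrite normrM ler_wpM2r// ger0_norm ?sq_ge0//.
  have xr : l2norm x <= 3 / 2 * rho by move: hx; rewrite /cball /= subr0.
  have xp := l2norm_ge0 x.
  rewrite -l2norm_le; last by rewrite mulr_ge0//; lra.
  rewrite /U' zoomU_in; last by rewrite /l2ball /= subr0; exact: le_lt_trans rr.
  have sx : s * l2norm x <= s * (3 / 2 * rho) by rewrite ler_wpM2l// ltW.
  rewrite addr0; apply: (@le_trans _ _ (C * l2norm x)); last by rewrite ler_wpM2l.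
  by apply: (resc_growth hU) => //; lra.
have D0 : 0 <= D2 G' phi by apply: D2_ge0 => x; have /andP[] := cut01 (rho^-1 *: (x - 0)).
apply: (le_trans h1); apply: le_trans h2; rewrite sh mulr_natl mulr2n lerDl; exact: D0.
Qed.

Variables (r : nat -> R) (k : nat -> nat) (Ub : E -> V).
Hypotheses (r0 : forall j, 0 < r j) (rj : forall j, r j <= j.+1%:R^-1) (kj : forall j, (j <= k j)%N)
  (hUb : forall M e : R, 0 < e -> exists J : nat, forall j, (J <= j)%N -> forall x, l2norm x <= M ->
    `|resc U (r (k j)) x - Ub x| < e).

Lemma blow_up_small (c : R) : 0 < c -> exists J : nat, forall j, (J <= j)%N -> r (k j) <= c.
Proof.
move=> c0; have [J hJ] := inv_succ_small rj c0; exists J => j Jj; apply: hJ.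
exact: leq_trans (kj j).
Qed.

Lemma blow_up_continuous : continuous Ub.
Proof.
move=> x A /nbhs_ballP[e /= e0 he].
have e3 : 0 < e / 3 by lra.
have [d [r1 [d0 d1 r10 hd]]] := resc_equi n0 N1 H sum0 U0 x e3.
have [J1 hJ1] := blow_up_small r10; have [J2 hJ2] := hUb (l2norm x + (n%:R + 1)) e3.
pose j := maxn J1 J2; have h1 := hJ1 j (leq_maxl _ _); have h2 := hJ2 j (leq_maxr _ _).
have n1 : 0 <= n%:R + 1 :> R by rewrite addr_ge0.
apply/nbhs_ballP; exists d => // y; rewrite -ball_normE /= => xy; apply: he; rewrite -ball_normE /=.
have yx : `|y - x| < d by rewrite distrC.
have a1 := hd _ (r0 (k j)) h1 y yx.
have a2 : `|resc U (r (k j)) x - Ub x| < e / 3 by apply: h2; rewrite lerDl.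
have a3 : `|resc U (r (k j)) y - Ub y| < e / 3.
  apply: h2; rewrite -[y in leLHS](subrK x) addrC; apply: (le_trans (l2normD _ _)); rewrite lerD2l.
  by apply: (le_trans (l2_le_norm _)); rewrite ler_piMr// (le_trans (ltW yx)).
rewrite (_ : Ub x - Ub y = - (resc U (r (k j)) x - Ub x) + (- (resc U (r (k j)) y - resc U (r (k j)) x) + (resc U (r (k j)) y - Ub y))); last first.
  by apply/rowP => i; rewrite !mxE; ring.
apply: (le_lt_trans (ler_normD _ _)); rewrite normrN.
have := ler_normD (- (resc U (r (k j)) y - resc U (r (k j)) x)) (resc U (r (k j)) y - Ub y).
rewrite normrN; move: a1 a2 a3; set z1 := `|_|; set z2 := `|_|; set z3 := `|_|; set z4 := `|_|; lra.
Qed.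

Lemma blow_up_ordered x : ordered (Ub x).
Proof.
move=> i j ij; rewrite leNgt; apply/negP => lt.
have ar (bi bj vi vj : R) : bi < bj -> vj <= vi -> - ((bj - bi) / 3) < vi - bi -> vi - bi < (bj - bi) / 3 ->
  - ((bj - bi) / 3) < vj - bj -> vj - bj < (bj - bi) / 3 -> False by lra.
have e0 : 0 < (Ub x ord0 j - Ub x ord0 i) / 3 by lra.
have [J hJ] := hUb (l2norm x) e0; have := hJ J (leqnn J) x (lexx _).
have := ordered_resc x (r0 (k J)) ij; clear hJ; generalize (resc U (r (k J)) x) => v hv h.
have := coord_le_norm (v - Ub x) i; have := coord_le_norm (v - Ub x) j; rewrite !mxE => h1 h2.
have := le_lt_trans h1 h; have := le_lt_trans h2 h; rewrite !ltr_norml => /andP[c1 c2] /andP[c3 c4].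
exact: ar lt hv c1 c2 c3 c4.
Qed.

Lemma blow_up_zero : Ub 0 = 0.
Proof.
apply/eqP; rewrite -normr_eq0; apply/eqP/le_anti; rewrite normr_ge0 andbT.
apply/ler_addgt0Pl => e e0; rewrite addr0; have [J hJ] := hUb 0 e0.
have := hJ J (leqnn J) 0; rewrite l2norm0 => /(_ (lexx _)).
by rewrite /resc scaler0 U0 scaler0 sub0r normrN => /ltW.
Qed.

Lemma blow_up_minimizer : global_minimizer Ub.
Proof.
have cU := blow_up_continuous; split => // x0 s s0.
have xp := l2norm_ge0 x0.
(* The radius for which [limit_min] covers perturbations in the ball of centre x0 and radius s. *)
pose rho := l2norm x0 + 2 * s; have rho0 : 0 < rho by rewrite /rho; lra.
have [M hM] := zoom_energy rho0.
have q0 : 0 < (16 * rho)^-1 by rewrite invr_gt0; lra.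
(* The first terms are dropped, so that all zooms to radius rho fit into the unit ball. *)
have [J0 hJ0] := blow_up_small q0.
pose t j := r (k (J0 + j)); have t0 j : 0 < t j := r0 _.
have tr j : 8 * (t j * rho) < 1.
  have := hJ0 (J0 + j)%N (leq_addr _ _); rewrite -/(t j) -[leRHS]mul1r ler_pdivlMr; last by lra.
  by move=> h; lra.
have tr1 j : l2norm (0 : E) + t j * rho <= 1.
  by rewrite l2norm0; have := tr j; have := mulr_gt0 (t0 j) rho0; lra.
have HV j := is_min_zoom H (t0 j) (tr1 j).
have sub i : sqi (fun x => extV (l2ball 0 rho) Ub x ord0 i).
  by rewrite extV_coord; apply: sqi_ext_cont => // x; apply: coord_cont_at; exact: cU.
have hc (e : R) : 0 < e -> exists J, forall j, (J <= j)%N -> forall i x,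
    `|zoomU 0 (t j) rho U x ord0 i - extV (l2ball 0 rho) Ub x ord0 i| <= e.
  move=> e0; have [J hJ] := hUb rho e0; exists J => j Jj i x.
  have [hx|hx] := pselect (l2ball 0 rho x); last by rewrite zoomU_out// extV_out// subrr normr0 ltW.
  rewrite zoomU_in// extV_in// addr0.
  have := coord_le_norm (resc U (t j) x - Ub x) i; rewrite !mxE => h; apply: (le_trans h); apply: ltW.
  apply: hJ; first by apply: leq_trans Jj _; exact: leq_addl.
  by move: hx; rewrite /l2ball /= subr0 => /ltW.
have [Gb [sG _ wG hmin]] := limit_min HV (fun j => hM _ (t0 j) (tr j)) sub (fun x hx => extV_out Ub hx) hc.
apply: (limit_minimizer (rho := rho) (Gb := Gb)) => //.
- exact: blow_up_ordered.
- by move=> w h Hw w0 h0 ow; exact: hmin s0 (lexx _) Hw w0 h0 ow.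
Qed.

Hypotheses (r8 : forall j, j.+1%:R * r j <= 1 / 8)
  (rd : forall j, j.+1%:R ^+ n.+2 * defect U G (j.+1%:R * r j) <= j.+1%:R^-1).

Lemma blow_up_homogeneous : homogeneous1 Ub.
Proof.
have cU := blow_up_continuous; move=> t x t0; apply/rowP => i; rewrite mxE.
apply: (@homogeneous_of_euler _ _ (fun y => Ub y ord0 i)) => //.
  by move=> y; apply: coord_cont_at; exact: cU.
move=> psi K K0 sp p0; exact: (euler_limit H r0 r8 rd kj cU hUb i K0 sp p0).
Qed.

(** If the limit vanished on the ball of radius d, uniform convergence would give |U| <= c r d on
    the ball of radius r d for a small r of the sequence, and U would vanish near 0. *)
Lemma blow_up_nonzero (c : R) : 0 < c ->
  (forall s, 0 < s -> s <= 1 -> (forall x, l2norm x < s -> l2norm (U x) <= c * s) ->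
    forall y, l2norm y < s / 2 -> U y = 0) ->
  (forall d, 0 < d -> exists2 y, l2norm y < d & U y != 0) ->
  forall d : R, 0 < d -> exists2 x, l2norm x < d & Ub x != 0.
Proof.
move=> c0 nd pos d d0; apply: contrapT => hn.
have z x : l2norm x < d -> Ub x = 0.
  by move=> xd; apply: contrapT => /eqP h; apply: hn; exists x.
have n1 : 0 < n%:R + 1 :> R by rewrite ltr_wpDl.
have N1' : 0 < N%:R + 1 :> R by rewrite ltr_wpDl.
(* The factor N + 1 converts the sup norm of R^N into the Euclidean norm. *)
have e0 : 0 < c * d / (N%:R + 1) by rewrite divr_gt0// mulr_gt0.
have [J1 hJ1] := hUb d e0.
have d1 : 0 < d^-1 by rewrite invr_gt0.
have [J2 hJ2] := blow_up_small d1.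
pose j := maxn J1 J2; have h1 := hJ1 j (leq_maxl _ _); have h2 := hJ2 j (leq_maxr _ _).
have rp := r0 (k j); pose s := r (k j) * d; have s0 : 0 < s by exact: mulr_gt0.
have s1 : s <= 1 by rewrite /s -ler_pdivlMr// mul1r.
have [y yd yn] := pos (s / 2) (divr_gt0 s0 (ltr0Sn _ 1)).
move/eqP: yn; apply; apply: (nd s s0 s1) yd => x xs.
pose w := (r (k j))^-1 *: x.
have xw : x = r (k j) *: w by rewrite /w scalerA mulfV ?gt_eqF// scale1r.
have wd : l2norm w < d.
  by rewrite /w l2normZ gtr0_norm ?invr_gt0// mulrC ltr_pdivrMr// mulrC.
have := h1 w (ltW wd); rewrite (z w wd) subr0 => hw.
have UE : U x = r (k j) *: resc U (r (k j)) w.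
  by rewrite /resc -xw scalerA mulfV ?gt_eqF// scale1r.
rewrite UE l2normZ gtr0_norm// /s mulrCA ler_wpM2l ?(ltW rp)//.
apply: (le_trans (l2_le_norm _)); rewrite mulrC -ler_pdivlMr//; exact: ltW.
Qed.

End cone.

Theorem theorem1p2 (R : realType) (n N : nat) (hn : (1 <= n)%N) (hN : (2 <= N)%N) :
  exists2 c : R, 0 < c &
  forall U : 'rV[R]_n -> 'rV[R]_N,
    continuous_minimizer (l2ball 0 1) U ->
    (forall x, l2ball 0 1 x -> \sum_(i < N) U x ord0 i = 0) ->
    boundary (positivity (l2ball 0 1) U) 0 ->
    (forall r : R, 0 < r < 1 ->
       c * r <= sup [set l2norm (U x) | x in l2ball 0 r]) /\
    exists (rj : R^nat) (Ubar : 'rV[R]_n -> 'rV[R]_N),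
      [/\ forall j, 0 < rj j,
          rj @ \oo --> 0,
          {family compact, (fun j => rescale U (rj j)) @ \oo --> Ubar},
          cone Ubar &
          boundary (positivity setT Ubar) 0].
Proof.
have [c c0 nd] := @small_min_vanishes R n N; exists c => // U0 hU0 hs [hb1 hb2].
have [G H] := minimizer_is_min ltr01 hU0; set U := extV _ _ in H.
have Uin x : l2ball 0 1 x -> U x = U0 x by exact: extV_in.
have B0 : l2ball (0 : 'rV[R]_n) 1 0 by rewrite /l2ball /= subr0 l2norm0.
have nbhs_l2 (d : R) : 0 < d -> nbhs (0 : 'rV[R]_n) (l2ball 0 d).
  by move=> d0; apply: open_nbhs_nbhs; split; [exact: open_l2ball|rewrite /l2ball /= subr0 l2norm0].
have sum0 x : \sum_i U x ord0 i = 0.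
  have [hx|hx] := pselect (l2ball 0 1 x); first by rewrite Uin//; exact: hs.
  by rewrite /U extV_out// big1// => i _; rewrite mxE.
have l2_neq0 m (v : 'rV[R]_m) : (0 < l2norm v) = (v != 0).
  apply/idP/idP => [|v0]; first by apply: contraTneq => ->; rewrite l2norm0 ltxx.
  by apply: lt_le_trans (norm_le_l2 v); rewrite normr_gt0.
(* Otherwise continuity would put 0 in the interior of the positivity set. *)
have U00 : U 0 = 0.
  apply/eqP/negPn/negP; rewrite -l2_neq0 => u0; apply: hb2.
  have := l2norm_cont_at (im_cont H B0) => /(_ [set t | 0 < t]) ct.
  have h1 : nbhs (0 : 'rV[R]_n) [set x : 'rV[R]_n | 0 < l2norm (U x)] by apply: ct; apply: open_nbhs_nbhs; split; [exact: open_gt|].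
  by apply: filterS (filterI (nbhs_l2 1 ltr01) h1) => x [hx hux]; split; [|rewrite /= -Uin].
have pos (d : R) : 0 < d -> exists2 y, l2norm y < d & U y != 0.
  move=> d0; have [y [[yB yU] yd]] := hb1 _ (nbhs_l2 d d0); exists y; last by rewrite -l2_neq0 Uin.
  by move: yd; rewrite /l2ball /= subr0.
have nd1 s : 0 < s -> s <= 1 -> (forall x, l2norm x < s -> l2norm (U x) <= c * s) ->
    forall y, l2norm y < s / 2 -> U y = 0 by exact: nd H sum0.
split.
  move=> r /andP[r0 r1]; rewrite leNgt; apply/negP => lt.
  have cB := @compact_cball R n 0 r.
  have cw : {within cball 0 r, continuous (fun x => l2norm (U x))}.
    apply: continuous_in_subspaceT => x /set_mem hx; apply: l2norm_cont_at; apply: (im_cont H).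
    exact: le_lt_trans hx r1.
  have ne : (cball (0 : 'rV[R]_n) r) !=set0 by exists 0; rewrite /cball /= subr0 l2norm0 ltW.
  have [z _ hz] := EVT_max_rV ne cB cw.
  (* The supremum over the open ball is compared with a maximum over the closed one, since [sup] is
     meaningful for bounded sets only. *)
  have ub : has_ubound [set l2norm (U0 x) | x in l2ball 0 r].
    exists (l2norm (U z)) => _ [x xr <-]; rewrite -Uin; last exact: lt_trans xr r1.
    by apply: hz; apply: mem_set; exact: ltW.
  have small x : l2norm x < r -> l2norm (U x) <= c * r.
    move=> xr; have xr' : l2ball 0 r x by rewrite /l2ball /= subr0.
    rewrite Uin; last exact: lt_trans xr' r1.
    by apply: le_trans (ltW lt); apply: ub_le_sup => //; exists x.
  have [y yr] := pos (r / 2) (divr_gt0 r0 (ltr0Sn _ 1)).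
  by rewrite (nd1 r r0 (ltW r1) small y yr) eqxx.
have [r [r0 rj r8 rd]] := blow_up_radii hn hN H sum0 U00.
have [k [Ub [kj hUb]]] := blow_up hn hN H sum0 U00 r0 rj.
have Ub0 := blow_up_zero U00 hUb.
exists (fun j => r (k j)), Ub; split.
- by move=> j; exact: r0.
- apply: cvg_sub0P => e e0; have [J hJ] := blow_up_small rj kj e0; exists J => j Jj.
  by rewrite subr0 gtr0_norm//; exact: hJ.
- apply/fam_cvgP => A cA P /uniform_nbhs[F [entF sub]].
  have [M [_ hM]] := compact_bounded cA.
  have hA x : A x -> l2norm x <= (n%:R + 1) * (`|M| + 1).
    move=> Ax; apply: (le_trans (l2_le_norm x)); rewrite ler_wpM2l ?addr_ge0//.
    by apply: hM Ax; rewrite (le_lt_trans (ler_norm M))// ltrDl.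
  set K := (n%:R + 1) * (`|M| + 1) in hA.
  have K0 : 0 < K by rewrite mulr_gt0// ltr_wpDl.
  move: entF; rewrite -entourage_ballE => -[e /= e0 heF].
  have [J1 hJ1] := hUb K e e0.
  (* Radii at most 1/(K + 1) send the compact set into the unit ball, where the extension agrees
     with the given minimizer. *)
  have [J2 hJ2] := blow_up_small rj kj (divr_gt0 ltr01 (addr_gt0 K0 ltr01)).
  exists (maxn J1 J2) => // j /=; rewrite geq_max => /andP[jJ1 jJ2]; apply: sub => y Ay; apply: heF.
  rewrite /= -ball_normE /= distrC; have := hJ1 j jJ1 y (hA y Ay).
  rewrite /resc /rescale Uin//; rewrite /l2ball /= subr0 l2normZ gtr0_norm//.
  have := hJ2 j jJ2; rewrite ler_pdivlMr ?addr_gt0// => h; have := hA y Ay => hy.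
  have rp := r0 (k j); nra.
- split; first exact: (blow_up_minimizer hn hN H sum0 U00 r0 rj kj hUb).
  exact: (blow_up_homogeneous hn hN H sum0 U00 r0 rj kj hUb r8 rd).
- split.
    move=> B /nbhs_ballP[e /= e0 he].
    have [x xe x0] := blow_up_nonzero r0 rj kj hUb c0 nd1 pos e0.
    exists x; split; first by split => //; rewrite /= l2_neq0.
    by apply: he; rewrite -ball_normE /= sub0r normrN; exact: le_lt_trans (norm_le_l2 x) xe.
  by move=> /interior_subset[_]; rewrite /= Ub0 l2norm0 ltxx.
Qed.
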